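(* Let $\mathsf G$ be a connected semisimple real Lie group without compact factors. Suppose the center $Z(\mathsf G)$ is trivial, $\theta\subset\Delta$ is symmetric and $\mathsf P_\theta$ contains no simple factors of $\mathsf G$. If $\Gamma\subset\mathsf G$ is $\mathsf P_\theta$-transverse, then there exist $d\in\mathbb N$, a properly convex domain $\Omega\subset\mathbb P(\mathbb R^d)$, a projectively visible subgroup $\Gamma_0\subset\mathrm{Aut}(\Omega)$ and a faithful $\mathsf P_\theta$-transverse representation $\rho:\Gamma_0\to\mathsf G$ with limit map $\xi:\Lambda_\Omega(\Gamma_0)\to\mathcal F_\theta$ such that $\rho(\Gamma_0)=\Gamma$ and $\xi(\Lambda_\Omega(\Gamma_0))=\Lambda_\theta(\Gamma)$.
   Context: Lie theory. Fix a Cartan involution of $\mathfrak g=\mathrm{Lie}(\mathsf G)$ with Cartan decomposition $\mathfrak g=\mathfrak k\oplus\mathfrak p$, let $\mathsf K\subset\mathsf G$ be the maximal compact subgroup with Lie algebra $\mathfrak k$, $\mathfrak a\subset\mathfrak p$ a maximal abelian subspace, $\Sigma\subset\mathfrak a^*$ the restricted roots with root spaces $\mathfrak g_\alpha$, $\Sigma^+$ a positive system with simple roots $\Delta$, and $\mathfrak a^+=\{X\in\mathfrak a:\alpha(X)\ge0\ \forall\alpha\in\Delta\}$. The Cartan projection $\kappa:\mathsf G\to\mathfrak a^+$ is defined by $g=me^{\kappa(g)}\ell$ with $m,\ell\in\mathsf K$ (a $\mathsf{KAK}$-decomposition). Let $w_0$ be the longest element of the Weyl group $\mathsf N_{\mathsf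 K}(\mathfrak a)/\mathsf Z_{\mathsf K}(\mathfrak a)$ (so $w_0\mathfrak a^+=-\mathfrak a^+$), $k_0\in\mathsf N_{\mathsf K}(\mathfrak a)$ a representative, and $\iota=-w_0$ the opposition involution. $\theta\subset\Delta$ is symmetric if $\iota^*(\theta)=\theta$. $\mathsf P_\theta$ is the normalizer in $\mathsf G$ of $\bigoplus_{\alpha\in\Sigma^+\setminus\mathrm{Span}(\Delta\setminus\theta)}\mathfrak g_\alpha$ and $\mathcal F_\theta=\mathsf G/\mathsf P_\theta$. Two flags in $\mathcal F_\theta$ are transverse if the pair lies in the $\mathsf G$-orbit of $(\mathsf P_\theta,k_0\mathsf P_\theta)$; $\mathcal Z_F$ is the set of flags not transverse to $F$. The simple factors of $\mathsf G$ are the connected subgroups whose Lie algebras are the simple ideals of $\mathfrak g$. A subgroup $\Gamma\subset\mathsf G$ is $\mathsf P_\theta$-divergent if $\alpha(\kappa(\gamma_n))\to\infty$ for all $\alpha\in\theta$ and all sequences of distinct $\gamma_n\in\Gamma$. If $\alpha(\kappa(g))>0$ for all $\alpha\in\theta$, put $U_\theta(g)=m\mathsf P_\theta$ where $g=me^{\kappa(g)}\ell$ is a $\mathsf{KAK}$-decomposition. $\Lambda_\theta(\Gamma)$ is the set of limits of convergent sequences $U_\theta(\gamma_n)$, $\gamma_n\in\Gamma$ distinct. $\Gamma$ is $\mathsf P_\theta$-transverse if it is $\mathsf P_\theta$-divergent and distinct flags in $\Lambda_\theta(\Gamma)$ are transverse. Convex domains. A properly convex domain $\Omega\subset\mathbb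 P(\mathbb R^{d})$ is an open set that is convex and bounded in some affine chart. For $x,y\in\overline\Omega$, $(x,y)_\Omega$ is the open projective segment in $\overline\Omega$ joining them. $\mathrm{Aut}(\Omega)\subset\mathsf{PGL}(d,\mathbb R)$ is the stabilizer of $\Omega$. A point $x\in\partial\Omega$ is $C^1$-smooth if there is a unique projective hyperplane through $x$ disjoint from $\Omega$. For a discrete subgroup $\Gamma_0\subset\mathrm{Aut}(\Omega)$, $\Lambda_\Omega(\Gamma_0)$ is the set of $x\in\partial\Omega$ with $x=\lim\gamma_n(p)$ for some $p\in\Omega$, $\{\gamma_n\}\subset\Gamma_0$. A discrete $\Gamma_0\subset\mathrm{Aut}(\Omega)$ is projectively visible if $(x,y)_\Omega\subset\Omega$ for all distinct $x,y\in\Lambda_\Omega(\Gamma_0)$ and every point of $\Lambda_\Omega(\Gamma_0)$ is a $C^1$-smooth point of $\partial\Omega$. A representation $\rho:\Gamma_0\to\mathsf G$ of a projectively visible group is $\mathsf P_\theta$-transverse if there is a continuous $\rho$-equivariant embedding $\xi:\Lambda_\Omega(\Gamma_0)\to\mathcal F_\theta$ (the limit map) such that distinct flags in the image are transverse and, whenever $\{\gamma_n\}\subset\Gamma_0$ satisfies $\gamma_n(b_0)\to x\in\Lambda_\Omega(\Gamma_0)$ and $\gamma_n^{-1}(b_0)\to y\in\Lambda_\Omega(\Gamma_0)$ for some (any) $b_0\in\Omega$, one has $\rho(\gamma_n)(F)\to\xi(x)$ for all $F\in\mathcal F_\theta\setminus\mathcal Z_{\xi(y)}$. *)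

(* Defs.v *)
From HB Require Import structures.
From mathcomp Require Import all_boot all_order all_algebra.
From mathcomp Require Import all_classical all_reals all_analysis.
Set Implicit Arguments.
Unset Strict Implicit.
Unset Printing Implicit Defensive.
Import Order.TTheory GRing.Theory Num.Theory.
Import numFieldNormedType.Exports.
Local Open Scope classical_set_scope.
Local Open Scope ring_scope.
Local Open Scope quotient_scope.

Section Smooth.
Context (R : realType) (V W : normedModType R).

(* On finite-dimensional V and open U, this is C^k: all partial derivatives up
   to order k exist and are continuous. *)
Fixpoint Ck (k : nat) (U : set V) (f : V -> W) : Prop :=
  if k is k'.+1 then
    (forall x, U x -> differentiable f x) /\
    (forall v, Ck k' U (fun x => 'd f x v))
  else forall x, U x -> {for x, continuous f}.

Definition smooth_on (U : set V) (f : V -> W) := forall k, Ck k U f.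

End Smooth.

(* [cfun] and [cinv] are only meaningful on [cdom] and on its image. *)
Record chart (R : realType) (n : nat) (M : topologicalType) := Chart {
  cdom : set M;
  cfun : M -> 'rV[R]_n;
  cinv : 'rV[R]_n -> M;
  cdom_open : open cdom;
  cimg_open : open (cfun @` cdom);
  cfunK : forall x, cdom x -> cinv (cfun x) = x;
  cfun_continuous : forall x, cdom x -> {for x, continuous cfun};
  cinv_continuous : forall x, cdom x -> {for cfun x, continuous cinv}
}.

HB.mixin Record isLieGroup (R : realType) (n : nat) G
    of Group G & Topological G := {
  lie_hausdorff : hausdorff_space G;
  lie_mul_continuous : continuous (fun p : G * G => (p.1 * p.2)%g);
  lie_inv_continuous : continuous (fun x : G => (x^-1)%g);
  lie_atlas : set (chart R n G);
  lie_atlas_cover : forall x : G, exists2 c, lie_atlas c & cdom c x;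
  lie_atlas_compat : forall c c', lie_atlas c -> lie_atlas c' ->
    smooth_on (cfun c @` (cdom c `&` cdom c')) (cfun c' \o cinv c);
  lie_mul_smooth : forall c c' c'',
    lie_atlas c -> lie_atlas c' -> lie_atlas c'' ->
    smooth_on
      [set p : 'rV[R]_n * 'rV[R]_n |
        [/\ (cfun c @` cdom c) p.1, (cfun c' @` cdom c') p.2 &
            cdom c'' (cinv c p.1 * cinv c' p.2)%g]]
      (fun p => cfun c'' (cinv c p.1 * cinv c' p.2)%g);
  lie_inv_smooth : forall c c', lie_atlas c -> lie_atlas c' ->
    smooth_on
      [set u | (cfun c @` cdom c) u /\ cdom c' ((cinv c u)^-1)%g]
      (fun u => cfun c' ((cinv c u)^-1)%g)
}.

#[short(type="lieGroupType")]
HB.structure Definition LieGroup (R : realType) (n : nat) :=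
  {G of Group G & Topological G & isLieGroup R n G}.

Definition subgroup (G : groupType) (H : set G) :=
  [/\ H 1%g, forall x y, H x -> H y -> H (x * y)%g &
      forall x, H x -> H (x^-1)%g].

Definition generated (G : groupType) (S : set G) : set G :=
  [set g | forall H, subgroup H -> S `<=` H -> H g].

Definition trivial_center (G : groupType) :=
  forall g : G, (forall h : G, (g * h = h * g)%g) -> g = 1%g.

Section LieAlgebraOfGroup.
Context (R : realType) (n : nat) (G : lieGroupType R n).
Implicit Types X Y : 'rV[R]_n.

(* A chart at the identity, used to identify the Lie algebra T_1 G with R^n;
   another chart gives an isomorphic Lie algebra. *)
Definition chart1 : chart R n G := s2val (cid2 (lie_atlas_cover (1%g : G))).

Definition Ad (g : G) X : 'rV[R]_n :=
  'd (fun u => cfun chart1 (g * cinv chart1 u * g^-1)%g)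
     (cfun chart1 (1%g : G)) X.

(* [X, Y] = ad(X) Y, where ad is the differential of Ad at the identity. *)
Definition lie X Y : 'rV[R]_n :=
  'd (fun u => Ad (cinv chart1 u) Y) (cfun chart1 (1%g : G)) X.

Definition one_parameter_subgroup X (gamma : R -> G) :=
  [/\ forall s t, gamma (s + t) = (gamma s * gamma t)%g,
      continuous gamma &
      is_derive (0 : R) (1 : R) (fun t => cfun chart1 (gamma t)) X].

Definition lie_exp X : G :=
  xget 1%g [set g | exists2 gamma, one_parameter_subgroup X gamma &
                                   gamma 1 = g].

Definition lie_algebra_of (H : set G) : set 'rV[R]_n :=
  [set X | forall t : R, H (lie_exp (t *: X))].

(* The connected Lie subgroup with Lie algebra [I]. *)
Definition connected_subgroup (I : {vspace 'rV[R]_n}) : set G :=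
  generated (lie_exp @` [set X | X \in I]).

Local Notation vsp := {vspace 'rV[R]_n}.

Definition brv (U V : vsp) : vsp :=
  <<[seq lie X Y | X <- vbasis U, Y <- vbasis V]>>%VS.

Definition ideal (I : vsp) := forall X Y, Y \in I -> lie X Y \in I.

Definition solvable (I : vsp) :=
  exists k, iter k (fun U => brv U U) I = 0%VS.

Definition semisimple := forall I, ideal I -> solvable I -> I = 0%VS.

Definition simple_ideal (I : vsp) :=
  [/\ ideal I, brv I I <> 0%VS &
      forall J : vsp, (J <= I)%VS ->
        (forall X Y, X \in I -> Y \in J -> lie X Y \in J) ->
        J = 0%VS \/ J = I].

Definition simple_factor (H : set G) :=
  exists2 I, simple_ideal I & H = connected_subgroup I.

Definition without_compact_factors :=
  forall H, simple_factor H -> ~ compact H.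

Definition killing X Y : R := \tr (lin1_mx (fun Z => lie X (lie Y Z))).

Definition cartan_involution (tau : 'End('rV[R]_n)) :=
  [/\ forall X Y, tau (lie X Y) = lie (tau X) (tau Y),
      forall X, tau (tau X) = X &
      forall X, X != 0 -> 0 < - killing X (tau X)].

Definition maximal_compact (K : set G) :=
  [/\ subgroup K, compact K &
      forall K', subgroup K' -> compact K' -> K `<=` K' -> K' = K].

Definition maximal_abelian_in (p : set 'rV[R]_n) (a : vsp) :=
  let abelian_in (b : vsp) :=
    (forall X, X \in b -> p X) /\
    (forall X Y, X \in b -> Y \in b -> lie X Y = 0) in
  abelian_in a /\ forall b, abelian_in b -> (a <= b)%VS -> b = a.

End LieAlgebraOfGroup.

Arguments lie {R n} G.
Arguments killing {R n} G.
Arguments semisimple {R n} G.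
Arguments without_compact_factors {R n} G.
Arguments cartan_involution {R n} G.
Arguments maximal_abelian_in {R n} G.
Arguments lie_exp {R n} G.

Definition span_set (K : fieldType) (V : vectType K) (S : set V) : set V :=
  [set v | exists2 s : seq V, (forall u, u \in s -> S u) & v \in << s >>%VS].

Section Roots.
Context (R : realType) (n : nat) (G : lieGroupType R n).
Context (a : {vspace 'rV[R]_n}).

Definition dual : vectType R := 'Hom(subvs_of a, R^o).

Implicit Types (alpha : dual) (Splus : set dual).

(* The value of [alpha] at [X]; meaningful for [X \in a] only. *)
Definition ev alpha (X : 'rV[R]_n) : R := alpha (vsproj a X).

Definition root_space alpha : set 'rV[R]_n :=
  [set X | forall H, H \in a -> lie G H X = ev alpha H *: X].

Definition roots : set dual :=
  [set alpha | alpha != 0 /\ exists2 X, X != 0 & root_space alpha X].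

Definition positive_system Splus :=
  exists2 H, H \in a & (forall alpha, roots alpha -> ev alpha H != 0) /\
                       Splus = [set alpha | roots alpha /\ 0 < ev alpha H].

Definition simple_roots Splus : set dual :=
  [set alpha | Splus alpha /\
     ~ exists beta gamma, [/\ Splus beta, Splus gamma & alpha = beta + gamma]].

Definition weyl_chamber Splus : set 'rV[R]_n :=
  [set X | X \in a /\ forall alpha, simple_roots Splus alpha -> 0 <= ev alpha X].

(* The reflection of [a] in the kernel of [alpha], for the inner product given by
   the Killing form. *)
Definition root_vector alpha : 'rV[R]_n :=
  xget 0 [set h | h \in a /\ forall H, H \in a -> killing G h H = ev alpha H].

Definition reflection alpha (H : 'rV[R]_n) : 'rV[R]_n :=
  H - (2 * ev alpha H / ev alpha (root_vector alpha)) *: root_vector alpha.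

(* The normalizer of [a] in [K]; its elements represent Weyl group elements. *)
Definition normalizer_in (K : set G) : set G :=
  [set k | K k /\ Ad k @` [set X | X \in a] = [set X | X \in a]].

(* The Weyl group element of [k] is a product of at most [m] simple
   reflections. *)
Definition length_le Splus (k : G) (m : nat) :=
  exists s : seq dual,
    [/\ (size s <= m)%N, forall alpha, alpha \in s -> simple_roots Splus alpha &
        forall H, H \in a -> Ad k H = foldr reflection H s].

Definition represents_longest (K : set G) Splus (k0 : G) :=
  normalizer_in K k0 /\
  forall k, normalizer_in K k ->
    forall m, length_le Splus k0 m -> length_le Splus k m.

End Roots.

Arguments roots {R n} G {a}.
Arguments root_space {R n} G {a}.
Arguments positive_system {R n} G {a}.

Record cartan_data (R : realType) (n : nat) (G : lieGroupType R n) :=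
  CartanData {
  cd_tau : 'End('rV[R]_n);
  cd_K : set G;
  cd_a : {vspace 'rV[R]_n};
  cd_pos : set (dual cd_a);
  cd_k0 : G;
  cd_tauP : cartan_involution G cd_tau;
  cd_K_maximal : maximal_compact cd_K;
  cd_K_lie : lie_algebra_of cd_K = [set X | cd_tau X = X];
  cd_aP : maximal_abelian_in G [set X | cd_tau X = - X] cd_a;
  cd_posP : positive_system G cd_pos;
  cd_k0_longest : represents_longest cd_K cd_pos cd_k0;
  (* w_0 a^+ = - a^+ is a consequence of the other fields, recorded here because
     it is part of the standing conventions *)
  cd_k0_chamber : Ad cd_k0 @` weyl_chamber cd_pos =
                  [set - X | X in weyl_chamber cd_pos]
}.

Arguments cd_pos {R n G} c _.

Section Cosets.
Context (G : groupType) (P : set G).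

Definition lcoset_set (g : G) : set G := [set (g * p)%g | p in P].

Definition same_coset : rel G :=
  fun g h => `[< lcoset_set g = lcoset_set h >].

Lemma same_coset_equiv : equiv_class_of same_coset.
Proof.
split=> [g|g h|h g k]; rewrite /same_coset.
- exact/asboolP.
- by apply/asboolP/asboolP => ->.
- by move=> /asboolP -> .
Qed.

Canonical same_coset_rel := EquivRelPack same_coset_equiv.

End Cosets.

Section Flags.
Context (R : realType) (n : nat) (G : lieGroupType R n) (D : cartan_data G).

Local Notation a := (cd_a D).
Local Notation K := (cd_K D).
Local Notation simple := (simple_roots (cd_pos D)).
Local Notation chamber := (weyl_chamber (cd_pos D)).

(* iota^* alpha = - alpha \o w_0; [theta] is symmetric if iota^* theta = theta *)
Definition opposition_dual (alpha beta : dual a) :=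
  forall H, H \in a -> ev beta H = - ev alpha (Ad (cd_k0 D) H).

Definition symmetric_roots (theta : set (dual a)) :=
  [set beta | exists2 alpha, theta alpha & opposition_dual alpha beta] = theta.

Definition KAK (g m : G) (X : 'rV[R]_n) (l : G) :=
  [/\ K m, chamber X, K l & g = (m * lie_exp G X * l)%g].

Definition cartan_projection (g : G) : 'rV[R]_n :=
  xget 0 [set X | exists m l, KAK g m X l].

Section Theta.
Context (theta : set (dual a)).

Definition nilradical : set 'rV[R]_n :=
  span_set [set X | exists2 alpha : dual a,
    cd_pos D alpha /\ ~ span_set (simple `\` theta) alpha &
    root_space G alpha X].

Definition parabolic : set G := [set g | Ad g @` nilradical = nilradical].

Definition flag : topologicalType :=
  quotient_topology {eq_quot (same_coset_rel parabolic)}.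

Definition mkflag (g : G) : flag := \pi_flag g.

Definition flag_act (g : G) (F : flag) : flag := mkflag (g * repr F)%g.

Definition transverse (F1 F2 : flag) :=
  exists g : G, F1 = flag_act g (mkflag 1%g) /\
                F2 = flag_act g (mkflag (cd_k0 D)).

Definition not_transverse_to (F : flag) : set flag :=
  [set F' | ~ transverse F' F].

Definition divergent (Gam : set G) :=
  forall gam : nat -> G, (forall i, Gam (gam i)) -> injective gam ->
  forall alpha : dual a, theta alpha ->
    (fun i => ev alpha (cartan_projection (gam i))) @ \oo --> +oo.

(* F = U_theta(g) *)
Definition is_U (g : G) (F : flag) :=
  (forall alpha : dual a, theta alpha -> 0 < ev alpha (cartan_projection g)) /\
  exists m l, KAK g m (cartan_projection g) l /\ F = mkflag m.

Definition limit_set (Gam : set G) : set flag :=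
  [set F | exists gam : nat -> G, exists U : nat -> flag,
     [/\ forall i, Gam (gam i), injective gam,
         forall i, is_U (gam i) (U i) & U @ \oo --> F]].

Definition transverse_subgroup (Gam : set G) :=
  [/\ subgroup Gam, divergent Gam &
      forall F1 F2, limit_set Gam F1 -> limit_set Gam F2 -> F1 <> F2 ->
        transverse F1 F2].

End Theta.
End Flags.

Arguments limit_set {R n G D} theta Gam _.

Section Projective.
Context (R : realType) (d : nat).

Definition proj_space := {L : {vspace 'cV[R]_d} | \dim L == 1%N}.

HB.instance Definition _ := Choice.on proj_space.

(* The quotient topology of R^d \ {0} -> P(R^d), v |-> <[v]>. *)
Definition proj_open (U : set proj_space) :=
  open [set v : 'cV[R]_d | exists2 L, U L & v != 0 /\ val L = <[v]>%VS].

Lemma proj_openT : proj_open setT.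
Proof.
rewrite /proj_open.
have -> : [set v : 'cV[R]_d | exists2 L : proj_space, setT L &
    v != 0 /\ val L = <[v]>%VS] = ~` [set 0].
  apply/seteqP; split=> v /=; first by case=> L _ [/eqP].
  move=> /eqP v0; have dv : \dim <[v]>%VS == 1%N by rewrite dim_vline v0.
  by exists (exist _ <[v]>%VS dv).
apply: closed_openC; apply: accessible_closed_set1.
exact/hausdorff_accessible/norm_hausdorff.
Qed.

Lemma proj_openI : setI_closed proj_open.
Proof.
move=> A B oA oB; have := openI oA oB; rewrite /proj_open.
congr open; apply/seteqP; split=> v /=.
  move=> [[L AL [v0 Lv]] [L' BL' [_ L'v]]]; exists L => //; split=> //.
  suff -> : L = L' by [].
  by apply: val_inj; rewrite /= Lv L'v.
by move=> [L [AL BL] Lv]; split; exists L.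
Qed.

Lemma proj_open_bigU (I : Type) (f : I -> set proj_space) :
  (forall i, proj_open (f i)) -> proj_open (\bigcup_i f i).
Proof.
move=> of_; have := @bigcup_open _ _ setT _ (fun i _ => of_ i).
rewrite /proj_open; congr open; apply/seteqP; split=> v /=.
  by move=> [i _ [L fL Lv]]; exists L => //; exists i.
by move=> [L [i _ fL] Lv]; exists i => //; exists L.
Qed.

HB.instance Definition _ :=
  isOpenTopological.Build proj_space proj_openT proj_openI proj_open_bigU.

Definition GL := [set A : 'M[R]_d | A \in unitmx].

Definition scalar_equiv : rel GL :=
  fun A B => `[< exists2 c : R, c != 0 & set_val B = c *: set_val A >].

Lemma scalar_equiv_equiv : equiv_class_of scalar_equiv.
Proof.
have sym A B : scalar_equiv A B -> scalar_equiv B A.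
  move=> /asboolP[c c0 e]; apply/asboolP; exists c^-1; first by rewrite invr_eq0.
  by rewrite e scalerA mulVf// scale1r.
split=> [A|A B|B A C].
- by apply/asboolP; exists 1; rewrite ?oner_eq0// scale1r.
- by apply/idP/idP; exact: sym.
- move=> /asboolP[c c0 e] /asboolP[c' c'0 e']; apply/asboolP.
  by exists (c' * c); rewrite ?mulf_neq0// e' e scalerA.
Qed.

Canonical scalar_equiv_rel := EquivRelPack scalar_equiv_equiv.

Definition PGL := quotient_topology {eq_quot scalar_equiv_rel}.

HB.instance Definition _ := Topological.on PGL.

Definition mkPGL (A : GL) : PGL := \pi_PGL A.
Definition PGL_mx (g : PGL) : 'M[R]_d := set_val (repr g).

Lemma PGL_mx_unit g : PGL_mx g \in unitmx.
Proof. by have := set_valP (repr g : GL). Qed.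

Definition PGL_of (A : 'M[R]_d) (hA : A \in unitmx) : PGL :=
  mkPGL (exist _ A (mem_set hA)).

Lemma PGL_of_eq A (hA : A \in unitmx) B (hB : B \in unitmx) :
  (exists2 c : R, c != 0 & B = c *: A) -> PGL_of hA = PGL_of hB.
Proof. by move=> e; apply/eqmodP/asboolP. Qed.

Lemma PGL_of_mx A (hA : A \in unitmx) :
  exists2 c : R, c != 0 & PGL_mx (PGL_of hA) = c *: A.
Proof.
by have /eqmodP/asboolP[c c0 e] := esym (reprK (PGL_of hA)); exists c.
Qed.

Lemma PGL_mxK g : PGL_of (PGL_mx_unit g) = g.
Proof.
rewrite -[RHS]reprK; apply/eqmodP/asboolP.
by exists 1; rewrite ?oner_eq0// scale1r.
Qed.

Lemma PGL_mul_subproof g h : PGL_mx g *m PGL_mx h \in unitmx.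
Proof. by rewrite unitmx_mul !PGL_mx_unit. Qed.

Lemma PGL_inv_subproof g : invmx (PGL_mx g) \in unitmx.
Proof. by rewrite unitmx_inv PGL_mx_unit. Qed.

Definition PGL_one : PGL := PGL_of (unitmx1 R d).
Definition PGL_mul (g h : PGL) : PGL := PGL_of (PGL_mul_subproof g h).
Definition PGL_inv (g : PGL) : PGL := PGL_of (PGL_inv_subproof g).

Lemma PGL_mulA : associative PGL_mul.
Proof.
move=> f g h; apply: PGL_of_eq.
have [c c0 ->] := PGL_of_mx (PGL_mul_subproof f g).
have [e e0 ->] := PGL_of_mx (PGL_mul_subproof g h).
exists (c / e); first by rewrite mulf_neq0// invr_eq0.
by rewrite -scalemxAr scalerA divfK// -scalemxAl mulmxA.
Qed.

Lemma PGL_mul1 : left_id PGL_one PGL_mul.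
Proof.
move=> g; rewrite -[RHS]PGL_mxK; apply: PGL_of_eq.
have [c c0 ->] := PGL_of_mx (unitmx1 R d).
exists c^-1; first by rewrite invr_eq0.
by rewrite -scalemxAl mul1mx scalerA mulVf// scale1r.
Qed.

Lemma PGL_mulr1 : right_id PGL_one PGL_mul.
Proof.
move=> g; rewrite -[RHS]PGL_mxK; apply: PGL_of_eq.
have [c c0 ->] := PGL_of_mx (unitmx1 R d).
exists c^-1; first by rewrite invr_eq0.
by rewrite -scalemxAr mulmx1 scalerA mulVf// scale1r.
Qed.

Lemma PGL_mulV : left_inverse PGL_one PGL_inv PGL_mul.
Proof.
move=> g; apply: PGL_of_eq.
have [c c0 ->] := PGL_of_mx (PGL_inv_subproof g).
exists c^-1; first by rewrite invr_eq0.
by rewrite -scalemxAl mulVmx ?PGL_mx_unit// scalerA mulVf// scale1r.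
Qed.

Lemma PGL_mulrV : right_inverse PGL_one PGL_inv PGL_mul.
Proof.
move=> g; apply: PGL_of_eq.
have [c c0 ->] := PGL_of_mx (PGL_inv_subproof g).
exists c^-1; first by rewrite invr_eq0.
by rewrite -scalemxAr mulmxV ?PGL_mx_unit// scalerA mulVf// scale1r.
Qed.

HB.instance Definition _ :=
  isGroup.Build PGL PGL_mulA PGL_mul1 PGL_mulr1 PGL_mulV PGL_mulrV.

Lemma PGL_act_subproof (g : PGL) (L : proj_space) :
  \dim (linfun (mulmx (PGL_mx g)) @: val L)%VS == 1%N.
Proof.
rewrite limg_dim_eq ?(eqP (valP L))//.
suff /eqP -> : lker (linfun (mulmx (PGL_mx g)) : 'End('cV[R]_d)) == 0%VS.
  by rewrite capv0.
apply/lker0P => u v; rewrite !lfunE /= => e.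
by rewrite -[u](mulKmx (PGL_mx_unit g)) e mulKmx// PGL_mx_unit.
Qed.

Definition PGL_act (g : PGL) (L : proj_space) : proj_space :=
  exist (fun L' : {vspace 'cV[R]_d} => \dim L' == 1%N) _ (PGL_act_subproof g L).

(* The affine chart {v | f v = 1} of the complement of the hyperplane f = 0. *)
Definition affine_slice (f : 'rV[R]_d) (Om : set proj_space) : set 'cV[R]_d :=
  [set v | f *m v = 1%:M /\ exists2 L, Om L & val L = <[v]>%VS].

Definition properly_convex_domain (Om : set proj_space) :=
  [/\ Om !=set0, open Om &
      exists f : 'rV[R]_d,
        [/\ forall L, Om L -> exists2 v, v \in val L & f *m v != 0,
            forall u v (t : R), affine_slice f Om u -> affine_slice f Om v ->
              0 <= t <= 1 -> affine_slice f Om (t *: u + (1 - t) *: v) &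
            bounded_set (affine_slice f Om)]].

Definition boundary (Om : set proj_space) : set proj_space :=
  closure Om `\` interior Om.

(* One of the two open segments of the projective line through <[u]> and
   <[v]>; the other one is [lift_segment u (- v)]. *)
Definition lift_segment (u v : 'cV[R]_d) : set proj_space :=
  [set L | exists s t : R, [/\ 0 < s, 0 < t & val L = <[s *: u + t *: v]>%VS]].

Definition open_segment (Om : set proj_space) (x y : proj_space)
    : set proj_space :=
  [set z | exists u v, [/\ val x = <[u]>%VS, val y = <[v]>%VS,
     lift_segment u v `<=` closure Om & lift_segment u v z]].

Definition Aut (Om : set proj_space) : set PGL :=
  [set g | PGL_act g @` Om = Om].

Definition C1_smooth_point (Om : set proj_space) (x : proj_space) :=
  exists! H : {vspace 'cV[R]_d},
    [/\ (\dim H).+1 = d, (val x <= H)%VS &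
        forall y, Om y -> ~ (val y <= H)%VS].

Definition discrete_subgroup (Gam0 : set PGL) :=
  subgroup Gam0 /\ Gam0 `<=` isolated Gam0.

Definition orbital_limit_set (Om : set proj_space) (Gam0 : set PGL)
    : set proj_space :=
  [set x | boundary Om x /\
     exists p, Om p /\ exists gam : nat -> PGL,
       (forall i, Gam0 (gam i)) /\ (fun i => PGL_act (gam i) p) @ \oo --> x].

Definition projectively_visible (Om : set proj_space) (Gam0 : set PGL) :=
  [/\ discrete_subgroup Gam0, Gam0 `<=` Aut Om,
      forall x y, orbital_limit_set Om Gam0 x -> orbital_limit_set Om Gam0 y ->
        x <> y -> open_segment Om x y `<=` Om &
      forall x, orbital_limit_set Om Gam0 x -> C1_smooth_point Om x].

End Projective.

Section TransverseRep.
Context (R : realType) (n : nat) (G : lieGroupType R n) (D : cartan_data G).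
Context (theta : set (dual (cd_a D))).
Context (d : nat) (Om : set (proj_space R d)) (Gam0 : set (PGL R d)).

(* [rho] and [xi] are only meaningful on [Gam0] and on its limit set. *)
Definition representation (rho : PGL R d -> G) :=
  forall g h, Gam0 g -> Gam0 h -> rho (g * h)%g = (rho g * rho h)%g.

Definition faithful (rho : PGL R d -> G) :=
  forall g h, Gam0 g -> Gam0 h -> rho g = rho h -> g = h.

Local Notation Lambda := (orbital_limit_set Om Gam0).

Definition embedding (xi : proj_space R d -> flag theta) :=
  [/\ {within Lambda, continuous xi},
      (forall x y, Lambda x -> Lambda y -> xi x = xi y -> x = y) &
      forall U, open U -> exists2 V, open V &
        xi @` (Lambda `&` U) = xi @` Lambda `&` V].

Definition transverse_representation (rho : PGL R d -> G)
    (xi : proj_space R d -> flag theta) :=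
  [/\ representation rho,
      embedding xi,
      (forall g x, Gam0 g -> Lambda x ->
         xi (PGL_act g x) = flag_act (rho g) (xi x)),
      (forall x y, Lambda x -> Lambda y -> xi x <> xi y ->
         transverse (xi x) (xi y)) &
      forall (gam : nat -> PGL R d) x y b0,
        (forall i, Gam0 (gam i)) -> Lambda x -> Lambda y -> Om b0 ->
        (fun i => PGL_act (gam i) b0) @ \oo --> x ->
        (fun i => PGL_act ((gam i)^-1)%g b0) @ \oo --> y ->
        forall F : flag theta, ~ not_transverse_to (xi y) F ->
          (fun i => flag_act (rho (gam i)) F) @ \oo --> xi x].

End TransverseRep.

(* Main.v *)
(* Let [k] be the dimension of the nilradical [u] of [P_theta], and send [g] to the
   rank one matrix [v v^T], where [v] is the Pluecker vector of [Ad g u].  These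
   matrices span a representation of [G]; the line of [rv g] depends only on the
   flag [g P_theta].  The Killing form induces functionals [rf g] with
   [rf g (rv h) >= 0], where equality holds if [g = h] and fails if the flags are
   transverse.  When the Cartan projection of [gamma_n] diverges from all walls
   in [theta], the normalized action of [gamma_n] converges to a rank one map
   [rv m *m rf m'].

   The trace is positive on all [rv g], so for small [eps] the cone
   [q v = tr v - eps |v| >= 0] has every [rv g] in its interior.  The domain
   [Omega] is the projectivized interior of the set of vectors whose whole
   [Gamma]-orbit stays in that cone.  By the rank one limits and transversality,
   the only ways to leave it are [q (gamma v) < 0] for one [gamma] and
   [rf m v <= 0] for one limit flag [m]: hence the limit points are the lines
   [rv m], segments between them lie in [Omega], and [ker (rf m)] is the only
   supporting hyperplane at [rv m].

   The kernel of the representation lies in every conjugate of [P_theta]; its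
   Lie algebra is an ideal, hence zero as [P_theta] contains no simple factor, so
   it is central and therefore trivial. *)

Require Import Defs.
From HB Require Import structures.
From mathcomp Require Import all_boot all_order all_algebra.
From mathcomp Require Import all_classical all_reals all_analysis.
From mathcomp Require Import ring lra.
Set Implicit Arguments.
Unset Strict Implicit.
Unset Printing Implicit Defensive.
Import Order.TTheory GRing.Theory Num.Theory.
Import numFieldNormedType.Exports.
Local Open Scope classical_set_scope.
Local Open Scope ring_scope.

(** * Calculus in finite dimension *)

(** Squaring the Pluecker vector settles signs: an element of P multiplies [v] by a scalar that may
    be negative, but [v v^T] by a positive one. A flag thus determines a ray and not only a line,
    and the Killing pairing becomes a square; only so can one convex cone contain every [rv g]. The
    Lie theory starts from charts alone. The Lie algebra is the model space of a chart at the
    identity; the exponential map and the factorization G = K P both rest on one second order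
    estimate for the product. Ultrafilters take the place of subsequences. Along an ultrafilter a
    family in Gamma is either constant or leaves every element; in the second case it has a rank one
    limit, and the arguments on the cone and on discreteness treat these two cases apart. The rank
    one limit itself does not come from highest weights. Conjugation by the Cartan part contracts
    the opposite unipotent group, and the vectors [rv y] with y in that group span the whole space,
    so the limit of the operators is read off from these vectors. *)

Section MatrixNorm.
Context (R : realType).

Lemma mx_norm_entry m n (A : 'M[R]_(m, n)) i j : `|A i j| <= `|A|.
Proof.
rewrite [leRHS]/Num.Def.normr/= mx_normrE.
exact: (le_bigmax _ (fun ij => `|A ij.1 ij.2|) (i, j)).
Qed.

Lemma mx_norm_le m n (A : 'M[R]_(m, n)) (e : R) :
  0 <= e -> (forall i j, `|A i j| <= e) -> `|A| <= e.
Proof.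
move=> e0 h; rewrite [leLHS]/Num.Def.normr/= mx_normrE.
by apply: bigmax_le => // -[i j] _; exact: h.
Qed.

Lemma mulmx_norm_le m n p (A : 'M[R]_(m, n)) (B : 'M[R]_(n, p)) :
  `|A *m B| <= n%:R * `|A| * `|B|.
Proof.
apply: mx_norm_le => [|i j]; first by rewrite !mulr_ge0// ler0n.
rewrite mxE; apply: le_trans (ler_norm_sum _ _ _) _.
apply: (@le_trans _ _ (\sum_(k < n) (`|A| * `|B|))).
  apply: ler_sum => k _; rewrite normrM.
  by apply: ler_pM => //; exact: mx_norm_entry.
by rewrite sumr_const card_ord -[leLHS]mulr_natl mulrA.
Qed.

Lemma is_derive_entry m n (f : R -> 'M[R]_(m, n)) (t : R) df i j :
  is_derive t (1 : R) f df -> is_derive t (1 : R) (fun s => f s i j) (df i j).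
Proof.
move=> [/[dup] fd /derive_mx fE dfE].
apply: DeriveDef; first exact: (derivable_mxP _ _ _).1 fd i j.
by rewrite -dfE fE mxE.
Qed.

Lemma is_derive_mx m n (f : R -> 'M[R]_(m, n)) (t : R) (df : 'M[R]_(m, n)) :
  (forall i j, is_derive t (1 : R) (fun s => f s i j) (df i j)) ->
  is_derive t (1 : R) f df.
Proof.
move=> h; have fd : derivable f t 1 by apply/derivable_mxP => i j; have [] := h i j.
apply: DeriveDef => //; rewrite derive_mx//.
by apply/matrixP => i j; rewrite mxE; have [] := h i j.
Qed.

(** The norm is the largest entry, so the scalar mean value theorem applied to each entry gives the
    bound without a dimensional constant. *)
Lemma norm_increment_le m n (f df : R -> 'M[R]_(m, n)) (M : R) :
  0 <= M -> (forall t : R, 0 <= t <= 1 -> is_derive t (1 : R) f (df t)) ->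
  (forall t : R, 0 <= t <= 1 -> `|df t| <= M) -> `|f 1 - f 0| <= M.
Proof.
move=> M0 fd dfM; apply: mx_norm_le => // i j; rewrite !mxE.
have [|||c c01 ->] := @MVT_segment _ (fun s => f s i j) (fun s => df s i j) 0 1.
- exact: ler01.
- move=> x; rewrite in_itv/= => /andP[x0 x1].
  by apply: is_derive_entry; apply: fd; rewrite !ltW.
- apply: derivable_within_continuous => x; rewrite in_itv/= => x01.
  by have [] := is_derive_entry i j (fd x x01).
- rewrite subr0 mulr1; apply: le_trans (mx_norm_entry _ _ _) (dfM _ _).
  by move: c01; rewrite in_itv.
Qed.

End MatrixNorm.

Lemma ler_norm_distD (R : numDomainType) (V : normedZmodType R) (x y : V) (e : R) :
  `|x - y| <= e -> `|y| <= `|x| + e.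
Proof.
by move=> h; rewrite -[y](subKr x); apply: le_trans (ler_normB _ _) _; rewrite lerD2l.
Qed.

Section SecondOrder.
Context (R : realType).

Lemma is_derive_line (V W : normedModType R) (F : V -> W) p q (s : R) :
  differentiable F (p + s *: q) ->
  is_derive s (1 : R) (fun s => F (p + s *: q)) ('d F (p + s *: q) q).
Proof.
move=> Fd; have E : (fun h : R => h^-1 *: (((fun s => F (p + s *: q)) \o shift s) (h *: 1)
      - F (p + s *: q))) =
    (fun h : R => h^-1 *: ((F \o shift (p + s *: q)) (h *: q) - F (p + s *: q))).
  apply/funext => h /=; congr (_ *: (F _ - _)).
  by rewrite [h *: 1]mulr1 scalerDl addrCA.
apply: DeriveDef; rewrite /derivable /derive E; first exact: diff_derivable.
exact: deriveE.
Qed.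

Lemma diff_sum_basis (V : normedModType R) (n : nat) (W : normedModType R)
    (F : V -> W) p (b : 'I_n -> V) (c : 'I_n -> R) :
  'd F p (\sum_i c i *: b i) = \sum_i c i *: 'd F p (b i).
Proof. by rewrite linear_sum; apply: eq_bigr => i _; rewrite linearZ. Qed.

Lemma segment_norm_lt m n (x x' c : 'M[R]_(m, n)) (s r : R) :
  0 <= s <= 1 -> `|x - c| < r -> `|x' - c| < r -> `|x' + s *: (x - x') - c| < r.
Proof.
move=> /andP[s0 s1] xr x'r.
have -> : x' + s *: (x - x') - c = (1 - s) *: (x' - c) + s *: (x - c).
  by apply/matrixP => i j; rewrite !mxE; ring.
apply: le_lt_trans (ler_normD _ _) _; rewrite !normrZ.
rewrite ger0_norm ?subr_ge0// ger0_norm//.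
have [z [ma mb mr]] : exists z, [/\ `|x' - c| <= z, `|x - c| <= z & z < r].
  by exists (Num.max `|x' - c| `|x - c|); rewrite !le_max !lexx orbT gt_max xr x'r.
by apply: le_lt_trans mr; nra.
Qed.

(* Hides the differentials, whose unfolding makes unification diverge. *)
Lemma second_order_coordinates n m p (F : 'rV[R]_n * 'rV[R]_m -> 'rV[R]_p) U :
  smooth_on U F ->
  exists (G : 'I_n -> 'rV[R]_n * 'rV[R]_m -> 'rV[R]_p)
         (H : 'I_n -> 'I_m -> 'rV[R]_n * 'rV[R]_m -> 'rV[R]_p),
  [/\ forall x u (t : R), U (x + t *: (u, 0)) ->
        is_derive t (1 : R) (fun s => F (x + s *: (u, 0)))
          (\sum_j u 0 j *: G j (x + t *: (u, 0))),
      forall j x v (t : R), U (x + t *: (0, v)) ->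
        is_derive t (1 : R) (fun s => G j (x + s *: (0, v)))
          (\sum_k v 0 k *: H j k (x + t *: (0, v))) &
      forall j k x, U x -> {for x, continuous (H j k)}].
Proof.
move=> /(_ 2%N) [Fd F2].
have pE1 (w : 'rV[R]_n) : (w, 0) = \sum_i w 0 i *: ((delta_mx 0 i, 0) : 'rV[R]_n * 'rV[R]_m).
  rewrite [in LHS](row_sum_delta w); elim/big_rec2: _ => // i y1 y2 _ <-.
  by apply: injective_projections => //=; rewrite scaler0 addr0.
have pE2 (w : 'rV[R]_m) : (0, w) = \sum_i w 0 i *: ((0, delta_mx 0 i) : 'rV[R]_n * 'rV[R]_m).
  rewrite [in LHS](row_sum_delta w); elim/big_rec2: _ => // i y1 y2 _ <-.
  by apply: injective_projections => //=; rewrite scaler0 addr0.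
exists (fun j x => 'd F x (delta_mx 0 j, 0)).
exists (fun j k x => 'd (fun y => 'd F y (delta_mx 0 j, 0)) x (0, delta_mx 0 k)).
split=> [x u t Ux|j x v t Ux|j k x Ux].
- by rewrite -diff_sum_basis -pE1; apply: is_derive_line; exact: Fd.
- rewrite -diff_sum_basis -pE2.
  have [+ _] := F2 (delta_mx 0 j, 0) => /(_ _ Ux) h.
  exact: (is_derive_line h).
- by have [_ /(_ (0, delta_mx 0 k) x Ux)] := F2 (delta_mx 0 j, 0).
Qed.

(** The mean value inequality is applied in the first variable to the difference of F at v and v',
    then in the second variable to the partial derivatives [G j]. This bound by a product of two
    increments is the source of all quantitative estimates on the group law. *)
Lemma mixed_increment_le n m p (F : 'rV[R]_n * 'rV[R]_m -> 'rV[R]_p) (U : set _)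
    (a : 'rV[R]_n * 'rV[R]_m) :
  nbhs a U -> smooth_on U F ->
  exists C r : R, [/\ 0 < C, 0 < r & forall u u' v v',
    `|u - a.1| < r -> `|u' - a.1| < r -> `|v - a.2| < r -> `|v' - a.2| < r ->
    `|F (u, v) - F (u', v) - F (u, v') + F (u', v')|
      <= C * `|u - u'| * `|v - v'|].
Proof.
move=> aU /second_order_coordinates [G [H [Fd Gd /(_ _ _ _ (nbhs_singleton aU)) Hc]]].
(* Exceeds each [H j k] at [a] by at least 1, so that continuity keeps the bound on a
   neighbourhood. *)
pose M : R := 1 + \sum_j \sum_k `|H j k a|.
have M0 : 0 < M by rewrite ltr_pwDl// sumr_ge0// => j _; rewrite sumr_ge0.
have : \forall x \near a, U x /\ forall j k, `|H j k x| <= M.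
  near=> x; split; first by near: x.
  move=> j k.
  have hM : `|H j k a| + 1 <= M.
    rewrite /M addrC lerD2l (bigD1 j)//= (bigD1 k)//= -addrA lerDl addr_ge0//.
      by apply: sumr_ge0 => i _.
    by apply: sumr_ge0 => i _; apply: sumr_ge0 => l _.
  apply: le_trans hM; apply: ler_norm_distD.
  move: j k; near: x; apply: filter_forall => j; apply: filter_forall => k.
  exact: (cvgrPdist_le _ _).1 (Hc j k) 1 ltr01.
move=> /nbhs_normP[r /= r0 rU].
exists (n%:R * m%:R * M + 1), r; split=> //.
  by rewrite ltr_wpDl// !mulr_ge0// ?ler0n ?ltW.
move=> u u' v v' ur u'r vr v'r.
have rU' x y : `|x - a.1| < r -> `|y - a.2| < r -> U (x, y) /\ forall j k, `|H j k (x, y)| <= M.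
  move=> xr yr; apply: rU; rewrite /ball_/= distrC.
  by rewrite [`|_|]/(Num.max _ _) gt_max xr yr.
pose L y t := F ((u', y) + t *: (u - u', 0)).
have LE y t : (u', y) + t *: (u - u', 0) = (u' + t *: (u - u'), y).
  by apply: injective_projections => //=; rewrite scaler0 addr0.
have GM j x : `|x - a.1| < r -> `|G j (x, v) - G j (x, v')| <= m%:R * M * `|v - v'|.
  move=> xr; pose g (t : R) := G j ((x, v') + t *: (0, v - v')).
  have gE t : (x, v') + t *: (0, v - v') = (x, v' + t *: (v - v')).
    by apply: injective_projections => //=; rewrite scaler0 addr0.
  have -> : G j (x, v) = g 1 by rewrite /g gE scale1r addrC subrK.
  have -> : G j (x, v') = g 0 by rewrite /g gE scale0r addr0.
  apply: (@norm_increment_le _ _ _ g (fun t => \sum_k (v - v') 0 k *: H j k ((x, v') + t *: (0, v - v')))).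
  - by rewrite !mulr_ge0// ?ler0n ?ltW.
  - move=> t t01; apply: Gd; rewrite gE.
    by have [] := rU' _ _ xr (segment_norm_lt t01 vr v'r).
  - move=> t t01.
    have [_ HM] := rU' _ _ xr (segment_norm_lt t01 vr v'r).
    apply: le_trans (ler_norm_sum _ _ _) _.
    apply: (@le_trans _ _ (\sum_(k < m) (M * `|v - v'|))).
      apply: ler_sum => k _; rewrite normrZ mulrC; apply: ler_pM => //.
        by rewrite gE; exact: HM.
      exact: mx_norm_entry.
    by rewrite sumr_const card_ord -[leLHS]mulr_natl mulrA.
pose f t := L v t - L v' t.
have -> : F (u, v) - F (u', v) - F (u, v') + F (u', v') = f 1 - f 0.
  rewrite /f /L !LE !scale1r !scale0r !addr0 [u' + _]addrC subrK.
  by apply/rowP => i; rewrite !mxE; ring.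
apply: (@norm_increment_le _ _ _ f (fun t => \sum_j (u - u') 0 j *: G j ((u', v) + t *: (u - u', 0)) - \sum_j (u - u') 0 j *: G j ((u', v') + t *: (u - u', 0)))).
- by rewrite !mulr_ge0// addr_ge0// !mulr_ge0// ?ler0n ?ltW.
- move=> t t01; apply: is_deriveB; apply: Fd; rewrite LE.
    by have [] := rU' _ _ (segment_norm_lt t01 ur u'r) vr.
  by have [] := rU' _ _ (segment_norm_lt t01 ur u'r) v'r.
- move=> t t01; rewrite !LE -sumrB.
  apply: le_trans (ler_norm_sum _ _ _) _.
  apply: (@le_trans _ _ (\sum_(k < n) (`|u - u'| * (m%:R * M * `|v - v'|)))).
    apply: ler_sum => k _; rewrite -scalerBr normrZ; apply: ler_pM => //.
      exact: mx_norm_entry.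
    exact: GM (segment_norm_lt t01 ur u'r).
  rewrite sumr_const card_ord -[leLHS]mulr_natl.
  have : 0 <= `|u - u'| * `|v - v'| by rewrite mulr_ge0.
  nra.
Unshelve. all: by end_near. Qed.

End SecondOrder.

(** * Ultrafilters in place of subsequences *)

Section UltraFilterCvg.

Lemma fmap_ultra (T U : Type) (F : set_system T) (f : T -> U) :
  UltraFilter F -> UltraFilter (f @ F).
Proof.
move=> FU; split; first exact: fmap_proper_filter.
move=> G GF sub; rewrite predeqE => A; split; last exact: sub.
move=> GA; have [//|FnA] := in_ultra_setVsetC (f @^-1` A) FU.
have GnA : G (~` A) by exact: sub.
have G0 : G set0 by rewrite -(setICr A); exact: filterI.
by case: (@filter_not_empty _ G _ G0).
Qed.

(** Plays the role of extracting a convergent subsequence; the index set stays the same, so several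
    limits can be taken along one ultrafilter. *)
Lemma compact_ultra_cvg (T : Type) (U : topologicalType) (F : set_system T)
    (f : T -> U) (K : set U) :
  UltraFilter F -> compact K -> F [set x | K (f x)] ->
  exists2 p, K p & f @ F --> p.
Proof.
move=> FU; rewrite compact_ultra => Kc FK.
by have [p [Kp fp]] := Kc _ (fmap_ultra f FU) FK; exists p.
Qed.

(** If some neighbourhood of l is missed, F restricted to the indices that miss it is still proper
    and extends to an ultrafilter along which f cannot tend to l. *)
Lemma cvg_ultra (T : Type) (U : topologicalType) (F : set_system T)
    (f : T -> U) (l : U) :
  Filter F ->
  (forall G, UltraFilter G -> F `<=` G -> f @ G --> l) -> f @ F --> l.
Proof.
move=> FF H A lA; apply: contrapT => nFA.
pose B := f @^-1` A.
have FB : ProperFilter (within (~` B) F).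
  apply: Build_ProperFilter_ex => C; rewrite /within/= => FC.
  apply: contrapT => nC; apply: nFA; rewrite /fmap/=.
  apply: filterS FC => x xC; apply: contrapT => nBx; apply: nC.
  by exists x; exact: xC.
have [G [GU sub]] := ultraFilterLemma FB.
have FG : F `<=` G.
  by move=> C FC; apply: sub; apply: filterS FC => x Cx _.
have GA : G B := H G GU FG A lA.
have GnB : G (~` B) by apply: sub; rewrite /within/=; exact: filterE.
have G0 : G set0 by rewrite -(setICr B); exact: filterI.
by case: (@filter_not_empty _ G _ G0).
Qed.

Lemma ultra_oo : exists F : set_system nat, UltraFilter F /\ \oo `<=` F.
Proof. exact: ultraFilterLemma. Qed.

Lemma compact_ball_rV (R : realType) n (q : R) :
  compact [set v : 'rV[R]_n | `|v| <= q].
Proof.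
apply: bounded_closed_compact.
  exists q; split; first exact: num_real.
  by move=> y yq v /= vq; apply: ltW; apply: le_lt_trans yq.
apply: (@closed_comp _ _ (fun v : 'rV[R]_n => `|v|) [set x | x <= q]).
  by move=> v _; exact: norm_continuous.
exact: closed_le.
Qed.

End UltraFilterCvg.

Section DerivativeAtZero.
Context (R : realType) (V : normedModType R).

Lemma is_derive_quadratic (f : R -> V) (X : V) (B delta : R) :
  0 < delta -> (forall t, `|t| < delta -> `|f t - f 0 - t *: X| <= B * t ^+ 2) ->
  is_derive (0 : R) (1 : R) f X.
Proof.
move=> d0 H.
have C : h^-1 *: ((f \o shift 0) (h *: 1) - f 0) @[h --> 0^'] --> X.
  apply/cvgrPdist_le => eps eps0.
  have B0 : 0 < `|B| + 1 by rewrite ltr_wpDl.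
  near=> h.
  have h0 : h != 0 by near: h; exact: nbhs_dnbhs_neq.
  have hd : `|h| < delta by near: h; exact: dnbhs0_lt.
  have he : `|h| < eps / (`|B| + 1) by near: h; apply: dnbhs0_lt; rewrite divr_gt0.
  rewrite /= addr0 [h *: 1]mulr1 distrC.
  have -> : h^-1 *: (f h - f 0) - X = h^-1 *: (f h - f 0 - h *: X).
    by rewrite [RHS]scalerBr scalerA mulVf// scale1r.
  rewrite normrZ normfV ler_pdivrMl ?normr_gt0//.
  apply: le_trans (H h hd) _; rewrite -(real_normK (num_real h)) expr2 mulrA mulrC.
  rewrite ler_wpM2l//; move/ltW: he; rewrite ler_pdivlMr//.
  apply: le_trans; rewrite mulrC ler_wpM2l//.
  by apply: le_trans (ler_norm _) _; rewrite lerDl.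
apply: DeriveDef; first by apply/cvg_ex; exists X.
exact: cvg_lim.
Unshelve. all: by end_near. Qed.

Lemma is_derive_littleo (f : R -> V) (X : V) :
  is_derive (0 : R) (1 : R) f X -> forall eps : R, 0 < eps ->
  exists2 delta : R, 0 < delta &
    forall t, `|t| < delta -> `|f t - f 0 - t *: X| <= eps * `|t|.
Proof.
move=> [fd fE] eps eps0.
have C : h^-1 *: ((f \o shift 0) (h *: 1) - f 0) @[h --> 0^'] --> X.
  by rewrite -fE; exact: fd.
have /cvgrPdist_le/(_ eps eps0) [delta /= d0 H] := C.
exists delta => // t td; have [->|t0] := eqVneq t 0.
  by rewrite scale0r subr0 subrr !normr0 mulr0.
have := H t; rewrite /ball_/= sub0r normrN => /(_ td t0).
rewrite addr0 [t *: 1]mulr1 distrC.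
have -> : t^-1 *: (f t - f 0) - X = t^-1 *: (f t - f 0 - t *: X).
  by rewrite [RHS]scalerBr scalerA mulVf// scale1r.
by rewrite normrZ normfV ler_pdivrMl ?normr_gt0// mulrC.
Qed.

End DerivativeAtZero.

Section MatrixCalculus.
Context (R : realType).

Lemma cvg_mx (T : Type) (F : set_system T) {FF : Filter F} m n
    (f : T -> 'M[R]_(m, n)) (A : 'M[R]_(m, n)) :
  (forall i j, (fun t => f t i j) @ F --> A i j) -> f @ F --> A.
Proof.
move=> H; apply/cvgrPdist_le => eps eps0.
have h : \forall t \near F, forall i j, `|A i j - f t i j| <= eps.
  apply: filter_forall => i; apply: filter_forall => j.
  by have /cvgrPdist_le/(_ eps eps0) := H i j.
apply: filterS h => t ht; apply: mx_norm_le => [|i j]; first exact: ltW.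
by rewrite !mxE.
Qed.

Lemma cvg_entry (T : Type) (F : set_system T) {FF : Filter F} m n
    (f : T -> 'M[R]_(m, n)) (A : 'M[R]_(m, n)) i j :
  f @ F --> A -> (fun t => f t i j) @ F --> A i j.
Proof.
move=> /cvgrPdist_le fA; apply/cvgrPdist_le => eps /fA; apply: filterS => t.
by apply: le_trans; have := mx_norm_entry (A - f t) i j; rewrite !mxE.
Qed.

Lemma cvg_bigsum (T : Type) (F : set_system T) {FF : Filter F} (I : finType)
    (f : I -> T -> R) (a : I -> R) :
  (forall i, f i @ F --> a i) -> (fun t => \sum_i f i t) @ F --> \sum_i a i.
Proof.
move=> H; have -> : (fun t => \sum_i f i t) = \sum_i f i by apply/funext => t; rewrite fct_sumE.
elim/big_ind2: _ => [|f1 a1 f2 a2 h1 h2|i _]; last exact: H.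
  exact: cvg_cst.
exact: cvgD.
Qed.

Lemma cvg_bigprod (T : Type) (F : set_system T) {FF : Filter F} (I : Type)
    (s : seq I) (f : I -> T -> R) (a : I -> R) :
  (forall i, f i @ F --> a i) ->
  (fun t => \prod_(i <- s) f i t) @ F --> \prod_(i <- s) a i.
Proof.
move=> H; elim: s => [|i s IH].
  by rewrite big_nil; under eq_fun do rewrite big_nil; exact: cvg_cst.
rewrite big_cons; under eq_fun do rewrite big_cons.
by apply: cvgM.
Qed.

Lemma cvg_mulmx (T : Type) (F : set_system T) {FF : Filter F} m n p
    (f : T -> 'M[R]_(m, n)) (g : T -> 'M[R]_(n, p)) (A : 'M[R]_(m, n)) (B : 'M[R]_(n, p)) :
  f @ F --> A -> g @ F --> B -> (fun t => f t *m g t) @ F --> A *m B.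
Proof.
move=> fA gB; apply: cvg_mx => i j; rewrite mxE.
under eq_fun do rewrite mxE.
by apply: cvg_bigsum => k; apply: cvgM; exact: cvg_entry.
Qed.

Lemma is_derive_bigsum (I : finType) (f : I -> R -> R) (df : I -> R) (t : R) :
  (forall i, is_derive t (1 : R) (f i) (df i)) ->
  is_derive t (1 : R) (fun s => \sum_i f i s) (\sum_i df i).
Proof.
move=> H; have -> : (fun t => \sum_i f i t) = \sum_i f i by apply/funext => s; rewrite fct_sumE.
elim/big_ind2: _ => [|f1 d1 f2 d2 h1 h2|i _]; last exact: H.
  exact: is_derive_cst.
exact: is_deriveD.
Qed.

Lemma is_derive_mul (f g : R -> R) (df dg t : R) :
  is_derive t (1 : R) f df -> is_derive t (1 : R) g dg ->
  is_derive t (1 : R) (fun s => f s * g s) (df * g t + f t * dg).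
Proof.
move=> fd gd; apply: is_derive_eq (is_deriveM fd gd) _.
by rewrite addrC [_ *: df]mulrC.
Qed.

Lemma is_derive_mulmx m n p (A : R -> 'M[R]_(m, n)) (B : R -> 'M[R]_(n, p)) t dA dB :
  is_derive t (1 : R) A dA -> is_derive t (1 : R) B dB ->
  is_derive t (1 : R) (fun s => A s *m B s) (dA *m B t + A t *m dB).
Proof.
move=> hA hB; apply: is_derive_mx => i j; rewrite !mxE -big_split/=.
under eq_fun do rewrite mxE.
apply: is_derive_bigsum => k; apply: is_derive_mul; exact: is_derive_entry.
Qed.

Lemma is_derive_unique (V : normedModType R) (f : R -> V) (t : R) x y :
  is_derive t (1 : R) f x -> is_derive t (1 : R) f y -> x = y.
Proof. by move=> [_ <-] [_ <-]. Qed.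

Lemma is_derive_linear m n (f : {linear 'rV[R]_m -> 'rV[R]_n}) (x : R -> 'rV[R]_m) t dx :
  is_derive t (1 : R) x dx -> is_derive t (1 : R) (f \o x) (f dx).
Proof.
move=> xd; have := is_derive_mulmx xd (is_derive_cst (lin1_mx f) t 1).
rewrite mulmx0 addr0 mul_rV_lin1; congr (is_derive _ _ _ _).
by apply/funext => s /=; rewrite mul_rV_lin1.
Qed.

Lemma is_derive_cst_eq (V : normedModType R) (f : R -> V) (a : V) (t : R) :
  (forall s, f s = a) -> is_derive t (1 : R) f 0.
Proof.
by move=> fa; have -> : f = cst a by [apply/funext]; exact: is_derive_cst.
Qed.

(* Gronwall: [exp (- 2 c t) * |f t|^2] is nonincreasing. *)
Lemma linear_ode_zero m n (D : R -> 'M[R]_(m, n)) (a : R -> 'M[R]_n) (T A : R) :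
  (forall t, 0 <= t <= T -> is_derive t (1 : R) D (D t *m a t)) ->
  (forall t i j, 0 <= t <= T -> `|a t i j| <= A) ->
  D 0 = 0 -> forall t, 0 <= t <= T -> D t = 0.
Proof.
move=> Dd aA D0 t /andP[t0 tT].
pose E s := \sum_i \sum_j D s i j * D s i j.
pose dE s := \sum_i \sum_j ((D s *m a s) i j * D s i j + D s i j * (D s *m a s) i j).
(* A product 2 x y z with |z| <= A is at most A (x^2 + y^2); summing over the n values of each of
   the two column indices gives the factor 2 A n. *)
pose K : R := 2 * A * n%:R.
have Ed s : 0 <= s <= T -> is_derive s (1 : R) E (dE s).
  move=> sT; apply: is_derive_bigsum => i; apply: is_derive_bigsum => j.
  by apply: is_derive_mul; apply: is_derive_entry; exact: Dd.
have dEE s : 0 <= s <= T -> dE s <= K * E s.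
  move=> sT; rewrite /dE /E mulr_sumr; apply: ler_sum => i _.
  have tri j k : 2 * (D s i j * (D s i k * a s k j)) <= A * (D s i j ^+ 2 + D s i k ^+ 2).
    have := aA s k j sT; rewrite ler_norml => /andP[a1 a2].
    have A0 : 0 <= A by apply: le_trans (aA s k j sT).
    set x := D s i j; set y := D s i k; set z := a s k j in a1 a2 *.
    have := sqr_ge0 (x + y); have := sqr_ge0 (x - y); rewrite !expr2; nra.
  apply: (@le_trans _ _ (\sum_j \sum_k A * (D s i j ^+ 2 + D s i k ^+ 2))).
    apply: ler_sum => j _; rewrite mxE mulr_suml mulr_sumr -big_split/=.
    apply: ler_sum => k _; apply: le_trans (tri j k); lra.
  under eq_bigr do rewrite -mulr_sumr big_split/= sumr_const card_ord -mulr_natl.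
  rewrite -mulr_sumr big_split/= -mulr_sumr sumr_const card_ord -[X in _ + X]mulr_natl.
  rewrite /K le_eqVlt; apply/orP; left; apply/eqP.
  have -> : \sum_(j < n) D s i j * D s i j = \sum_(j < n) D s i j ^+ 2 by apply: eq_bigr => j _; rewrite expr2.
  by ring.
pose h s : R := expR (- K * s).
have hd s : is_derive s (1 : R) h (- K * h s).
  have ld : is_derive s (1 : R) (fun s => - K * s) (- K).
    apply: is_derive_eq (is_derive_mul (is_derive_cst (- K) s 1) (is_derive_id s 1)) _.
    by rewrite mul0r add0r mulr1.
  apply: is_derive_eq (is_derive1_comp (is_derive_expR (- K * s)) ld) _.
  by rewrite mulrC.
have [t00|tn0] := eqVneq t 0; first by rewrite t00.
have [||c ct] := @MVT_segment _ (fun s => E s * h s) (fun s => dE s * h s + E s * (- K * h s)) 0 t t0.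
- move=> s; rewrite in_itv/= => /andP[s0 st]; apply: is_derive_mul => //.
  by apply: Ed; rewrite !ltW//=; apply: lt_le_trans tT.
- apply: derivable_within_continuous => s; rewrite in_itv/= => /andP[s0 st].
  have := is_derive_mul (Ed s _) (hd s); rewrite s0 (le_trans st tT) => /(_ isT).
  by case.
have -> : E 0 = 0.
  by rewrite /E D0 big1// => i _; rewrite big1// => j _; rewrite !mxE mul0r.
rewrite mul0r !subr0 => FE.
have : E t * h t <= 0.
  rewrite FE pmulr_lle0; last by rewrite lt_neqAle eq_sym tn0.
  move: ct; rewrite in_itv/= => /andP[c0 c1].
  have := dEE c; rewrite c0 (le_trans c1 tT) => /(_ isT) Ec.
  have := expR_gt0 (- K * c); rewrite -/(h c); nra.
rewrite pmulr_lle0 ?expR_gt0// => Et.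
have E0 i : 0 <= \sum_j D t i j * D t i j by apply: sumr_ge0 => j _; exact: sqr_ge0.
apply/matrixP => i j; rewrite mxE; apply/eqP; rewrite -sqrf_eq0 eq_le sqr_ge0 andbT expr2.
apply: le_trans Et; rewrite /E (bigD1 i)//= (bigD1 j)//= -addrA lerDl addr_ge0//.
  by apply: sumr_ge0 => k _; exact: sqr_ge0.
by apply: sumr_ge0 => k _; exact: E0.
Qed.

End MatrixCalculus.

Section NearDiff.
Context (R : realType) (V W : normedModType R).

Lemma near_eq_is_diff (f g : V -> W) (x : V) (df : V -> W) :
  {near x, f =1 g} -> is_diff x f df -> is_diff x g df.
Proof.
move=> fg [fd <-]; have fgx : f x = g x by exact: nbhs_singleton fg.
have H : g \o shift x = cst (g x) + 'd f x +o_ (0 : V) id.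
  apply/eqaddoP => eps eps0.
  have /eqaddoP/(_ _ eps0) := diff_locally fd.
  have : \forall h \near (0 : V), f (h + x) = g (h + x).
    by move: fg; rewrite (near_shift 0) subr0; apply: filterS.
  apply: filterS2 => h E; rewrite -!/(_ + _) /=.
  by rewrite !fctE/= E fgx.
have dE := diff_unique (diff_continuous fd) H.
apply: DiffDef => //.
by apply/diff_locallyP; rewrite dE; split=> //; exact: diff_continuous.
Qed.

Lemma is_derive_diff_comp (F : V -> W) (f : R -> V) (t : R) (df : V) :
  differentiable F (f t) -> is_derive t (1 : R) f df ->
  is_derive t (1 : R) (F \o f) ('d F (f t) df).
Proof.
move=> Fd [/derivable1_diffP fd fE].
have Fdf := differentiable_comp fd Fd.
apply: DeriveDef; first exact/derivable1_diffP.
by rewrite -fE deriveE// diff_comp//= deriveE.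
Qed.

End NearDiff.

(** * Lie groups: charts, exponential, bracket *)

Section LieCharts.
Context (R : realType) (n : nat) (G : lieGroupType R n).
Implicit Types (g h : G) (X Y Z : 'rV[R]_n).

Lemma cvg_mulg T (F : set_system T) {FF : Filter F} (f g : T -> G) (a b : G) :
  f @ F --> a -> g @ F --> b -> (fun x => (f x * g x)%g) @ F --> (a * b)%g.
Proof.
move=> fa gb; have := lie_mul_continuous (a, b).
exact: cvg_comp (cvg_pair fa gb).
Qed.

Lemma cvg_invg T (F : set_system T) {FF : Filter F} (f : T -> G) (a : G) :
  f @ F --> a -> (fun x => ((f x)^-1)%g) @ F --> (a^-1)%g.
Proof. by move=> fa; apply: cvg_comp fa _; exact: lie_inv_continuous. Qed.

Lemma nbhs_cdom (c : chart R n G) g : cdom c g -> nbhs g (cdom c).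
Proof. by move=> cg; apply: open_nbhs_nbhs; split=> //; exact: cdom_open. Qed.

Lemma nbhs_cimg (c : chart R n G) g :
  cdom c g -> nbhs (cfun c g) (cfun c @` cdom c).
Proof.
by move=> cg; apply: open_nbhs_nbhs; split; [exact: cimg_open|exists g].
Qed.

Lemma cdom_cinv (c : chart R n G) u : (cfun c @` cdom c) u -> cdom c (cinv c u).
Proof. by move=> [g cg <-]; rewrite cfunK. Qed.

Lemma cinvK (c : chart R n G) u : (cfun c @` cdom c) u -> cfun c (cinv c u) = u.
Proof. by move=> [g cg <-]; rewrite cfunK. Qed.

Definition chart_mul (c1 c2 c3 : chart R n G) (p : 'rV[R]_n * 'rV[R]_n) :=
  cfun c3 (cinv c1 p.1 * cinv c2 p.2)%g.

Definition chart_mul_dom (c1 c2 c3 : chart R n G) :=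
  [set p : 'rV[R]_n * 'rV[R]_n |
    [/\ (cfun c1 @` cdom c1) p.1, (cfun c2 @` cdom c2) p.2 &
        cdom c3 (cinv c1 p.1 * cinv c2 p.2)%g]].

Lemma nbhs_chart_mul_dom c1 c2 c3 g h :
  cdom c1 g -> cdom c2 h -> cdom c3 (g * h)%g ->
  nbhs (cfun c1 g, cfun c2 h) (chart_mul_dom c1 c2 c3).
Proof.
move=> g1 h2 gh3.
have fstc : fst @ nbhs (cfun c1 g, cfun c2 h) --> cfun c1 g by exact: cvg_fst.
have sndc : snd @ nbhs (cfun c1 g, cfun c2 h) --> cfun c2 h by exact: cvg_snd.
have i1 : (fun p => cinv c1 p.1) @ nbhs (cfun c1 g, cfun c2 h) --> g.
  by rewrite -[X in _ --> X](cfunK g1); apply: cvg_comp fstc _; exact: cinv_continuous.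
have i2 : (fun p => cinv c2 p.2) @ nbhs (cfun c1 g, cfun c2 h) --> h.
  by rewrite -[X in _ --> X](cfunK h2); apply: cvg_comp sndc _; exact: cinv_continuous.
have /= i3 := cvg_mulg i1 i2.
near=> p; split; near: p.
- exact: fstc (nbhs_cimg g1).
- exact: sndc (nbhs_cimg h2).
- exact: i3 (nbhs_cdom gh3).
Unshelve. all: by end_near. Qed.

Lemma differentiable_chart_mul c1 c2 c3 g h :
  lie_atlas c1 -> lie_atlas c2 -> lie_atlas c3 ->
  cdom c1 g -> cdom c2 h -> cdom c3 (g * h)%g ->
  differentiable (chart_mul c1 c2 c3) (cfun c1 g, cfun c2 h).
Proof.
move=> A1 A2 A3 g1 h2 gh3.
have [+ _] := lie_mul_smooth _ _ _ A1 A2 A3 1%N; apply; split=> /=.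
- by exists g.
- by exists h.
- by rewrite !cfunK.
Qed.

Definition chart_id := @chart1 R n G.
Local Notation c := (cfun chart_id).
Local Notation ci := (cinv chart_id).
Local Notation e := (c (1%g : G)).

Lemma chart_id_atlas : lie_atlas chart_id.
Proof. by rewrite /chart_id /chart1; case: cid2. Qed.

Lemma chart_id1 : cdom chart_id 1%g.
Proof. by rewrite /chart_id /chart1; case: cid2. Qed.

Lemma cinv_e : ci e = 1%g.
Proof. exact: cfunK chart_id1. Qed.

Local Hint Resolve chart_id1 chart_id_atlas : core.

Lemma cvg_cinv_e : ci @ e --> (1%g : G).
Proof. by have := cinv_continuous chart_id1; rewrite /prop_for /continuous_at cinv_e. Qed.

Definition conjc g u := c (g * ci u * g^-1)%g.

Lemma conjc_e g : conjc g e = e.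
Proof. by rewrite /conjc cinv_e mulg1 mulgV. Qed.

Lemma cvg_conj g (T : Type) (F : set_system T) {FF : Filter F} (f : T -> G) :
  f @ F --> (1%g : G) -> (fun x => g * f x * g^-1)%g @ F --> (1%g : G).
Proof.
move=> f1; have E : (g * 1 * g^-1)%g = 1%g by rewrite mulg1 mulgV.
rewrite -[X in _ --> X]E.
by apply: cvg_mulg; [apply: cvg_mulg => //; exact: cvg_cst|exact: cvg_cst].
Qed.

(** The chart at the identity need not contain g, so the product is computed through auxiliary
    charts [c1] at g and [c2] at its inverse. *)
Lemma differentiable_conjc g : differentiable (conjc g) e.
Proof.
have [c1 A1 g1] := lie_atlas_cover g.
have [c2 A2 g2] := lie_atlas_cover (g^-1)%g.
pose L u := chart_mul c1 chart_id c1 (cfun c1 g, u).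
pose Rr v := chart_mul c1 c2 chart_id (v, cfun c2 (g^-1)%g).
have Ld : differentiable L e.
  apply: (@differentiable_comp _ _ _ _ (fun u => (cfun c1 g, u))).
    exact: differentiable_pair.
  by apply: differentiable_chart_mul => //; rewrite mulg1.
have LE : L e = cfun c1 g by rewrite /L /chart_mul/= !cfunK// mulg1.
have Rd : differentiable Rr (L e).
  rewrite LE.
  apply: (@differentiable_comp _ _ _ _ (fun u => (u, cfun c2 (g^-1)%g))).
    exact: differentiable_pair.
  by apply: differentiable_chart_mul => //; rewrite mulgV.
have /differentiableP RL := differentiable_comp Ld Rd.
suff : is_diff e (conjc g) ('d (Rr \o L) e) by case.
apply: near_eq_is_diff RL.
have Lc : (fun u => (g * ci u)%g) @ e --> g.
  by rewrite -[X in _ --> X]mulg1; exact: (cvg_mulg (cvg_cst g) cvg_cinv_e).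
near=> u; rewrite /= /Rr /L /chart_mul /conjc/= !cfunK//.
by near: u; exact: Lc (nbhs_cdom g1).
Unshelve. all: by end_near. Qed.

Lemma AdE g X : Ad g X = 'd (conjc g) e X.
Proof. by []. Qed.

Lemma Ad_is_linear g : linear (Ad g).
Proof. by move=> a X Y; rewrite !AdE linearP. Qed.

HB.instance Definition _ g := GRing.isLinear.Build R 'rV[R]_n 'rV[R]_n _ (Ad g)
  (Ad_is_linear g).

Lemma nbhs_cdom_conj g : \forall u \near e, cdom chart_id (g * ci u * g^-1)%g.
Proof. exact: (cvg_conj g cvg_cinv_e) (nbhs_cdom chart_id1). Qed.

Lemma AdM g h X : Ad (g * h)%g X = Ad g (Ad h X).
Proof.
have hd := differentiable_conjc h.
have gd : differentiable (conjc g) (conjc h e).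
  by rewrite conjc_e; exact: differentiable_conjc.
have /differentiableP ghd := differentiable_comp hd gd.
rewrite AdE; suff [_ ->] : is_diff e (conjc (g * h)%g) ('d (conjc g \o conjc h) e).
  transitivity ('d (conjc g) (conjc h e) ('d (conjc h) e X)).
    exact: (congr1 (fun k => k X) (diff_comp hd gd)).
  by rewrite conjc_e.
apply: near_eq_is_diff ghd; near=> u.
rewrite /= /conjc cfunK; first by rewrite invgM !mulgA.
by near: u; exact: nbhs_cdom_conj.
Unshelve. all: by end_near. Qed.

Lemma Ad1 X : Ad (1%g : G) X = X.
Proof.
rewrite AdE; suff [_ ->] : is_diff e (conjc 1%g) id by [].
apply: (@near_eq_is_diff _ _ _ id).
near=> u; rewrite /conjc invg1 mul1g mulg1 cinvK//.
by near: u; exact: nbhs_cimg chart_id1.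
Unshelve. all: by end_near. Qed.

Lemma AdK g X : Ad (g^-1)%g (Ad g X) = X.
Proof. by rewrite -AdM mulVg Ad1. Qed.

Lemma AdVK g X : Ad g (Ad (g^-1)%g X) = X.
Proof. by rewrite -AdM mulgV Ad1. Qed.

(** Velocity at the identity of a curve that need not be a homomorphism. Continuity is required in
    G, because the chart function says nothing about points off its domain. *)
Definition tangent (eta : R -> G) Z :=
  [/\ eta 0 = 1%g, eta @ (0 : R) --> (1%g : G) &
      is_derive (0 : R) (1 : R) (c \o eta) Z].

Lemma tangent_conj g eta Z : tangent eta Z ->
  tangent (fun t => (g * eta t * g^-1)%g) (Ad g Z).
Proof.
move=> [eta0 eta1 etaZ]; split; first by rewrite eta0 mulg1 mulgV.
  exact: cvg_conj.
have h : is_derive (0 : R) (1 : R) (conjc g \o (c \o eta)) (Ad g Z).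
  rewrite AdE; have -> : e = (c \o eta) 0 by rewrite /= eta0.
  by apply: is_derive_diff_comp => //=; rewrite eta0; exact: differentiable_conjc.
apply: near_eq_is_derive h; near=> t; rewrite /= /conjc cfunK//.
by near: t; exact: eta1 (nbhs_cdom chart_id1).
Unshelve. all: by end_near. Qed.

(** A differential on a product is determined by its restrictions to the two axes, where
    multiplication by the identity makes it the identity map. *)
Lemma is_diff_chart_mul_e : is_diff (e, e) (chart_mul chart_id chart_id chart_id)
  (fun p => p.1 + p.2).
Proof.
set m := chart_mul _ _ _.
have md : differentiable m (e, e).
  apply: differentiable_chart_mul; try exact: chart_id_atlas; try exact: chart_id1.
  by rewrite mulg1; exact: chart_id1.
have k1 : is_diff e (m \o (fun u => (u, e))) id.
  apply: (@near_eq_is_diff _ _ _ id); near=> u.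
  rewrite /= /m /chart_mul/= cinv_e mulg1 cinvK//.
  by near: u; exact: nbhs_cimg chart_id1.
have k2 : is_diff e (m \o (fun u => (e, u))) id.
  apply: (@near_eq_is_diff _ _ _ id); near=> u.
  rewrite /= /m /chart_mul/= cinv_e mul1g cinvK//.
  by near: u; exact: nbhs_cimg chart_id1.
apply: DiffDef => //; apply/funext => -[x y] /=.
have -> : (x, y) = (x, 0) + (0, y) :> 'rV[R]_n * 'rV[R]_n.
  by apply: injective_projections => /=; rewrite ?addr0 ?add0r.
rewrite linearD.
have p1 : is_diff e (fun u : 'rV[R]_n => (u, e)) (fun u => (u, 0)).
  exact: (is_diff_pair (is_diff_id e) (is_diff_cst e e)).
have p2 : is_diff e (fun u : 'rV[R]_n => (e, u)) (fun u => (0, u)).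
  exact: (is_diff_pair (is_diff_cst e e) (is_diff_id e)).
have q1 := is_diff_comp p1 (differentiableP md).
have q2 := is_diff_comp p2 (differentiableP md).
have E1 : 'd m (e, e) \o (fun u => (u, 0)) = id by case: q1 => _ <-; case: k1 => _ ->.
have E2 : 'd m (e, e) \o (fun u => (0, u)) = id by case: q2 => _ <-; case: k2 => _ ->.
congr (_ + _); first exact: (congr1 (fun k => k x) E1).
exact: (congr1 (fun k => k y) E2).
Unshelve. all: by end_near. Qed.

Lemma tangent_mul eta zeta X Y : tangent eta X -> tangent zeta Y ->
  tangent (fun t => (eta t * zeta t)%g) (X + Y).
Proof.
move=> [eta0 eta1 etaX] [zeta0 zeta1 zetaY]; split.
- by rewrite eta0 zeta0 mulg1.
- by rewrite -[X in _ --> X]mulg1; exact: cvg_mulg.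
have h : is_derive (0 : R) (1 : R)
    (chart_mul chart_id chart_id chart_id \o (fun t => (c (eta t), c (zeta t)))) (X + Y).
  have -> : X + Y = 'd (chart_mul chart_id chart_id chart_id) (e, e) (X, Y).
    by have [_ ->] := is_diff_chart_mul_e.
  have -> : (e, e) = (fun t => (c (eta t), c (zeta t))) 0 by rewrite /= eta0 zeta0.
  apply: is_derive_diff_comp => /=.
    by rewrite eta0 zeta0; have [] := is_diff_chart_mul_e.
  have [/derivable1_diffP d1 E1] := etaX; have [/derivable1_diffP d2 E2] := zetaY.
  have d12 := differentiable_pair d1 d2.
  apply: DeriveDef; first exact/derivable1_diffP.
  by rewrite deriveE//= diff_pair//= -E1 -E2 !deriveE.
apply: near_eq_is_derive h; near=> t; rewrite /= /chart_mul/= !cfunK//.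
- by near: t; exact: zeta1 (nbhs_cdom chart_id1).
- by near: t; exact: eta1 (nbhs_cdom chart_id1).
Unshelve. all: by end_near. Qed.


Lemma differentiable_scale_fun (V : normedModType R) m (k : V -> R)
    (F : V -> 'rV[R]_m) x :
  differentiable k x -> differentiable F x ->
  differentiable (fun y => k y *: F y) x.
Proof.
move=> kd Fd.
have -> : (fun y => k y *: F y) =
    \sum_(j < m) (fun y => (k y * F y 0 j) *: (delta_mx 0 j : 'rV[R]_m)).
  apply/funext => y; rewrite [in LHS](row_sum_delta (F y)) scaler_sumr fct_sumE.
  by apply: eq_bigr => j _; rewrite scalerA.
apply: differentiable_sum => j; apply: differentiableZl.
apply: (@differentiableM _ _ k (fun y => F y 0 j)) => //.
apply: (@differentiable_comp _ _ _ _ F (fun r : 'rV[R]_m => r 0 j)) => //.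
exact: differentiable_coord.
Qed.

Lemma first_order_coordinates (V W : normedModType R) (F : V -> W) (U : set V) :
  smooth_on U F ->
  exists D : V -> {linear V -> W}, (forall x, U x -> is_diff x F (D x)) /\
    forall v x, U x -> differentiable (fun y => D y v) x.
Proof.
move=> /(_ 2%N) [Fd F2]; exists (fun x => [the {linear V -> W} of 'd F x]); split.
  by move=> x Ux; apply: differentiableP; exact: Fd.
by move=> v x Ux; have [+ _] := F2 v; apply.
Qed.

(** In coordinates, conjugation by u is v -> m (m (u, v), u^-1). Hence [Ad] is the partial
    differential of the product at (u, e) in the second variable followed by the one at (u, u^-1) in
    the first, and both depend differentiably on u because the product is twice differentiable. *)
Lemma differentiable_Ad Y : differentiable (fun u => Ad (ci u) Y) e.
Proof.
pose U := chart_mul_dom chart_id chart_id chart_id.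
pose m := chart_mul chart_id chart_id chart_id.
have [D [mD Dd]] : exists D : ('rV[R]_n * 'rV[R]_n)%type -> {linear ('rV[R]_n * 'rV[R]_n)%type -> 'rV[R]_n},
    (forall x, U x -> is_diff x m (D x)) /\
    forall v x, U x -> differentiable (fun y => D y v) x.
  by apply: first_order_coordinates; apply: lie_mul_smooth.
pose io u := c ((ci u)^-1)%g.
have iod : differentiable io e.
  have [+ _] := lie_inv_smooth _ _ chart_id_atlas chart_id_atlas 1%N; apply.
  split; first by exists 1%g.
  by rewrite (cfunK chart_id1) invg1.
have ioe : io e = e by rewrite /io (cfunK chart_id1) invg1.
have Uee : nbhs (e, e) U by apply: nbhs_chart_mul_dom => //; rewrite mulg1.
have cioe : io @ e --> e by rewrite -{2}ioe; exact: differentiable_continuous.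
have V1 : nbhs ((1%g : G)^-1)%g (cdom chart_id) by rewrite invg1; exact: nbhs_cdom.
have U1 : \forall u \near e, U (u, e).
  have h : {for e, continuous (fun u : 'rV[R]_n => (u, e))}.
    by apply: differentiable_continuous; exact: differentiable_pair.
  exact: h Uee.
have U2 : \forall u \near e, U (u, io u).
  have h : {for e, continuous (fun u : 'rV[R]_n => (u, io u))}.
    by apply: differentiable_continuous; exact: differentiable_pair.
  by apply: h; rewrite ioe.
pose w u := D (u, e) (0, Y).
have wd : differentiable w e.
  apply: (@differentiable_comp _ _ _ _ (fun u => (u, e)) (fun y => D y (0, Y))).
    exact: differentiable_pair.
  by apply: Dd; exact: nbhs_singleton Uee.
pose T u := \sum_(j < n) w u 0 j *: D (u, io u) (delta_mx 0 j, 0).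
have Td : differentiable T e.
  have -> : T = \sum_(j < n) (fun u => w u 0 j *: D (u, io u) (delta_mx 0 j, 0)).
    by apply/funext => u; rewrite fct_sumE.
  apply: differentiable_sum => j; apply: differentiable_scale_fun.
    apply: (@differentiable_comp _ _ _ _ w (fun r : 'rV[R]_n => r 0 j)) => //.
    exact: differentiable_coord.
  apply: (@differentiable_comp _ _ _ _ (fun u => (u, io u)) (fun y => D y (delta_mx 0 j, 0))).
    exact: differentiable_pair.
  by rewrite ioe; apply: Dd; exact: nbhs_singleton Uee.
suff : is_diff e (fun u => Ad (ci u) Y) ('d T e) by case.
have /differentiableP := Td; apply: near_eq_is_diff; near=> u.
have ui : (c @` cdom chart_id) u by near: u; exact: nbhs_cimg.
have Uu : U (u, io u) by near: u.
have Ue : U (u, e) by near: u.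
have p1 : is_diff e (fun v : 'rV[R]_n => (u, v)) (fun v => (0, v)).
  exact: (is_diff_pair (is_diff_cst u e) (is_diff_id e)).
have q1 := is_diff_comp p1 (mD _ Ue).
have mue : m (u, e) = u by rewrite /m /chart_mul/= (cfunK chart_id1) mulg1 cinvK.
have p2 : is_diff u (fun v : 'rV[R]_n => (v, io u)) (fun v => (v, 0)).
  exact: (is_diff_pair (is_diff_id u) (is_diff_cst (io u) u)).
have q2 := is_diff_comp p2 (mD _ Uu).
rewrite -[X in is_diff X]mue in q2.
have q12 := is_diff_comp q1 q2.
rewrite AdE; have [_ ->] : is_diff e (conjc (ci u)) (D (u, io u) \o (fun v => (v, 0)) \o (D (u, e) \o (fun v => (0, v)))).
  apply: near_eq_is_diff q12; near=> v.
  rewrite /= /m /chart_mul /conjc/= cfunK.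
    by rewrite /io cfunK//; near: u; exact: (cvg_invg cvg_cinv_e) V1.
  near: v; have Lc : (fun v => (ci u * ci v)%g) @ e --> ci u.
    by rewrite -[X in _ --> X]mulg1; exact: (cvg_mulg (cvg_cst (ci u)) cvg_cinv_e).
  by apply: Lc; apply: nbhs_cdom; exact: cdom_cinv.
rewrite /= /T -/(w u).
have -> : (w u, 0) = \sum_i w u 0 i *: ((delta_mx 0 i, 0) : 'rV[R]_n * 'rV[R]_n).
  rewrite [in LHS](row_sum_delta (w u)); elim/big_rec2: _ => // i y1 y2 _ <-.
  by apply: injective_projections => //=; rewrite scaler0 addr0.
by rewrite linear_sum; apply: eq_bigr => i _; rewrite linearZ.
Unshelve. all: by end_near. Qed.

Lemma tangent_Ad eta Z Y : tangent eta Z ->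
  is_derive (0 : R) (1 : R) (fun t => Ad (eta t) Y) (lie G Z Y).
Proof.
move=> [eta0 eta1 etaZ].
have h : is_derive (0 : R) (1 : R) ((fun u => Ad (ci u) Y) \o (c \o eta)) (lie G Z Y).
  rewrite /lie -/e -[cfun _ _]/e -[chart1 G]/chart_id.
  have -> : e = (c \o eta) 0 by rewrite /= eta0.
  by apply: is_derive_diff_comp => //=; rewrite eta0; exact: differentiable_Ad.
apply: near_eq_is_derive h; near=> t; rewrite /= cfunK//.
by near: t; exact: eta1 (nbhs_cdom chart_id1).
Unshelve. all: by end_near. Qed.

Lemma continuous_Ad Y : continuous (fun g : G => Ad g Y).
Proof.
have c1 Z : (fun g : G => Ad g Z) @ (1%g : G) --> Z.
  have h : ((fun u => Ad (ci u) Z) \o c) @ (1%g : G) --> Z.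
    have := differentiable_continuous (differentiable_Ad Z).
    rewrite /prop_for /continuous_at cinv_e Ad1; apply: cvg_comp.
    exact: cfun_continuous.
  apply: cvg_trans h; apply: near_eq_cvg; near=> g.
  rewrite /= cfunK//; near: g; exact: nbhs_cdom.
have clin g : continuous (Ad g).
  by have := diff_continuous (differentiable_conjc g).
move=> g; have k : (fun h : G => (g^-1 * h)%g) @ g --> (1%g : G).
  by rewrite -[X in _ --> X](mulVg g); exact: (cvg_mulg (cvg_cst _) cvg_id).
have F : (fun h : G => Ad (g^-1 * h)%g Y) @ g --> Y by exact: cvg_comp k (c1 Y).
have H : (fun h : G => Ad g (Ad (g^-1 * h)%g Y)) @ g --> Ad g Y.
  by apply: cvg_comp F _; exact: clin.
apply: cvg_trans H; apply: near_eq_cvg; near=> h.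
by rewrite /= -AdM mulgA mulgV mul1g.
Unshelve. all: by end_near. Qed.

Lemma chart_mul_increment :
  exists C r : R, [/\ 0 < C, 0 < r,
    forall u, `|u - e| < r -> (c @` cdom chart_id) u &
    forall u u' v v', `|u - e| < r -> `|u' - e| < r ->
      `|v - e| < r -> `|v' - e| < r ->
      cdom chart_id (ci u * ci v)%g /\
      `|c (ci u * ci v)%g - c (ci u' * ci v)%g - c (ci u * ci v')%g
        + c (ci u' * ci v')%g| <= C * `|u - u'| * `|v - v'|].
Proof.
pose U := chart_mul_dom chart_id chart_id chart_id.
have Uee : nbhs (e, e) U by apply: nbhs_chart_mul_dom => //; rewrite mulg1.
have [C [r [C0 r0 H]]] :=
  mixed_increment_le Uee (lie_mul_smooth _ _ _ chart_id_atlas chart_id_atlas chart_id_atlas).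
have [r2 /= r20 rU] : exists2 r2, 0 < r2 & ball_ Num.Def.normr (e, e) r2 `<=` U.
  by have /nbhs_normP[r2 /= ? ?] := Uee; exists r2.
have rU' u v : `|u - e| < r2 -> `|v - e| < r2 -> U (u, v).
  move=> ur vr; apply: rU; rewrite /ball_/= distrC.
  by rewrite [`|_|]/(Num.max _ _) gt_max ur vr.
exists C, (Num.min r r2); split=> //.
- by rewrite lt_min r0.
- by move=> u; rewrite lt_min => /andP[_ ur]; have [] := rU' u e ur; rewrite ?subrr ?normr0.
- move=> u u' v v'; rewrite !lt_min.
  move=> /andP[ur ur2] /andP[u'r _] /andP[vr vr2] /andP[v'r _].
  by split; [have [] := rU' u v ur2 vr2|exact: H].
Qed.

End LieCharts.

Lemma max_diff (R : realDomainType) (s : R) : s = Num.max s 0 - Num.max (- s) 0.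
Proof.
case: (leP 0 s) => s0; first by rewrite max_r ?oppr_le0// subr0.
by rewrite max_l ?oppr_ge0 ?ltW// sub0r opprK.
Qed.

(** * Existence of one-parameter subgroups *)

Section OneParameter.
Context (R : realType) (n : nat) (G : lieGroupType R n).
Implicit Types (g h : G) (X Y Z u v : 'rV[R]_n).

Local Notation c := (cfun (@chart_id R n G)).
Local Notation ci := (cinv (@chart_id R n G)).
Local Notation dom := (cdom (@chart_id R n G)).
Local Notation e := (c (1%g : G)).
Local Hint Resolve chart_id1 chart_id_atlas : core.

(** Coordinates centred at the identity, in which the product is u + v up to a term of order |u|
    |v|. *)
Definition lc g : 'rV[R]_n := c g - e.
Definition li u : G := ci (u + e).

Lemma lc1 : lc 1%g = 0. Proof. exact: subrr. Qed.

Lemma lcK g : dom g -> li (lc g) = g.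
Proof. by move=> dg; rewrite /li /lc subrK cfunK. Qed.

Lemma li0 : li 0 = 1%g. Proof. by rewrite /li add0r cinv_e. Qed.

Lemma lc_cvg1 : lc @ (1%g : G) --> (0 : 'rV[R]_n).
Proof.
rewrite -[X in _ --> X](subrr e); apply: cvgB; last exact: cvg_cst.
exact: cfun_continuous.
Qed.

Lemma li_cvg T (F : set_system T) {FF : Filter F} (f : T -> 'rV[R]_n) u :
  (c @` dom) (u + e) -> f @ F --> u -> li \o f @ F --> li u.
Proof.
move=> ue fu.
have fe : (fun t => f t + e) @ F --> u + e by apply: cvgD => //; exact: cvg_cst.
rewrite /li; apply: cvg_comp fe _.
by have [g dg E] := ue; rewrite -E cfunK//; have := cinv_continuous dg; rewrite /prop_for /continuous_at cfunK.
Qed.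

(** The three estimates are instances of the mixed increment bound in which some arguments are the
    identity, where the product reduces to the other factor. *)
Lemma local_group :
  exists C r : R, [/\ 0 < C, 0 < r,
    forall u, `|u| < r -> (c @` dom) (u + e),
    forall u, `|u| < r -> dom (li u) /\ lc (li u) = u &
    forall u u' v v', `|u| < r -> `|u'| < r -> `|v| < r -> `|v'| < r ->
      [/\ dom (li u * li v)%g,
        `|lc (li u * li v)%g - u - v| <= C * `|u| * `|v|,
        `|lc (li u * li v)%g - lc (li u' * li v)%g - (u - u')|
          <= C * `|u - u'| * `|v| &
        `|lc (li u * li v)%g - lc (li u * li v')%g - (v - v')|
          <= C * `|u| * `|v - v'|]].
Proof.
have [C [r [C0 r0 D H]]] := chart_mul_increment G.
have D' u : `|u| < r -> (c @` dom) (u + e) by move=> ur; apply: D; rewrite addrK.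
have Dl u : `|u| < r -> dom (li u) /\ lc (li u) = u.
  move=> ur; split; first exact: cdom_cinv (D' _ ur).
  by rewrite /lc /li cinvK ?addrK//; exact: D'.
exists C, r; split=> // u u' v v' ur u'r vr v'r.
have r0' : `|0 : 'rV[R]_n| < r by rewrite normr0.
have K a a' b b' : `|a| < r -> `|a'| < r -> `|b| < r -> `|b'| < r ->
  `|lc (li a * li b)%g - lc (li a' * li b)%g - lc (li a * li b')%g
    + lc (li a' * li b')%g| <= C * `|a - a'| * `|b - b'|.
  move=> ar a'r br b'r.
  have [] := H (a + e) (a' + e) (b + e) (b' + e); rewrite ?addrK// => _.
  rewrite !(opprD a') !(opprD b') !addrA ![_ - a' - e]addrAC ![_ - b' - e]addrAC !addrK.
  apply: le_trans; rewrite le_eqVlt; apply/orP; left; apply/eqP; congr (`| _ |).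
  by rewrite /lc /li; apply/rowP => i; rewrite !mxE; ring.
have l1 w : `|w| < r -> lc (li w * li 0)%g = w.
  by move=> /Dl[_]; rewrite li0 mulg1.
have l2 w : `|w| < r -> lc (li 0 * li w)%g = w.
  by move=> /Dl[_]; rewrite li0 mul1g.
split.
- by have [] := H (u + e) (u + e) (v + e) (v + e); rewrite ?addrK.
- have := K u 0 v 0 ur r0' vr r0'; rewrite l1// l2// l1// !subr0 addr0.
  by rewrite addrAC.
- have := K u u' v 0 ur u'r vr r0'; rewrite !l1// subr0.
  apply: le_trans; rewrite le_eqVlt; apply/orP; left; apply/eqP; congr (`| _ |).
  by apply/rowP => i; rewrite !mxE; ring.
- have := K u 0 v v' ur r0' vr v'r; rewrite !l2// subr0.
  apply: le_trans; rewrite le_eqVlt; apply/orP; left; apply/eqP; congr (`| _ |).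
  by apply/rowP => i; rewrite !mxE; ring.
Qed.

(** By induction on k: one more factor adds an error of order |u| |x| with |u| <= 2 k |x|, and these
    errors add up to the order of (k |x|)^2. The constants do not depend on k, so that the estimate
    applies to N-th powers of elements of size 1/N. *)
Lemma power_estimate : exists C rho : R, [/\ 0 < C, 0 < rho &
  forall g (k : nat), dom g -> `|lc g| <= rho -> k%:R * `|lc g| <= rho ->
    dom (g ^+ k)%g /\
    `|lc (g ^+ k)%g - k%:R *: lc g| <= C * (k%:R * `|lc g|) ^+ 2].
Proof.
have [C [r [C0 r0 _ _ H]]] := local_group.
(* The bound r / 4 keeps all factors in the local group; the bound C^-1 / 2 makes the quadratic
   error at most the linear term, whence |u| <= 2 k |x|. *)
pose rho := Num.min (r / 4) (C^-1 / 2).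
have rho0 : 0 < rho by rewrite lt_min !divr_gt0// invr_gt0.
have rhor : 4 * rho <= r.
  by rewrite mulrC -ler_pdivlMr// ge_min lexx.
have rhoC : 2 * C * rho <= 1.
  have : rho <= C^-1 / 2 by rewrite ge_min lexx orbT.
  rewrite ler_pdivlMr// -(ler_pM2l C0) mulfV ?gt_eqF//; lra.
exists (2 * C), rho; split => //; first by rewrite mulr_gt0.
move=> g k dg xr; set x := lc g.
elim: k => [|k IH] kx.
  by rewrite expg0 lc1 scale0r subrr normr0 mul0r expr0n mulr0; split.
have x0 : 0 <= `|x| by [].
have kx' : k%:R * `|x| <= rho by move: kx; rewrite -natr1; nra.
have {IH} [dk Hk] := IH kx'.
set u := lc (g ^+ k)%g in Hk *.
have k0 : 0 <= k%:R :> R by exact: ler0n.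
have kx0 : 0 <= k%:R * `|x| by rewrite mulr_ge0.
have uk : `|u| <= 2 * (k%:R * `|x|).
  have : `|u| <= `|u - k%:R *: x| + `|k%:R *: x|.
    by rewrite -{1}(subrK (k%:R *: x) u); exact: ler_normD.
  rewrite normrZ ger0_norm//; move: Hk; rewrite -/x; set y := k%:R * `|x| in kx' kx0 *.
  nra.
have ur : `|u| < r by apply: le_lt_trans uk _; lra.
have xr' : `|x| < r by apply: le_lt_trans xr _; lra.
have [d1 d2 _ _] := H u u x x ur ur xr' xr'.
move: d1 d2; rewrite !lcK// -expgSr => d1 d2; split=> //.
have -> : lc (g ^+ k.+1)%g - k.+1%:R *: x
    = (lc (g ^+ k.+1)%g - u - x) + (u - k%:R *: x).
  by rewrite -natr1 scalerDl scale1r; apply/rowP => i; rewrite !mxE; ring.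
apply: le_trans (ler_normD _ _) _.
have : C * `|u| * `|x| <= 2 * C * (k%:R * `|x|) * `|x|.
  rewrite -mulrA [leRHS](_ : _ = C * (2 * (k%:R * `|x|) * `|x|)); last by ring.
  by rewrite ler_pM2l// ler_wpM2r.
have -> : k.+1%:R * `|x| = k%:R * `|x| + `|x| by rewrite -natr1 mulrDl mul1r.
move: Hk d2; rewrite -/x.
set p := k%:R * `|x| in kx0 *; set q := `|x| in x0 * => B A A'.
have : 0 <= C * (p * q) by rewrite !mulr_ge0// ltW.
have : 0 <= C * (q * q) by rewrite !mulr_ge0// ltW.
by move: B; rewrite !expr2; lra.
Qed.

(** The product of g and its inverse has coordinates 0, so the two coordinate vectors cancel up to C
    times the product of their norms; for small g this first bounds the inverse by twice the norm of
    g. *)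
Lemma inverse_estimate : exists C : R, 0 < C /\
  \forall g \near (1%g : G), `|lc (g^-1)%g + lc g| <= C * `|lc g| ^+ 2.
Proof.
have [C [r [C0 r0 _ _ H]]] := local_group.
exists (2 * C); split; first by rewrite mulr_gt0.
have V1 : (fun g : G => g^-1)%g @ (1%g : G) --> (1%g : G).
  by rewrite -[X in _ --> X]invg1; exact: lie_inv_continuous.
have small (q : R) : 0 < q -> \forall g \near (1%g : G), `|lc g| < q.
  move=> q0; have /cvgrPdist_lt/(_ q q0) := lc_cvg1.
  by apply: filterS => g; rewrite sub0r normrN.
have d1 : nbhs (1%g : G) dom by exact: nbhs_cdom.
have q0 : 0 < C^-1 / 2 by rewrite divr_gt0// invr_gt0.
near=> g.
have dg : dom g by near: g.
have dg' : dom (g^-1)%g by near: g; exact: V1 d1.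
have gr : `|lc g| < r by near: g; exact: small.
have g'r : `|lc (g^-1)%g| < r by near: g; exact: V1 (small r r0).
have gC : `|lc g| < C^-1 / 2 by near: g; exact: small.
have [_ + _ _] := H _ _ _ _ gr gr g'r g'r.
rewrite !lcK// mulgV lc1 sub0r -opprD normrN addrC.
have h : 2 * C * `|lc g| <= 1.
  by move: (ltW gC); rewrite ler_pdivlMr// -(ler_pM2l C0) mulfV ?gt_eqF//; lra.
have : `|lc (g^-1)%g| <= `|lc (g^-1)%g + lc g| + `|lc g|.
  by rewrite -{1}(addrK (lc g) (lc (g^-1)%g)); exact: ler_normB.
have x0 : 0 <= `|lc g| by [].
have y0 : 0 <= `|lc (g^-1)%g| by [].
set a := `|lc g| in h x0 *; set b := `|lc (g^-1)%g| in y0 *; set s := `|_ + _|.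
move=> bs sC; have : b <= 2 * a by nra.
have : C * a * b <= C * a * (2 * a) -> s <= 2 * C * a ^+ 2 by nra.
by move=> k ba; apply: k; rewrite ler_wpM2l// mulr_ge0// ltW.
Unshelve. all: by end_near. Qed.

(* A finer chain of powers of ever smaller elements, indexed by an ultrafilter,
   yields a one-parameter subgroup without solving a differential equation. *)
Section Existence.
Context (X : 'rV[R]_n) (F : set_system nat).
Hypotheses (FU : UltraFilter F) (Foo : forall N, F [set m | (N <= m)%N]).

(** An Euler approximation of the exponential: [root N] is a root of exp X only to first order, and
    [limpow t h] expresses that its powers of exponent about t (N + 1) tend to h, the future value
    of exp (t X). *)
Let root (N : nat) : G := li (N.+1%:R^-1 *: X).
Let steps (t : R) (N : nat) := Num.trunc (t * N.+1%:R).
Let limpow (t : R) (h : G) := (fun N => root N ^+ steps t N)%g @ F --> h.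

Lemma inv_succ_small (q : R) : 0 < q -> F [set N | N.+1%:R^-1 < q].
Proof.
move=> q0; apply: filterS (Foo (Num.trunc q^-1)) => N /= hN.
rewrite -[ltRHS]invrK ltf_pV2 ?posrE ?invr_gt0// ?ltr0n//.
by apply: lt_le_trans (truncnS_gt _) _; rewrite ler_nat ltnS.
Qed.

Lemma root_small : forall q : R, 0 < q -> F [set N | `|N.+1%:R^-1 *: X| < q].
Proof.
move=> q q0; have q1 : 0 < q / (`|X| + 1) by rewrite divr_gt0// ltr_wpDl.
apply: filterS (inv_succ_small q1) => N /=.
rewrite ltr_pdivlMr ?ltr_wpDl// normrZ ger0_norm ?invr_ge0 ?ler0n//.
apply: le_lt_trans; rewrite ler_wpM2l ?invr_ge0 ?ler0n//.
by rewrite lerDl.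
Qed.

Lemma root_cvg1 : root @ F --> (1%g : G).
Proof.
have [C [r [C0 r0 De _ _]]] := local_group.
rewrite -li0; apply: li_cvg; first by apply: De; rewrite normr0.
apply/cvgrPdist_lt => q q0; apply: filterS (root_small q0) => N.
by rewrite /= sub0r normrN.
Qed.

Lemma limpow0 : limpow 0 1%g.
Proof.
rewrite /limpow; have -> : (fun N => root N ^+ steps 0 N)%g = cst 1%g.
  by apply/funext => N; rewrite /steps mul0r truncn0 expg0.
exact: cvg_cst.
Qed.

(** The integer parts of two numbers add up to that of their sum with a carry [d] of 0 or 1, and one
    additional factor [root N] tends to the identity. *)
Lemma limpowD s t a b : 0 <= s -> 0 <= t -> limpow s a -> limpow t b ->
  limpow (s + t) (a * b)%g.
Proof.
move=> s0 t0 sa tb.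
have [d dE] : exists d : nat -> bool, forall N,
    steps (s + t) N = (steps s N + steps t N + d N)%N.
  suff h N : exists d : bool, steps (s + t) N = (steps s N + steps t N + d)%N.
    by exists (fun N => sval (cid (h N))) => N; exact: (svalP (cid (h N))).
  have M0 : 0 <= N.+1%:R :> R by exact: ler0n.
  rewrite /steps mulrDl; set x := s * _; set y := t * _.
  have x0 : 0 <= x by rewrite mulr_ge0.
  have y0 : 0 <= y by rewrite mulr_ge0.
  have /andP[x1 x2] := truncn_itv x0; have /andP[y1 y2] := truncn_itv y0.
  have [xy|xy] := leP (Num.trunc x + Num.trunc y + 1)%:R (x + y).
    exists true; apply: truncn_def; rewrite xy/=.
    by move: x2 y2; rewrite -!natr1 !natrD; lra.
  exists false; rewrite addn0; apply: truncn_def.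
  by rewrite -addn1 xy andbT natrD; lra.
have -> : (a * b = a * b * 1)%g by rewrite mulg1.
rewrite /limpow; have -> : (fun N => root N ^+ steps (s + t) N)%g =
    (fun N => root N ^+ steps s N * root N ^+ steps t N * root N ^+ d N)%g.
  by apply/funext => N; rewrite dE !expgnDr.
apply: cvg_mulg; first exact: cvg_mulg.
move=> A A1; have RA : F (root @^-1` A) := root_cvg1 A1.
suff : F ((fun N => root N ^+ d N)%g @^-1` A) by [].
apply: filterS RA => N /= RA; rewrite expgb; case: (d N) => //.
exact: nbhs_singleton.
Qed.

(** The power estimate confines the powers to a compact coordinate ball, so a limit along F exists,
    and the closed condition on the error passes to it. *)
Lemma limpow_small : exists C rho : R, [/\ 0 < C, 0 < rho &
  forall t, 0 <= t -> t * `|X| <= rho ->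
    exists h, [/\ limpow t h, dom h & `|lc h - t *: X| <= C * (t * `|X|) ^+ 2]].
Proof.
have [C1 [r [C10 r0 De Dl _]]] := local_group.
have [C2 [rho2 [C20 rho20 P]]] := power_estimate.
pose rho := Num.min (rho2 / 2) (Num.min (r / 4) (C2^-1 / 2)).
have rho0 : 0 < rho by rewrite !lt_min !divr_gt0// invr_gt0.
exists C2, rho; split=> // t t0 tX.
have [h1 [h2 h3]] : [/\ rho <= rho2 / 2, rho <= r / 4 & C2 * rho <= 1 / 2].
  split; rewrite ?ge_min ?lexx ?orbT//.
  have : rho <= C2^-1 / 2 by rewrite !ge_min lexx !orbT.
  by rewrite -(ler_pM2l C20) mulrA mulfV ?gt_eqF// mul1r.
pose y N := lc (root N ^+ steps t N)%g.
have kN N : (steps t N)%:R * `|N.+1%:R^-1 *: X| <= t * `|X|.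
  rewrite normrZ ger0_norm ?invr_ge0 ?ler0n// mulrA ler_wpM2r//.
  rewrite ler_pdivrMr ?ltr0n// /steps.
  by have /andP[] := truncn_itv (mulr_ge0 t0 (ler0n R N.+1)).
have near_ok : F [set N | dom (root N ^+ steps t N)%g /\
    `|y N - (steps t N)%:R *: (N.+1%:R^-1 *: X)| <= C2 * (t * `|X|) ^+ 2].
  apply: filterS2 (root_small r0) (root_small rho20) => N /= xr xrho.
  have [dr lr] := Dl _ xr; rewrite -/(root N) in dr lr.
  have xr2 : `|lc (root N)| <= rho2 by rewrite lr ltW.
  have kk : (steps t N)%:R * `|lc (root N)| <= rho2.
    by rewrite lr; apply: le_trans (kN N) _; lra.
  have [d1 d2] := P _ _ dr xr2 kk.
  rewrite lr in d2; split=> //; apply: le_trans d2 _.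
  have k0 : 0 <= (steps t N)%:R * `|N.+1%:R^-1 *: X| by rewrite mulr_ge0 ?ler0n.
  by rewrite ler_wpM2l ?(ltW C20)// !expr2; apply: ler_pM.
set q := C2 * (t * `|X|) ^+ 2 in near_ok *.
have q0 : 0 <= q by rewrite mulr_ge0 ?sqr_ge0// ltW.
pose z N := (steps t N)%:R *: (N.+1%:R^-1 *: X).
have zt : z @ F --> t *: X.
  have : (fun N => (steps t N)%:R / N.+1%:R) @ F --> t.
    apply/cvgrPdist_le => eps eps0; apply: filterS (inv_succ_small eps0) => N /=.
    move=> /ltW; apply: le_trans.
    have /andP[s1 s2] := truncn_itv (mulr_ge0 t0 (ler0n R N.+1)).
    have N0 : 0 < N.+1%:R :> R by rewrite ltr0n.
    have -> : t - (steps t N)%:R / N.+1%:R = (t * N.+1%:R - (steps t N)%:R) / N.+1%:R.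
      by rewrite mulrBl mulfK// gt_eqF.
    have iN0 : 0 <= N.+1%:R^-1 :> R by rewrite invr_ge0 ltW.
    rewrite normrM (ger0_norm iN0) ger0_norm ?subr_ge0//.
    rewrite -[X in _ <= X]mul1r; apply: ler_wpM2r => //.
    by rewrite lerBlDl natr1 ltW.
  move=> h; have -> : z = (fun N => ((steps t N)%:R / N.+1%:R) *: X).
    by apply/funext => N; rewrite /z scalerA.
  exact: cvgZr_tmp h.
have [v Bv yv] : exists2 v : 'rV[R]_n, `|v| <= rho + rho & y @ F --> v.
  apply: (compact_ultra_cvg FU (@compact_ball_rV R n (rho + rho))).
  apply: filterS near_ok => N [_ yz] /=.
  rewrite -(subrK (z N) (y N)); apply: le_trans (ler_normD _ _) _.
  apply: lerD; first apply: le_trans yz _.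
    rewrite /q expr2; have : 0 <= t * `|X| by rewrite mulr_ge0.
    set p := t * `|X| in tX *; nra.
  rewrite /z normrZ ger0_norm ?ler0n//.
  exact: le_trans (kN N) tX.
have vr : `|v| < r by move: Bv => /le_lt_trans; apply; lra.
have [dv lv] := Dl _ vr.
exists (li v); split=> //.
  have h : li \o y @ F --> li v by apply: li_cvg; first exact: De.
  apply: cvg_trans h; apply: near_eq_cvg.
  by apply: filterS near_ok => N [dN _]; rewrite /= /y lcK.
rewrite lv; suff : [set w : R | w <= q] `|v - t *: X| by [].
apply: (@closed_cvg _ _ F _ (fun N => `|y N - z N|) [set w : R | w <= q]).
- exact: closed_le.
- by apply: filterS near_ok => N [].
- by apply: cvg_norm; exact: cvgB.
Qed.

Lemma limpow_ex t : 0 <= t -> exists h, limpow t h.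
Proof.
move=> t0; have [C [rho [_ rho0 S]]] := limpow_small.
have [m tm] : exists m : nat, t / m.+1%:R * `|X| <= rho.
  exists (Num.trunc (t * `|X| / rho)); rewrite mulrAC ler_pdivrMr ?ltr0n//.
  by rewrite [rho * _]mulrC -ler_pdivrMr//; apply: ltW; exact: truncnS_gt.
have tm0 : 0 <= t / m.+1%:R by rewrite divr_ge0.
have [h [th _ _]] := S _ tm0 tm.
have P k : limpow (k%:R * (t / m.+1%:R)) (h ^+ k)%g.
  elim: k => [|k IH]; first by rewrite mul0r expg0; exact: limpow0.
  rewrite expgSr -natr1 mulrDl mul1r; apply: limpowD => //.
  by rewrite mulr_ge0.
by exists (h ^+ m.+1)%g; have := P m.+1; rewrite mulrC divfK// pnatr_eq0.
Qed.

Lemma limpow_unique t a b : limpow t a -> limpow t b -> a = b.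
Proof.
move=> ta tb; apply: (@cvg_unique _ _ _ _ a b ta tb).
exact: lie_hausdorff.
Qed.

Lemma one_parameter_ex0 : exists gamma : R -> G, one_parameter_subgroup X gamma.
Proof.
pose f t : G := if t >= 0 then xget 1%g (limpow t) else 1%g.
have fP t : 0 <= t -> limpow t (f t).
  move=> t0; rewrite /f t0; case: xgetP => [h -> //|nex].
  by have [h /nex] := limpow_ex t0.
have fD s t : 0 <= s -> 0 <= t -> f (s + t) = (f s * f t)%g.
  move=> s0 t0; apply: limpow_unique (fP _ (addr_ge0 s0 t0)) _.
  exact: limpowD (fP _ s0) (fP _ t0).
have f0 : f 0 = 1%g by apply: limpow_unique (fP _ (lexx _)) _; exact: limpow0.
have fC s t : 0 <= s -> 0 <= t -> (f s * f t = f t * f s)%g.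
  by move=> s0 t0; rewrite -!fD// addrC.
(* The positive and the negative part of t are treated apart; the values of [f] commute, so the
   quotient is a homomorphism on the whole line. *)
pose gam t := (f (Num.max t 0) * (f (Num.max (- t) 0))^-1)%g.
have m0 (t : R) : 0 <= Num.max t 0 by rewrite le_max lexx orbT.
have gE a b : 0 <= a -> 0 <= b -> gam (a - b) = (f a * (f b)^-1)%g.
  move=> a0 b0; rewrite /gam; set p := Num.max _ _; set q := Num.max _ _.
  have pq : p + b = a + q.
    rewrite /p /q opprB; case: (leP a b) => ab.
      by rewrite max_r ?subr_le0// max_l ?subr_ge0// add0r addrC subrK.
    by rewrite max_l ?subr_ge0 ?ltW// max_r ?subr_le0 ?ltW// addr0 subrK.
  have := congr1 f pq; rewrite !fD ?m0//.
  move=> E; apply: (@mulIg _ (f b)); rewrite mulgVK.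
  rewrite -mulgA; have -> : ((f q)^-1 * f b = f b * (f q)^-1)%g.
    apply: (@mulgI _ (f q)); rewrite mulVKg [RHS]mulgA fC ?m0//.
    by rewrite mulgK.
  by rewrite mulgA E mulgK.
have gD s t : gam (s + t) = (gam s * gam t)%g.
  have sE := max_diff s; have tE := max_diff t.
  rewrite {1}sE {1}tE addrACA -opprD gE ?addr_ge0 ?m0// !fD ?m0//.
  rewrite /gam; set a := f (Num.max s 0); set b := f (Num.max t 0).
  set a' := f _; set b' := f _.
  rewrite (fC _ _ (m0 (- s)) (m0 (- t))) -/a' -/b' invgM.
  rewrite -!mulgA; congr (_ * _)%g; rewrite !mulgA; congr (_ * _)%g.
  apply: (@mulgI _ a'); rewrite [in RHS]mulVKg !mulgA.
  by rewrite /a' /b (fC _ _ (m0 (- s)) (m0 t)) mulgK.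
have gp t : 0 <= t -> gam t = f t.
  by move=> t0; have := gE t 0 t0 (lexx _); rewrite subr0 f0 invg1 mulg1.
have gn t : 0 <= t -> gam (- t) = ((f t)^-1)%g.
  by move=> t0; have := gE 0 t (lexx _) t0; rewrite sub0r f0 mul1g.
have [C [rho [C0 rho0 S]]] := limpow_small.
have est t : 0 <= t -> t * `|X| <= rho ->
    dom (gam t) /\ `|lc (gam t) - t *: X| <= C * (t * `|X|) ^+ 2.
  move=> t0 tX; have [h [th dh lh]] := S t t0 tX; rewrite gp//.
  by rewrite (limpow_unique (fP t t0) th).
have [D [D0 inv]] := inverse_estimate.
have [C1 [r [C10 r0 De Dl _]]] := local_group.
have g0 : gam 0 = 1%g by rewrite gp.
pose x := `|X| + 1.
have x0 : 0 < x by rewrite ltr_wpDl.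
have [d1 d10 est1] : exists2 d1, 0 < d1 & forall t, 0 <= t < d1 ->
    [/\ dom (gam t), `|lc (gam t) - t *: X| <= C * x ^+ 2 * t ^+ 2 &
       `|lc (gam t)| <= 2 * x * t].
  exists (Num.min (rho / x) (C^-1 / x)).
    by rewrite lt_min !divr_gt0// invr_gt0.
  move=> t /andP[t0]; rewrite lt_min !ltr_pdivlMr// => /andP[tx tC].
  have Xx : `|X| <= x by rewrite lerDl.
  have tXx : t * `|X| <= t * x by rewrite ler_wpM2l.
  have [|d1 d2] := est t t0; first by apply: le_trans tXx (ltW _).
  have d3 : `|lc (gam t) - t *: X| <= C * x ^+ 2 * t ^+ 2.
    apply: le_trans d2 _; rewrite -mulrA ler_wpM2l ?(ltW C0)// -exprMn [x * t]mulrC.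
    by rewrite !expr2; apply: ler_pM => //; rewrite mulr_ge0.
  split=> //; rewrite -(subrK (t *: X) (lc _)); apply: le_trans (ler_normD _ _) _.
  rewrite normrZ ger0_norm//.
  have : C * (t * x) <= 1.
    by rewrite -ler_pdivlMl// mulr1; exact: ltW.
  have : 0 <= t * x by rewrite mulr_ge0// ltW.
  by move: d3; rewrite !expr2; nra.
have near1 (A : set G) : nbhs (1%g : G) A ->
    exists2 d, 0 < d & forall t, 0 <= t < d -> A (gam t).
  move=> A1; have h : li @ (0 : 'rV[R]_n) --> (1%g : G).
    rewrite -li0; apply: (@li_cvg _ _ _ id); last exact: cvg_id.
      exact: nbhs_filter.
    by apply: De; rewrite normr0.
  have /nbhs_normP[eta /= eta0 H] := h A A1.
  exists (Num.min d1 (eta / (2 * x))).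
    by rewrite lt_min d10 divr_gt0// mulr_gt0.
  move=> t /andP[t0]; rewrite lt_min ltr_pdivlMr ?mulr_gt0// => /andP[td te].
  have [|dg _ lg] := est1 t; first by rewrite t0.
  rewrite -(lcK dg); apply: H; rewrite /ball_/= sub0r normrN.
  by apply: le_lt_trans lg _; rewrite mulrC.
have near1' (A : set G) : nbhs (1%g : G) A ->
    exists2 d, 0 < d & forall t, `|t| < d -> A (gam t).
  move=> A1; have [d dd Hd] := near1 A A1.
  have A1' : nbhs (1%g : G) [set g | A (g^-1)%g].
    have V1 : (fun g : G => g^-1)%g @ (1%g : G) --> (1%g : G).
      by rewrite -[X in _ --> X]invg1; exact: lie_inv_continuous.
    exact: V1.
  have [d' dd' Hd'] := near1 _ A1'.
  exists (Num.min d d'); first by rewrite lt_min dd.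
  move=> t; rewrite lt_min => /andP[td td'].
  have [t0|t0] := leP 0 t.
    by apply: Hd; rewrite t0 -(ger0_norm t0).
  rewrite -[t]opprK gn ?oppr_ge0 ?ltW//.
  have := Hd' (- t); rewrite /= gp ?oppr_ge0 ?ltW//; apply.
  by rewrite -(ltr0_norm t0).
have gam1 : gam @ (0 : R) --> (1%g : G).
  move=> A /near1'[d d0 H]; apply/nbhs_normP; exists d => // t.
  by rewrite /ball_/= sub0r normrN; exact: H.
exists gam; split=> //.
  move=> s; have h : (fun t => gam s * gam (t - s))%g @ s --> gam s.
    rewrite -[X in _ --> X]mulg1; apply: cvg_mulg; first exact: cvg_cst.
    move=> A /near1'[d d0 H]; apply/nbhs_normP; exists d => // t.
    by rewrite /ball_/= distrC; exact: H.
  apply: cvg_trans h; apply: near_eq_cvg; near=> t.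
  by rewrite -gD addrC subrK.
have [d2 d20 H2] := near1 _ inv.
(* The first term is the error for t >= 0; for t < 0 inversion adds at most D |lc|^2, where |lc| <=
   2 x |t|. *)
pose B := C * x ^+ 2 + D * (2 * x) ^+ 2.
apply: (@is_derive_quadratic _ _ _ _ B (Num.min d1 d2)); first by rewrite lt_min d10.
move=> t; rewrite lt_min => /andP[td1 td2].
have -> : c (gam t) - c (gam 0) = lc (gam t) by rewrite g0.
have C2 : 0 <= C * x ^+ 2 by rewrite mulr_ge0 ?sqr_ge0// ltW.
have D2 : 0 <= D * (2 * x) ^+ 2 by rewrite mulr_ge0 ?sqr_ge0// ltW.
have [t0|t0] := leP 0 t.
  have [|_ h _] := est1 t; first by rewrite t0 -(ger0_norm t0).
  apply: le_trans h _; rewrite ler_wpM2r ?sqr_ge0// /B; lra.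
have s0 : 0 <= - t by rewrite oppr_ge0 ltW.
rewrite (ltr0_norm t0) in td1 td2.
have [|_ h1 h2] := est1 (- t); first by rewrite s0.
have := H2 (- t); rewrite s0 td2 => /(_ isT) h3.
rewrite -[X in gam X]opprK gn// -gp//.
set g := gam (- t) in h1 h2 h3 *.
have -> : lc (g^-1)%g - t *: X = (lc (g^-1)%g + lc g) - (lc g - (- t) *: X).
  by apply/rowP => i; rewrite !mxE; ring.
apply: le_trans (ler_normB _ _) _.
have h4 : D * `|lc g| ^+ 2 <= D * ((2 * x * - t) ^+ 2).
  by rewrite ler_wpM2l ?(ltW D0)// !expr2; apply: ler_pM.
rewrite /B mulrDl addrC; apply: lerD; first by move: h1; rewrite sqrrN.
by apply: le_trans h3 _; apply: le_trans h4 _; rewrite exprMn sqrrN mulrA.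
Unshelve. all: by end_near. Qed.

End Existence.

Lemma one_parameter_ex X : exists gamma : R -> G, one_parameter_subgroup X gamma.
Proof.
have [F [FU Foo]] := ultra_oo.
apply: (@one_parameter_ex0 X F) => // N; apply: Foo.
by exists N => // m /=.
Qed.

End OneParameter.

Section LieExponential.
Context (R : realType) (n : nat) (G : lieGroupType R n).
Implicit Types (g h : G) (X Y Z u v : 'rV[R]_n) (gamma : R -> G).

Local Notation c := (cfun (@chart_id R n G)).
Local Notation dom := (cdom (@chart_id R n G)).
Local Notation li := (@li R n G).
Local Notation onep := (@one_parameter_subgroup R n G).

Lemma onep0 X gamma : onep X gamma -> gamma 0 = 1%g.
Proof.
move=> [gD _ _]; apply: (@mulgI _ (gamma 0)).
by rewrite -gD addr0 mulg1.
Qed.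

Lemma onepN X gamma t : onep X gamma -> gamma (- t) = ((gamma t)^-1)%g.
Proof.
move=> gX; have [gD _ _] := gX; apply: (@mulgI _ (gamma t)).
by rewrite -gD subrr mulgV (onep0 gX).
Qed.

Lemma onep_nat X gamma k t : onep X gamma -> gamma (k%:R * t) = (gamma t ^+ k)%g.
Proof.
move=> gX; have [gD _ _] := gX; elim: k => [|k IH].
  by rewrite mul0r expg0 (onep0 gX).
by rewrite -natr1 mulrDl mul1r gD IH expgSr.
Qed.

Lemma onep_tangent X gamma : onep X gamma -> tangent gamma X.
Proof.
move=> gX; have [_ gc gd] := gX; split=> //; first exact: onep0 gX.
by rewrite -(onep0 gX); exact: gc.
Qed.

Lemma onep_scale X gamma (s : R) : onep X gamma ->
  onep (s *: X) (fun t => gamma (s * t)).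
Proof.
move=> gX; have [gD gc gd] := gX; split.
- by move=> a b; rewrite mulrDr gD.
- move=> t; apply: (@cvg_comp _ _ _ ( *%R s) gamma _ (nbhs (s * t))); last exact: gc.
  exact: mulrl_continuous.
have s0 : s * 0 = 0 by rewrite mulr0.
have [/derivable1_diffP cd cE] := gd.
have sd : is_derive (0 : R) (1 : R) ( *%R s) s.
  apply: (@is_derive_quadratic _ _ _ _ 0 1) => // t _.
  by rewrite mulr0 subr0 mulrC subrr normr0 mul0r.
rewrite -s0 in cd.
have h := is_derive_diff_comp cd sd.
apply: is_derive_eq h _; rewrite s0 in cd *.
rewrite -[X in 'd _ _ X]mulr1 -[s * 1]/(s *: (1 : R)) linearZ; congr (_ *: _).
by rewrite -deriveE.
Qed.

Lemma onep_conj X gamma g : onep X gamma ->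
  onep (Ad g X) (fun t => (g * gamma t * g^-1)%g).
Proof.
move=> gX; have [gD gc _] := gX; split.
- by move=> a b; rewrite gD !mulgA mulgVK.
- move=> t; apply: cvg_mulg; last exact: cvg_cst.
  by apply: cvg_mulg; [exact: cvg_cst|exact: gc].
- by have [_ _] := tangent_conj g (onep_tangent gX).
Qed.

(** The derivative at 0 shows that gamma (1/N) has coordinates X / N up to eps / N, and the power
    estimate carries this to its N-th power gamma 1. The constants depend neither on gamma nor on
    eps, so eps can tend to 0. *)
Lemma onep_estimate : exists C rho : R, [/\ 0 < C, 0 < rho &
  forall X gamma, onep X gamma -> `|X| <= rho ->
    dom (gamma 1) /\ `|lc (gamma 1) - X| <= C * `|X| ^+ 2].
Proof.
have [C [rho [C0 rho0 P]]] := power_estimate G.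
exists C, (rho / 2); split=> //; first by rewrite divr_gt0.
move=> X gamma gX Xr.
have [_ cg _] := onep_tangent gX.
have [_ _ gd] := gX.
have K (eps : R) : 0 < eps -> eps <= rho / 2 ->
    dom (gamma 1) /\ `|lc (gamma 1) - X| <= C * (`|X| + eps) ^+ 2 + eps.
  move=> eps0 epsr; have [d d0 H] := is_derive_littleo gd eps0.
  have [d' /= d'0 H'] : exists2 d', 0 < d' & forall t : R, `|t| < d' -> dom (gamma t).
    have /nbhs_normP[d' /= d'0 H'] : \forall t \near (0 : R), dom (gamma t).
      by apply: cg; apply: nbhs_cdom; exact: chart_id1.
    by exists d' => // t td; apply: H'; rewrite /ball_/= sub0r normrN.
  have dd : 0 < Num.min d d' by rewrite lt_min d0.
  pose N := Num.trunc (Num.min d d')^-1.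
  have N0 : 0 < N.+1%:R :> R by rewrite ltr0n.
  have : `|N.+1%:R^-1 : R| < Num.min d d'.
    rewrite ger0_norm ?invr_ge0 ?ltW// -[ltRHS]invrK ltf_pV2 ?posrE ?invr_gt0//.
    exact: truncnS_gt.
  rewrite lt_min => /andP[hd hd'].
  have := H _ hd; have dg := H' _ hd'; set g := gamma _ in dg *.
  have -> : c (gamma 0) = c (1%g : G) by rewrite (onep0 gX).
  rewrite -/(lc g) => lg.
  have lg' : `|N.+1%:R *: lc g - X| <= eps.
    have -> : N.+1%:R *: lc g - X = N.+1%:R *: (lc g - N.+1%:R^-1 *: X).
      by rewrite [RHS]scalerBr scalerA mulfV ?gt_eqF// scale1r.
    rewrite normrZ (ger0_norm (ltW N0)) mulrC -ler_pdivlMr//.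
    have iN0 : 0 <= N.+1%:R^-1 :> R by rewrite invr_ge0 ltW.
    by apply: le_trans lg _; rewrite (ger0_norm iN0).
  have Ng : N.+1%:R * `|lc g| <= `|X| + eps.
    rewrite -[X in X * _](ger0_norm (ltW N0)) -normrZ -(subrK X (_ *: _)) [_ + X]addrC.
    by apply: le_trans (ler_normD _ _) _; rewrite lerD2l.
  have Nr : N.+1%:R * `|lc g| <= rho by apply: le_trans Ng _; lra.
  have gr : `|lc g| <= rho.
    by apply: le_trans Nr; rewrite ler_peMl// ler1n.
  have [dN lN] := P _ _ dg gr Nr.
  have E : (g ^+ N.+1)%g = gamma 1 by rewrite -(onep_nat _ _ gX) mulfV ?gt_eqF.
  rewrite E in dN lN; split=> //.
  rewrite -(subrK (N.+1%:R *: lc g) (lc _)) -addrA.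
  apply: le_trans (ler_normD _ _) _; apply: lerD => //.
  apply: le_trans lN _; rewrite ler_wpM2l ?(ltW C0)// !expr2.
  by apply: ler_pM => //; rewrite mulr_ge0// ltW.
have r20 : 0 < rho / 2 by rewrite divr_gt0.
split; first by have [] := K _ r20 (lexx _).
apply/ler_addgt0Pr => eps eps0.
pose M := C * (2 * `|X| + rho) + 1.
have M0 : 0 < M by rewrite ltr_wpDl// mulr_ge0 ?(ltW C0)// addr_ge0 ?(ltW rho0)// mulr_ge0.
pose e := Num.min (rho / 2) (eps / M).
have e1 : e <= rho / 2 by rewrite ge_min lexx.
have e2 : e * M <= eps by rewrite -ler_pdivlMr// ge_min lexx orbT.
have e0 : 0 < e by rewrite lt_min !divr_gt0.
have [_ h] := K e e0 e1; apply: le_trans h _.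
have X0 : 0 <= `|X| by [].
rewrite sqrrD mulr2n; move: e2; rewrite /M; set x := `|X| in X0 *.
have : C * e * e <= C * e * rho.
  by rewrite ler_wpM2l// ?mulr_ge0 ?ltW//; lra.
rewrite !expr2; lra.
Qed.

Lemma geometric_le0 (x K q : R) : 0 <= q < 1 -> (forall N, x <= K * q ^+ N) -> x <= 0.
Proof.
move=> /andP[q0 q1] H; rewrite leNgt; apply/negP => x0.
have h : (fun N => K * q ^+ N) @ \oo --> K * 0.
  by apply: cvgMr; apply: cvg_expr; rewrite ger0_norm.
rewrite mulr0 in h; have /cvgrPdist_lt/(_ x x0) := h.
case=> N _ /(_ N (leqnn N)) /=; rewrite sub0r normrN => /(le_lt_trans (ler_norm _)).
by move=> /(le_lt_trans (H N)); rewrite ltxx.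
Qed.

(* The coordinates of two one-parameter subgroups with equal velocity differ by
   O(t^2), and the difference at most triples when t doubles. *)
Lemma onep_unique X gamma gamma' : onep X gamma -> onep X gamma' -> gamma =1 gamma'.
Proof.
move=> gX g'X.
have [C [rho [C0 rho0 E]]] := onep_estimate.
have [C1 [r [C10 r0 _ Dl H]]] := local_group G.
pose x := `|X| + 1.
have x0 : 0 < x by rewrite ltr_wpDl.
pose T := Num.min (rho / x) (Num.min (C^-1 / x) (Num.min (r / (4 * x)) (C1^-1 / (4 * x)))).
have T0 : 0 < T by rewrite !lt_min !divr_gt0// ?invr_gt0// mulr_gt0.
have est gam t : onep X gam -> 0 <= t <= T ->
    [/\ dom (gam t), `|lc (gam t) - t *: X| <= C * (t * x) ^+ 2 & `|lc (gam t)| <= 2 * t * x].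
  move=> gm /andP[t0]; rewrite !le_min => /and4P[t1 t2 t3 t4].
  have Xx : `|t *: X| <= t * x by rewrite normrZ ger0_norm// ler_wpM2l// lerDl.
  rewrite !ler_pdivlMr// in t1 t2.
  have [|dg lg] := E _ _ (onep_scale t gm); first exact: le_trans t1.
  rewrite mulr1 in dg lg.
  have lg' : `|lc (gam t) - t *: X| <= C * (t * x) ^+ 2.
    by apply: le_trans lg _; rewrite ler_wpM2l ?(ltW C0)// !expr2; apply: ler_pM.
  split=> //; rewrite -(subrK (t *: X) (lc _)); apply: le_trans (ler_normD _ _) _.
  have : C * (t * x) <= 1 by rewrite -ler_pdivlMl// mulr1.
  have : 0 <= t * x by rewrite mulr_ge0// ltW.
  by move: lg' Xx; rewrite !expr2; nra.
pose d t := `|lc (gamma t) - lc (gamma' t)|.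
have dbl t : 0 <= t <= T -> d (2 * t) <= 3 * d t.
  move=> t0T; have [dg _ lg] := est _ _ gX t0T; have [dg' _ lg'] := est _ _ g'X t0T.
  have /andP[t0 tT] := t0T.
  move: (tT); rewrite !le_min => /and4P[_ _ t3 t4].
  have x40 : 0 < 4 * x by rewrite mulr_gt0.
  have small v : `|v| <= 2 * t * x -> `|v| < r /\ C1 * `|v| <= 1 / 2.
    move=> vt; rewrite !ler_pdivlMr// in t3 t4.
    have : C1 * (t * (4 * x)) <= 1 by rewrite -ler_pdivlMl// mulr1.
    have : C1 * `|v| <= C1 * (2 * t * x) by rewrite ler_wpM2l// ltW.
    by split; [apply: le_lt_trans vt _; nra | nra].
  have [ur uC] := small _ lg; have [vr vC] := small _ lg'.
  set u := lc (gamma t) in lg ur uC; set v := lc (gamma' t) in lg' vr vC.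
  have Eg : gamma (2 * t) = (li u * li u)%g.
    by rewrite (onep_nat 2 t gX) expg2 /u lcK.
  have Eg' : gamma' (2 * t) = (li v * li v)%g.
    by rewrite (onep_nat 2 t g'X) expg2 /v lcK.
  rewrite /d Eg Eg' -/u -/v.
  have [_ _ h1 _] := H u v u u ur vr ur ur.
  have [_ _ _ h2] := H v v u v vr vr ur vr.
  have -> : lc (li u * li u)%g - lc (li v * li v)%g =
      (lc (li u * li u)%g - lc (li v * li u)%g - (u - v)) +
      ((lc (li v * li u)%g - lc (li v * li v)%g - (u - v)) + 2 *: (u - v)).
    by apply/rowP => i; rewrite !mxE; ring.
  apply: le_trans (ler_normD _ _) _.
  have := ler_normD (lc (li v * li u)%g - lc (li v * li v)%g - (u - v)) (2 *: (u - v)).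
  rewrite normrZ ger0_norm//; have w0 : 0 <= `|u - v| by [].
  set w := `|u - v| in h1 h2 w0 *; move=> h3.
  have : C1 * w * `|u| <= 1 / 2 * w by rewrite mulrAC ler_wpM2r.
  have : C1 * `|v| * w <= 1 / 2 * w by rewrite ler_wpM2r.
  lra.
have small t : 0 <= t <= T -> gamma t = gamma' t.
  move=> t0T; have /andP[t0 tT] := t0T.
  have pow N : 0 <= t / 2 ^+ N <= T.
    rewrite divr_ge0 ?exprn_ge0//=; apply: le_trans tT.
    by rewrite ler_pdivrMr ?exprn_gt0// ler_peMr// exprn_ege1// ler1n.
  have dN N : d t <= 3 ^+ N * d (t / 2 ^+ N).
    elim: N => [|N IH]; first by rewrite !expr0 mul1r divr1.
    apply: le_trans IH _; rewrite exprSr -mulrA ler_wpM2l ?exprn_ge0//.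
    have := dbl _ (pow N.+1); congr (_ <= _).
    by congr (d _); rewrite exprS; field; rewrite expf_neq0.
  (* N doublings multiply the difference by at most 3^N, while at t / 2^N it is of order 4^-N; this
     leaves the ratio 3/4. *)
  have : d t <= 0.
    apply: (@geometric_le0 _ (2 * C * (t * x) ^+ 2) (3 / 4)); first by lra.
    move=> N; apply: le_trans (dN N) _.
    have [dg lg _] := est _ _ gX (pow N); have [dg' lg' _] := est _ _ g'X (pow N).
    have h : d (t / 2 ^+ N) <= 2 * C * (t / 2 ^+ N * x) ^+ 2.
      rewrite /d -(subrKA (t / 2 ^+ N *: X)); apply: le_trans (ler_normD _ _) _.
      by rewrite [X in _ + X]distrC; lra.
    apply: le_trans (ler_wpM2l _ h) _; first by rewrite exprn_ge0.
    rewrite le_eqVlt; apply/orP; left; apply/eqP.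
    rewrite [(3 / 4) ^+ N]exprMn exprVn.
    have -> : (4 : R) ^+ N = 2 ^+ N * 2 ^+ N.
      by rewrite -exprMn; congr (_ ^+ _); rewrite -natrM.
    by field; rewrite expf_neq0.
  rewrite normr_le0 subr_eq0 => /eqP El.
  have [dg _ _] := est _ _ gX t0T; have [dg' _ _] := est _ _ g'X t0T.
  by rewrite -(lcK dg) El lcK.
have pos t : 0 <= t -> gamma t = gamma' t.
  move=> t0; pose k := (Num.trunc (t / T)).+1.
  have k0 : 0 < k%:R :> R by rewrite ltr0n.
  have -> : t = k%:R * (t / k%:R) by rewrite mulrC divfK// gt_eqF.
  rewrite (onep_nat _ _ gX) (onep_nat _ _ g'X) small// divr_ge0//=.
  by rewrite ler_pdivrMr// mulrC -ler_pdivrMr//; apply: ltW; exact: truncnS_gt.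
move=> t; have [/pos//|t0] := leP 0 t.
by rewrite -[t]opprK (onepN _ gX) (onepN _ g'X) pos// oppr_ge0 ltW.
Qed.

End LieExponential.

Opaque Ad.

Section Bracket.
Context (R : realType) (n : nat) (G : lieGroupType R n).
Implicit Types (g h : G) (X Y Z u v : 'rV[R]_n) (gamma : R -> G).

Local Notation c := (cfun (@chart_id R n G)).
Local Notation dom := (cdom (@chart_id R n G)).
Local Notation li := (@li R n G).
Local Notation onep := (@one_parameter_subgroup R n G).
Local Notation exp := (lie_exp G).

Lemma lie_expE X gamma : onep X gamma -> exp X = gamma 1.
Proof.
move=> gX; rewrite /lie_exp; case: xgetP => [h -> [gam' g'X <-]|/(_ (gamma 1))].
  exact: onep_unique g'X gX 1.
by case; exists gamma.
Qed.

Opaque lie_exp.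

Lemma lie_exp_onep X : onep X (fun t => exp (t *: X)).
Proof.
have [gamma gX] := one_parameter_ex G X.
have -> // : (fun t => exp (t *: X)) = gamma.
by apply/funext => t; rewrite (lie_expE (onep_scale t gX)) mulr1.
Qed.

Lemma lie_exp_estimate : exists C rho : R, [/\ 0 < C, 0 < rho &
  forall X, `|X| <= rho -> dom (exp X) /\ `|lc (exp X) - X| <= C * `|X| ^+ 2].
Proof.
have [C [rho [C0 r0 H]]] := onep_estimate G.
exists C, rho; split=> // X Xr; have := H _ _ (lie_exp_onep X) Xr.
by rewrite scale1r.
Qed.

Lemma lie_exp_conj g X : exp (Ad g X) = (g * exp X * g^-1)%g.
Proof. by rewrite (lie_expE (onep_conj g (lie_exp_onep X))) scale1r. Qed.

Lemma lie_expN X : exp (- X) = ((exp X)^-1)%g.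
Proof.
by rewrite -[X in RHS]scale1r -(onepN _ (lie_exp_onep X)) scaleN1r.
Qed.

Lemma exp0 : exp 0 = 1%g.
Proof. by have := onep0 (lie_exp_onep 0); rewrite scale0r. Qed.

Lemma lie_exp_Ad X Y : is_derive (0 : R) (1 : R) (fun t => Ad (exp (t *: X)) Y) (lie G X Y).
Proof. exact: tangent_Ad (onep_tangent (lie_exp_onep X)). Qed.

Lemma lie_is_linear X : linear (lie G X).
Proof.
move=> a Y Z; apply: is_derive_unique (lie_exp_Ad X (a *: Y + Z)) _.
have -> : (fun t : R => Ad (exp (t *: X)) (a *: Y + Z)) =
    (a \*: (fun t : R => Ad (exp (t *: X)) Y)) + (fun t : R => Ad (exp (t *: X)) Z).
  by apply/funext => t; rewrite linearP.
by apply: is_deriveD; [apply: is_deriveZ|]; exact: lie_exp_Ad.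
Qed.

HB.instance Definition _ X := GRing.isLinear.Build R 'rV[R]_n 'rV[R]_n _ (lie G X)
  (lie_is_linear X).

Lemma lie_linearl a X Y Z : lie G (a *: X + Y) Z = a *: lie G X Z + lie G Y Z.
Proof. by rewrite /lie linearP. Qed.

Lemma lieDl X Y Z : lie G (X + Y) Z = lie G X Z + lie G Y Z.
Proof. by have := lie_linearl 1 X Y Z; rewrite !scale1r. Qed.

Lemma lieZl a X Z : lie G (a *: X) Z = a *: lie G X Z.
Proof. by have := lie_linearl a X 0 Z; rewrite addr0 /lie linear0 addr0. Qed.

Lemma Ad_exp_self X t : Ad (exp (t *: X)) X = X.
Proof.
have gX := lie_exp_onep X; have [gD _ gd] := gX.
have [_ _ hd] := onep_conj (exp (t *: X)) gX.
apply: is_derive_unique hd _.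
have -> // : (fun s => c (exp (t *: X) * exp (s *: X) * (exp (t *: X))^-1)%g) =
  (fun s => c (exp (s *: X))).
by apply/funext => s; rewrite -!gD addrC gD mulgK.
Qed.

Lemma lieXX X : lie G X X = 0.
Proof.
apply: is_derive_unique (lie_exp_Ad X X) _.
by apply: (@is_derive_cst_eq _ _ _ X) => s; exact: Ad_exp_self.
Qed.

Lemma lieC X Y : lie G X Y = - lie G Y X.
Proof.
apply/eqP; rewrite -addr_eq0; apply/eqP.
have := lieXX (X + Y).
by rewrite lieDl !linearD/= !lieXX addr0 add0r.
Qed.

Lemma lie_sum_l (I : Type) (r : seq I) (F : I -> 'rV[R]_n) Y :
  lie G (\sum_(i <- r) F i) Y = \sum_(i <- r) lie G (F i) Y.
Proof. by rewrite /lie linear_sum. Qed.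

Opaque lie.

Lemma Ad_lie g X Y : Ad g (lie G X Y) = lie G (Ad g X) (Ad g Y).
Proof.
have h : is_derive (0 : R) (1 : R) (fun t => Ad g (Ad (exp (t *: X)) Y)) (Ad g (lie G X Y)).
  exact: (is_derive_linear [the {linear _ -> _} of Ad g] (lie_exp_Ad X Y)).
have h2 := tangent_Ad (Ad g Y) (tangent_conj g (onep_tangent (lie_exp_onep X))).
have E : (fun t : R => Ad (g * exp (t *: X) * g^-1)%g (Ad g Y)) =
    (fun t : R => Ad g (Ad (exp (t *: X)) Y)).
  by apply/funext => t /=; rewrite -!AdM mulgVK.
by rewrite E in h2; have := is_derive_unique h h2.
Qed.

(* Sealed, so that comparing two values never unfolds the differentials. *)
Fact ad_mx_spec : {f : 'rV[R]_n -> 'M[R]_n | forall X Y, Y *m f X = lie G X Y}.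
Proof. by exists (fun X => lin1_mx (lie G X)) => X Y; rewrite mul_rV_lin1. Qed.

Definition ad_mx := sval ad_mx_spec.

Lemma ad_mxE X Y : Y *m ad_mx X = lie G X Y.
Proof. exact: svalP ad_mx_spec X Y. Qed.

Lemma lie_suml X Y : lie G X Y = \sum_i X 0 i *: (Y *m ad_mx (delta_mx 0 i)).
Proof.
rewrite [in LHS](row_sum_delta X) lie_sum_l; apply: eq_bigr => i _.
by rewrite lieZl ad_mxE.
Qed.

Lemma is_derive_lie (p q : R -> 'rV[R]_n) t dp dq :
  is_derive t (1 : R) p dp -> is_derive t (1 : R) q dq ->
  is_derive t (1 : R) (fun s => lie G (p s) (q s)) (lie G dp (q t) + lie G (p t) dq).
Proof.
move=> pd qd; apply: is_derive_mx => i j; rewrite ord1 mxE.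
under eq_fun do rewrite lie_suml summxE.
rewrite !lie_suml !summxE -big_split/=.
under eq_fun do under eq_bigr do rewrite mxE.
apply: is_derive_bigsum => k; rewrite [in X in _ + X]mxE [in X in X + _]mxE.
apply: is_derive_mul; first exact: is_derive_entry.
apply: is_derive_entry.
have := is_derive_mulmx qd (is_derive_cst (ad_mx (delta_mx 0 k)) t 1).
by rewrite mulmx0 addr0.
Qed.

(** The derivative at t = 0 of the fact that [Ad] of exp (t X) preserves brackets. *)
Lemma jacobi X Y Z :
  lie G X (lie G Y Z) = lie G (lie G X Y) Z + lie G Y (lie G X Z).
Proof.
apply: is_derive_unique (lie_exp_Ad X (lie G Y Z)) _.
under eq_fun do rewrite Ad_lie.
have := is_derive_lie (lie_exp_Ad X Y) (lie_exp_Ad X Z).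
by rewrite scale0r exp0 !Ad1.
Qed.

Lemma Ad_exp_derive X Y t :
  is_derive t (1 : R) (fun s => Ad (exp (s *: X)) Y) (Ad (exp (t *: X)) (lie G X Y)).
Proof.
have gX := lie_exp_onep X; have [gD _ gd] := gX.
have h := is_derive_linear [the {linear _ -> _} of Ad (exp (t *: X))] (lie_exp_Ad X Y).
have [hd hE] := h.
have E : (fun h : R => h^-1 *: (((fun s => Ad (exp (s *: X)) Y) \o shift t) (h *: 1)
      - Ad (exp (t *: X)) Y)) =
   (fun h : R => h^-1 *: ((([the {linear _ -> _} of Ad (exp (t *: X))] \o (fun s => Ad (exp (s *: X)) Y)) \o shift 0) (h *: 1)
      - ([the {linear _ -> _} of Ad (exp (t *: X))] \o (fun s => Ad (exp (s *: X)) Y)) 0)).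
  apply/funext => s /=; rewrite !addr0 scale0r exp0 Ad1 -AdM -gD.
  by rewrite [_ + t]addrC.
by apply: DeriveDef; rewrite /derivable /derive E.
Qed.


Fact Ad_mx_spec : {f : G -> 'M[R]_n | forall g Y, Y *m f g = Ad g Y}.
Proof. by exists (fun g => lin1_mx (Ad g)) => g Y; rewrite mul_rV_lin1. Qed.

Definition Ad_mx := sval Ad_mx_spec.

Lemma Ad_mxE g Y : Y *m Ad_mx g = Ad g Y.
Proof. exact: svalP Ad_mx_spec g Y. Qed.

Lemma Ad_mxM g h : Ad_mx (g * h)%g = Ad_mx h *m Ad_mx g.
Proof.
apply/row_matrixP => i; rewrite [LHS]rowE [RHS]rowE mulmxA.
by rewrite (Ad_mxE (g * h)%g) AdM (Ad_mxE h) (Ad_mxE g).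
Qed.

Lemma Ad_mx1 : Ad_mx 1%g = 1%:M.
Proof. by apply/row_matrixP => i; rewrite !rowE Ad_mxE Ad1 mulmx1. Qed.

Lemma Ad_mx_entry g i j : Ad_mx g i j = Ad g (delta_mx 0 i) 0 j.
Proof. by rewrite -Ad_mxE -rowE mxE. Qed.

Lemma Ad_mx_continuous : continuous Ad_mx.
Proof.
move=> g; apply: cvg_mx => i j; rewrite Ad_mx_entry.
under eq_fun do rewrite Ad_mx_entry.
by apply: cvg_entry; exact: continuous_Ad.
Qed.

Lemma is_derive_Ad_mx X t :
  is_derive t (1 : R) (fun s => Ad_mx (exp (s *: X))) (ad_mx X *m Ad_mx (exp (t *: X))).
Proof.
apply: is_derive_mx => i j; under eq_fun do rewrite Ad_mx_entry.
apply: is_derive_eq (is_derive_entry 0 j (Ad_exp_derive X (delta_mx 0 i) t)) _.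
by rewrite -ad_mxE -Ad_mxE -mulmxA -rowE mxE.
Qed.

(** * Factorization of a connected group as a product of two closed subgroups *)

Section ClosedSubgroups.
Context (K P : set G) (kk pp : set 'rV[R]_n) (M : R).
Hypotheses (Kgrp : subgroup K) (Kc : compact K) (Pgrp : subgroup P) (Pc : closed P).
Hypotheses (expK : forall X, kk X -> K (exp X)) (expP : forall X, pp X -> P (exp X)).
(** The sign is chosen so that multiplying an element with coordinates X by exp Y on the left and by
    exp Z on the right cancels X to first order. *)
Hypothesis (kp : forall X, exists Y Z,
  [/\ X = - (Y + Z), kk Y, pp Z, `|Y| <= M * `|X| & `|Z| <= M * `|X|]).
Hypothesis Gconn : connected [set: G].

(** One Newton step: with the coordinates u of g split as in [kp], the linear terms of exp Y g exp Z
    cancel, so that its coordinates are of order |u|^2, at most half of |u| when u is small. *)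
Lemma newton_step : exists delta c : R, [/\ 0 < delta, 0 < c & forall g, dom g -> `|lc g| <= delta ->
  exists k p, [/\ K k, P p, dom k /\ `|lc k| <= c * `|lc g|, dom (k * g * p)%g &
    `|lc (k * g * p)%g| <= `|lc g| / 2]].
Proof.
have [C [r [C0 r0 _ Dl H]]] := local_group G.
have [C1 [rho [C10 rho0 E]]] := lie_exp_estimate.
pose m := `|M| + 1.
have m1 : 1 <= m by rewrite lerDr.
have m0 : 0 < m by apply: lt_le_trans m1.
(* Bounds the coefficient of |u|^2 in the error: 2 C1 m^2 from the two exponentials, 2 C m^2 from
   the product k g and 8 C m^2 from its product with p. The summand 1 keeps it positive. *)
pose Q := 2 * C1 * m ^+ 2 + 10 * C * m ^+ 2 + 1.
have Q0 : 0 < Q by rewrite ltr_wpDl// addr_ge0// !mulr_ge0 ?sqr_ge0// ltW.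
pose delta := Num.min (rho / m) (Num.min (C1^-1 / m) (Num.min (r / (8 * m)) (Num.min (C^-1 / (8 * m)) (Q^-1 / 2)))).
exists delta, (2 * m); split; first by rewrite !lt_min !divr_gt0 ?invr_gt0// mulr_gt0.
  by rewrite mulr_gt0.
move=> g dg; rewrite !le_min !ler_pdivlMr// ?mulr_gt0// => /and5P[h1 h2 h3 h4 h5].
set u := lc g in h1 h2 h3 h4 h5 *.
have u0 : 0 <= `|u| by [].
have [Y [Z [uE kY pZ Yu Zu]]] := kp u.
have Mm : M * `|u| <= `|u| * m.
  by rewrite mulrC ler_wpM2l// (le_trans (ler_norm _))// lerDl.
have Ym := le_trans Yu Mm; have Zm := le_trans Zu Mm.
have h2' : C1 * (`|u| * m) <= 1 by rewrite -ler_pdivlMl// mulr1.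
have h4' : C * (`|u| * (8 * m)) <= 1 by rewrite -ler_pdivlMl// mulr1.
have h5' : Q * (`|u| * 2) <= 1 by rewrite -ler_pdivlMl// mulr1.
have est W : `|W| <= `|u| * m -> [/\ dom (exp W), `|lc (exp W) - W| <= C1 * (`|u| * m) ^+ 2
    & `|lc (exp W)| <= 2 * (`|u| * m)].
  move=> Wm; have [d1 d2] := E W (le_trans Wm h1); split=> //.
    by apply: le_trans d2 _; rewrite ler_wpM2l ?(ltW C10)// !expr2; apply: ler_pM.
  rewrite -(subrK W (lc _)); apply: le_trans (ler_normD _ _) _.
  have : `|W| ^+ 2 <= (`|u| * m) * (`|u| * m) by rewrite expr2; apply: ler_pM.
  have : 0 <= `|u| * m by rewrite mulr_ge0// ltW.
  move: d2; nra.
have [dk k1 k2] := est _ Ym; have [dp p1 p2] := est _ Zm.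
set k := exp Y in dk k1 k2; set p := exp Z in dp p1 p2.
have um : `|u| <= `|u| * m by rewrite ler_peMr.
have um0 : 0 <= `|u| * m by rewrite mulr_ge0// ltW.
have kr : `|lc k| < r by apply: le_lt_trans k2 _; nra.
have pr : `|lc p| < r by apply: le_lt_trans p2 _; nra.
have ur : `|u| < r by apply: le_lt_trans um _; nra.
have [] := H _ _ _ _ kr kr ur ur; rewrite /u !lcK// -/u => dkg q1 _ _.
have kg : `|lc (k * g)%g| <= 4 * (`|u| * m).
  have -> : lc (k * g)%g = (lc (k * g)%g - lc k - u) + (lc k + u).
    by apply/rowP => i; rewrite !mxE; ring.
  apply: le_trans (ler_normD _ _) _.
  have := ler_normD (lc k) u.
  have : C * `|lc k| * `|u| <= C * (2 * (`|u| * m)) * `|u|.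
    by rewrite ler_wpM2r// ler_wpM2l// ltW.
  nra.
have kgr : `|lc (k * g)%g| < r by apply: le_lt_trans kg _; nra.
have [] := H _ _ _ _ kgr kgr pr pr; rewrite !lcK// => dkgp q2 _ _.
exists k, p; split; [exact: expK|exact: expP| |by []|].
  by split=> //; rewrite -mulrA (mulrC m).
have -> : lc (k * g * p)%g = (lc (k * g * p)%g - lc (k * g)%g - lc p) +
   ((lc (k * g)%g - lc k - u) + ((lc k - Y) + (lc p - Z))) + (u + (Y + Z)).
  by apply/rowP => i; rewrite !mxE; ring.
have -> : u + (Y + Z) = 0 by rewrite uE addNr.
rewrite addr0; apply: le_trans (ler_normD _ _) _.
have e1 := ler_normD (lc (k * g)%g - lc k - u) ((lc k - Y) + (lc p - Z)).
have e2 := ler_normD (lc k - Y) (lc p - Z).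
have f1 : C * `|lc (k * g)%g| * `|lc p| <= C * (4 * (`|u| * m)) * (2 * (`|u| * m)).
  by apply: ler_pM => //; rewrite ?mulr_ge0// ?(ltW C0)// ler_wpM2l// ltW.
have f2 : C * `|lc k| * `|u| <= C * (2 * (`|u| * m)) * (`|u| * m).
  by apply: ler_pM => //; rewrite ?mulr_ge0// ?(ltW C0)// ler_wpM2l// ltW.
have e3 := ler_normD (lc (k * g * p)%g - lc (k * g)%g - lc p)
  ((lc (k * g)%g - lc k - u) + ((lc k - Y) + (lc p - Z))).
apply: (@le_trans _ _ ((2 * C1 * m ^+ 2 + 10 * C * m ^+ 2) * `|u| ^+ 2)).
  move: e1 e2 f1 f2 q1 q2 k1 p1 e3; rewrite !expr2; lra.
have : Q * (`|u| * 2) * `|u| <= 1 * `|u| by rewrite ler_wpM2r.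
have : 0 <= `|u| * `|u| by rewrite mulr_ge0.
rewrite /Q !expr2; lra.
Qed.

(* The successive corrections [k] decay geometrically, so that their products
   stay in a compact coordinate ball. *)
Lemma newton_nbhs : exists2 delta : R, 0 < delta & forall g, dom g -> `|lc g| <= delta ->
  exists k p, [/\ closure K k, closure P p & g = (k * p)%g].
Proof.
have [delta1 [c [d10 c0 step]]] := newton_step.
have [K1 KM KV] := Kgrp; have [P1 PM PV] := Pgrp.
have [C [r [C0 r0 De Dl Hmul]]] := local_group G.
pose s := r / 2; have s0 : 0 < s by rewrite divr_gt0.
have sr : s < r by rewrite /s; lra.
pose delta := Num.min delta1 (s / (2 * c * (1 + C * s))).
have q0 : 0 < 2 * c * (1 + C * s) by rewrite !mulr_gt0// addr_gt0// mulr_gt0.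
have d0 : 0 < delta by rewrite lt_min d10/= divr_gt0.
have d1 : delta <= delta1 by rewrite ge_min lexx.
have d2 : delta * (2 * c * (1 + C * s)) <= s.
  by rewrite -ler_pdivlMr// ge_min lexx orbT.
exists delta => // g dg gd.
(* The bound s (1 - 2^-N) is a partial sum of s/2 + s/4 + ..., so the next correction still fits
   below s. The factor 1 + C s in [delta] absorbs the error of multiplying the corrections. *)
have it N : exists kp : G * G, [/\ K kp.1, P kp.2,
    dom kp.1 /\ `|lc kp.1| <= s * (1 - 2^-1 ^+ N), dom (kp.1 * g * kp.2)%g &
    `|lc (kp.1 * g * kp.2)%g| <= delta * 2^-1 ^+ N].
  elim: N => [|N [[k p] /= [Kk Pp [dk0 lk0] dk lk]]].
    exists (1%g, 1%g) => /=; rewrite mul1g mulg1 expr0 mulr1 subrr mulr0 lc1 normr0.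
    by split=> //; split=> //; exact: chart_id1.
  have e0 : 0 <= 2^-1 ^+ N :> R by rewrite exprn_ge0// invr_ge0.
  have hle : delta * 2^-1 ^+ N <= delta.
    by rewrite ger_pMr// exprn_ile1//; lra.
  have [k' [p' [Kk' Pp' [dk1 lk1] dk' lk']]] := step _ dk (le_trans lk (le_trans hle d1)).
  have lk1' : `|lc k'| <= c * (delta * 2^-1 ^+ N).
    by apply: le_trans lk1 _; rewrite ler_wpM2l// ltW.
  have lks : `|lc k| <= s by apply: le_trans lk0 _; nra.
  have Cs0 : 0 <= C * s by rewrite mulr_ge0// ltW.
  have dN : delta * 2^-1 ^+ N * (2 * c * (1 + C * s)) <= s * 2^-1 ^+ N.
    by rewrite mulrAC ler_wpM2r.
  have cd0 : 0 <= c * (delta * 2^-1 ^+ N).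
    by rewrite mulr_ge0 ?(ltW c0)// mulr_ge0 ?(ltW d0).
  have lk1s : `|lc k'| <= s * 2^-1 ^+ N / 2.
    apply: le_trans lk1' _; move: dN; nra.
  have e1 : 2^-1 ^+ N <= 1 :> R by rewrite exprn_ile1//; lra.
  have k'r : `|lc k'| < r by apply: le_lt_trans sr; apply: le_trans lk1s _; nra.
  have kr : `|lc k| < r by exact: le_lt_trans lks sr.
  have [] := Hmul _ _ _ _ k'r k'r kr kr; rewrite !lcK// => dkk hkk _ _.
  exists (k' * k, p * p')%g => /=; rewrite !mulgA in dk' lk' *; split=> //.
  - exact: KM.
  - exact: PM.
  - split=> //; have -> : lc (k' * k)%g = (lc (k' * k)%g - lc k' - lc k) + (lc k' + lc k).
      by apply/rowP => i; rewrite !mxE; ring.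
    apply: le_trans (ler_normD _ _) _; have h1 := ler_normD (lc k') (lc k).
    have h2 : C * `|lc k'| * `|lc k| <= C * `|lc k'| * s by rewrite ler_wpM2l// mulr_ge0// ltW.
    have h3 : `|lc k'| * (1 + C * s) <= c * (delta * 2^-1 ^+ N) * (1 + C * s).
      by rewrite ler_wpM2r// addr_ge0.
    rewrite exprSr; move: dN lk0 h1 h2 h3 hkk; lra.
  - by apply: le_trans lk' _; rewrite exprSr mulrA; apply: ler_wpM2r; rewrite ?invr_ge0.
pose kpf N := sval (cid (it N)).
have kpP N := svalP (cid (it N)); rewrite -/(kpf _) in kpP.
have [F [FU Foo]] := ultra_oo.
have [v vs vc] : exists2 v : 'rV[R]_n, `|v| <= s & (fun N => lc (kpf N).1) @ F --> v.
  apply: (compact_ultra_cvg FU (@compact_ball_rV R n s)); apply: filterE => N.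
  have [_ _ [_ h] _ _] := kpP N; apply: le_trans h _.
  have e0 : 0 <= 2^-1 ^+ N :> R by rewrite exprn_ge0// invr_ge0.
  by nra.
pose k := li v.
have kc : (fun N => (kpf N).1) @ F --> k.
  have h : li \o (fun N => lc (kpf N).1) @ F --> k.
    by apply: li_cvg => //; apply: De; exact: le_lt_trans vs sr.
  apply: cvg_trans h; apply: near_eq_cvg; apply: filterE => N /=.
  by have [_ _ [dN _] _ _] := kpP N; rewrite lcK.
have Kk : closure K k.
  apply: (@closed_cvg _ _ F _ _ (closure K) (@closed_closure _ K) _ _ kc).
  by apply: filterE => N; apply: subset_closure; have [] := kpP N.
have g1 : (fun N => (kpf N).1 * g * (kpf N).2)%g @ F --> (1%g : G).
  have l0 : (fun N => lc ((kpf N).1 * g * (kpf N).2)%g) @ F --> (0 : 'rV[R]_n).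
    apply: cvg_trans (_ : _ @ \oo --> _).
      by move=> A; exact: Foo.
    apply/norm_cvg0P/(@squeeze_cvgr _ _ _ _ (cst 0) (fun N => delta * 2^-1 ^+ N)).
    - by near=> N => /=; rewrite normr_ge0/=; have [] := kpP N.
    - exact: cvg_cst.
    - rewrite -[X in _ --> X](mulr0 delta); apply: cvgMr; apply: cvg_expr.
      by rewrite ger0_norm; lra.
  have h : li \o (fun N => lc ((kpf N).1 * g * (kpf N).2)%g) @ F --> (1%g : G).
    by rewrite -li0; apply: li_cvg => //; apply: De; rewrite normr0.
  apply: cvg_trans h; apply: near_eq_cvg; apply: filterE => N /=.
  by have [_ _ _ dN _] := kpP N; rewrite lcK.
have pc : (fun N => (kpf N).2) @ F --> ((k * g)^-1 * 1)%g.
  have -> : (fun N => (kpf N).2) =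
      (fun N => ((kpf N).1 * g)^-1 * ((kpf N).1 * g * (kpf N).2))%g.
    by apply/funext => N; rewrite mulKg.
  apply: cvg_mulg => //; apply: cvg_invg; apply: cvg_mulg => //; exact: cvg_cst.
have Pkg : closure P ((k * g)^-1 * 1)%g.
  apply: (@closed_cvg _ _ F _ _ (closure P) (@closed_closure _ P) _ _ pc).
  by apply: filterE => N; apply: subset_closure; have [] := kpP N.
have clV (Q : set G) : (forall x, Q x -> Q (x^-1)%g) -> forall x, closure Q x -> closure Q (x^-1)%g.
  move=> QV x Qx B /(@lie_inv_continuous R n G x) /Qx[y [Qy By]].
  by exists (y^-1)%g; split=> //; exact: QV.
rewrite mulg1 in Pkg; exists (k^-1)%g, (k * g)%g; split.
- exact: clV.
- by rewrite -[(k * g)%g]invgK; exact: clV.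
- by rewrite mulKg.
Unshelve. all: by end_near. Qed.

(** The set of products k p is open, by translating the local factorization with k and p, and closed
    because K is compact and P is closed. Connectedness concludes. *)
Lemma lie_group_factorization g : exists k p, [/\ K k, P p & g = (k * p)%g].
Proof.
pose A := [set g : G | exists k p, [/\ K k, P p & g = (k * p)%g]].
suff : A = [set: G] by move=> AT; have : A g by rewrite AT.
have [K1 KM KV] := Kgrp; have [P1 PM PV] := Pgrp.
have [delta d0 nb] := newton_nbhs.
apply: Gconn.
- by exists 1%g, 1%g, 1%g; rewrite mulg1.
- exists A; last by rewrite setTI.
  rewrite openE => _ [k [p [Kk Pp ->]]].
  suff : nbhs (k * p)%g A by [].
  have c1 : (fun x => k^-1 * x * p^-1)%g @ (k * p)%g --> (1%g : G).
    have -> : 1%g = (k^-1 * (k * p) * p^-1)%g by rewrite mulKg mulgV.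
    apply: cvg_mulg; last exact: cvg_cst.
    by apply: cvg_mulg; [exact: cvg_cst|exact: cvg_id].
  have near1 : \forall x \near (1%g : G), dom x /\ `|lc x| <= delta.
    near=> x; split; first by near: x; apply: nbhs_cdom; exact: chart_id1.
    near: x; have /cvgrPdist_le/(_ _ d0) := @lc_cvg1 R n G.
    by apply: filterS => x; rewrite sub0r normrN.
  have H : nbhs (k * p)%g [set x | dom (k^-1 * x * p^-1)%g /\
    `|lc (k^-1 * x * p^-1)%g| <= delta] := c1 _ near1.
  apply: filterS H => x [dx lx].
  have [k' [p' [Kk' Pp' E]]] := nb _ dx lx.
  rewrite -((closure_id P).1 Pc) in Pp'.
  rewrite -((closure_id K).1 (compact_closed (@lie_hausdorff R n G) Kc)) in Kk'.
  exists (k * k')%g, (p' * p)%g; split; [exact: KM|exact: PM|].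
  by rewrite mulgA -[(k * k' * p')%g]mulgA -E !mulgA mulgV mul1g mulgVK.
- exists A; last by rewrite setTI.
  move=> x; rewrite closureEcvg => -[F FP [Fx FA]].
  have [F' [FU sub]] := ultraFilterLemma FP.
  have F'A : F' A by apply: sub; apply: FA.
  have H y : exists k, A y -> K k /\ P (k^-1 * y)%g.
    have [[k [p [Kk Pp ->]]]|nA] := pselect (A y); last by exists 1%g.
    by exists k; rewrite mulKg.
  have [kap kapP] := choice H.
  have [k Kk kc] : exists2 k, K k & kap @ F' --> k.
    by apply: (compact_ultra_cvg FU Kc); apply: filterS F'A => y /kapP[].
  have F'x : (fun y : G => y) @ F' --> x by apply: cvg_trans Fx => B; exact: sub.
  have pc : (fun y => (kap y)^-1 * y)%g @ F' --> (k^-1 * x)%g.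
    by apply: cvg_mulg => //; exact: cvg_invg.
  have Pkx : P (k^-1 * x)%g.
    by apply: (@closed_cvg _ _ F' _ _ P Pc _ _ pc); apply: filterS F'A => y /kapP[].
  by exists k, (k^-1 * x)%g; split=> //; rewrite mulVKg.
Unshelve. all: by end_near. Qed.

End ClosedSubgroups.

End Bracket.

Lemma is_derive_trmx (R : realType) m n (f : R -> 'M[R]_(m, n)) (t : R) df :
  is_derive t (1 : R) f df -> is_derive t (1 : R) (fun s => (f s)^T) df^T.
Proof.
move=> fd; apply: is_derive_mx => i j; rewrite mxE.
by under eq_fun do rewrite mxE; exact: is_derive_entry.
Qed.

Lemma eqmx_cokermx_row_base (F : fieldType) m n (W : 'M[F]_(m, n)) :
  row_base W *m cokermx W = 0.
Proof. by apply/eqP; rewrite -submxE eq_row_base. Qed.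

(** For a basis B of W one has B A = a B, so B M read modulo W satisfies a linear equation with
    initial value 0 and vanishes. The transpose puts the coefficient on the right, as in
    [linear_ode_zero]. *)
Lemma matrix_ode_invariant (R : realType) m n (A : 'M[R]_n) (M : R -> 'M[R]_n) (W : 'M[R]_(m, n)) :
  (forall t, is_derive t (1 : R) M (A *m M t)) -> M 0 = 1%:M ->
  (W *m A <= W)%MS -> (W *m M 1 <= W)%MS.
Proof.
move=> Md M0 WA.
pose B := row_base W; pose Q := cokermx W.
have BA : (B *m A <= B)%MS.
  by rewrite eq_row_base; apply: submx_trans WA; apply: submxMr; rewrite eq_row_base.
have /submxP[a aE] := BA.
pose D t := (B *m M t *m Q)^T.
have Dd t : is_derive t (1 : R) D (D t *m a^T).
  have h1 := is_derive_mulmx (is_derive_cst B t 1) (Md t).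
  have h2 := is_derive_mulmx h1 (is_derive_cst Q t 1).
  rewrite mul0mx add0r mulmx0 addr0 mulmxA aE in h2.
  apply: is_derive_eq (is_derive_trmx h2) _.
  by rewrite /D -trmx_mul !mulmxA.
have D0 : D 0 = 0.
  by rewrite /D M0 mulmx1 (eqmx_cokermx_row_base W) trmx0.
pose C := \sum_i \sum_j `|a^T i j|.
have aC (t : R) i j : 0 <= t <= 1 -> `|a^T i j| <= C.
  move=> _; rewrite /C (bigD1 i)//= (bigD1 j)//= -addrA lerDl addr_ge0//.
    by apply: sumr_ge0 => k _.
  by apply: sumr_ge0 => k _; apply: sumr_ge0 => l _.
have := @linear_ode_zero _ _ _ D (fun=> a^T) 1 C (fun t _ => Dd t) aC D0 1.
rewrite ler01 lexx => /(_ isT) /(congr1 trmx); rewrite trmxK trmx0 => BMQ.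
have BM : (B *m M 1 <= W)%MS by rewrite submxE BMQ.
by apply: submx_trans BM; apply: submxMr; rewrite eq_row_base.
Qed.

Section Invariance.
Context (R : realType) (n : nat) (G : lieGroupType R n).

Lemma Ad_exp_invariant (X : 'rV[R]_n) m (W : 'M[R]_(m, n)) :
  (W *m ad_mx G X <= W)%MS -> (W *m Ad_mx (lie_exp G X) <= W)%MS.
Proof.
move=> WX; have := matrix_ode_invariant (@is_derive_Ad_mx R n G X) _ WX.
by rewrite scale0r exp0 Ad_mx1 scale1r; apply.
Qed.

End Invariance.

Lemma mulmxr_continuous (R : realType) m n p (A : 'M[R]_(n, p)) :
  continuous (fun x : 'M[R]_(m, n) => x *m A).
Proof.
by move=> x; apply: (cvg_mulmx (FF := nbhs_filter x)); [exact: cvg_id|exact: cvg_cst].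
Qed.

(** * Restricted roots *)

Section Spectral.
Context (R : realType) (n : nat) (Q : 'M[R]_n).
Local Notation form x y := ((x *m Q *m y^T) 0 0).
Hypothesis Qsym : Q^T = Q.
Hypothesis Qpos : forall x : 'rV[R]_n, x != 0 -> 0 < form x x.

Let selfadjoint (A : 'M[R]_n) := A *m Q = Q *m A^T.

Lemma form_continuous (A : 'M[R]_n) :
  continuous (fun x : 'rV[R]_n => (x *m A *m x^T) 0 0).
Proof.
move=> x; apply: (cvg_entry (FF := nbhs_filter x)).
have xx : (fun y : 'rV[R]_n => y) @ x --> x by exact: cvg_id.
have h1 : (fun y : 'rV[R]_n => y *m A) @ x --> x *m A.
  exact: mulmxr_continuous.
have h2 : (fun y : 'rV[R]_n => y^T) @ x --> x^T.
  apply: (cvg_mx (FF := nbhs_filter x)) => i j; rewrite mxE.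
  by under eq_fun do rewrite mxE; exact: (cvg_entry (FF := nbhs_filter x)).
exact: (cvg_mulmx (FF := nbhs_filter x)).
Qed.

(* A maximum of the Rayleigh quotient on the unit sphere of [U]. *)
Lemma selfadjoint_eigenvector (A : 'M[R]_n) (U : 'M[R]_n) :
  selfadjoint A -> U != 0 -> stablemx U A ->
  exists (x : 'rV[R]_n) (c : R), [/\ x != 0, (x <= U)%MS & x *m A = c *: x].
Proof.
move=> sA U0 UA.
pose S := [set x : 'rV[R]_n | (x <= U)%MS /\ `|x| = 1].
have [i Ui] : exists i, row i U != 0.
  apply/existsP; apply: contraNT U0; rewrite negb_exists => /forallP h.
  apply/eqP/row_matrixP => i; rewrite row0; apply/eqP.
  by have := h i; rewrite negbK.
have norm1 (x : 'rV[R]_n) : x != 0 -> `|(`|x|^-1 *: x)| = 1.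
  move=> x0; rewrite normrZ normfV normr_id mulVf// normr_eq0//.
have S0 : S !=set0.
  exists (`|row i U|^-1 *: row i U); split; last exact: norm1.
  by apply: scalemx_sub; exact: row_sub.
have Sc : compact S.
  apply: (@subclosed_compact _ _ [set x : 'rV[R]_n | `|x| <= 1]).
  - have -> : S = (fun x : 'rV[R]_n => x *m cokermx U) @^-1` [set 0] `&`
        (fun x : 'rV[R]_n => `|x|) @^-1` [set 1].
      apply/seteqP; split=> x [h1 h2]; split=> //=.
        by apply/eqP; rewrite -submxE.
      rewrite submxE; by move: h1 => /= /eqP.
    apply: closedI; apply: closed_comp.
    - by move=> x _; exact: mulmxr_continuous.
    - by apply: accessible_closed_set1; exact/hausdorff_accessible/norm_hausdorff.
    - by move=> x _; exact: norm_continuous.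
    - by apply: accessible_closed_set1; exact/hausdorff_accessible/norm_hausdorff.
  - exact: compact_ball_rV.
  - by move=> x [_ /= ->].
pose f (x : 'rV[R]_n) : R := form (x *m A) x.
pose q (x : 'rV[R]_n) : R := form x x.
have fc : continuous f.
  by move=> x; have := @form_continuous (A *m Q) x; under eq_fun do rewrite mulmxA.
have qc : continuous q.
  exact: form_continuous.
have S_neq0 x : S x -> x != 0.
  by move=> [_ x1]; apply/eqP => x0; move: x1; rewrite x0 normr0 => /esym/eqP; rewrite oner_eq0.
have fqc : {within S, continuous (fun x => f x / q x)}.
  apply: continuous_in_subspaceT => x /set_mem Sx.
  have fx : f @ x --> f x := fc x; have qx : q @ x --> q x := qc x.
  have qx0 : q x != 0 by rewrite gt_eqF// Qpos// S_neq0.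
  exact: cvgM fx (cvgV qx0 qx).
have [x0 /set_mem Sx0 xmax] := EVT_max_rV S0 Sc fqc.
have x00 := S_neq0 _ Sx0; have [x0U _] := Sx0.
pose c := f x0 / q x0.
have bnd y : (y <= U)%MS -> f y <= c * q y.
  move=> yU; have [->|y0] := eqVneq y 0.
    by rewrite /f /q !mul0mx mxE mulr0.
  have Sy : S (`|y|^-1 *: y) by split; [exact: scalemx_sub|exact: norm1].
  have := xmax _ (mem_set Sy).
  have fZ a z : f (a *: z) = a ^+ 2 * f z.
    by rewrite /f linearZ/= -!scalemxAl -scalemxAr scalerA mxE expr2.
  have qZ a z : q (a *: z) = a ^+ 2 * q z.
    by rewrite /q linearZ/= -!scalemxAl -scalemxAr scalerA mxE expr2.
  have a0 : `|y|^-1 ^+ 2 != 0 by rewrite expf_neq0// invr_eq0 normr_eq0.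
  rewrite fZ qZ -mulf_div divff// mul1r -/c ler_pdivrMr//.
  exact: Qpos.
(* As c is the maximum of the quotient, this form is positive semidefinite on U. It vanishes at x0,
   hence x0 lies in its kernel, which is the eigenvector equation. *)
pose b (x y : 'rV[R]_n) : R := form (x *m (c%:M - A)) y.
have bsym x y : b x y = b y x.
  have tr1 (M : 'M[R]_1) : M 0 0 = M^T 0 0 by rewrite mxE.
  have BQ : (c%:M - A) *m Q = Q *m (c%:M - A)^T.
    by rewrite linearB/= tr_scalar_mx mulmxBr mulmxBl sA scalar_mxC.
  by rewrite /b [RHS]tr1 !trmx_mul trmxK Qsym -!mulmxA (mulmxA Q) -BQ !mulmxA.
have bD (x y z : 'rV[R]_n) t : b (x + t *: y) (x + t *: z) = b x x + t * (b y x + b x z) + t ^+ 2 * b y z.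
  rewrite /b; move: (c%:M - A : 'M[R]_n) => B.
  have -> : (x + t *: z)^T = x^T + t *: z^T by rewrite linearD/= linearZ.
  rewrite !mulmxDl !mulmxDr -!scalemxAl -!scalemxAr.
  have DE (M N : 'M[R]_1) : (M + N) 0 0 = M 0 0 + N 0 0 by rewrite mxE.
  have ZE a (M : 'M[R]_1) : (a *: M) 0 0 = a * M 0 0 by rewrite mxE.
  rewrite !(DE, ZE); ring.
have bb y : (y <= U)%MS -> 0 <= b y y.
  move=> /bnd; rewrite /b mulmxBr !mulmxBl mul_mx_scalar -!scalemxAl mxE [X in _ + X]mxE [X in X - _]mxE.
  by rewrite subr_ge0.
have b0 : b x0 x0 = 0.
  rewrite /b mulmxBr !mulmxBl mul_mx_scalar -!scalemxAl mxE [X in _ + X]mxE [X in X - _]mxE.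
  rewrite -/(q x0) -/(f x0) /c divfK ?subrr// gt_eqF// Qpos//.
have bx y : (y <= U)%MS -> b x0 y = 0.
  move=> yU; apply/eqP; rewrite -[_ == 0]negbK; apply/negP => bn.
  (* Nearly the minimizer of t -> b (x0 + t y, x0 + t y); adding 1 avoids a zero denominator and
     still makes the value negative. *)
  pose t := - b x0 y / (b y y + 1).
  have by0 := bb y yU; have by1 : b y y + 1 != 0 by rewrite gt_eqF// ltr_wpDl.
  have := bb (x0 + t *: y); rewrite addmx_sub ?scalemx_sub// => /(_ isT).
  rewrite bD b0 add0r (bsym y x0).
  have -> : t * (b x0 y + b x0 y) + t ^+ 2 * b y y =
     - (b x0 y / (b y y + 1)) ^+ 2 * (b y y + 2).
    by rewrite /t; field.
  rewrite leNgt => /negP; apply; rewrite mulNr oppr_lt0 mulr_gt0//.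
    by rewrite exprn_even_gt0//= mulf_neq0// invr_eq0.
  by rewrite ltr_wpDl.
exists x0, c; split=> //; apply/esym/eqP; rewrite -subr_eq0.
have -> : c *: x0 - x0 *m A = x0 *m (c%:M - A) by rewrite mulmxBr mul_mx_scalar.
apply: contraT => z0; have := Qpos z0.
have zU : (x0 *m (c%:M - A) <= U)%MS.
  rewrite mulmxBr mul_mx_scalar addmx_sub ?scalemx_sub// eqmx_opp.
  by apply: submx_trans UA; exact: submxMr.
by have := bx _ zU; rewrite /b => ->; rewrite ltxx.
Qed.

(** The part of U in one eigenspace of A is nonzero, and it is stable under the remaining maps
    because they commute with A. *)
Lemma common_eigenvector (s : seq 'M[R]_n) (U : 'M[R]_n) :
  (forall A, A \in s -> selfadjoint A) ->
  (forall A B, A \in s -> B \in s -> A *m B = B *m A) ->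
  U != 0 -> (forall A, A \in s -> stablemx U A) ->
  exists x : 'rV[R]_n, [/\ x != 0, (x <= U)%MS &
    forall A, A \in s -> exists c, x *m A = c *: x].
Proof.
elim: s U => [|A s IH] U sa cm U0 st.
  have [i Ui] : exists i, row i U != 0.
    apply/existsP; apply: contraNT U0; rewrite negb_exists => /forallP h.
    apply/eqP/row_matrixP => i; rewrite row0; apply/eqP.
    by have := h i; rewrite negbK.
  by exists (row i U); split=> //; exact: row_sub.
have As : A \in A :: s by rewrite inE eqxx.
have [x [c [x0 xU xA]]] := selfadjoint_eigenvector (sa _ As) U0 (st _ As).
pose W := (U :&: kermx (A - c%:M))%MS.
have xW : (x <= W)%MS.
  by rewrite sub_capmx xU/= sub_kermx mulmxBr mul_mx_scalar xA subrr.
have W0 : W != 0 by apply: contraNneq x0 => W0; move: xW; rewrite W0 submx0.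
have stW B : B \in s -> stablemx W B.
  move=> Bs; have Bs' : B \in A :: s by rewrite inE Bs orbT.
  rewrite sub_capmx; apply/andP; split.
    by apply: submx_trans (st _ Bs'); apply: submxMr; exact: capmxSl.
  rewrite sub_kermx -mulmxA mulmxBr -(cm _ _ As Bs') scalar_mxC -mulmxBl mulmxA.
  have -> : W *m (A - c%:M) = 0 by apply/eqP; rewrite -sub_kermx capmxSr.
  by rewrite mul0mx.
have sa' B : B \in s -> selfadjoint B by move=> Bs; apply: sa; rewrite inE Bs orbT.
have cm' B C : B \in s -> C \in s -> B *m C = C *m B.
  by move=> Bs Cs; apply: cm; rewrite inE ?Bs ?Cs orbT.
have [y [y0 yW yE]] := IH W sa' cm' W0 stW.
exists y; split=> //; first by apply: submx_trans yW (capmxSl _ _).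
move=> B; rewrite inE => /predU1P[->|/yE//].
exists c; have /eqP : y *m (A - c%:M) = 0.
  by apply/eqP; rewrite -sub_kermx; apply: submx_trans yW (capmxSr _ _).
by rewrite mulmxBr mul_mx_scalar subr_eq0 => /eqP.
Qed.

(** A largest independent family of common eigenvectors must be a basis: otherwise its orthogonal
    complement [U] is nonzero, stable by self-adjointness, and contains a further common
    eigenvector. *)
Lemma common_eigenbasis (s : seq 'M[R]_n) :
  (forall A, A \in s -> selfadjoint A) ->
  (forall A B, A \in s -> B \in s -> A *m B = B *m A) ->
  exists2 P : 'M[R]_n, P \in unitmx &
    forall A i, A \in s -> exists c, row i P *m A = c *: row i P.
Proof.
move=> sa cm.
pose good m := `[< exists P : 'M[R]_(m, n), row_free P /\
    forall A i, A \in s -> exists c, row i P *m A = c *: row i P >].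
have ex : exists m, good m.
  exists 0%N; apply/asboolP; exists 0; split; first by rewrite /row_free mxrank0.
  by move=> A [].
have bd m : good m -> (m <= n)%N.
  by move=> /asboolP[P [Pf _]]; rewrite -(eqP Pf); exact: rank_leq_col.
have [m /asboolP[P [Pf PE]] mmax] := ex_maxnP ex bd.
have [mn|mn] := eqVneq m n.
  by move: mn P Pf PE => -> P Pf PE; exists P => //; rewrite -row_free_unit.
have {mn} mn : (m < n)%N by rewrite ltn_neqAle mn bd//; apply/asboolP; exists P.
pose U := kermx (Q *m P^T).
have U0 : U != 0.
  rewrite kermx_eq0 -row_leq_rank -ltnNge (leq_ltn_trans _ mn)//.
  exact: leq_trans (rank_leq_col _) _.
have Ust A : A \in s -> stablemx U A.
  move=> As; have UQP : U *m (Q *m P^T) = 0 := mulmx_ker _.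
  rewrite sub_kermx -(mulmxA U) (mulmxA A) (sa _ As) -(mulmxA Q).
  have -> : A^T *m P^T = P^T *m diag_mx (\row_i xget 0 [set c | row i P *m A = c *: row i P]).
    rewrite -trmx_mul; apply: trmx_inj; rewrite trmxK trmx_mul trmxK tr_diag_mx.
    apply/row_matrixP => i; rewrite !row_mul row_diag_mx -scalemxAl -rowE mxE.
    by case: xgetP => [c _ //|no]; have [c cE] := PE A i As; case: (no c).
  by rewrite (mulmxA Q) (mulmxA U) UQP mul0mx.
have [y [y0 yU yE]] := common_eigenvector sa cm U0 Ust.
have yP : y *m Q *m P^T = 0 by rewrite -mulmxA; apply/eqP; rewrite -sub_kermx.
have : good m.+1.
  rewrite -addn1; apply/asboolP; exists (col_mx P y); split.
    rewrite -row_leq_rank -addsmxE mxrank_disjoint_sum.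
      by rewrite (eqP Pf) rank_rV y0.
    apply/eqP; rewrite -submx0; apply/rV_subP => z; rewrite sub_capmx => /andP[/submxP[u ->]].
    move=> /sub_rVP[a aE]; rewrite aE.
    have : form (a *: y) (u *m P) = 0.
      by rewrite trmx_mul -!scalemxAl mulmxA yP mul0mx scaler0 mxE.
    rewrite aE linearZ/= -!scalemxAl -scalemxAr scalerA mxE => /eqP.
    rewrite mulf_eq0 (gt_eqF (Qpos y0)) orbF mulf_eq0 orbb => /eqP ->.
    by rewrite scale0r sub0mx.
  move=> A i As; case: (split_ordP i) => j ->.
    by rewrite rowKu; exact: PE.
  by rewrite rowKd ord1 row_id; exact: yE.
by move=> /mmax; rewrite ltnn.
Qed.

End Spectral.

Lemma eq_mulmx_rV (R : pzSemiRingType) m n (A B : 'M[R]_(m, n)) :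
  (forall x : 'rV[R]_m, x *m A = x *m B) -> A = B.
Proof. by move=> h; apply/row_matrixP => i; rewrite !rowE. Qed.

(** * The Killing form and the Cartan involution *)

Section Killing.
Context (R : realType) (n : nat) (G : lieGroupType R n).
Implicit Types X Y Z : 'rV[R]_n.
Local Notation kil := (killing G).
Local Notation ad := (ad_mx G).

Lemma lieZr c X Y : lie G X (c *: Y) = c *: lie G X Y.
Proof. by rewrite -!ad_mxE -scalemxAl. Qed.

Lemma lie0r X : lie G X 0 = 0.
Proof. by rewrite -ad_mxE mul0mx. Qed.

Lemma ad_mx_linear a X Y : ad (a *: X + Y) = a *: ad X + ad Y.
Proof.
apply: eq_mulmx_rV => Z.
by rewrite mulmxDr -scalemxAr !ad_mxE lie_linearl.
Qed.

Lemma ad_mxD X Y : ad (X + Y) = ad X + ad Y.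
Proof. by have := ad_mx_linear 1 X Y; rewrite !scale1r. Qed.

Lemma ad_mxZ a X : ad (a *: X) = a *: ad X.
Proof. by apply: eq_mulmx_rV => Z; rewrite -scalemxAr !ad_mxE lieZl. Qed.

(** Matrices act on row vectors from the right, which reverses the order in the commutator. *)
Lemma ad_mx_lie X Y : ad (lie G X Y) = ad Y *m ad X - ad X *m ad Y.
Proof.
apply: eq_mulmx_rV => Z; rewrite mulmxBr !mulmxA !ad_mxE.
by rewrite (jacobi G X Y Z) addrK.
Qed.

Lemma ad_mx_Ad (g : G) X : ad (Ad g X) = Ad_mx (g^-1)%g *m ad X *m Ad_mx g.
Proof.
apply: eq_mulmx_rV => Z; rewrite !mulmxA !ad_mxE !Ad_mxE Ad_lie.
by rewrite AdVK.
Qed.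

Lemma killingE X Y : kil X Y = \tr (ad Y *m ad X).
Proof.
congr (\tr _); apply/matrixP => i j.
by rewrite mxE -!ad_mxE -mulmxA -rowE mxE.
Qed.

Lemma killingC X Y : kil X Y = kil Y X.
Proof. by rewrite !killingE mxtrace_mulC. Qed.

Lemma killing_linearl a X Y Z : kil (a *: X + Y) Z = a * kil X Z + kil Y Z.
Proof.
by rewrite !killingE ad_mx_linear mulmxDr mxtraceD -scalemxAr mxtraceZ.
Qed.

Lemma killingDl X Y Z : kil (X + Y) Z = kil X Z + kil Y Z.
Proof. by have := killing_linearl 1 X Y Z; rewrite scale1r mul1r. Qed.

Lemma killingZl a X Z : kil (a *: X) Z = a * kil X Z.
Proof. by rewrite !killingE ad_mxZ -scalemxAr mxtraceZ. Qed.

Lemma killingDr X Y Z : kil Z (X + Y) = kil Z X + kil Z Y.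
Proof. by rewrite killingC killingDl !(killingC Z). Qed.

Lemma killingZr a X Z : kil Z (a *: X) = a * kil Z X.
Proof. by rewrite killingC killingZl killingC. Qed.

Lemma killingNl X Z : kil (- X) Z = - kil X Z.
Proof. by rewrite -scaleN1r killingZl mulN1r. Qed.

Lemma killingNr X Z : kil Z (- X) = - kil Z X.
Proof. by rewrite -scaleN1r killingZr mulN1r. Qed.

Lemma killing_lie X Y Z : kil (lie G X Y) Z = kil X (lie G Y Z).
Proof.
rewrite !killingE !ad_mx_lie mulmxBr mulmxBl !linearB/= !mulmxA; congr (_ - _).
by rewrite -(mulmxA (ad Y)) [RHS]mxtrace_mulC.
Qed.

Lemma killing_Ad (g : G) X Y : kil (Ad g X) (Ad g Y) = kil X Y.
Proof.
rewrite !killingE !ad_mx_Ad -!mulmxA (mulmxA (Ad_mx g)) -Ad_mxM mulVg Ad_mx1 mul1mx.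
by rewrite mxtrace_mulC -!mulmxA -Ad_mxM mulVg Ad_mx1 mulmx1.
Qed.

Definition killing_mx : 'M[R]_n := \matrix_(i, j) kil (delta_mx 0 i) (delta_mx 0 j).

Lemma killing_mxE X Y : (X *m killing_mx *m Y^T) 0 0 = kil X Y.
Proof.
rewrite mxE [in RHS](row_sum_delta Y).
have -> : forall Z (F : 'I_n -> 'rV[R]_n), kil Z (\sum_j F j) = \sum_j kil Z (F j).
  move=> Z F; elim/big_ind2: _ => // [|x1 x2 y1 y2 <- <-]; last by rewrite killingDr.
  by rewrite -(scale0r (0 : 'rV[R]_n)) killingZr mul0r.
apply: eq_bigr => j _; rewrite killingZr mulrC mxE; congr (_ * _).
rewrite mxE [in RHS](row_sum_delta X).
have -> : forall Z (F : 'I_n -> 'rV[R]_n), kil (\sum_j F j) Z = \sum_j kil (F j) Z.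
  move=> Z F; elim/big_ind2: _ => // [|x1 x2 y1 y2 <- <-]; last by rewrite killingDl.
  by rewrite -(scale0r (0 : 'rV[R]_n)) killingZl mul0r.
by apply: eq_bigr => i _; rewrite killingZl mxE.
Qed.

Lemma killing_mx_sym : killing_mx^T = killing_mx.
Proof. by apply/matrixP => i j; rewrite !mxE killingC. Qed.

End Killing.

Section CartanInvolution.
Context (R : realType) (n : nat) (G : lieGroupType R n) (tau : 'End('rV[R]_n)).
Hypothesis tauP : cartan_involution G tau.
Implicit Types X Y Z : 'rV[R]_n.
Local Notation kil := (killing G).
Local Notation ad := (ad_mx G).

Lemma tau_lie X Y : tau (lie G X Y) = lie G (tau X) (tau Y).
Proof. by case: tauP. Qed.

Lemma tauK X : tau (tau X) = X.
Proof. by case: tauP. Qed.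

(** The inner product attached to the Cartan involution, for which [ad H] is self-adjoint when tau H
    = - H. *)
Definition ip X Y : R := - kil X (tau Y).

Lemma ip_gt0 X : X != 0 -> 0 < ip X X.
Proof. by case: tauP => _ _; apply. Qed.

Lemma ip_eq0 X : ip X X = 0 -> X = 0.
Proof. by move=> h; apply/eqP; apply: contraT => /ip_gt0; rewrite h ltxx. Qed.

Lemma ip_ge0 X : 0 <= ip X X.
Proof.
have [->|/ip_gt0/ltW//] := eqVneq X 0.
by rewrite /ip -(scale0r (0 : 'rV[R]_n)) killingZl mul0r oppr0.
Qed.

Lemma killing_tau X Y : kil (tau X) (tau Y) = kil X Y.
Proof.
pose T := lin1_mx tau.
have TE Z : Z *m T = tau Z by rewrite mul_rV_lin1.
have TT : T *m T = 1%:M by apply: eq_mulmx_rV => Z; rewrite mulmxA !TE tauK mulmx1.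
have adE Z : ad (tau Z) = T *m ad Z *m T.
  by apply: eq_mulmx_rV => W; rewrite !mulmxA ad_mxE !TE ad_mxE tau_lie tauK.
rewrite !killingE !adE -!mulmxA (mulmxA T T) TT mul1mx mxtrace_mulC -!mulmxA TT.
by rewrite mulmx1.
Qed.

Lemma ipC X Y : ip X Y = ip Y X.
Proof. by rewrite /ip -killing_tau tauK killingC. Qed.

Lemma ip_ad H X Y : tau H = - H -> ip (lie G H X) Y = ip X (lie G H Y).
Proof.
move=> tH; rewrite /ip tau_lie tH lieC killingNl killing_lie; congr (- _).
by rewrite -killingNr -scaleN1r -lieZl scaleN1r.
Qed.

Let Q : 'M[R]_n := - (killing_mx G *m (lin1_mx tau)^T).

Let QE X Y : (X *m Q *m Y^T) 0 0 = ip X Y.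
Proof.
by rewrite /Q mulmxN mulNmx mulmxA -mulmxA -trmx_mul mxE killing_mxE mul_rV_lin1.
Qed.

Lemma commuting_eigenbasis (a : {vspace 'rV[R]_n}) :
  (forall X, X \in a -> tau X = - X) ->
  (forall X Y, X \in a -> Y \in a -> lie G X Y = 0) ->
  exists2 P : 'M[R]_n, P \in unitmx &
    forall X i, X \in a -> exists c, lie G X (row i P) = c *: row i P.
Proof.
move=> ta ca.
have QP (A B : 'M[R]_n) : (forall X Y, (X *m A *m Y^T) 0 0 = (X *m B *m Y^T) 0 0) -> A = B.
  move=> h; apply/matrixP => i j; have := h (delta_mx 0 i) (delta_mx 0 j).
  by rewrite -!rowE !trmx_delta -!colE !mxE.
have Qsym : Q^T = Q.
  apply: QP => X Y; rewrite QE ipC -QE.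
  have tr1 (M : 'M[R]_1) : M 0 0 = M^T 0 0 by rewrite mxE.
  by rewrite [RHS]tr1 !trmx_mul trmxK mulmxA.
have Qpos X : X != 0 -> 0 < (X *m Q *m X^T) 0 0 by move=> X0; rewrite QE ip_gt0.
pose s := [seq ad X | X <- vbasis a].
have sa A : A \in s -> A *m Q = Q *m A^T.
  move=> /mapP[X Xa ->]; apply: QP => Y Z.
  rewrite mulmxA QE ad_mxE ip_ad ?ta ?vbasis_mem// -QE.
  by rewrite mulmxA -[in RHS]mulmxA -trmx_mul ad_mxE.
have sc A B : A \in s -> B \in s -> A *m B = B *m A.
  move=> /mapP[X Xa ->] /mapP[Y Ya ->]; apply/eqP; rewrite -subr_eq0.
  by rewrite -ad_mx_lie ca ?vbasis_mem// -(scale0r (0 : 'rV[R]_n)) ad_mxZ scale0r.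
have [P Pu PE] := common_eigenbasis Qsym Qpos sa sc.
exists P => // X i /coord_vbasis ->.
suff : exists c, row i P *m ad (\sum_(j < \dim a) coord (vbasis a) j X *: (vbasis a)`_j) = c *: row i P.
  by move=> [c cE]; exists c; rewrite -ad_mxE.
elim/big_ind: _ => [|x y [c cE] [d dE]|j _].
- by exists 0; rewrite -(scale0r (0 : 'rV[R]_n)) ad_mxZ !scale0r mulmx0.
- by exists (c + d); rewrite ad_mxD mulmxDr cE dE scalerDl.
- have js : ad (vbasis a)`_j \in s by apply: map_f; apply: mem_nth; rewrite size_tuple.
  have [c cE] := PE _ i js; exists (coord (vbasis a) j X * c).
  by rewrite ad_mxZ -scalemxAr cE scalerA.
Qed.

End CartanInvolution.

Local Notation roots := Defs.roots.

Section Evaluation.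
Context (R : realType) (n : nat) (a : {vspace 'rV[R]_n}).
Implicit Types (alpha beta : dual a) (X Y H : 'rV[R]_n).

Lemma evD alpha beta X : ev (alpha + beta) X = ev alpha X + ev beta X.
Proof. by rewrite /ev add_lfunE. Qed.

Lemma evN alpha X : ev (- alpha) X = - ev alpha X.
Proof. by rewrite /ev opp_lfunE. Qed.

Lemma evZ c alpha X : ev (c *: alpha) X = c * ev alpha X.
Proof. by rewrite /ev scale_lfunE. Qed.

Lemma ev0 X : ev (0 : dual a) X = 0.
Proof. by rewrite /ev zero_lfunE. Qed.

Lemma ev_sum (I : Type) (r : seq I) (F : I -> dual a) X :
  ev (\sum_(i <- r) F i) X = \sum_(i <- r) ev (F i) X.
Proof. by elim/big_rec2: _ => [|i x y _ <-]; rewrite ?ev0 ?evD. Qed.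

Lemma ev_scaler alpha c X : ev alpha (c *: X) = c * ev alpha X.
Proof. by rewrite /ev !linearZ. Qed.

Lemma ev_oppr alpha X : ev alpha (- X) = - ev alpha X.
Proof. by rewrite /ev !linearN. Qed.

Lemma ev_zeror alpha : ev alpha 0 = 0.
Proof. by rewrite /ev !linear0. Qed.

Lemma ev_sumr alpha (I : Type) (r : seq I) (F : I -> 'rV[R]_n) :
  ev alpha (\sum_(i <- r) F i) = \sum_(i <- r) ev alpha (F i).
Proof. by rewrite /ev !linear_sum. Qed.

Lemma ev_ext alpha beta : (forall H, H \in a -> ev alpha H = ev beta H) -> alpha = beta.
Proof.
move=> h; apply/lfunP => u; have := h _ (subvsP u).
by rewrite /ev vsvalK.
Qed.

Lemma ev_proj alpha X : ev alpha (vsval (vsproj a X)) = ev alpha X.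
Proof. by rewrite /ev vsvalK. Qed.

End Evaluation.

Section Roots.
Context (R : realType) (n : nat) (G : lieGroupType R n) (D : cartan_data G).
Local Notation a := (cd_a D).
Local Notation tau := (cd_tau D).
Local Notation tauP := (cd_tauP D).
Local Notation kil := (killing G).
Local Notation pos := (cd_pos D).
Local Notation simple := (simple_roots (cd_pos D)).
Local Notation ip := (ip G tau).
Implicit Types (alpha beta : dual a) (X Y H : 'rV[R]_n).

Lemma a_tau H : H \in a -> tau H = - H.
Proof. by have [[h _] _] := cd_aP D; exact: h. Qed.

Lemma a_abelian H H' : H \in a -> H' \in a -> lie G H H' = 0.
Proof. by have [[_ h] _] := cd_aP D; exact: h. Qed.

Lemma a_maximal H : tau H = - H -> (forall H', H' \in a -> lie G H' H = 0) -> H \in a.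
Proof.
move=> tH cH; have [_ amax] := cd_aP D.
have <- : (a + <[H]>)%VS = a; last by rewrite (subvP (addvSr _ _))// memv_line.
apply: amax (addvSl _ _); split.
  move=> _ /memv_addP[X Xa [_ /vlineP[c ->] ->]] /=.
  by rewrite linearD linearZ/= tH a_tau// scalerN opprD.
move=> _ _ /memv_addP[X Xa [_ /vlineP[c ->] ->]] /memv_addP[Y Ya [_ /vlineP[d ->] ->]].
rewrite lieDl lieZl !linearD !linearZ/= a_abelian// cH// lieC cH// lieXX.
by rewrite oppr0 !(scaler0, addr0).
Qed.

(** The eigenvalue on the i-th basis vector is a diagonal entry of [ad H] in this basis, hence
    linear in H. Weights may repeat or vanish; the nonzero ones are exactly the roots. *)
Fact weight_basis_spec : {Pmu : 'M[R]_n * ('I_n -> dual a) | Pmu.1 \in unitmx /\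
  forall i H, H \in a -> lie G H (row i Pmu.1) = ev (Pmu.2 i) H *: row i Pmu.1}.
Proof.
apply: cid; have [P Pu PE] := commuting_eigenbasis tauP a_tau a_abelian.
pose f i (u : subvs_of a) : R^o := (row i P *m ad_mx G (vsval u) *m invmx P) 0 i.
have fl i : linear (f i).
  by move=> c u v; rewrite /f linearP ad_mx_linear mulmxDr mulmxDl -scalemxAr -scalemxAl mxE [X in X + _]mxE.
pose fL i := GRing.isLinear.Build _ _ _ _ _ (fl i).
pose fl' i : {linear subvs_of a -> R^o} := HB.pack (f i) (fL i).
exists (P, fun i => linfun (fl' i)); split=> // i H Ha /=.
have [c cE] := PE H i Ha; rewrite cE; congr (_ *: _).
rewrite /ev (lfunE (fl' i)) /= /f vsprojK// ad_mxE cE -scalemxAl mxE.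
have -> : row i P *m invmx P = delta_mx 0 i.
  by rewrite rowE -mulmxA mulmxV// mulmx1.
by rewrite mxE !eqxx mulr1.
Qed.

Definition wb : 'M[R]_n := (sval weight_basis_spec).1.
Definition wt (i : 'I_n) : dual a := (sval weight_basis_spec).2 i.
Definition co X : 'rV[R]_n := X *m invmx wb.

Lemma wb_unit : wb \in unitmx.
Proof. by case: (svalP weight_basis_spec). Qed.

Lemma wb_lie i H : H \in a -> lie G H (row i wb) = ev (wt i) H *: row i wb.
Proof. by case: (svalP weight_basis_spec) => _; apply. Qed.

Lemma coK X : co X *m wb = X.
Proof. by rewrite /co mulmxKV// wb_unit. Qed.

Lemma co_sum X : X = \sum_i co X 0 i *: row i wb.
Proof. by rewrite -mulmx_sum_row coK. Qed.

Lemma co_row i : co (row i wb) = delta_mx 0 i.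
Proof. by rewrite /co rowE -mulmxA mulmxV ?wb_unit// mulmx1. Qed.

Lemma coD X Y : co (X + Y) = co X + co Y.
Proof. exact: mulmxDl. Qed.

Lemma coZ c X : co (c *: X) = c *: co X.
Proof. by rewrite /co scalemxAl. Qed.

Lemma co_lie H X i : H \in a -> co (lie G H X) 0 i = ev (wt i) H * co X 0 i.
Proof.
move=> Ha; rewrite {1}(co_sum X) linear_sum/=.
have -> : \sum_j lie G H (co X 0 j *: row j wb) =
    (\row_j (ev (wt j) H * co X 0 j)) *m wb.
  rewrite mulmx_sum_row; apply: eq_bigr => j _.
  by rewrite linearZ/= wb_lie// scalerA mxE mulrC.
by rewrite /co mulmxK ?wb_unit// mxE.
Qed.

Lemma co_eigen H X c i : H \in a -> lie G H X = c *: X -> co X 0 i != 0 ->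
  ev (wt i) H = c.
Proof.
move=> Ha HX Xi; have := co_lie X i Ha; rewrite HX coZ mxE => /eqP.
by rewrite (inj_eq (mulIf Xi)) => /eqP.
Qed.

Lemma co_neq0 X : X != 0 -> exists i, co X 0 i != 0.
Proof.
move=> X0; apply/existsP; apply: contraNT X0; rewrite negb_exists => /forallP h.
apply/eqP; rewrite (co_sum X) big1// => i _.
by have /negPn/eqP -> := h i; rewrite scale0r.
Qed.

Lemma row_wb_neq0 i : row i wb != 0.
Proof.
apply/eqP => h; have := co_row i; rewrite h /co mul0mx => /matrixP/(_ 0 i)/eqP.
by rewrite !mxE !eqxx eq_sym oner_eq0.
Qed.

Lemma rootsP alpha : roots G alpha <-> alpha != 0 /\ exists i, wt i = alpha.
Proof.
split=> [[a0 [X X0 Xa]]|[a0 [i iE]]]; split=> //.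
  have [i Xi] := co_neq0 X0; exists i; apply: ev_ext => H Ha.
  by apply: co_eigen Xi => //; exact: Xa.
exists (row i wb); first exact: row_wb_neq0.
by move=> H Ha; rewrite wb_lie// iE.
Qed.

Lemma root_space_tau alpha X : root_space G alpha X -> root_space G (- alpha) (tau X).
Proof.
move=> Xa H Ha; have := congr1 tau (Xa _ Ha).
rewrite (tau_lie tauP) a_tau// -scaleN1r lieZl linearZ/= => /(congr1 (fun v => -1 *: v)).
by rewrite !scalerA mulrNN mulr1 scale1r mulN1r evN.
Qed.

Lemma root_space_lie alpha beta X Y : root_space G alpha X -> root_space G beta Y ->
  root_space G (alpha + beta) (lie G X Y).
Proof.
move=> Xa Yb H Ha; rewrite (jacobi G H X Y) (Xa H Ha) (Yb H Ha) lieZl.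
by rewrite lieZr -scalerDl evD.
Qed.

Lemma rootsN alpha : roots G alpha -> roots G (- alpha).
Proof.
move=> [a0 [X X0 Xa]]; split; first by rewrite oppr_eq0.
exists (tau X); last exact: root_space_tau.
by apply: contraNneq X0 => tX; rewrite -(tauK tauP X) tX linear0.
Qed.

Fact regular_spec : {H | H \in a & (forall alpha, roots G alpha -> ev alpha H != 0) /\
  pos = [set alpha | roots G alpha /\ 0 < ev alpha H]}.
Proof. exact/cid2/(cd_posP D). Qed.

Definition regular : 'rV[R]_n := s2val regular_spec.

Lemma regular_a : regular \in a.
Proof. exact: s2valP regular_spec. Qed.

Lemma posP alpha : pos alpha <-> roots G alpha /\ 0 < ev alpha regular.
Proof. by have [_ h] := s2valP' regular_spec; rewrite {1}h. Qed.

Lemma root_pos alpha : roots G alpha -> pos alpha \/ pos (- alpha).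
Proof.
move=> ra; have [/(_ _ ra) h _] := s2valP' regular_spec.
move: h; rewrite neq_lt -/regular => /orP[h|h]; [right|left]; apply/posP; split=> //.
- exact: rootsN.
- by rewrite evN oppr_gt0.
Qed.

(** Descent on the number of weights whose value at [regular] is below that of alpha: each summand
    of a decomposition has a smaller value, and as a root it is one of the weights lost. *)
Lemma pos_sum_simple alpha : pos alpha -> exists s : seq (dual a),
  (forall beta, beta \in s -> simple beta) /\ alpha = \sum_(beta <- s) beta.
Proof.
pose below (alpha : dual a) := [set i | ev (wt i) regular < ev alpha regular]%SET.
have [m] := ubnP #|below alpha|; elim: m alpha => // m IH alpha am pa.
have [sa|nsa] := pselect (simple alpha).
  by exists [:: alpha]; rewrite big_seq1; split=> // b; rewrite inE => /eqP ->.
have [b [c [pb pc bc]]] : exists b c, [/\ pos b, pos c & alpha = b + c].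
  by apply: contrapT => h; apply: nsa; split.
have lt x y : pos x -> pos y -> alpha = x + y -> (#|below x| < m)%N.
  move=> px py xy; have /posP[_ y0] := py.
  have xlt : ev x regular < ev alpha regular by rewrite xy evD ltrDl.
  rewrite -ltnS; apply: leq_trans am; rewrite ltnS; apply: proper_card; apply/properP; split.
    by apply/fintype.subsetP => i; rewrite !inE => /lt_trans; apply.
  have /posP[/rootsP[_ [i iE]] _] := px.
  by exists i; rewrite !inE iE// ltxx.
have [s1 [h1 e1]] := IH b (lt _ _ pb pc bc) pb.
have [s2 [h2 e2]] : exists s2 : seq (dual a), (forall beta, beta \in s2 -> simple beta) /\ c = \sum_(beta <- s2) beta.
  by apply: IH => //; apply: lt pc pb _; rewrite addrC.
exists (s1 ++ s2); rewrite big_cat/= -e1 -e2; split=> // x.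
by rewrite mem_cat => /orP[/h1|/h2].
Qed.

Lemma simple_pos alpha : simple alpha -> pos alpha.
Proof. by case. Qed.

(** The bracket has weight 0 and is negated by tau, so maximality puts it in [a]; invariance of the
    Killing form shows that it represents alpha up to the squared length of X. *)
Lemma root_vector_dual alpha X : root_space G alpha X ->
  lie G (tau X) X \in a /\
  forall H, H \in a -> kil (lie G (tau X) X) H = ev alpha H * ip X X.
Proof.
move=> Xa; have tXa := root_space_tau Xa; split.
  apply: a_maximal; first by rewrite (tau_lie tauP) (tauK tauP) lieC.
  by move=> H Ha; have := root_space_lie tXa Xa Ha; rewrite addNr ev0 scale0r.
move=> H Ha; rewrite killing_lie lieC killingNr Xa// killingZr /ip.
by rewrite (killingC _ (tau X)) mulrN.
Qed.

Lemma root_space_exists alpha : roots G alpha -> exists2 X, ip X X = 1 & root_space G alpha X.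
Proof.
move=> [_ [X X0 Xa]]; have X1 := ip_gt0 tauP X0.
pose c := (Num.sqrt (ip X X))^-1.
exists (c *: X).
  rewrite /ip linearZ/= killingZl killingZr -!mulrN mulrA -/(ip X X) -expr2.
  by rewrite exprVn sqr_sqrtr ?ltW// mulVf// gt_eqF.
by move=> H Ha; rewrite linearZ/= Xa// !scalerA mulrC.
Qed.

Lemma coroot_spec alpha : exists T, roots G alpha ->
  T \in a /\ forall H, H \in a -> kil T H = ev alpha H.
Proof.
have [ra|] := pselect (roots G alpha); last by exists 0.
have [X X1 Xa] := root_space_exists ra; have [Ta TE] := root_vector_dual Xa.
by exists (lie G (tau X) X) => _; split=> // H Ha; rewrite TE// X1 mulr1.
Qed.

(** The bracket [tau E, F] has weight beta - alpha, which is not a root: either sign would decompose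
    beta or alpha. With it gone, the Jacobi identity gives that the value of beta at T is minus the
    squared length of [E, F]. *)
Lemma simple_obtuse alpha beta T : simple alpha -> simple beta -> alpha <> beta ->
  T \in a -> (forall H, H \in a -> kil T H = ev alpha H) -> ev beta T <= 0.
Proof.
move=> sa sb ab Ta TE.
have [ra _] := (posP alpha).1 (simple_pos sa).
have [rb _] := (posP beta).1 (simple_pos sb).
have [E E1 Ea] := root_space_exists ra; have [F F1 Fb] := root_space_exists rb.
have [T'a T'E] := root_vector_dual Ea.
have TT : T = lie G (tau E) E.
  apply/eqP; rewrite -subr_eq0; apply/eqP; apply: (ip_eq0 tauP).
  set W := T - _; have Wa : W \in a by rewrite memvB.
  by rewrite /ip a_tau// killingNr opprK {1}/W -scaleN1r killingDl killingZl TE// T'E// E1 mulr1 mulN1r subrr.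
have tEF : lie G (tau E) F = 0.
  apply/eqP; apply: contraT => h.
  have rba : roots G (beta - alpha).
    split; first by rewrite subr_eq0; apply/eqP => /esym.
    exists (lie G (tau E) F) => //; rewrite addrC.
    by apply: root_space_lie => //; exact: root_space_tau.
  have [h'|h'] := root_pos rba.
    by case: sb => _; case; exists alpha, (beta - alpha); split=> //; [exact: simple_pos|rewrite addrC subrK].
  case: sa => _; case; exists beta, (alpha - beta); split=> //; first exact: simple_pos.
    by rewrite -opprB.
  by rewrite addrC subrK.
have EF : lie G (tau E) (lie G E F) = ev beta T *: F.
  rewrite (jacobi G (tau E) E F) tEF -TT (Fb T Ta).
  by rewrite lie0r addr0.
have := ip_ge0 tauP (lie G E F).
rewrite {1}/ip (tau_lie tauP) -killing_lie lieC killingNl opprK EF killingZl.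
have -> : kil F (tau F) = - 1 by rewrite -F1 /ip opprK.
by rewrite mulrN1 oppr_ge0.
Qed.


Fact simple_seq_spec : {s : seq (dual a) | uniq s /\ forall beta, beta \in s <-> simple beta}.
Proof.
exists (undup [seq wt i | i <- enum 'I_n & `[< simple (wt i) >]]).
split=> [|b]; first exact: undup_uniq.
rewrite mem_undup; split=> [/mapP[i]|sb].
  by rewrite mem_filter => /andP[/asboolP si _] ->.
have [/rootsP[_ [i iE]] _] := (posP b).1 (simple_pos sb).
apply/mapP; exists i => //; rewrite mem_filter mem_enum iE andbT.
exact/asboolP.
Qed.

Definition simples := sval simple_seq_spec.

Lemma mem_simples beta : beta \in simples <-> simple beta.
Proof. by case: (svalP simple_seq_spec) => _; apply. Qed.

Lemma simples_uniq : uniq simples.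
Proof. by case: (svalP simple_seq_spec). Qed.

(* The part of a vanishing combination of simple roots with positive
   coefficients is represented by a vector of nonpositive length, as distinct
   simple roots form obtuse angles. *)
Lemma simple_relation_le0 (c : dual a -> R) :
  \sum_(beta <- simples) c beta *: beta = 0 ->
  forall beta, beta \in simples -> c beta <= 0.
Proof.
move=> c0.
have [T TP] := choice coroot_spec.
have Tr b : b \in simples -> T b \in a /\ forall H, H \in a -> kil (T b) H = ev b H.
  move=> /mem_simples /simple_pos /posP[rb _]; exact: TP.
pose cp b := Num.max (c b) 0; pose cm b := Num.max (- c b) 0.
have cE b : c b = cp b - cm b by exact: max_diff.
have cp0 b : 0 <= cp b by rewrite /cp le_max lexx orbT.
have cm0 b : 0 <= cm b by rewrite /cm le_max lexx orbT.
have cpm b : cp b * cm b = 0.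
  rewrite /cp /cm; have [h|h] := leP (c b) 0; first by rewrite mul0r.
  by rewrite [Num.max (- _) _]max_r ?oppr_le0 ?ltW// mulr0.
pose h := \sum_(b <- simples) cp b *: T b.
have ha : h \in a.
  by rewrite /h big_seq; apply: rpred_sum => b /Tr[Ta _]; rewrite memvZ.
have hE H : H \in a -> kil h H = \sum_(b <- simples) cp b * ev b H.
  move=> Ha; rewrite /h big_seq [RHS]big_seq.
  elim/big_ind2: _ => [|x1 x2 y1 y2 <- <-|b /Tr[_ Tb]].
  - by rewrite -(scale0r (0 : 'rV[R]_n)) killingZl mul0r.
  - by rewrite killingDl.
  - by rewrite killingZl Tb.
have pm H : \sum_(b <- simples) cp b * ev b H = \sum_(b <- simples) cm b * ev b H.
  apply/eqP; rewrite -subr_eq0 -sumrB; apply/eqP.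
  have := congr1 (fun x : dual a => ev x H) c0; rewrite ev0 ev_sum => e; rewrite -[RHS]e.
  by apply: eq_bigr => b _; rewrite evZ cE mulrBl.
have hh : kil h h <= 0.
  rewrite hE// pm big_seq; apply: sumr_le0 => b bs.
  rewrite /h ev_sumr mulr_sumr big_seq; apply: sumr_le0 => b' bs'; rewrite ev_scaler mulrA.
  have [->|/eqP bb] := eqVneq b' b; first by rewrite mulrC (mulrC (cm b)) cpm mulr0.
  apply: mulr_ge0_le0; first exact: mulr_ge0.
  have [Ta TE] := Tr _ bs'.
  by apply: (simple_obtuse _ _ bb) Ta TE; exact/mem_simples.
have h0 : h = 0.
  apply: (ip_eq0 tauP); apply/eqP; rewrite eq_le (ip_ge0 tauP) andbT.
  by rewrite /ip (a_tau ha) killingNr opprK.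
move=> b bs; have := hE _ regular_a; rewrite h0 -(scale0r (0 : 'rV[R]_n)) killingZl mul0r.
move=> /esym/eqP; rewrite big_seq psumr_eq0 => [/allP/(_ _ bs)|b' /mem_simples/simple_pos/posP[_ /ltW b'0]].
  rewrite bs/= mulf_eq0 => /orP[/eqP cb|/eqP e].
    by rewrite cE cb sub0r oppr_le0.
  by have /mem_simples/simple_pos/posP[_] := bs; rewrite e ltxx.
exact: mulr_ge0.
Qed.

(** Applied to a relation and to its negative, [simple_relation_le0] shows that the simple roots are
    linearly independent, so the matrix of their values has a right inverse. *)
Lemma simple_dual_ex (w : dual a -> R) :
  exists2 H, H \in a & forall beta, simple beta -> ev beta H = w beta.
Proof.
pose m := size simples; pose b (j : 'I_m) := nth 0 simples j.
pose A : 'M[R]_(m, n) := \matrix_(j, i) ev (b j) (delta_mx 0 i).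
have bs j : b j \in simples by exact: mem_nth.
have rel (c : 'I_m -> R) : \sum_j c j *: b j = 0 -> forall j, c j <= 0.
  move=> c0 j; pose c' (x : dual a) := if insub (index x simples) is Some i then c i else 0.
  have c'E i : c' (b i) = c i.
    by rewrite /c' /b index_uniq ?simples_uniq// valK.
  rewrite -c'E; apply: simple_relation_le0 (bs j).
  rewrite (big_nth 0) big_mkord -[RHS]c0; apply: eq_bigr => i _.
  by rewrite -/(b i) c'E.
have Afree : row_free A.
  rewrite -kermx_eq0; apply/eqP/row_matrixP => i; rewrite row0.
  set u := row i _; have uA : u *m A = 0 by apply/eqP; rewrite -sub_kermx row_sub.
  have u0 : \sum_j u 0 j *: b j = 0.
    apply: ev_ext => H Ha; rewrite ev_sum ev0.
    under eq_bigr do rewrite evZ [in ev _ H](row_sum_delta H) ev_sumr mulr_sumr.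
    rewrite exchange_big big1//= => l _.
    transitivity (H 0 l * (u *m A) 0 l); last by rewrite uA mxE mulr0.
    rewrite mxE mulr_sumr; apply: eq_bigr => j _.
    by rewrite [A j l]mxE ev_scaler mulrCA.
  apply/rowP => j; rewrite [RHS]mxE; apply/eqP; rewrite eq_le rel//=.
  rewrite -oppr_le0; apply: (rel (fun j => - u 0 j)).
  under eq_bigr do rewrite scaleNr; by rewrite sumrN u0 oppr0.
have [B AB] := row_freeP Afree.
pose x : 'cV[R]_n := B *m \col_j w (b j).
exists (vsval (vsproj a x^T)); first exact: subvsP.
move=> beta /mem_simples bS.
have [j jE] : exists j, b j = beta.
  have h : (index beta simples < m)%N by rewrite index_mem.
  by exists (Ordinal h); rewrite /b nth_index.
rewrite ev_proj -jE.
have : (A *m x) j 0 = w (b j) by rewrite /x mulmxA AB mul1mx mxE.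
move=> <-; rewrite mxE [in LHS](row_sum_delta x^T) ev_sumr.
by apply: eq_bigr => l _; rewrite ev_scaler !mxE mulrC.
Qed.

End Roots.

(** * The grading of the Lie algebra defined by theta *)

Section Grading.
Context (R : realType) (n : nat) (G : lieGroupType R n) (D : cartan_data G).
Local Notation a := (cd_a D).
Local Notation tau := (cd_tau D).
Local Notation tauP := (cd_tauP D).
Local Notation pos := (cd_pos D).
Local Notation simple := (simple_roots (cd_pos D)).
Local Notation chamber := (weyl_chamber (cd_pos D)).
Local Notation k0 := (cd_k0 D).
Implicit Types (alpha beta : dual a) (X Y H : 'rV[R]_n).
Context (theta : set (dual a)).
Hypothesis theta_sym : symmetric_roots theta.

Fact theta_coweight_spec : {H | H \in a &
  forall beta, simple beta -> ev beta H = (`[< theta beta >])%:R}.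
Proof. exact/cid2/simple_dual_ex. Qed.

(** The grading element of the parabolic subgroup: a root space belongs to the nilradical exactly
    when its root is positive here. *)
Definition theta_coweight : 'rV[R]_n := s2val theta_coweight_spec.
Local Notation Ht := theta_coweight.

Lemma theta_coweight_a : Ht \in a.
Proof. exact: s2valP theta_coweight_spec. Qed.

Lemma theta_coweightE beta : simple beta -> ev beta Ht = (`[< theta beta >])%:R.
Proof. exact: (s2valP' theta_coweight_spec). Qed.

(** Written as a sum of simple roots, a positive root takes at the grading element the number of its
    terms in theta. Any such term bounds the root from below on the chamber, where the other terms
    are nonnegative. *)
Lemma pos_theta alpha : pos alpha ->
  (0 < ev alpha Ht <-> ~ span_set (simple `\` theta) alpha) /\
  (0 <= ev alpha Ht) /\
  (0 < ev alpha Ht -> exists2 beta, theta beta &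
     forall X, chamber X -> ev beta X <= ev alpha X).
Proof.
move=> /pos_sum_simple[s [hs ->]].
have evH b : b \in s -> ev b Ht = (`[< theta b >])%:R by move=> /hs /theta_coweightE.
have ge0 : 0 <= ev (\sum_(b <- s) b) Ht.
  by rewrite ev_sum big_seq; apply: sumr_ge0 => b bs; rewrite evH.
have ex : 0 < ev (\sum_(b <- s) b) Ht -> exists2 b, b \in s & theta b.
  move=> p; apply: contrapT => h; move: p; rewrite ev_sum big_seq big1 ?ltxx// => b bs.
  by rewrite evH//; case: asboolP => // tb; case: h; exists b.
split; last split=> //.
  split=> [p [t ht bt]|h].
    have : ev (\sum_(b <- s) b) Ht = 0.
      rewrite (coord_span (X := in_tuple t) bt) ev_sum big1// => i _.
      have /ht[si nti] : t`_i \in t by exact: mem_nth.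
      rewrite evZ /= theta_coweightE//.
      by case: asboolP => // _; rewrite mulr0.
    by move=> e; rewrite e ltxx in p.
  rewrite lt_def ge0 andbT; apply/eqP => e; apply: h; exists s; last first.
    by rewrite big_seq; apply: rpred_sum => b bs; exact: memv_span.
  move=> b bs; split; first exact: hs.
  move=> tb; move/eqP: e; rewrite ev_sum big_seq psumr_eq0; last first.
    by move=> c cs; rewrite evH.
  by move=> /allP/(_ _ bs); rewrite bs evH//= (asboolT tb) oner_eq0.
move=> /ex[b bs tb]; exists b => // X [Xa Xc].
rewrite ev_sum (big_rem b)//= lerDl big_seq; apply: sumr_ge0 => c cs.
by apply/Xc/hs; exact: mem_rem cs.
Qed.

Lemma chamber_pos alpha X : pos alpha -> chamber X -> 0 <= ev alpha X.
Proof.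
move=> /pos_sum_simple[s [hs ->]] [Xa Xc]; rewrite ev_sum big_seq.
by apply: sumr_ge0 => b /hs; exact: Xc.
Qed.

(** There is a chamber vector at which all simple roots equal 1, and a negative root takes minus its
    height there. *)
Lemma pos_of_chamber alpha : roots G alpha ->
  (forall X, chamber X -> 0 <= ev alpha X) -> pos alpha.
Proof.
move=> ra h; have [//|] := root_pos ra.
move=> /pos_sum_simple[s [hs e]].
have [H Ha HE] := simple_dual_ex (D := D) (fun=> 1).
have : chamber H by split=> // b /HE ->.
move=> /h; rewrite -oppr_le0 -evN e ev_sum.
have -> : \sum_(b <- s) ev b H = (size s)%:R.
  rewrite big_seq (eq_bigr (fun=> 1)) => [|b /hs/HE//].
  by rewrite -big_seq big_const_seq count_predT iter_addr_0.
case: s hs e => [hs|b s _ _]; last by rewrite lern0.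
by rewrite big_nil => /eqP; rewrite oppr_eq0 => /eqP a0; case: ra; rewrite a0 eqxx.
Qed.

Definition grade (i : 'I_n) : R := ev (wt D i) Ht.

Lemma root_pos_grade alpha : roots G alpha -> 0 < ev alpha Ht -> pos alpha.
Proof.
move=> ra p; have [//|/pos_theta[_ []]] := root_pos ra.
by rewrite evN oppr_ge0 leNgt p.
Qed.

Lemma grade_root i : grade i != 0 -> roots G (wt D i).
Proof.
move=> gi; apply/rootsP; split; last by exists i.
by apply: contraNneq gi => w0; rewrite /grade w0 ev0.
Qed.

(** Turns divergence along theta into divergence of all weights of the nilradical; the contraction
    of the opposite unipotent group rests on it. *)
Lemma grade_gap i : 0 < grade i -> exists2 beta, theta beta &
  forall X, chamber X -> ev beta X <= ev (wt D i) X.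
Proof.
move=> gi; have ri := grade_root (lt0r_neq0 gi).
by have [_ [_]] := pos_theta (root_pos_grade ri gi); apply.
Qed.

Lemma nilradical_coP X : nilradical theta X <-> forall i, grade i <= 0 -> co D X 0 i = 0.
Proof.
split=> [[s hs Xs] i gi|h].
  rewrite (coord_span (X := in_tuple s) Xs) /co mulmx_suml summxE big1// => j _.
  have /hs[al [pal nal] sal] : s`_j \in s by exact: mem_nth.
  rewrite -scalemxAl mxE; apply/eqP; rewrite mulf_eq0; apply/orP; right.
  apply: contraLR gi => e; rewrite -ltNge.
  have -> : grade i = ev al Ht.
    by apply: co_eigen e; [exact: theta_coweight_a|apply: sal; exact: theta_coweight_a].
  by apply/(pos_theta pal).1.
exists [seq row i (wb D) | i <- enum 'I_n & 0 < grade i] => [u /mapP[i]|].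
  rewrite mem_filter => /andP[gi _] ->; exists (wt D i).
    have pi := root_pos_grade (grade_root (lt0r_neq0 gi)) gi.
    by split=> //; apply/(pos_theta pi).1.
  by move=> H Ha; rewrite wb_lie.
rewrite (co_sum D X); apply: rpred_sum => i _.
have [/h ->|gi] := leP (grade i) 0; first by rewrite scale0r mem0v.
apply: memvZ; apply: memv_span; apply/mapP; exists i => //.
by rewrite mem_filter gi mem_enum.
Qed.

Definition nil_index : {set 'I_n} := [set i | 0 < grade i]%SET.
(** The rows form a basis of the nilradical, so that translates of it become row spaces and
    membership in the parabolic subgroup becomes an inclusion of row spaces. *)
Definition nilmx : 'M[R]_(#|nil_index|, n) := rowsub enum_val (wb D).

Lemma nilmx_free : row_free nilmx.
Proof.
apply/row_freeP; exists (invmx (wb D) *m (rowsub enum_val 1%:M)^T).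
rewrite /nilmx mulmxA mul_rowsub_mx mulmxV ?wb_unit//.
apply/matrixP => i j; rewrite !mxE (bigD1 (enum_val i))//= big1 ?addr0 => [|l li].
  by rewrite !mxE eqxx mul1r (inj_eq enum_val_inj) eq_sym.
by rewrite !mxE eq_sym (negbTE li) mul0r.
Qed.

Lemma nilradicalP X : nilradical theta X <-> (X <= nilmx)%MS.
Proof.
split=> [/nilradical_coP h|/submxP[u ->]]; last first.
  apply/nilradical_coP => i gi; rewrite /co -mulmxA /nilmx mul_rowsub_mx mulmxV ?wb_unit//.
  rewrite mxE big1// => j _; rewrite !mxE.
  case: eqP => [e|_]; last by rewrite mulr0.
  by have := enum_valP j; rewrite e inE ltNge gi.
rewrite (co_sum D X); apply: summx_sub => i _.
have [/h ->|gi] := leP (grade i) 0; first by rewrite scale0r sub0mx.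
have iI : i \in nil_index by rewrite inE.
apply: scalemx_sub; have -> : row i (wb D) = row (enum_rank_in iI i) nilmx.
  by rewrite /nilmx row_rowsub enum_rankK_in.
exact: row_sub.
Qed.

Lemma parabolicP (g : G) : parabolic theta g <-> (nilmx *m Ad_mx g <= nilmx)%MS.
Proof.
split=> [Pg|h].
  apply/row_subP => i; rewrite row_mul Ad_mxE; apply/nilradicalP.
  by rewrite -Pg; exists (row i nilmx) => //; apply/nilradicalP/row_sub.
have e : (nilmx *m Ad_mx g :=: nilmx)%MS.
  apply/eqmxP; rewrite h -(geq_leqif (mxrank_leqif_sup h)) mxrankMfree//=.
  apply/row_freeP; exists (Ad_mx (g^-1)%g).
  by rewrite -Ad_mxM mulVg Ad_mx1.
apply/seteqP; split=> X /=.
  move=> [Y /nilradicalP Yn <-]; apply/nilradicalP.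
  by rewrite -Ad_mxE; apply: submx_trans h; exact: submxMr.
move=> /nilradicalP Xn; exists (Ad (g^-1)%g X); last exact: AdVK.
apply/nilradicalP; rewrite -Ad_mxE.
have : (X *m Ad_mx (g^-1)%g <= nilmx *m Ad_mx g *m Ad_mx (g^-1)%g)%MS.
  by apply: submxMr; rewrite e.
by rewrite -mulmxA -Ad_mxM mulVg Ad_mx1 mulmx1.
Qed.

Lemma co_lie_grade X Y l : co D (lie G X Y) 0 l != 0 ->
  exists i j, [/\ co D X 0 i != 0, co D Y 0 j != 0 & grade l = grade i + grade j].
Proof.
move=> h; apply: contrapT => no; move/eqP: h; apply.
rewrite {1}(co_sum D X) lie_sum_l /co mulmx_suml summxE big1// => i _.
rewrite {1}(co_sum D Y) -ad_mxE mulmx_suml mulmx_suml summxE big1// => j _.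
rewrite ad_mxE lieZr lieZl -!scalemxAl mxE [X in _ * X]mxE.
apply/eqP; apply: contraT; rewrite !mulf_eq0 !negb_or => /and3P[Yj Xi e].
case: no; exists i, j; split=> //.
apply: (co_eigen (theta_coweight_a) _ e).
have := @root_space_lie _ _ _ D (wt D i) (wt D j) (row i (wb D)) (row j (wb D)).
rewrite /grade -evD; apply; last exact: theta_coweight_a.
- by move=> H Ha; rewrite wb_lie.
- by move=> H Ha; rewrite wb_lie.
Qed.

(** A map that anticommutes with the bracket by the grading element reverses the grading. Both tau
    and [Ad k0] are of this kind. *)
Lemma co_antigraded (f : {linear 'rV[R]_n -> 'rV[R]_n}) X l :
  (forall X, f (lie G Ht X) = - lie G Ht (f X)) -> co D (f X) 0 l != 0 ->
  exists2 i, co D X 0 i != 0 & grade l = - grade i.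
Proof.
move=> fH h; apply: contrapT => no; move/eqP: h; apply.
rewrite (co_sum D X) linear_sum /co mulmx_suml summxE big1// => i _.
rewrite linearZ/= -scalemxAl mxE; apply/eqP; apply: contraT.
rewrite mulf_eq0 negb_or => /andP[Xi e]; case: no; exists i => //.
apply: (co_eigen theta_coweight_a _ e); apply: oppr_inj.
by rewrite -fH wb_lie ?theta_coweight_a// linearZ/= scaleNr opprK.
Qed.

Lemma co_tau X l : co D (tau X) 0 l != 0 -> exists2 i, co D X 0 i != 0 & grade l = - grade i.
Proof.
apply: co_antigraded => Y /=; rewrite (tau_lie tauP) (a_tau theta_coweight_a).
by rewrite -scaleN1r lieZl scaleN1r.
Qed.

(** Bracketing with terms of nonnegative grade does not lower positive grades, so [ad X] preserves
    the nilradical and its exponential does too. *)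
Lemma parabolic_exp X : (forall i, grade i < 0 -> co D X 0 i = 0) ->
  parabolic theta (lie_exp G X).
Proof.
move=> h; apply/parabolicP.
apply: Ad_exp_invariant; apply/row_subP => i; rewrite row_mul ad_mxE.
apply/nilradicalP/nilradical_coP => l gl; apply/eqP; apply: contraLR gl.
move=> /co_lie_grade[i' [j [Xi Yj ->]]]; rewrite -ltNge.
apply: ltr_wpDl.
  by rewrite leNgt; apply/negP => /h e; rewrite e eqxx in Xi.
rewrite ltNge; apply/negP => gj; move/eqP: Yj; apply.
by move: j gj; apply/nilradical_coP/nilradicalP/row_sub.
Qed.

Lemma normalizer_a (H : 'rV[R]_n) : H \in a -> Ad k0 H \in a /\ Ad (k0^-1)%g H \in a.
Proof.
have [[_ k0a] _] := cd_k0_longest D; move=> Ha; split.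
  suff : [set X | X \in a] (Ad k0 H) by [].
  by rewrite -k0a; exists H.
have : [set X | X \in a] H by [].
by rewrite -k0a => -[Y Ya <-]; rewrite AdK.
Qed.

Lemma root_conj (g : G) alpha :
  (forall H, H \in a -> Ad (g^-1)%g H \in a) -> (forall H, H \in a -> Ad g H \in a) ->
  roots G alpha -> exists2 beta : dual a, roots G beta &
    forall H, H \in a -> ev beta H = - ev alpha (Ad g H).
Proof.
move=> gVa ga [a0 [X X0 Xa]].
have X'0 : Ad (g^-1)%g X != 0.
  by apply: contraNneq X0 => e; rewrite -(AdVK g X) e -Ad_mxE mul0mx.
have X'E H : H \in a -> lie G H (Ad (g^-1)%g X) = ev alpha (Ad g H) *: Ad (g^-1)%g X.
  move=> Ha; rewrite -[in LHS](AdK g H) -Ad_lie (Xa _ (ga _ Ha)).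
  by rewrite -!Ad_mxE -scalemxAl.
have [j Xj] := co_neq0 D X'0.
have jE H : H \in a -> ev (wt D j) H = ev alpha (Ad g H).
  by move=> Ha; apply: co_eigen (X'E _ Ha) Xj.
exists (- wt D j); last by move=> H Ha; rewrite evN jE.
apply: rootsN; apply/rootsP; split; last by exists j.
apply: contraNneq a0 => w0; apply/eqP/ev_ext => H Ha.
by rewrite ev0 -(AdVK g H) -jE ?gVa// w0 ev0.
Qed.

Lemma k0_chamber X : chamber X -> chamber (- Ad k0 X).
Proof.
move=> Xc; have : [set - Y | Y in chamber] (Ad k0 X) by rewrite -cd_k0_chamber; exists X.
by move=> [Y Yc <-]; rewrite opprK.
Qed.

Lemma k0_chamber_inv X : chamber X -> exists2 Y, chamber Y & Ad k0 Y = - X.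
Proof.
move=> Xc; have : [set - Y | Y in chamber] (- X) by exists X.
by rewrite -cd_k0_chamber => -[Y Yc <-]; exists Y.
Qed.

(** The map - [Ad k0] preserves the chamber, so beta is positive; a decomposition of beta,
    transported back by the inverse of k0, would decompose alpha. *)
Lemma k0_simple alpha : simple alpha -> exists2 beta, simple beta &
  opposition_dual alpha beta.
Proof.
move=> sa; have [ra _] := (posP alpha).1 (simple_pos sa).
have [b rb bE] := root_conj (fun H Ha => (normalizer_a Ha).2)
  (fun H Ha => (normalizer_a Ha).1) ra.
exists b => //; split.
  apply: pos_of_chamber => // X Xc; rewrite bE; last by case: Xc.
  rewrite -ev_oppr; apply: chamber_pos; [exact: simple_pos|exact: k0_chamber].
move=> [b1 [b2 [p1 p2 b12]]].
have inv c : pos c -> exists2 c', pos c' & forall H, H \in a -> ev c' H = - ev c (Ad (k0^-1)%g H).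
  move=> pc; have [rc _] := (posP c).1 pc.
  have [||c' rc' c'E] := root_conj (g := (k0^-1)%g) _ _ rc.
  - by move=> H Ha; rewrite invgK; exact: (normalizer_a Ha).1.
  - by move=> H Ha; exact: (normalizer_a Ha).2.
  exists c' => //; apply: pos_of_chamber => // X Xc.
  have Xa : X \in a by case: Xc.
  have [Y Yc YE] := k0_chamber_inv Xc.
  rewrite c'E// -ev_oppr.
  have -> : - Ad (k0^-1)%g X = Y.
    by rewrite -[X]opprK -YE -!Ad_mxE mulNmx opprK Ad_mxE Ad_mxE AdK.
  exact: chamber_pos.
have [c1 pc1 c1E] := inv _ p1; have [c2 pc2 c2E] := inv _ p2.
case: sa => _; apply; exists c1, c2; split=> //.
apply: ev_ext => H Ha; have Ha' := (normalizer_a Ha).2.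
rewrite evD c1E// c2E// -opprD -evD -b12 bE// AdVK opprK//.
Qed.

(** The place where symmetry of theta enters: the opposition involution permutes the simple roots
    and preserves theta, so on every simple root [Ad k0] changes the sign of the grading element. *)
Lemma k0_theta_coweight alpha : simple alpha -> ev alpha (Ad k0 Ht) = - ev alpha Ht.
Proof.
move=> sa; have [b sb ob] := k0_simple sa.
have := ob _ theta_coweight_a; rewrite !theta_coweightE// => /(congr1 -%R).
rewrite opprK => <-; congr (- (nat_of_bool _)%:R).
apply: asbool_equiv_eq; split=> [tb|ta]; last first.
  by rewrite -theta_sym; exists alpha.
move: (tb); rewrite -[X in X b]theta_sym => -[a' ta' ob'].
suff -> : alpha = a' by [].
apply: ev_ext => H Ha; have Ha' := (normalizer_a Ha).2.
by have := ob _ Ha'; rewrite (ob' _ Ha') AdVK => /oppr_inj.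
Qed.

Lemma k0_grade i : ev (wt D i) (Ad k0 Ht) = - grade i.
Proof.
have posE al : pos al -> ev al (Ad k0 Ht) = - ev al Ht.
  move=> /pos_sum_simple[s [hs ->]]; rewrite !ev_sum -sumrN big_seq [RHS]big_seq.
  by apply: eq_bigr => b /hs; exact: k0_theta_coweight.
have [w0|w0] := eqVneq (wt D i) 0; first by rewrite /grade w0 !ev0 oppr0.
have ri : roots G (wt D i) by apply/rootsP; split=> //; exists i.
rewrite /grade; have [/posE//|/posE] := root_pos ri.
by rewrite !evN => /oppr_inj.
Qed.

Lemma co_k0 X l : co D (Ad k0 X) 0 l != 0 -> exists2 i, co D X 0 i != 0 & grade l = - grade i.
Proof.
have -> : Ad k0 X = mulmxr (Ad_mx k0) X by rewrite /= Ad_mxE.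
apply: co_antigraded => Y /=; rewrite !Ad_mxE Ad_lie.
have H'a := (normalizer_a theta_coweight_a).1.
rewrite (co_sum D (lie G (Ad k0 Ht) _)) (co_sum D (lie G Ht _)) -sumrN.
apply: eq_bigr => j _; rewrite -scaleNr; congr (_ *: _).
by rewrite !co_lie ?theta_coweight_a// k0_grade mulNr.
Qed.

End Grading.

(** * Parabolic subgroups *)

Section Parabolic.
Context (R : realType) (n : nat) (G : lieGroupType R n) (D : cartan_data G).
Local Notation a := (cd_a D).
Local Notation tau := (cd_tau D).
Local Notation tauP := (cd_tauP D).
Local Notation kil := (killing G).
Local Notation K := (cd_K D).
Local Notation k0 := (cd_k0 D).
Implicit Types (X Y H : 'rV[R]_n).
Context (theta : set (dual a)).
Hypothesis theta_sym : symmetric_roots theta.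
Local Notation P := (parabolic theta).
Local Notation U := (nilmx theta).
Local Notation gr := (@grade R n G D theta).
Local Notation parP := (@parabolicP R n G D theta).
Local Notation nilP := (@nilradicalP R n G D theta).
Local Notation nilcoP := (@nilradical_coP R n G D theta).

Lemma parabolic_subgroup : subgroup P.
Proof.
split=> [|x y Px Py|x Px].
- by apply/parP; rewrite Ad_mx1 mulmx1.
- apply/parP; rewrite Ad_mxM mulmxA.
  apply: submx_trans ((parP x).1 Px).
  by apply: submxMr; apply/parP.
- apply/seteqP; split=> X /=.
    by move=> [Y]; rewrite -{1}Px => -[Z Zn <-] <-; rewrite AdK.
  move=> Xn; exists (Ad x X); last exact: AdK.
  by rewrite -Px; exists X.
Qed.

Lemma parabolic_closed : closed P.
Proof.
have -> : P = (fun g => U *m Ad_mx g *m cokermx U) @^-1` [set 0].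
  apply/seteqP; split=> g /=.
    by move=> /parP; rewrite submxE => /eqP.
  by move=> /eqP; rewrite -submxE => h; apply/parP.
apply: closed_comp; last first.
  by apply: accessible_closed_set1; exact/hausdorff_accessible/norm_hausdorff.
move=> g _.
have h : (fun x : G => U *m Ad_mx x) @ g --> U *m Ad_mx g.
  apply: (cvg_mulmx (FF := nbhs_filter g)); first exact: cvg_cst.
  exact: Ad_mx_continuous.
exact: (continuous_comp h (@mulmxr_continuous _ _ _ _ _ _)).
Qed.

(** With W the part of X in negative grades, Y = -(W + tau W) is fixed by tau, and Z = - X + W + tau
    W has no negative part because tau moves W to positive grades. This is the splitting that the
    Newton iteration requires. *)
Lemma KP_factorization : connected [set: G] ->
  forall g, exists k p, [/\ K k, P p & g = (k * p)%g].
Proof.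
move=> Gc; have [Ksub Kc _] := cd_K_maximal D.
pose T := lin1_mx tau.
pose neg : 'M[R]_n := diag_mx (\row_(i < n) (if gr i < 0 then 1 else 0 : R)).
pose A := - (invmx (wb D) *m neg *m wb D *m (1%:M + T)).
pose B := - (1%:M + A).
apply: (lie_group_factorization (kk := [set X | tau X = X])
   (pp := [set X | forall i, gr i < 0 -> co D X 0 i = 0])
   (M := Num.max (n%:R * `|A|) (n%:R * `|B|)) Ksub Kc parabolic_subgroup parabolic_closed _ _ _ Gc).
- move=> X /= tX; have : [set X | tau X = X] X by [].
  by rewrite -cd_K_lie => /(_ 1); rewrite scale1r.
- exact: parabolic_exp.
move=> X; exists (X *m A), (X *m B).
have negE : X *m A = - (co D X *m neg *m wb D + tau (co D X *m neg *m wb D)).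
  by rewrite /A mulmxN !mulmxA mulmxDr mulmx1 mul_rV_lin1.
split.
- by rewrite -mulmxDr /B opprD addrCA subrr addr0 mulmxN mulmx1 opprK.
- by rewrite /= negE linearN linearD/= (tauK tauP) addrC.
- move=> i gi; rewrite /= /B mulmxN mulmxDr mulmx1 negE opprD opprK.
  set W := co D X *m neg *m wb D.
  have -> : co D (- X + (W + tau W)) 0 i = co D (W - X) 0 i + co D (tau W) 0 i.
    by rewrite addrA (addrC _ W) coD mxE.
  have -> : co D (W - X) 0 i = 0.
    rewrite -scaleN1r coD coZ /W /co mulmxK ?wb_unit// /neg.
    by rewrite mul_mx_diag !mxE gi mulr1 mulN1r subrr.
  rewrite add0r; apply/eqP; apply: contraT => /(@co_tau R n G D theta)[j].
  rewrite /W /co mulmxK ?wb_unit// mul_mx_diag mxE [X in _ * X]mxE.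
  case: ltP => [gj _ gij|_]; last by rewrite mulr0 eqxx.
  by move: gi; rewrite gij oppr_lt0 ltNge (ltW gj).
- apply: le_trans (mulmx_norm_le _ _) _; rewrite mulrAC ler_wpM2r//.
  by rewrite le_max lexx.
- apply: le_trans (mulmx_norm_le _ _) _; rewrite mulrAC ler_wpM2r//.
  by rewrite le_max lexx orbT.
Qed.

Lemma sub_nilmx X : (forall i, co D X 0 i != 0 -> 0 < gr i) -> (X <= U)%MS.
Proof.
move=> h; apply/nilP/nilcoP => i gi.
by apply/eqP; apply: contraLR gi => /h; rewrite ltNge.
Qed.

Lemma nilmx_co X i : (X <= U)%MS -> co D X 0 i != 0 -> 0 < gr i.
Proof.
move=> /nilP/nilcoP h Xi.
by rewrite ltNge; apply/negP => /h e; rewrite e eqxx in Xi.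
Qed.

(** Invariance under the grading element shows that the Killing form pairs only opposite grades,
    while all grades of the nilradical are positive. *)
Lemma killing_nil : U *m killing_mx G *m U^T = 0.
Proof.
apply/matrixP => i j; rewrite [RHS]mxE.
have -> : (U *m killing_mx G *m U^T) i j = kil (row i U) (row j U).
  rewrite -killing_mxE !matrix.rowE trmx_mul trmx_delta !mulmxA -colE.
  by rewrite -!(mulmxA (delta_mx 0 i)) -matrix.rowE !mxE.
have rowE l : row l U = row (enum_val l) (wb D) by rewrite /nilmx row_rowsub.
have pos (l : 'I_#|nil_index theta|) : 0 < gr (enum_val l) by have : enum_val l \in nil_index theta := enum_valP l; rewrite inE.
have Ha := @theta_coweight_a R n G D theta.
have := killing_lie G (row i U) (theta_coweight theta) (row j U).
have ei : lie G (row i U) (theta_coweight theta) = - gr (enum_val i) *: row i U.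
  by rewrite lieC rowE wb_lie// scaleNr.
have ej : lie G (theta_coweight theta) (row j U) = gr (enum_val j) *: row j U.
  by rewrite rowE wb_lie.
rewrite ei ej killingZl killingZr => /eqP.
rewrite -subr_eq0 -mulrBl mulf_eq0 -opprD oppr_eq0 gt_eqF ?addr_gt0//=.
by move=> /eqP.
Qed.

(** Both sides are the opposite nilradical. The reverse inclusion follows from the grading, and
    equality of ranks turns it around. *)
Lemma k0_nil_tau : (U *m lin1_mx tau <= U *m Ad_mx k0)%MS.
Proof.
have h : (U *m Ad_mx k0 <= U *m lin1_mx tau)%MS.
  apply/row_subP => i; rewrite row_mul Ad_mxE; set X := Ad k0 _.
  have -> : X = tau X *m lin1_mx tau by rewrite mul_rV_lin1 /= (tauK tauP).
  apply: submxMr; apply: sub_nilmx => l /(@co_tau R n G D theta)[j Xj ->].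
  have [j' /(nilmx_co (row_sub _ _)) p ->] := co_k0 theta_sym Xj.
  by rewrite opprK.
have fr : row_free (Ad_mx k0).
  by apply/row_freeP; exists (Ad_mx (k0^-1)%g); rewrite -Ad_mxM mulVg Ad_mx1.
have TT : lin1_mx tau *m lin1_mx tau = 1%:M.
  by apply: eq_mulmx_rV => Z; rewrite mulmxA !mul_rV_lin1 /= (tauK tauP) mulmx1.
have ft : row_free (lin1_mx tau) by apply/row_freeP; exists (lin1_mx tau).
by rewrite -(geq_leqif (mxrank_leqif_sup h)) !mxrankMfree.
Qed.

(** A vector in the left kernel is a nilradical element orthogonal to the opposite nilradical, hence
    to its own image under tau; definiteness of the Cartan involution forces it to be 0. *)
Lemma killing_k0_unit : U *m killing_mx G *m (U *m Ad_mx k0)^T \in unitmx.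
Proof.
rewrite -row_free_unit -kermx_eq0; apply/eqP/row_matrixP => i; rewrite row0.
set x := row i _; have x0 : x *m (U *m killing_mx G *m (U *m Ad_mx k0)^T) = 0.
  by apply/eqP; rewrite -sub_kermx row_sub.
have /submxP[y yE] : (tau (x *m U) <= U *m Ad_mx k0)%MS.
  apply: submx_trans k0_nil_tau; rewrite -[tau _]mul_rV_lin1 -mulmxA.
  exact: submxMl.
have : ip G tau (x *m U) (x *m U) = 0.
  by rewrite /ip -killing_mxE yE trmx_mul mulmxA -2!(mulmxA x) x0 mul0mx mxE oppr0.
move=> /(ip_eq0 tauP) xU; have /row_freeP[B UB] := nilmx_free theta.
by rewrite -[x]mulmx1 -UB mulmxA xU mul0mx.
Qed.

(** [k0] need not be an involution in G; this is what makes it one on flags, as the limits of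
    inverses require. *)
Lemma k0_sq_parabolic : P (k0 * k0)%g.
Proof.
apply/parP/row_subP => i; rewrite row_mul Ad_mxE AdM.
apply: sub_nilmx => l /(co_k0 theta_sym)[j].
move=> /(co_k0 theta_sym)[j' /(nilmx_co (row_sub _ _)) p -> ->].
by rewrite opprK.
Qed.

End Parabolic.

Lemma vspace_of_linear_set (K : fieldType) (V : vectType K) (S : set V) :
  S 0 -> (forall c u v, S u -> S v -> S (c *: u + v)) ->
  exists W : {vspace V}, forall v, v \in W <-> S v.
Proof.
move=> S0 Slin.
pose good m := `[< exists W : {vspace V}, (forall v, v \in W -> S v) /\ \dim W = m >].
have ex : exists m, good m.
  exists 0%N; apply/asboolP; exists 0%VS; split; last exact: dimv0.
  by move=> v /[!memv0]/eqP ->.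
have bd m : good m -> (m <= \dim {:V})%N.
  by move=> /asboolP[W [_ <-]]; apply: dimvS; exact: subvf.
have [m /asboolP[W [WS Wm]] mmax] := ex_maxnP ex bd.
exists W => v; split=> [|Sv]; first exact: WS.
have gW : good (\dim (W + <[v]>)%VS).
  apply/asboolP; exists (W + <[v]>)%VS; split=> // _ /memv_addP[w Ww [_ /vlineP[c ->] ->]].
  by rewrite addrC; apply: Slin => //; exact: WS.
have /eqP e : W == (W + <[v]>)%VS.
  by rewrite eqEdim addvSl/= Wm; exact: mmax.
by rewrite e (subvP (addvSr _ _))// memv_line.
Qed.

(** * Ideals and the kernel of the action on flags *)

Section Ideals.
Context (R : realType) (n : nat) (G : lieGroupType R n).
Local Notation kil := (killing G).
Local Notation vsp := {vspace 'rV[R]_n}.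
Implicit Types X Y Z : 'rV[R]_n.

Lemma ideal_cap (I J : vsp) : ideal G I -> ideal G J -> ideal G (I :&: J)%VS.
Proof.
move=> hI hJ X Y; rewrite !memv_cap => /andP[YI YJ].
by apply/andP; split; [exact: hI|exact: hJ].
Qed.

Lemma ideal_lie_l (I : vsp) X Y : ideal G I -> X \in I -> lie G X Y \in I.
Proof. by move=> hI XI; rewrite lieC rpredN; exact: hI. Qed.

Variable tau : 'End('rV[R]_n).
Hypothesis tauP : cartan_involution G tau.

(** By minimality I meets its image under tau in 0 or in I. In the first case the composition of
    [ad X] and [ad (tau X)] has values in that intersection, so it vanishes, and so does the Killing
    product of X and tau X, against definiteness. *)
Lemma minimal_ideal_tau (I : vsp) : ideal G I ->
  (forall J, ideal G J -> (J <= I)%VS -> J = 0%VS \/ J = I) ->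
  forall X, X \in I -> tau X \in I.
Proof.
move=> hI Imin.
have tI : ideal G (tau @: I)%VS.
  move=> X _ /memv_imgP[Y YI ->]; apply/memv_imgP; exists (lie G (tau X) Y); first exact: hI.
  by rewrite (tau_lie tauP) (tauK tauP).
have [I0|II] := Imin _ (ideal_cap hI tI) (capvSl _ _).
  move=> X XI; have [->|X0] := eqVneq X 0; first by rewrite linear0 mem0v.
  exfalso; have := ip_gt0 tauP X0; rewrite /ip killingE.
  have -> : ad_mx G (tau X) *m ad_mx G X = 0.
    apply: eq_mulmx_rV => Z; rewrite mulmxA !ad_mxE mulmx0.
    apply/eqP; rewrite -memv0 -I0 memv_cap; apply/andP; split.
      exact: ideal_lie_l.
    apply: (tI); apply: ideal_lie_l => //; apply/memv_imgP; by exists X.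
  by rewrite linear0 oppr0 ltxx.
have sub : (I <= tau @: I)%VS by rewrite -{1}II capvSr.
have /eqP e : I == (tau @: I)%VS.
  by rewrite eqEdim sub/= -[X in (_ <= X)%N](limg_ker_dim tau I) leq_addl.
by move=> X XI; rewrite e; exact: memv_img.
Qed.

(** The complement is the Killing orthogonal [lker f]. It meets I trivially since I is stable under
    tau, and brackets between the two lie in both, hence vanish. *)
Lemma ideal_complement (I : vsp) : ideal G I -> (forall X, X \in I -> tau X \in I) ->
  forall X, exists Y W, [/\ X = Y + W, Y \in I & forall Z, Z \in I -> lie G W Z = 0].
Proof.
move=> hI It.
pose B : 'M[R]_(\dim I, n) := \matrix_j (vbasis I)`_j.
pose f : 'Hom('rV[R]_n, 'rV[R]_(\dim I)) := linfun (mulmxr (killing_mx G *m B^T)).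
have fE X : f X = X *m (killing_mx G *m B^T) by rewrite lfunE.
have perpP X : X \in lker f -> forall Y, Y \in I -> kil X Y = 0.
  rewrite memv_ker fE => /eqP h Y /coord_vbasis ->.
  elim/big_ind: _ => [|x y hx hy|j _].
  - by rewrite -(scale0r (0 : 'rV[R]_n)) killingZr mul0r.
  - by rewrite killingDr hx hy addr0.
  - rewrite killingZr; have -> : kil X (vbasis I)`_j = (X *m (killing_mx G *m B^T)) 0 j.
      rewrite -killing_mxE mulmxA !mxE; apply: eq_bigr => l _.
      by rewrite !mxE.
    by rewrite h mxE mulr0.
have perpI X : (forall Y, Y \in I -> kil X Y = 0) -> X \in lker f.
  move=> h; rewrite memv_ker fE; apply/eqP/rowP => j; rewrite [RHS]mxE.
  rewrite -(h (vbasis I)`_j); last by apply/vbasis_mem/mem_nth; rewrite size_tuple.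
  rewrite -killing_mxE mulmxA !mxE; apply: eq_bigr => l _.
  by rewrite !mxE.
have perp_ideal : ideal G (lker f).
  move=> X Y /perpP h; apply: perpI => Z ZI.
  by rewrite lieC killingNl killing_lie h ?oppr0//; exact: hI.
have disj : (I :&: lker f = 0)%VS.
  apply/eqP; rewrite -subv0; apply/subvP => X; rewrite memv_cap => /andP[XI /perpP h].
  by rewrite memv0; apply/eqP/(ip_eq0 tauP); rewrite /ip h ?oppr0//; exact: It.
have full : (I + lker f)%VS = fullv.
  apply/eqP; rewrite eqEdim subvf/= dimv_disjoint_sum//.
  rewrite -(limg_ker_dim f fullv) capfv addnC leq_add2r.
  apply: leq_trans (dimvS (subvf _)) _; by rewrite dimvf dim_matrix mul1r.
move=> X; have /memv_addP[Y YI [W Wp ->]] : X \in (I + lker f)%VS by rewrite full memvf.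
exists Y, W; split=> // Z ZI; apply/eqP; rewrite -memv0 -disj memv_cap; apply/andP; split.
  exact: hI.
exact: ideal_lie_l.
Qed.

(** A nonzero ideal of least dimension inside J. The centralizing complement makes every ideal of I
    an ideal of the whole algebra, so minimality leaves only 0 and I; an abelian I would be
    solvable. *)
Lemma simple_ideal_ex (J : vsp) : semisimple G -> ideal G J -> J <> 0%VS ->
  exists2 I, simple_ideal G I & (I <= J)%VS.
Proof.
move=> ss hJ J0.
pose good m := `[< exists I : vsp, [/\ ideal G I, I <> 0%VS, (I <= J)%VS & \dim I = m] >].
have ex : exists m, good m by exists (\dim J); apply/asboolP; exists J.
have [m /asboolP[I [hI I0 IJ Im]] mmin] := ex_minnP ex.
have Imin (I' : vsp) : ideal G I' -> (I' <= I)%VS -> I' = 0%VS \/ I' = I.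
  move=> hI' I'I; have [->|/eqP I'0] := eqVneq I' 0%VS; [by left|right].
  apply/eqP; rewrite eqEdim I'I Im; apply: mmin; apply/asboolP; exists I'.
  by split=> //; exact: subv_trans I'I IJ.
have It := minimal_ideal_tau hI Imin.
exists I => //; split=> //.
  by move=> b0; apply: I0; apply: ss => //; exists 1%N.
move=> L LI Lst; apply: Imin => // X Z ZL.
have [Y [W [-> YI /(_ Z (subvP LI _ ZL)) WZ]]] := ideal_complement hI It X.
by rewrite lieDl WZ addr0; exact: Lst.
Qed.

End Ideals.

Section Kernel.
Context (R : realType) (n : nat) (G : lieGroupType R n) (D : cartan_data G).
Context (theta : set (dual (cd_a D))).
Local Notation P := (parabolic theta).
Local Notation U := (nilmx theta).
Local Notation exp := (lie_exp G).
Hypothesis Gc : connected [set: G].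
Hypothesis ss : semisimple G.
Hypothesis Gz : trivial_center G.
Hypothesis noP : forall H : set G, simple_factor H -> ~ H `<=` P.
Implicit Types X Y Z : 'rV[R]_n.

(** Such a g commutes with all exponentials. The factorization theorem, with the trivial group and
    the centralizer of g as the two factors, makes the centralizer everything. *)
Lemma centralizes_exp (g : G) : (forall X, Ad g X = X) -> g = 1%g.
Proof.
move=> gX; apply: Gz => h.
pose C := [set h : G | (g * h = h * g)%g].
have Cgrp : subgroup C.
  split=> [|x y|x]; rewrite /C /=; first by rewrite mulg1 mul1g.
    by move=> hx hy; rewrite mulgA hx -mulgA hy mulgA.
  by move=> hx; apply: (mulgI x); rewrite mulgA -hx mulgK mulVKg.
have Cc : closed C.
  have -> : C = (fun h => g * h * g^-1 * h^-1)%g @^-1` [set 1%g].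
    apply/seteqP; split=> x; rewrite /C /=; first by move=> ->; rewrite mulgK mulgV.
    by move=> e; rewrite -[LHS](mulgVK g) -[X in (X * g)%g = _](mulgVK x) e mul1g.
  apply: closed_comp; last first.
    by apply: accessible_closed_set1; exact/hausdorff_accessible/lie_hausdorff.
  move=> x _; apply: (cvg_mulg (FF := nbhs_filter x)); last first.
    by apply: (cvg_invg (FF := nbhs_filter x)); exact: cvg_id.
  apply: (cvg_mulg (FF := nbhs_filter x)); last exact: cvg_cst.
  by apply: (cvg_mulg (FF := nbhs_filter x)); [exact: cvg_cst|exact: cvg_id].
have S1 : subgroup [set (1%g : G)].
  by split=> [//|x y -> ->|x ->] /=; rewrite ?mul1g ?invg1.
have expS X : [set (0 : 'rV[R]_n)] X -> [set (1%g : G)] (exp X).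
  by move=> -> /=; rewrite exp0.
have expC X : setT X -> C (exp X).
  move=> _; have := lie_exp_conj g X; rewrite gX => /(congr1 (fun x => x * g)%g).
  by rewrite mulgVK.
have dec X : exists Y Z, [/\ X = - (Y + Z), [set (0 : 'rV[R]_n)] Y, setT Z,
    `|Y| <= 1 * `|X| & `|Z| <= 1 * `|X|].
  by exists 0, (- X); rewrite add0r opprK !mul1r normr0 normrN.
have [k [p [-> Cp ->]]] := lie_group_factorization S1 (@compact_set1 _ _) Cgrp Cc expS expC dec Gc h.
by rewrite mul1g.
Qed.

Lemma derive_in_vspace (W : {vspace 'rV[R]_n}) (f : R -> 'rV[R]_n) df (t : R) :
  (forall s, f s \in W) -> is_derive t (1 : R) f df -> df \in W.
Proof.
move=> fW fd; have projE v : v \in W -> projv W v = v by exact: projv_id.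
have h : is_derive t (1 : R) (fun s => projv W (f s)) (projv W df).
  exact: (is_derive_linear (projv W) fd).
have fE : (fun s => projv W (f s)) = f by apply/funext => s; rewrite projE.
rewrite fE in h; rewrite (is_derive_unique fd h).
exact: memv_proj.
Qed.

(** The Lie algebra of the intersection of all conjugates of P: bracketing with Z preserves every
    translate of the nilradical. *)
Let nn Z := forall h : G, (U *m Ad_mx h *m ad_mx G Z <= U *m Ad_mx h)%MS.

Lemma kernel_trivial (g : G) : (forall h : G, P (h^-1 * g * h)%g) -> g = 1%g.
Proof.
move=> gN.
have [N NE] : exists W : {vspace 'rV[R]_n}, forall v, v \in W <-> nn v.
  apply: vspace_of_linear_set => [h|c u v hu hv h].
    by rewrite -(scale0r (0 : 'rV[R]_n)) ad_mxZ scale0r mulmx0 sub0mx.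
  by rewrite ad_mx_linear mulmxDr -scalemxAr addmx_sub// scalemx_sub.
have Nideal : ideal G N.
  move=> X Z ZN; refine (@derive_in_vspace N (fun t => Ad (exp (t *: X)) Z) _ 0 _ (lie_exp_Ad G X Z)) => t.
  move: (exp (t *: X)) => x; apply/NE => h; rewrite ad_mx_Ad.
  have := (NE Z).1 ZN (x^-1 * h)%g; rewrite Ad_mxM => hh.
  rewrite !mulmxA -[U *m Ad_mx h *m _]mulmxA.
  have -> : U *m Ad_mx h = U *m (Ad_mx h *m Ad_mx x^-1%g) *m Ad_mx x.
    by rewrite -!mulmxA -Ad_mxM mulgV Ad_mx1 mulmx1.
  exact: submxMr.
have N0 : N = 0%VS.
  apply: contrapT => N0; have [I sI IN] := simple_ideal_ex (cd_tauP D) ss Nideal N0.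
  apply: (noP (H := connected_subgroup I)); first by exists I.
  move=> x; apply; first exact: parabolic_subgroup.
  move=> _ [X XI <-]; apply/parabolicP; apply: Ad_exp_invariant.
  by have := (NE X).1 (subvP IN _ XI) 1%g; rewrite Ad_mx1 mulmx1.
apply: centralizes_exp => X; apply/eqP; rewrite -subr_eq0 -memv0 -N0.
apply/NE => h.
(* A commutator curve: it consists of products of conjugates of g and of its inverse, so it stays in
   all conjugates of P. Its velocity [Ad g X - X] therefore lies in [N], which is 0. *)
pose eta t := (g * exp (t *: X) * g^-1 * exp (t *: - X))%g.
have teta : tangent eta (Ad g X - X).
  apply: tangent_mul; first by apply: tangent_conj; exact/onep_tangent/lie_exp_onep.
  exact/onep_tangent/lie_exp_onep.
have etaP t : P (h^-1 * eta t * h)%g.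
  have [_ PM PV] := parabolic_subgroup theta.
  pose x := exp (t *: X); rewrite /eta -/x scalerN lie_expN -/x.
  have -> : (h^-1 * (g * x * g^-1 * x^-1) * h = (h^-1 * g * h) * ((x^-1 * h)^-1 * g * (x^-1 * h))^-1)%g.
    by rewrite !invgM !invgK !mulgA mulgK.
  by apply: PM => //; apply: PV.
apply/row_subP => i; rewrite row_mul ad_mxE; set Y := row i _.
have h0 t : Ad (eta t) Y *m cokermx (U *m Ad_mx h) = 0.
  apply/eqP; rewrite -submxE -Ad_mxE.
  apply: (@submx_trans _ _ _ _ _ _ (U *m Ad_mx h *m Ad_mx (eta t))); first by apply: submxMr; exact: row_sub.
  rewrite -mulmxA -Ad_mxM.
  have -> : (eta t * h = h * (h^-1 * eta t * h))%g by rewrite !mulgA mulgV mul1g.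
  by rewrite Ad_mxM mulmxA; apply: submxMr; exact/parabolicP/etaP.
have d1 := is_derive_linear (mulmxr (cokermx (U *m Ad_mx h))) (tangent_Ad Y teta).
rewrite submxE; apply/eqP; apply: (is_derive_unique d1).
have -> : mulmxr (cokermx (U *m Ad_mx h)) \o (fun t => Ad (eta t) Y) = cst 0.
  by apply/funext => t /=; rewrite h0.
exact: is_derive_cst.
Qed.

End Kernel.

(** * A representation with rank one limits *)

Section Minors.
Context (R : comNzRingType) (k n : nat).
Local Notation idx := {ffun 'I_k -> 'I_n}.

(** The k-th tensor power. Indices are arbitrary functions instead of increasing ones: the Pluecker
    vector [minors] is kept as an antisymmetric tensor, on which the group acts by plain matrix
    products. *)
Definition tensor_mx (M : 'M[R]_n) : 'M[R]_#|{: idx}| :=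
  \matrix_(x, y) \prod_i M ((enum_val x : idx) i) ((enum_val y : idx) i).

Definition minors (A : 'M[R]_(n, k)) : 'cV[R]_#|{: idx}| :=
  \col_x \det (rowsub (enum_val x : idx) A).

Definition tensor_row (B : 'M[R]_(k, n)) : 'rV[R]_#|{: idx}| :=
  \row_x \prod_i B i ((enum_val x : idx) i).

Lemma sum_enum_val (F : idx -> R) :
  \sum_f F f = \sum_(x < #|{: idx}|) F (enum_val x).
Proof. exact: (reindex _ (onW_bij _ (@enum_val_bij _))). Qed.

(** The Cauchy-Binet formula before antisymmetrization, by expanding every row of the product;
    indices f that are not injective contribute 0. *)
Lemma det_mulmx_rows (B : 'M[R]_(k, n)) (A : 'M[R]_(n, k)) :
  \det (B *m A) = \sum_(f : idx) (\prod_i B i (f i)) * \det (rowsub f A).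
Proof.
rewrite /determinant.
under eq_bigr do under eq_bigr do rewrite mxE.
under eq_bigr do rewrite bigA_distr_bigA mulr_sumr.
rewrite exchange_big; apply: eq_bigr => f _; rewrite mulr_sumr.
apply: eq_bigr => s _; rewrite big_split mulrCA; congr (_ * (_ * _)).
by apply: eq_bigr => i _; rewrite !mxE.
Qed.

Lemma tensor_minors (M : 'M[R]_n) (A : 'M[R]_(n, k)) :
  tensor_mx M *m minors A = minors (M *m A).
Proof.
apply/colP => x; rewrite !mxE -mul_rowsub_mx det_mulmx_rows sum_enum_val.
by apply: eq_bigr => y _; rewrite !mxE; under [in RHS]eq_bigr do rewrite mxE.
Qed.

Lemma tensor_row_minors (B : 'M[R]_(k, n)) (A : 'M[R]_(n, k)) :
  tensor_row B *m minors A = (\det (B *m A))%:M.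
Proof.
apply/matrixP => i j; rewrite !ord1 !mxE eqxx mulr1n det_mulmx_rows sum_enum_val.
by apply: eq_bigr => y _; rewrite !mxE.
Qed.

Lemma minorsM (A : 'M[R]_(n, k)) (C : 'M[R]_k) : minors (A *m C) = \det C *: minors A.
Proof. by apply/colP => x; rewrite !mxE -mul_rowsub_mx det_mulmx mulrC. Qed.

(* Replacing the [j]-th row of a left inverse of [A] by [r] gives a matrix [B]
   with [\det (B *m A) = (r *m A) 0 j] and [\det (B *m A') = 0]. *)
Lemma minors_ker (A A' : 'M[R]_(n, k)) (L : 'M[R]_(k, n)) (c : R) (r : 'rV[R]_n) :
  L *m A = 1%:M -> minors A = c *: minors A' -> r *m A' = 0 -> r *m A = 0.
Proof.
move=> LA AA' rA'; apply/rowP => j; rewrite [RHS]mxE.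
pose B := \matrix_i (if i == j then r else row i L).
have rowB (A1 : 'M[R]_(n, k)) i : row i (B *m A1) = if i == j then r *m A1 else row i (L *m A1).
  by rewrite row_mul rowK; case: eqP => // _; rewrite row_mul.
have det0 : \det (B *m A') = 0.
  rewrite (expand_det_row _ j) big1// => l _.
  have := congr1 (fun M : 'rV[R]_k => M 0 l) (rowB A' j).
  by rewrite eqxx rA' !mxE => ->; rewrite mul0r.
have det1 : \det (B *m A) = (r *m A) 0 j.
  rewrite (expand_det_row _ j).
  have adj1 : \adj (1%:M : 'M[R]_k) = 1%:M by have := mul_mx_adj (1%:M : 'M[R]_k); rewrite mul1mx det1.
  rewrite -[in RHS](mulmx1 (r *m A)) -adj1 [RHS]mxE; apply: eq_bigr => l _.
  rewrite [\adj _ l j]mxE; congr (_ * _).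
    by have := congr1 (fun M : 'rV[R]_k => M 0 l) (rowB A j); rewrite eqxx mxE.
  rewrite /cofactor; congr (_ * \det _).
  apply/matrixP => i i'; rewrite !mxE.
  have := congr1 (fun M : 'rV[R]_k => M 0 (lift l i')) (rowB A (lift j i)).
  by rewrite eq_sym (negbTE (neq_lift _ _)) LA !mxE.
have := congr1 (mulmx (tensor_row B)) AA'.
rewrite -scalemxAr !tensor_row_minors det0 det1 => /matrixP/(_ 0 0).
by rewrite !mxE !eqxx !mulr1n mulr0.
Qed.

End Minors.

(** The [t (x j)] form a largest independent subfamily and C reads off coordinates in it. This turns
    an abstract span into a concrete coordinate space. *)
Lemma span_coordinates (R : fieldType) m (I : Type) (t : I -> 'rV[R]_m) :
  exists d (x : 'I_d -> I) (C : 'M[R]_(m, d)),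
    (forall g, t g = \sum_j (t g *m C) 0 j *: t (x j)) /\
    (forall j, t (x j) *m C = delta_mx 0 j).
Proof.
pose J d (x : 'I_d -> I) := \matrix_j t (x j).
pose good d := `[< exists x : 'I_d -> I, row_free (J d x) >].
have ex : exists d, good d.
  have x0 : 'I_0 -> I by case.
  by exists 0%N; apply/asboolP; exists x0; rewrite /row_free -leqn0 rank_leq_row.
have bd d : good d -> (d <= m)%N.
  by move=> /asboolP[x xf]; rewrite -(eqP xf); exact: rank_leq_col.
have [d /asboolP[x xf] dmax] := ex_maxnP ex bd.
have /row_freeP[C JC] := xf; exists d, x, C.
have xC j : t (x j) *m C = delta_mx 0 j.
  have -> : t (x j) = row j (J d x) by rewrite rowK.
  by rewrite -row_mul JC row1.
split=> // g.
suff /submxP[u uE] : (t g <= J d x)%MS.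
  rewrite {1}uE mulmx_sum_row; apply: eq_bigr => j _.
  by rewrite rowK uE -mulmxA JC mulmx1.
apply: contraT => ng; have : good (d + 1)%N.
  apply/asboolP; exists (fun i : 'I_(d + 1) => match fintype.split i with inl j => x j | inr _ => g end).
  have -> : J _ (fun i : 'I_(d + 1) => match fintype.split i with inl j => x j | inr _ => g end) = col_mx (J d x) (t g).
    apply/row_matrixP => i; rewrite rowK; case: splitP => j ij.
      have -> : i = lshift 1 j by exact: val_inj.
      by rewrite rowKu rowK.
    have -> : i = rshift d j by exact: val_inj.
    by rewrite rowKd ord1 row_id.
  rewrite -row_leq_rank -addsmxE mxrank_disjoint_sum ?(eqP xf) ?rank_rV.
    by case: eqP => // t0; rewrite t0 sub0mx in ng.
  apply/eqP; rewrite -submx0; apply/rV_subP => z; rewrite sub_capmx => /andP[zJ].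
  move=> /sub_rVP[c zE]; have [->|c0] := eqVneq z 0; first by rewrite sub0mx.
  rewrite zE in zJ c0; case/negP: ng; rewrite -(scale1r (t g)) -(mulVf (x := c)).
    by rewrite -scalerA scalemx_sub.
  by apply: contraNneq c0 => ->; rewrite scale0r.
by move=> /dmax; rewrite addn1 ltnn.
Qed.

(* The span of the rank one matrices [v g *m (v g)^T], in coordinates. *)
Section SquareRepresentation.
Context (R : fieldType) (G : groupType) (N : nat).
Context (T : G -> 'M[R]_N) (v : G -> 'cV[R]_N).
Hypothesis vM : forall g h, v (g * h)%g = T g *m v h.

Let sq g := v g *m (v g)^T.
Let vsq g := mxvec (sq g).

Fact square_coordinates_spec : {x : {d & (('I_d -> G) * 'M[R]_(N * N, d))%type} |
  (forall g, vsq g = \sum_j (vsq g *m (projT2 x).2) 0 j *: vsq ((projT2 x).1 j)) /\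
  (forall j, vsq ((projT2 x).1 j) *m (projT2 x).2 = delta_mx 0 j)}.
Proof.
apply: cid; have [d [x [C [h1 h2]]]] := span_coordinates vsq.
by exists (existT _ d (x, C)).
Qed.

Definition sq_dim := projT1 (sval square_coordinates_spec).
Definition sq_base (j : 'I_sq_dim) : G := (projT2 (sval square_coordinates_spec)).1 j.
Definition sq_coord : 'M[R]_(N * N, sq_dim) := (projT2 (sval square_coordinates_spec)).2.
Definition sq_vec (g : G) : 'cV[R]_sq_dim := (mxvec (v g *m (v g)^T) *m sq_coord)^T.
(** The action x -> T x T^t on the span, given by its columns: the basis consists of squares, which
    go to squares again. *)
Definition sq_rep (g : G) : 'M[R]_sq_dim := \matrix_(i, j) sq_vec (g * sq_base j)%g i 0.

Let vsqE g : vsq g = \sum_j sq_vec g j 0 *: vsq (sq_base j).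
Proof.
rewrite {1}((svalP square_coordinates_spec).1 g); apply: eq_bigr => j _.
by rewrite /sq_vec [in RHS]mxE.
Qed.

Lemma sqE g : v g *m (v g)^T = \sum_j sq_vec g j 0 *: (v (sq_base j) *m (v (sq_base j))^T).
Proof.
have := congr1 vec_mx (vsqE g); rewrite /vsq /sq mxvecK linear_sum => ->.
by apply: eq_bigr => j _; rewrite linearZ/= mxvecK.
Qed.

Lemma sq_vec_base j : sq_vec (sq_base j) = delta_mx j 0.
Proof. by rewrite /sq_vec ((svalP square_coordinates_spec).2 j) trmx_delta. Qed.

Lemma sq_form m p (A : 'M[R]_(m, N)) (B : 'M[R]_(N, p)) g :
  A *m (v g *m (v g)^T) *m B = \sum_j sq_vec g j 0 *: (A *m (v (sq_base j) *m (v (sq_base j))^T) *m B).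
Proof.
rewrite sqE mulmx_sumr mulmx_suml; apply: eq_bigr => j _.
by rewrite -scalemxAr -scalemxAl.
Qed.

Lemma sq_vecM g h : sq_vec (g * h)%g = sq_rep g *m sq_vec h.
Proof.
have e : v (g * h)%g *m (v (g * h)%g)^T =
    \sum_j sq_vec h j 0 *: (v (g * sq_base j)%g *m (v (g * sq_base j)%g)^T).
  rewrite vM trmx_mul mulmxA -(mulmxA (T g)) sq_form; apply: eq_bigr => j _.
  by rewrite vM trmx_mul !mulmxA.
rewrite {1}/sq_vec e; apply/colP => i.
rewrite mxE linear_sum mulmx_suml summxE [RHS]mxE; apply: eq_bigr => j _.
by rewrite linearZ/= -scalemxAl mxE [in RHS]mxE mulrC /sq_vec [in RHS]mxE.
Qed.

Lemma sq_rep_ext (A B : 'M[R]_sq_dim) : (forall g, A *m sq_vec g = B *m sq_vec g) -> A = B.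
Proof.
move=> h; apply/matrixP => i j; have := h (sq_base j).
by rewrite sq_vec_base -!colE => /colP/(_ i); rewrite !mxE.
Qed.

Lemma sq_repM g h : sq_rep (g * h)%g = sq_rep g *m sq_rep h.
Proof. by apply: sq_rep_ext => x; rewrite -mulmxA -!sq_vecM mulgA. Qed.

Lemma sq_rep1 : sq_rep 1%g = 1%:M.
Proof. by apply: sq_rep_ext => x; rewrite -sq_vecM mul1g mul1mx. Qed.

Lemma sq_vec_span (x : 'rV[R]_sq_dim) : (forall g, x *m sq_vec g = 0) -> x = 0.
Proof.
move=> h; apply/rowP => j; have := h (sq_base j).
by rewrite sq_vec_base -colE => /colP/(_ 0); rewrite !mxE.
Qed.

Lemma sq_vecZ g h c : v g = c *: v h -> sq_vec g = c ^+ 2 *: sq_vec h.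
Proof.
move=> e; rewrite /sq_vec e linearZ/= -scalemxAl -scalemxAr scalerA -expr2.
by rewrite linearZ/= -scalemxAl linearZ.
Qed.

Lemma sq_vec_line g h c : v g != 0 -> sq_vec g = c *: sq_vec h -> exists c', v g = c' *: v h.
Proof.
move=> vg e; have e' : v g *m (v g)^T = c *: (v h *m (v h)^T).
  rewrite !sqE scaler_sumr; apply: eq_bigr => j _.
  by rewrite e mxE scalerA.
have [i vi] : exists i, v g i 0 != 0.
  apply/existsP; apply: contraNT vg; rewrite negb_exists => /forallP h0.
  by apply/eqP/colP => i; rewrite mxE; apply/eqP; have := h0 i; rewrite negbK.
exists ((v g i 0)^-1 * c * v h i 0); apply/colP => j.
have := congr1 (fun M : 'M[R]_N => M j i) e'.
rewrite !mxE !big_ord1 !mxE => ev.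
by apply: (mulIf vi); rewrite ev; field.
Qed.

End SquareRepresentation.

Section Representation.
Context (R : realType) (n : nat) (G : lieGroupType R n) (D : cartan_data G).
Context (theta : set (dual (cd_a D))).
Local Notation P := (parabolic theta).
Local Notation U := (nilmx theta).
Local Notation k0 := (cd_k0 D).
Local Notation k := #|nil_index theta|.

Definition plucker (g : G) := minors (U *m Ad_mx g)^T.
Definition tensor_Ad (g : G) := tensor_mx k (Ad_mx g)^T.

Lemma pluckerM (g h : G) : plucker (g * h)%g = tensor_Ad g *m plucker h.
Proof. by rewrite tensor_minors -trmx_mul -mulmxA -Ad_mxM. Qed.

Lemma nilmx_Ad_inverse (g : G) : exists L, L *m (U *m Ad_mx g)^T = 1%:M.
Proof.
have /row_freeP[B UB] := nilmx_free theta.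
exists (Ad_mx (g^-1)%g *m B)^T; rewrite -trmx_mul !mulmxA -(mulmxA U) -Ad_mxM mulVg Ad_mx1 mulmx1.
by rewrite UB trmx1.
Qed.

Lemma plucker_neq0 g : plucker g != 0.
Proof.
have [L LA] := nilmx_Ad_inverse g; apply/eqP => p0.
have := tensor_row_minors L (U *m Ad_mx g)^T; rewrite -/(plucker g) p0 mulmx0 LA det1.
by move=> /matrixP/(_ 0 0)/eqP; rewrite !mxE eqxx eq_sym oner_eq0.
Qed.

(** The Killing form induced on the k-th exterior power, taken at the Pluecker vectors of g and h.
    Its square is nonnegative, and it is linear in the rank one matrix of h. *)
Definition pairing (g h : G) : R :=
  (\det (U *m Ad_mx g *m killing_mx G *m (U *m Ad_mx h)^T)) ^+ 2.

Lemma pairingE g h : pairing g h =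
  (tensor_row (U *m Ad_mx g *m killing_mx G) *m (plucker h *m (plucker h)^T) *m
   (tensor_row (U *m Ad_mx g *m killing_mx G))^T) 0 0.
Proof.
rewrite mulmxA -mulmxA -trmx_mul tensor_row_minors tr_scalar_mx.
by rewrite -scalar_mxM mxE eqxx mulr1n -expr2.
Qed.

Local Notation d := (sq_dim plucker).

Definition rep (g : G) : 'M[R]_d := sq_rep plucker g.
Definition rep_vec (g : G) : 'cV[R]_d := sq_vec plucker g.
Definition rep_form (g : G) : 'rV[R]_d := \row_j pairing g (sq_base j).
Definition rep_trace : 'rV[R]_d :=
  \row_j ((plucker (sq_base j))^T *m plucker (sq_base j)) 0 0.

Lemma rep_vecM g h : rep_vec (g * h)%g = rep g *m rep_vec h.
Proof. exact: sq_vecM pluckerM _ _. Qed.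

Lemma repM g h : rep (g * h)%g = rep g *m rep h.
Proof. exact: sq_repM pluckerM _ _. Qed.

Lemma rep1 : rep 1%g = 1%:M.
Proof. exact: sq_rep1 pluckerM. Qed.

Lemma rep_vec_span (x : 'rV[R]_d) : (forall g, x *m rep_vec g = 0) -> x = 0.
Proof. exact: sq_vec_span. Qed.

Lemma rep_form_vec g h : (rep_form g *m rep_vec h) 0 0 = pairing g h.
Proof.
rewrite pairingE sq_form summxE mxE; apply: eq_bigr => j _.
by rewrite [rep_form g 0 j]mxE pairingE mulrC [in RHS]mxE.
Qed.

Lemma rep_trace_gt0 g : 0 < (rep_trace *m rep_vec g) 0 0.
Proof.
have -> : (rep_trace *m rep_vec g) 0 0 = \tr (plucker g *m (plucker g)^T).
  rewrite sqE linear_sum mxE; apply: eq_bigr => j _.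
  by rewrite mxE linearZ/= mulrC mxtrace_mulC [in RHS]/mxtrace big_ord1.
rewrite mxtrace_mulC /mxtrace big_ord1 mxE.
have [i pi] : exists i, plucker g i 0 != 0.
  apply/existsP; apply: contraNT (plucker_neq0 g); rewrite negb_exists => /forallP h0.
  by apply/eqP/colP => i; rewrite [RHS]mxE; apply/eqP; have := h0 i; rewrite negbK.
rewrite (bigD1 i)//= mxE -expr2 ltr_wpDr//; last by rewrite exprn_even_gt0.
by apply: sumr_ge0 => j _; rewrite mxE -expr2 sqr_ge0.
Qed.

Lemma pairing_inv x g h : pairing (x * g)%g (x * h)%g = pairing g h.
Proof.
rewrite /pairing !Ad_mxM !mulmxA trmx_mul; congr (\det _ ^+ 2).
have Binv : Ad_mx x *m killing_mx G *m (Ad_mx x)^T = killing_mx G.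
  apply/matrixP => i j; have := killing_Ad x (delta_mx 0 i) (delta_mx 0 j).
  rewrite -!killing_mxE -!Ad_mxE trmx_mul !mulmxA -!(mulmxA (delta_mx 0 i)) -!rowE.
  by rewrite !trmx_delta -!colE !mxE.
by rewrite !mulmxA -(mulmxA _ (Ad_mx x)) -(mulmxA _ _ (Ad_mx x)^T) Binv.
Qed.

Lemma pairingC g h : pairing g h = pairing h g.
Proof.
by rewrite /pairing -det_tr !trmx_mul !trmxK killing_mx_sym !mulmxA.
Qed.

Lemma pairing_ge0 g h : 0 <= pairing g h.
Proof. exact: sqr_ge0. Qed.

Lemma rep_form_rep g h : rep_form (g * h)%g *m rep g = rep_form h.
Proof.
apply/rowP => j; rewrite mxE [RHS]mxE -(pairing_inv g) -rep_form_vec mxE.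
by apply: eq_bigr => i _; rewrite [rep g i j]mxE.
Qed.

(** An element of P changes the basis of the nilradical by an invertible matrix C, which multiplies
    all maximal minors by its determinant. *)
Lemma parabolic_nilmx (p : G) : P p -> exists2 c, c != 0 &
  forall g, plucker (g * p)%g = c *: plucker g /\
    forall h, pairing (g * p)%g h = c ^+ 2 * pairing g h.
Proof.
move=> /parabolicP/submxP[C UC].
have UE g : U *m Ad_mx (g * p)%g = C *m (U *m Ad_mx g) by rewrite Ad_mxM mulmxA UC -mulmxA.
have pE g : plucker (g * p)%g = \det C *: plucker g.
  by rewrite /plucker UE trmx_mul minorsM det_tr.
exists (\det C).
  apply/eqP => C0; have := plucker_neq0 (1 * p)%g; by rewrite pE C0 scale0r eqxx.
move=> g; split=> // h; rewrite /pairing UE -!mulmxA det_mulmx exprMn.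
by rewrite !mulmxA.
Qed.

Lemma rep_vec_parabolic (p : G) : P p -> exists2 c, 0 < c &
  forall g, rep_vec (g * p)%g = c *: rep_vec g /\ rep_form (g * p)%g = c *: rep_form g.
Proof.
move=> /parabolic_nilmx[c c0 cE]; exists (c ^+ 2); first by rewrite exprn_even_gt0.
move=> g; have [c1 c2] := cE g; split; first exact: sq_vecZ.
by apply/rowP => j; rewrite !mxE c2.
Qed.

(** The rank one matrix determines the Pluecker vector up to scale, and by [minors_ker] that vector
    determines the row space, here the translate of the nilradical. *)
Lemma rep_vec_line g h c : rep_vec g = c *: rep_vec h -> P (h^-1 * g)%g.
Proof.
move=> /(sq_vec_line (plucker_neq0 g))[c' e]; apply/parabolicP.
have [L LA] := nilmx_Ad_inverse g.
have sub : (U *m Ad_mx g <= U *m Ad_mx h)%MS.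
  rewrite submxE; apply/eqP/trmx_inj; rewrite trmx_mul trmx0.
  apply/row_matrixP => i; rewrite row0 row_mul.
  apply: minors_ker LA e _; rewrite -row_mul -trmx_mul mulmx_coker trmx0.
  exact: row0.
rewrite Ad_mxM mulmxA; have := submxMr (Ad_mx (h^-1)%g) sub.
by rewrite -[X in (_ <= X)%MS]mulmxA -Ad_mxM mulVg Ad_mx1 mulmx1.
Qed.

Lemma pairing_k0 : theta `<=` simple_roots (cd_pos D) -> symmetric_roots theta ->
  0 < pairing 1%g k0.
Proof.
move=> th1 th2; rewrite /pairing exprn_even_gt0//= Ad_mx1 mulmx1.
by rewrite -unitfE -unitmxE killing_k0_unit.
Qed.

Lemma pairing_self g : (0 < k)%N -> pairing g g = 0.
Proof.
move=> kpos; rewrite -(mulg1 g) pairing_inv /pairing Ad_mx1 mulmx1 killing_nil.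
(* The zero matrix has determinant 0 in positive size only; in size 0 the pairing would be 1. *)
by move: #|nil_index theta| kpos => [//|m] _; rewrite det0 expr0n.
Qed.

Lemma continuous_nilmx_Ad : continuous (fun g : G => U *m Ad_mx g).
Proof.
move=> g; apply: (cvg_mulmx (FF := nbhs_filter g)); first exact: cvg_cst.
exact: Ad_mx_continuous.
Qed.

End Representation.

Section Continuity.
Context (R : realType).

Lemma cvg_det (T : Type) (F : set_system T) {FF : Filter F} m (A : T -> 'M[R]_m) (a : 'M[R]_m) :
  A @ F --> a -> (fun t => \det (A t)) @ F --> \det a.
Proof.
move=> Aa; rewrite /determinant; apply: cvg_bigsum => s.
apply: cvgM; first exact: cvg_cst.
by apply: cvg_bigprod => i; exact: cvg_entry.
Qed.

Lemma cvg_trmx (T : Type) (F : set_system T) {FF : Filter F} m n (A : T -> 'M[R]_(m, n)) (a : 'M[R]_(m, n)) :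
  A @ F --> a -> (fun t => (A t)^T) @ F --> a^T.
Proof.
move=> Aa; apply: cvg_mx => i j; rewrite mxE; under eq_fun do rewrite mxE.
exact: cvg_entry.
Qed.

Lemma cvg_minors (T : Type) (F : set_system T) {FF : Filter F} k n (A : T -> 'M[R]_(n, k)) (a : 'M[R]_(n, k)) :
  A @ F --> a -> (fun t => minors (A t)) @ F --> minors a.
Proof.
move=> Aa; apply: cvg_mx => i j; rewrite mxE; under eq_fun do rewrite mxE.
apply: cvg_det; apply: cvg_mx => i' j'; rewrite mxE; under eq_fun do rewrite mxE.
exact: cvg_entry.
Qed.

Context (n : nat) (G : lieGroupType R n) (D : cartan_data G).
Context (theta : set (dual (cd_a D))).
Local Notation U := (nilmx theta).

Lemma rep_vec_continuous : continuous (@rep_vec R n G D theta).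
Proof.
move=> g; have FF := nbhs_filter g.
have h := @continuous_nilmx_Ad R n G D theta g.
have hp : (fun x : G => plucker theta x) @ g --> plucker theta g.
  by apply: cvg_minors; exact: cvg_trmx.
apply: cvg_trmx; apply: cvg_mulmx; last exact: cvg_cst.
have hs : (fun x : G => plucker theta x *m (plucker theta x)^T) @ g -->
    plucker theta g *m (plucker theta g)^T.
  by apply: cvg_mulmx => //; exact: cvg_trmx.
apply: cvg_mx => i j; rewrite ord1; case/mxvec_indexP: j => i' j'.
by rewrite mxvecE; under eq_fun do rewrite mxvecE; exact: cvg_entry.
Qed.

Lemma rep_continuous : continuous (@rep R n G D theta).
Proof.
move=> g; have FF := nbhs_filter g; apply: cvg_mx => i j.
rewrite mxE; under eq_fun do rewrite mxE.
apply: cvg_entry.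
have h : (fun x : G => x * sq_base j)%g @ g --> (g * sq_base j)%g.
  by apply: cvg_mulg; [exact: cvg_id|exact: cvg_cst].
exact: (cvg_comp _ _ h (@rep_vec_continuous _)).
Qed.

Lemma rep_form_continuous : continuous (@rep_form R n G D theta).
Proof.
move=> g; have FF := nbhs_filter g; apply: cvg_mx => i j.
rewrite mxE; under eq_fun do rewrite mxE.
have h := @continuous_nilmx_Ad R n G D theta g.
have hd : (fun x : G => \det (U *m Ad_mx x *m killing_mx G *m (U *m Ad_mx (sq_base j))^T)) @ g
   --> \det (U *m Ad_mx g *m killing_mx G *m (U *m Ad_mx (sq_base j))^T).
  apply: cvg_det; apply: cvg_mulmx; last exact: cvg_cst.
  by apply: cvg_mulmx => //; exact: cvg_cst.
exact: (cvgM hd hd).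
Qed.

Lemma lie_exp_cvg1 (T : Type) (F : set_system T) {FF : Filter F} (W : T -> 'rV[R]_n) :
  W @ F --> (0 : 'rV[R]_n) -> (fun t => lie_exp G (W t)) @ F --> (1%g : G).
Proof.
move=> W0; have [C [rho [C0 rho0 E]]] := lie_exp_estimate G.
have [C' [r [C'0 r0 De _ _]]] := local_group G.
have Wrho : \forall t \near F, `|W t| <= rho.
  have /cvgrPdist_le/(_ _ rho0) := W0.
  by apply: filterS => t; rewrite sub0r normrN.
have lc0 : (fun t => lc (lie_exp G (W t))) @ F --> (0 : 'rV[R]_n).
  have nW : (fun t => `|W t|) @ F --> (0 : R) by rewrite -(@normr0 _ 'rV[R]_n); exact: cvg_norm.
  apply/norm_cvg0P; apply: (@squeeze_cvgr _ _ _ _ (cst 0) (fun t => `|W t| + C * (`|W t| * `|W t|))).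
  - apply: filterS Wrho => t /E[_ e] /=; rewrite normr_ge0/=.
    rewrite -[lc _](subrK (W t)); apply: le_trans (ler_normD _ _) _.
    by rewrite addrC lerD2l -expr2.
  - exact: cvg_cst.
  - have e0 : 0 = 0 + C * (0 * 0) :> R by rewrite !mulr0 addr0.
    rewrite [X in _ --> X]e0.
    apply: cvgD => //; apply: cvgM; first exact: cvg_cst.
    exact: cvgM.
have h : (fun t => li G (lc (lie_exp G (W t)))) @ F --> (1%g : G).
  by rewrite -(@li0 R n G); apply: li_cvg => //; apply: De; rewrite normr0.
apply: cvg_trans h; apply: near_eq_cvg; apply: filterS Wrho => t /E[dt _] /=.
by rewrite lcK.
Qed.

End Continuity.

Lemma open_subgroup_full (R : realType) n (G : lieGroupType R n) (H : set G) :
  connected [set: G] -> subgroup H -> nbhs (1%g : G) H -> H = setT.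
Proof.
move=> Gc [H1 HM HV] nH.
have tr (x : G) : (fun y => x^-1 * y)%g @ x --> (1%g : G).
  rewrite -(mulVg x); apply: (cvg_mulg (FF := nbhs_filter x)); [exact: cvg_cst|exact: cvg_id].
apply: Gc.
- by exists 1%g.
- exists H; last by rewrite setTI.
  rewrite openE => x Hx; have h : nbhs x [set y | H (x^-1 * y)%g] := tr x _ nH.
  apply: filterS h => y /(HM _ _ Hx); by rewrite mulVKg.
- exists H; last by rewrite setTI.
  move=> x clx; have [y [Hy xy]] := clx _ (tr x _ nH).
  have : H (y * (x^-1 * y)^-1)%g by apply: HM => //; exact: HV.
  by rewrite invgM invgK mulVKg.
Qed.

(* An equivariant map [rv] from [G/P] to the lines of [R^d], with a dual map
   [rf]: the hyperplane [rf g] contains the line [rv h] when the flags of [g]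
   and [h] are not transverse. *)
Record flag_model (R : realType) (n : nat) (G : lieGroupType R n) (D : cartan_data G)
    (theta : set (dual (cd_a D))) := FlagModel {
  fm_dim : nat;
  rp : G -> 'M[R]_fm_dim;
  rv : G -> 'cV[R]_fm_dim;
  rf : G -> 'rV[R]_fm_dim;
  rt : 'rV[R]_fm_dim;
  rpM : forall g h, rp (g * h)%g = rp g *m rp h;
  rp1 : rp 1%g = 1%:M;
  rvM : forall g h, rv (g * h)%g = rp g *m rv h;
  rv_span : forall x : 'rV[R]_fm_dim, (forall g, x *m rv g = 0) -> x = 0;
  rv_parabolic : forall p, parabolic theta p -> exists2 c : R, 0 < c &
    forall g, rv (g * p)%g = c *: rv g /\ rf (g * p)%g = c *: rf g;
  rv_line : forall g h c, rv g = c *: rv h -> parabolic theta (h^-1 * g)%g;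
  rf_rp : forall g h, rf (g * h)%g *m rp g = rf h;
  rf_ge0 : forall g h, 0 <= (rf g *m rv h) 0 0;
  rf_sym : forall g h, (rf g *m rv h) 0 0 = (rf h *m rv g) 0 0;
  rf_k0 : 0 < (rf (cd_k0 D) *m rv 1%g) 0 0;
  rf_self : (0 < #|nil_index theta|)%N -> forall g, (rf g *m rv g) 0 0 = 0;
  rt_gt0 : forall g, 0 < (rt *m rv g) 0 0;
  rp_continuous : continuous rp;
  rv_continuous : continuous rv;
  rf_continuous : continuous rf
}.

Lemma flag_model_ex (R : realType) (n : nat) (G : lieGroupType R n) (D : cartan_data G)
    (theta : set (dual (cd_a D))) :
  theta `<=` simple_roots (cd_pos D) -> symmetric_roots theta -> inhabited (flag_model theta).
Proof.
move=> th1 th2; constructor; apply: (@FlagModel _ _ _ _ _ _ (@rep R n G D theta)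
  (@rep_vec R n G D theta) (@rep_form R n G D theta) (@rep_trace R n G D theta)).
- exact: repM.
- exact: rep1.
- exact: rep_vecM.
- exact: rep_vec_span.
- exact: rep_vec_parabolic.
- exact: rep_vec_line.
- exact: rep_form_rep.
- by move=> g h; rewrite rep_form_vec; exact: pairing_ge0.
- by move=> g h; rewrite !rep_form_vec pairingC.
- by rewrite rep_form_vec pairingC; exact: pairing_k0.
- by move=> k0 g; rewrite rep_form_vec; exact: pairing_self.
- exact: rep_trace_gt0.
- exact: rep_continuous.
- exact: rep_vec_continuous.
- exact: rep_form_continuous.
Qed.

(** * Contraction by the Cartan part and its rank one limit *)

Section Contraction.
Context (R : realType) (n : nat) (G : lieGroupType R n) (D : cartan_data G).
Local Notation a := (cd_a D).
Local Notation chamber := (weyl_chamber (cd_pos D)).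
Local Notation k0 := (cd_k0 D).
Local Notation exp := (lie_exp G).
Context (theta : set (dual a)) (L : flag_model theta).
Hypothesis Gc : connected [set: G].
Local Notation P := (parabolic theta).
Local Notation d := (fm_dim L).
Local Notation rv := (rv L).
Local Notation rf := (rf L).
Local Notation rp := (rp L).
Implicit Types (X Y : 'rV[R]_n).

Lemma Ad_exp_wb X i : X \in a -> Ad (exp X) (row i (wb D)) = expR (ev (wt D i) X) *: row i (wb D).
Proof.
move=> Xa; set mu := ev _ X; have := wb_lie i Xa; rewrite -/mu.
move: (row i (wb D)) => w wE.
have ed t : is_derive t (1 : R) (fun t => expR (mu * t)) (mu * expR (mu * t)).
  have d1 := is_derive_mul (is_derive_cst mu t (1 : R)) (is_derive_id t (1 : R)).
  rewrite mul0r add0r mulr1 in d1.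
  by have := is_derive1_comp (is_derive_expR (mu * t)) d1; rewrite mulrC.
pose f (t : R) := Ad (exp (t *: X)) w - expR (mu * t) *: w.
have fd t : is_derive t (1 : R) f (f t *m mu%:M).
  apply: is_derive_mx => l j.
  have d1 := is_derive_entry l j (Ad_exp_derive G X w t).
  have d2 := is_derive_mul (ed t) (is_derive_cst (w l j) t (1 : R)).
  rewrite mulr0 addr0 in d2.
  have -> : (fun s => f s l j) = (fun s => Ad (exp (s *: X)) w l j) - (fun s => expR (mu * s) * w l j).
    by apply/funext => s; rewrite /f !mxE.
  apply: is_derive_eq (is_deriveB d1 d2) _.
  rewrite wE -!Ad_mxE -scalemxAl mul_mx_scalar /f Ad_mxE.
  by rewrite [LHS]/= !mxE mulrBr mulrA.
have f0 : f 0 = 0.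
  by rewrite /f scale0r exp0 Ad1 mulr0 expR0 scale1r subrr.
have aC (t : R) l j : 0 <= t <= 1 -> `|(mu%:M : 'M[R]_n) l j| <= `|mu|.
  by move=> _; rewrite mxE; case: eqP => _; rewrite ?mulr1n// mulr0n normr0.
have := @linear_ode_zero R _ _ f (fun=> mu%:M) 1 `|mu| (fun t _ => fd t) aC f0 1.
rewrite ler01 lexx => /(_ isT) /eqP; rewrite /f subr_eq0 scale1r mulr1 => /eqP //.
Qed.

Lemma parabolic_exp_a X : X \in a -> P (exp X).
Proof.
move=> Xa; apply: parabolic_exp => i gi.
apply/eqP; apply: contraTT gi => Xi; rewrite -leNgt.
have Ha := @theta_coweight_a R n G D theta.
have e : lie G (theta_coweight theta) X = 0 *: X by rewrite scale0r (a_abelian (D := D)).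
by rewrite /grade (co_eigen Ha e Xi).
Qed.

(** Takes the place of analytic continuation. Let W be the largest space of functionals that
    annihilate [rv] near 1, for all such neighbourhoods at once. Shrinking the neighbourhood shows
    that W is stable under [rp h] for h near 1, hence for all h by connectedness; so W annihilates
    every [rv g]. *)
Lemma rv_ann_nbhs (O : set G) (x : 'rV[R]_d) : nbhs (1%g : G) O ->
  (forall g, O g -> x *m rv g = 0) -> x = 0.
Proof.
pose ann (O : set G) (x : 'rV[R]_d) := forall g, O g -> x *m rv g = 0.
have annW (O' : set G) : exists W : {vspace 'rV[R]_d}, forall x, x \in W <-> ann O' x.
  apply: vspace_of_linear_set => [g _|c u v hu hv g Og]; first by rewrite mul0mx.
  by rewrite mulmxDl -scalemxAl hu// hv// scaler0 addr0.
pose good m := `[< exists (O' : set G) (W : {vspace 'rV[R]_d}),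
  [/\ nbhs (1%g : G) O', forall x, x \in W <-> ann O' x & \dim W = m] >].
have ex : exists m, good m.
  have [W WE] := annW setT; exists (\dim W); apply/asboolP; exists setT, W.
  by split=> //; exact: filterT.
have bd m : good m -> (m <= \dim {:'rV[R]_d})%N.
  by move=> /asboolP[V [W [_ _ <-]]]; apply: dimvS; exact: subvf.
have [m /asboolP[V1 [W [nV1 WE Wm]]] mmax] := ex_maxnP ex bd.
have key O' y : nbhs (1%g : G) O' -> ann O' y -> y \in W.
  move=> nO' yO'; have [W' W'E] := annW (O' `&` V1).
  have sub : (W <= W')%VS.
    by apply/subvP => z /WE zO; apply/W'E => g [_ /zO].
  have /eqP -> : W == W'.
    rewrite eqEdim sub/= Wm; apply: mmax; apply/asboolP; exists (O' `&` V1), W'.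
    by split=> //; exact: filterI.
  by apply/W'E => g [/yO'].
move=> nO xO; have {xO nO} xW : x \in W := key _ _ nO xO.
have [[A B] /= [nA nB] AB] : exists2 AB : set G * set G, nbhs (1%g : G) AB.1 /\ nbhs (1%g : G) AB.2 &
    forall p : G * G, (AB.1 `*` AB.2) p -> V1 (p.1 * p.2)%g.
  have := @lie_mul_continuous R n G (1%g, 1%g); rewrite /continuous_at /= mulg1 => /(_ _ nV1).
  by move=> [[A B] /= [nA nB] AB]; exists (A, B).
have Ast h y : A h -> y \in W -> y *m rp h \in W.
  move=> Ah /WE yO; apply: (key B) => // b Bb.
  by rewrite -mulmxA -rvM; apply: yO; exact: (AB (h, b)).
pose H := [set h : G | forall y, y \in W -> y *m rp h \in W /\ y *m rp (h^-1)%g \in W].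
have Hgrp : subgroup H.
  split=> [y yW|g h gH hH y yW|g gH y yW].
  - by rewrite invg1 rp1 mulmx1.
  - rewrite invgM !rpM !mulmxA; have [h1 h2] := gH _ yW; have [h3 h4] := hH _ yW.
    by split; [have [] := hH _ h1|have [] := gH _ h4].
  - by rewrite invgK; have [] := gH _ yW.
have nH : nbhs (1%g : G) H.
  have nA' : nbhs (1%g : G) [set h | A (h^-1)%g].
    have := @lie_inv_continuous R n G 1%g; rewrite /continuous_at invg1; exact.
  by apply: filterS (filterI nA nA') => h [h1 h2] y yW; split; exact: Ast.
have HT := open_subgroup_full Gc Hgrp nH.
apply: rv_span => g.
have : H g by rewrite HT.
move=> /(_ _ xW)[/WE + _] => /(_ 1%g (nbhs_singleton nV1)).
by rewrite -mulmxA -rvM mulg1.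
Qed.

(** The opposite nilradical; [S] is the unipotent group generated by its exponentials. *)
Let nm Y := forall i, 0 <= grade theta i -> co D Y 0 i = 0.
Let S := generated (exp @` nm).

Lemma generated_subgroup (G' : groupType) (A : set G') : subgroup (generated A).
Proof.
split=> [H [] //|x y hx hy H Hg AH|x hx H Hg AH].
- by case: (Hg) => _ HM _; apply: HM; [exact: hx|exact: hy].
- by case: (Hg) => _ _ HV; apply: HV; exact: hx.
Qed.

(** The Newton iteration shows that elements near 1 are products of an element of the closure of S
    and one of P. Since P only rescales [rv], a functional vanishing on S vanishes near 1. *)
Lemma rv_ann_opposite (x : 'rV[R]_d) :
  (forall y, S y -> x *m rv y = 0) -> x = 0.
Proof.
move=> xS.
have Sgrp : subgroup S := generated_subgroup _.
pose neg : 'M[R]_n := diag_mx (\row_(i < n) (if grade theta i < 0 then 1 else 0 : R)).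
pose A := - (invmx (wb D) *m neg *m wb D); pose B := - (1%:M + A).
have dec X : exists Y Z, [/\ X = - (Y + Z), nm Y,
    [set Z | forall i, grade theta i < 0 -> co D Z 0 i = 0] Z,
    `|Y| <= Num.max (n%:R * `|A|) (n%:R * `|B|) * `|X| &
    `|Z| <= Num.max (n%:R * `|A|) (n%:R * `|B|) * `|X|].
  exists (X *m A), (X *m B).
  have coA i : co D (X *m A) 0 i = - (co D X 0 i * (if grade theta i < 0 then 1 else 0)).
    rewrite /co /A mulmxN mulNmx !mulmxA mulmxK ?wb_unit// mxE; congr (- _).
    by rewrite mul_mx_diag !mxE.
  split.
  - by rewrite -mulmxDr /B opprD addrCA subrr addr0 mulmxN mulmx1 opprK.
  - by move=> i gi; rewrite coA ltNge gi /= mulr0 oppr0.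
  - move=> i gi; rewrite /= /B mulmxN mulmxDr mulmx1 -scaleN1r coZ coD.
    rewrite mxE [X in _ * X]mxE coA gi mulr1 subrr mulr0//.
  - apply: le_trans (mulmx_norm_le _ _) _; rewrite mulrAC ler_wpM2r//.
    by rewrite le_max lexx.
  - apply: le_trans (mulmx_norm_le _ _) _; rewrite mulrAC ler_wpM2r//.
    by rewrite le_max lexx orbT.
have expS Y : nm Y -> S (exp Y).
  by move=> Yn H _; apply; exists Y.
have [delta d0 nb] := newton_nbhs Sgrp (parabolic_subgroup theta) expS (@parabolic_exp R n G D theta) dec.
apply: (@rv_ann_nbhs [set g | cdom (chart_id G) g /\ `|lc g| <= delta]).
  near=> g; split; first by near: g; apply: nbhs_cdom; exact: chart_id1.
  near: g; have /cvgrPdist_le/(_ _ d0) := @lc_cvg1 R n G.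
  by apply: filterS => g; rewrite sub0r normrN.
move=> g [dg lg]; have [k [p [Sk Pp ->]]] := nb _ dg lg.
rewrite -((closure_id P).1 (@parabolic_closed R n G D theta)) in Pp.
have [c _ /(_ k)[-> _]] := rv_parabolic L Pp.
rewrite -scalemxAr.
have cl : closed [set h : G | x *m rv h = 0].
  have -> : [set h : G | x *m rv h = 0] = (fun h => x *m rv h) @^-1` [set 0] by [].
  apply: closed_comp; last by apply: accessible_closed_set1; exact/hausdorff_accessible/norm_hausdorff.
  move=> h _; apply: (cvg_mulmx (FF := nbhs_filter h)); first exact: cvg_cst.
  exact: rv_continuous.
have : closure S `<=` [set h : G | x *m rv h = 0].
  by rewrite [X in _ `<=` X](closure_id _).1//; apply: closure_subset => y /xS.
by move=> /(_ k Sk) /= ->; rewrite scaler0.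
Unshelve. all: by end_near. Qed.

(** For y in S, exp X y is the conjugate of y by exp X times exp X. The conjugate tends to 1, and
    exp X scales [rv 1] by b; so the operators divided by b send each [rv y] to a vector tending to
    [rv 1]. As these vectors span, the operators converge to some [rv 1 *m r]. *)
Lemma rp_contraction (T : Type) (F : set_system T) {FF : ProperFilter F} (X : T -> 'rV[R]_n) :
  (forall t, chamber (X t)) -> (forall beta, theta beta -> (fun t => ev beta (X t)) @ F --> +oo) ->
  exists (c : T -> R) (b : R), [/\ forall t, 0 < c t, 0 < b &
    (fun t => c t *: rp (exp (X t))) @ F --> b *: (rv 1%g *m rf k0)].
Proof.
move=> Xc Xoo.
have Xa t : X t \in a by case: (Xc t).
have bt t : {b | 0 < b & rv (exp (X t)) = b *: rv 1%g}.
  apply: cid2; have [b b0 /(_ 1%g)[e _]] := rv_parabolic L (parabolic_exp_a (Xa t)).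
  by exists b => //; rewrite -e mul1g.
pose b t := s2val (bt t); have b0 t : 0 < b t := s2valP (bt t).
have bE t : rv (exp (X t)) = b t *: rv 1%g := s2valP' (bt t).
have contr_weight i : grade theta i < 0 -> (fun t => expR (ev (wt D i) (X t))) @ F --> (0 : R).
  move=> gi.
  have rN : roots G (- wt D i) by apply/rootsN/(grade_root (theta := theta)); rewrite lt_eqF.
  have [_ [j jE]] := (rootsP _).1 rN.
  have gj : 0 < grade theta j by rewrite /grade jE evN oppr_gt0.
  have [beta tb bX] := grade_gap gj.
  apply: (@squeeze_cvgr _ _ _ _ (cst 0) (fun t => expR (- ev beta (X t)))).
  - apply: filterE => t; rewrite /= expR_ge0/= ler_expR lerNr -evN -jE.
    exact: bX.
  - exact: cvg_cst.
  - have h := Xoo _ tb.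
    exact: (cvg_comp _ _ h (@cvgr_expR R)).
pose conj y t := (exp (X t) * y * (exp (X t))^-1)%g.
pose H := [set y : G | conj y @ F --> (1%g : G)].
have Hgrp : subgroup H.
  split=> [|x y hx hy|x hx]; rewrite /H /=.
  - have -> : conj 1%g = cst 1%g by apply/funext => t; rewrite /conj mulg1 mulgV.
    exact: cvg_cst.
  - have -> : conj (x * y)%g = (fun t => conj x t * conj y t)%g.
      by apply/funext => t; rewrite /conj !mulgA mulgVK.
    by rewrite -[X in _ --> X]mulg1; exact: cvg_mulg.
  - have -> : conj (x^-1)%g = (fun t => (conj x t)^-1)%g.
      by apply/funext => t; rewrite /conj !invgM invgK mulgA.
    by rewrite -[X in _ --> X]invg1; exact: cvg_invg.
have expH Y : nm Y -> H (exp Y).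
  move=> Yn; rewrite /H /=.
  have -> : conj (exp Y) = (fun t => exp (Ad (exp (X t)) Y)).
    by apply/funext => t; rewrite lie_exp_conj.
  apply: lie_exp_cvg1.
  have -> : (fun t => Ad (exp (X t)) Y) =
     (fun t => (\row_i (co D Y 0 i * expR (ev (wt D i) (X t)))) *m wb D).
    apply/funext => t; rewrite {1}(co_sum D Y) -Ad_mxE mulmx_suml mulmx_sum_row.
    by apply: eq_bigr => i _; rewrite -scalemxAl Ad_mxE Ad_exp_wb// scalerA mxE.
  rewrite -[X in _ --> X](mul0mx _ (wb D)); apply: cvg_mulmx; last exact: cvg_cst.
  apply: cvg_mx => l i; rewrite [X in _ --> X]mxE; under eq_fun do rewrite mxE.
  have [/Yn ->|gi] := leP 0 (grade theta i).
    by under eq_fun do rewrite mul0r; exact: cvg_cst.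
  by rewrite -(mulr0 (co D Y 0 i)); apply: cvgM; [exact: cvg_cst|exact: contr_weight].
have SH y : S y -> H y.
  by apply => // _ [Y Yn <-]; exact: expH.
pose M t := (b t)^-1 *: rp (exp (X t)).
have Mrv y : S y -> (fun t => M t *m rv y) @ F --> rv 1%g.
  move=> /SH yH.
  have -> : (fun t => M t *m rv y) = (fun t => rp (conj y t) *m rv 1%g).
    apply/funext => t; have e : rp (exp (X t)) *m rv y = rp (conj y t) *m rv (exp (X t)).
      by rewrite -(rvM L (exp (X t)) y) -(rvM L (conj y t)) /conj mulgVK.
    by rewrite /M -scalemxAl e bE -scalemxAr scalerA mulVf ?scale1r// gt_eqF.
  rewrite -[X in _ --> X]mul1mx -(rp1 L); apply: cvg_mulmx; last exact: cvg_cst.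
  exact: (cvg_comp _ _ yH (@rp_continuous _ _ _ _ _ L 1%g)).
(* Finitely many elements of S already give a spanning set, so convergence of the operators reduces
   to convergence on these vectors. *)
have [m [y [C [yE _]]]] := span_coordinates (fun y : {y : G | S y} => (rv (sval y))^T).
pose J := \matrix_j (rv (sval (y j)))^T.
have Jfull : row_full J.
  rewrite -sub1mx; rewrite submxE mul1mx; apply/eqP/trmx_inj; rewrite trmx0.
  apply/row_matrixP => i; rewrite row0; apply: rv_ann_opposite => z Sz.
  apply: trmx_inj; rewrite trmx_mul trmx0 tr_row trmxK.
  have : ((rv z)^T <= J)%MS.
    rewrite (yE (exist _ z Sz)); apply: summx_sub => j _; apply: scalemx_sub.
    have -> : (rv (sval (y j)))^T = row j J by rewrite rowK.
    exact: row_sub.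
  by move=> /submxP[u ->]; rewrite colE mulmxA -(mulmxA u) mulmx_coker mulmx0 mul0mx.
have [B BJ] := row_fullP Jfull.
pose r := const_mx 1 *m B^T : 'rV[R]_d.
have Mlim : M @ F --> rv 1%g *m r.
  have JB : J^T *m B^T = 1%:M by rewrite -trmx_mul BJ trmx1.
  have -> : M = (fun t => M t *m J^T *m B^T) by apply/funext => t; rewrite -mulmxA JB mulmx1.
  rewrite /r mulmxA; apply: cvg_mulmx; last exact: cvg_cst.
  apply: cvg_mx => i j.
  have -> : (rv 1%g *m const_mx 1) i j = rv 1%g i 0.
    by rewrite mxE big_ord1 mxE mulr1.
  have -> : (fun t => (M t *m J^T) i j) = (fun t => (M t *m rv (sval (y j))) i 0).
    apply/funext => t; rewrite !mxE; apply: eq_bigr => l _.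
    by rewrite !mxE.
  by apply: cvg_entry; apply: Mrv; exact: svalP (y j).
(* [rf k0] is a left eigenvector, and its eigenvalue is b t because its value at the right
   eigenvector [rv 1] is nonzero. In the limit this identifies r as a multiple of [rf k0]. *)
have sE t : rf k0 *m M t = rf k0.
  have Pk : P (k0^-1 * exp (- X t) * k0)%g.
    have := lie_exp_conj (k0^-1)%g (- X t); rewrite invgK => <-.
    apply: parabolic_exp_a; apply: (normalizer_a _).2; rewrite rpredN.
    exact: Xa.
  have [c c0 /(_ k0)[_ e]] := rv_parabolic L Pk.
  have e1 : rf k0 *m rp (exp (X t)) = c *: rf k0.
    rewrite -e; have -> : (k0 * (k0^-1 * exp (- X t) * k0) = (exp (X t))^-1 * k0)%g.
      by rewrite !mulgA mulgV mul1g lie_expN.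
    by rewrite -[in LHS](mulVKg (exp (X t)) k0) rf_rp.
  have s0 : (rf k0 *m rv 1%g) 0 0 != 0.
    by rewrite gt_eqF//; exact: rf_k0.
  have : c * (rf k0 *m rv 1%g) 0 0 = b t * (rf k0 *m rv 1%g) 0 0.
    have := congr1 (fun A => (A *m rv 1%g) 0 0) e1; rewrite -mulmxA -rvM mulg1 bE.
    by rewrite -scalemxAr -scalemxAl mxE [in RHS]mxE => ->.
  move=> /(mulIf s0) cb; rewrite /M -scalemxAr e1 cb scalerA mulVf ?scale1r// gt_eqF//.
pose s1 := (rf k0 *m rv 1%g) 0 0.
have s10 : 0 < s1 by exact: rf_k0.
exists (fun t => (b t)^-1), s1^-1; split=> [t||]; rewrite ?invr_gt0//.
have rE : s1 *: r = rf k0.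
  have h1 : (fun t => rf k0 *m M t) @ F --> rf k0 *m (rv 1%g *m r).
    by apply: cvg_mulmx => //; exact: cvg_cst.
  have h2 : (fun t => rf k0 *m M t) @ F --> rf k0.
    by under eq_fun do rewrite sE; exact: cvg_cst.
  have := cvg_unique (@norm_hausdorff _ _) h1 h2.
  rewrite mulmxA => <-; have -> : rf k0 *m rv 1%g = s1%:M by apply/matrixP => i j; rewrite !ord1 [RHS]mxE eqxx mulr1n.
  by rewrite mul_scalar_mx.
by rewrite -rE -scalemxAr scalerA mulVf ?gt_eqF// scale1r.
Qed.

End Contraction.

(** * Flags and dynamics *)

Section Functional.
Context (R : realType) (d : nat).
Implicit Types (x y : 'rV[R]_d) (v w : 'cV[R]_d).

Definition app x v : R := (x *m v) 0 0.

Lemma app_mx x v : x *m v = (app x v)%:M.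
Proof. by apply/matrixP => i j; rewrite !ord1 [RHS]mxE eqxx mulr1n. Qed.

Lemma appDr x v w : app x (v + w) = app x v + app x w.
Proof. by rewrite /app mulmxDr mxE. Qed.

Lemma appZr x c v : app x (c *: v) = c * app x v.
Proof. by rewrite /app -scalemxAr mxE. Qed.

Lemma appNr x v : app x (- v) = - app x v.
Proof. by rewrite -scaleN1r appZr mulN1r. Qed.

Lemma appZl x c v : app (c *: x) v = c * app x v.
Proof. by rewrite /app -scalemxAl mxE. Qed.

Lemma app0r x : app x 0 = 0.
Proof. by rewrite /app mulmx0 mxE. Qed.

Lemma app_sumr x (I : Type) (r : seq I) (F : I -> 'cV[R]_d) :
  app x (\sum_(i <- r) F i) = \sum_(i <- r) app x (F i).
Proof. by rewrite /app mulmx_sumr summxE. Qed.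

Lemma app_cvg (T : Type) (F : set_system T) {FF : Filter F} (x : T -> 'rV[R]_d) (v : T -> 'cV[R]_d) x0 v0 :
  x @ F --> x0 -> v @ F --> v0 -> (fun t => app (x t) (v t)) @ F --> app x0 v0.
Proof. by move=> hx hv; apply: cvg_entry; exact: cvg_mulmx. Qed.

End Functional.

Lemma cvg_eq_inj (X Y : topologicalType) (f : X -> Y) (T : Type) (F : set_system T)
    {FF : ProperFilter F} (u : T -> X) (x y : X) :
  hausdorff_space Y -> continuous f -> injective f -> u @ F --> x -> u @ F --> y -> x = y.
Proof.
move=> hY fc fi ux uy; apply: fi.
exact: (cvg_unique hY (cvg_comp _ _ ux (fc x)) (cvg_comp _ _ uy (fc y))).
Qed.

Lemma ultra_finite (T I : Type) (U : set_system T) (f : T -> I) (A : set I) :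
  UltraFilter U -> finite_set A -> U [set t | A (f t)] -> exists i, U [set t | f t = i].
Proof.
move=> UU fA UA; apply: contrapT => no.
have h (s : seq {classic I}) : U [set t | (f t : {classic I}) \in s] -> False.
  elim: s => [|i s IH] Us.
    by apply: (@filter_not_empty _ U _); apply: filterS Us.
  have [h|h] := in_ultra_setVsetC [set t | f t = i] UU; first by apply: no; exists i.
  apply: IH; apply: filterS (filterI Us h) => t [] /=.
  by rewrite inE => /predU1P[].
have [s As] := (@finite_seqP {classic I} A).1 fA.
by apply: (h s); apply: filterS UA => t /=; rewrite As.
Qed.

Section Flags.
Context (R : realType) (n : nat) (G : lieGroupType R n) (D : cartan_data G).
Local Notation a := (cd_a D).
Local Notation K := (cd_K D).
Local Notation chamber := (weyl_chamber (cd_pos D)).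
Local Notation k0 := (cd_k0 D).
Local Notation exp := (lie_exp G).
Context (theta : set (dual a)) (L : flag_model theta).
Local Notation P := (parabolic theta).
Local Notation d := (fm_dim L).
Local Notation rv := (rv L).
Local Notation rf := (rf L).
Local Notation rp := (rp L).
Local Notation rt := (rt L).
Local Notation mkf := (@mkflag R n G D theta).

Lemma mkflag_eq (g h : G) : mkf g = mkf h <-> P (h^-1 * g)%g.
Proof.
have [P1 PM PV] := parabolic_subgroup theta.
split=> [/eqmodP/asboolP e|Phg].
  have : lcoset_set P g g by exists 1%g; rewrite ?mulg1.
  by rewrite e => -[p Pp <-]; rewrite mulKg.
apply/eqmodP/asboolP/seteqP; split=> _ [p Pp <-].
  by exists (h^-1 * g * p)%g; [exact: PM|rewrite !mulgA mulgV mul1g].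
exists ((h^-1 * g)^-1 * p)%g; first exact: (PM _ _ (PV _ Phg) Pp).
by rewrite invgM invgK !mulgA mulgV mul1g.
Qed.

Lemma mkflag_repr (F : flag theta) : mkf (repr F) = F.
Proof. exact: reprK. Qed.

Lemma repr_mkflag g : exists2 p, P p & repr (mkf g) = (g * p)%g.
Proof.
exists (g^-1 * repr (mkf g))%g; last by rewrite mulVKg.
by apply/mkflag_eq; rewrite mkflag_repr.
Qed.

Lemma flag_act_mkflag (g h : G) : flag_act g (mkf h) = mkf (g * h)%g.
Proof.
apply/mkflag_eq; have [p Pp ->] := repr_mkflag h.
by rewrite (mulgA g) mulKg.
Qed.

Lemma mkflag_continuous : continuous mkf.
Proof. exact: pi_continuous. Qed.

Lemma rv_neq0 g : rv g != 0.
Proof.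
by apply/eqP => e; have := rt_gt0 L g; rewrite e mulmx0 mxE ltxx.
Qed.

Definition nv g := (app rt (rv g))^-1 *: rv g.

Lemma nvE g : rv g = app rt (rv g) *: nv g.
Proof. by rewrite /nv scalerA divff ?scale1r// gt_eqF//; exact: rt_gt0. Qed.

Lemma rt_nv g : app rt (nv g) = 1.
Proof. by rewrite appZr mulVf// gt_eqF//; exact: rt_gt0. Qed.

Lemma nv_parabolic g p : P p -> nv (g * p)%g = nv g.
Proof.
move=> /(rv_parabolic L)[c c0 /(_ g)[e _]].
rewrite /nv e appZr scalerA; congr (_ *: _).
by rewrite invfM mulrAC mulVf ?mul1r// gt_eqF.
Qed.

(** Normalizing by the trace selects one vector on each line. The resulting continuous injection
    into a vector space gives uniqueness of limits for the quotient topology on flags. *)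
Definition tn (F : flag theta) := nv (repr F).

Lemma tn_mkflag g : tn (mkf g) = nv g.
Proof. by rewrite /tn; have [p Pp ->] := repr_mkflag g; exact: nv_parabolic. Qed.

Lemma nv_continuous : continuous nv.
Proof.
move=> g; have FF := nbhs_filter g.
have h : rv @ g --> rv g := @rv_continuous _ _ _ _ _ L g.
apply: cvgZ => //; apply: cvgV; first by rewrite gt_eqF//; exact: rt_gt0.
by apply: app_cvg => //; exact: cvg_cst.
Qed.

Lemma tn_continuous : continuous tn.
Proof.
apply: repr_comp_continuous; first exact: nv_continuous.
move=> g h /eqP e; apply/eqP; rewrite -!tn_mkflag; congr tn; exact: e.
Qed.

Lemma tn_inj : injective tn.
Proof.
move=> F F'; rewrite -(mkflag_repr F) -(mkflag_repr F') !tn_mkflag => e.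
apply/mkflag_eq; apply: (@rv_line _ _ _ _ _ L _ _ (app rt (rv (repr F)) / app rt (rv (repr F')))).
by rewrite {1}(nvE (repr F)) e /nv scalerA.
Qed.

Hypothesis Gc : connected [set: G].

Lemma flag_compact (F : flag theta) : exists2 k, K k & F = mkf k.
Proof.
have [k [p [Kk Pp e]]] := KP_factorization theta Gc (repr F).
exists k => //; rewrite -(mkflag_repr F) e; apply/mkflag_eq.
by rewrite mulKg.
Qed.

Lemma flag_ultra (T : Type) (U : set_system T) (F : T -> flag theta) :
  UltraFilter U -> exists F0 : flag theta, F @ U --> F0.
Proof.
move=> UU.
have [k kP] := choice (fun t => (let: ex_intro2 k kK kE := flag_compact (F t) in
  ex_intro (fun k => K k /\ F t = mkf k) k (conj kK kE))).
have [_ Kc _] := cd_K_maximal D.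
have [k1 Kk1 kc] : exists2 p, K p & k @ U --> p.
  by apply: (compact_ultra_cvg UU Kc); apply: filterE => t; case: (kP t).
exists (mkf k1); have -> : F = mkf \o k by apply/funext => t; case: (kP t).
exact: (cvg_comp _ _ kc (@mkflag_continuous k1)).
Qed.

Lemma flag_cvg_eq (T : Type) (F : set_system T) {FF : ProperFilter F} (u : T -> flag theta) (x y : flag theta) :
  u @ F --> x -> u @ F --> y -> x = y.
Proof. exact: (cvg_eq_inj (@norm_hausdorff _ _) tn_continuous tn_inj). Qed.

(** By compactness u converges along every finer ultrafilter, and [tn] being injective identifies
    the limit. *)
Lemma tn_cvg (T : Type) (F : set_system T) {FF : Filter F} (u : T -> flag theta) (x : flag theta) :
  (fun t => tn (u t)) @ F --> tn x -> u @ F --> x.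
Proof.
move=> h; apply: cvg_ultra => H HU sub.
have [y uy] := flag_ultra u HU.
suff <- : y = x by [].
apply: tn_inj; apply: (cvg_unique (@norm_hausdorff _ _) (F := (fun t => tn (u t)) @ H)).
  exact: (cvg_comp _ _ uy (@tn_continuous y)).
by apply: cvg_trans h => A; exact: sub.
Qed.

Lemma tn_bounded : exists C : R, forall g, `|nv g| <= C.
Proof.
have [_ Kc _] := cd_K_maximal D.
have : compact (nv @` K).
  by apply: continuous_compact => //; apply: continuous_subspaceT; exact: nv_continuous.
move=> /compact_bounded[C [_ hC]]; exists (C + 1) => g.
apply: (hC (C + 1)); first by rewrite ltrDl.
have [k Kk e] := flag_compact (mkf g); exists k => //.
by rewrite -!tn_mkflag e.
Qed.

Lemma rf_neq0 g : exists u, 0 < app (rf g) u.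
Proof.
exists (rv (g * k0)%g); rewrite /app rf_sym.
rewrite -[X in rf _ *m rv X]mulg1 rvM mulmxA.
rewrite rf_rp; exact: rf_k0.
Qed.

Lemma transverse_gt0 (g h : G) : transverse (mkf g) (mkf h) -> 0 < app (rf g) (rv h).
Proof.
move=> [x []]; rewrite !flag_act_mkflag mulg1.
move=> /mkflag_eq /(rv_parabolic L)[c c0 /(_ x)[_ e1]] /mkflag_eq /(rv_parabolic L)[c' c'0 /(_ (x * k0)%g)[e2 _]].
move: e1 e2; rewrite !mulgA mulgV mul1g -mulgA mulVKg => -> ->.
rewrite appZl appZr !mulr_gt0// /app rf_sym -[X in rf _ *m rv X]mulg1 rvM mulmxA rf_rp.
exact: rf_k0.
Qed.

Lemma rf_flag g h : mkf g = mkf h -> exists2 c, 0 < c & rf g = c *: rf h.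
Proof.
move=> /mkflag_eq /(rv_parabolic L)[c c0 /(_ h)[_ e]]; exists c => //.
by rewrite -e mulVKg.
Qed.

Lemma rv_flag g h : mkf g = mkf h -> exists2 c, 0 < c & rv g = c *: rv h.
Proof.
move=> /mkflag_eq /(rv_parabolic L)[c c0 /(_ h)[e _]]; exists c => //.
by rewrite -e mulVKg.
Qed.

(* [rp (gam t)], suitably normalized, converges to the rank one map with image
   [rv m] and kernel [rf m']. *)
Definition rank_one_limit (T : Type) (F : set_system T) (gam : T -> G) (m m' : G) :=
  exists (c : T -> R) (b : R), [/\ forall t, 0 < c t, 0 < b &
    (fun t => c t *: rp (gam t)) @ F --> b *: (rv m *m rf m')].

Lemma rank_one_apply (T : Type) (F : set_system T) {FF : Filter F} (gam : T -> G) m m'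
    (z : T -> 'cV[R]_d) z0 (c : T -> R) b :
  (fun t => c t *: rp (gam t)) @ F --> b *: (rv m *m rf m') -> z @ F --> z0 ->
  (fun t => c t *: (rp (gam t) *m z t)) @ F --> (b * app (rf m') z0) *: rv m.
Proof.
move=> h zc.
have h1 : (fun t => c t *: rp (gam t) *m z t) @ F --> b *: (rv m *m rf m') *m z0.
  exact: cvg_mulmx.
move: h1; rewrite -scalemxAl -mulmxA app_mx mul_mx_scalar scalerA.
by under eq_fun do rewrite -scalemxAl.
Qed.

Lemma cartan_rank_one (T : Type) (F : set_system T) {FF : ProperFilter F}
    (m l : T -> G) (X : T -> 'rV[R]_n) m0 l0 :
  m @ F --> m0 -> l @ F --> l0 -> (forall t, chamber (X t)) ->
  (forall beta, theta beta -> (fun t => ev beta (X t)) @ F --> +oo) ->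
  rank_one_limit F (fun t => m t * exp (X t) * l t)%g m0 (l0^-1 * k0)%g.
Proof.
move=> mc lc Xc Xoo.
have [c [b [c0 b0 h]]] := rp_contraction L Gc Xc Xoo.
exists c, b; split=> //.
have -> : (fun t => c t *: rp (m t * exp (X t) * l t)%g) =
    (fun t => rp (m t) *m (c t *: rp (exp (X t))) *m rp (l t)).
  by apply/funext => t; rewrite !rpM -scalemxAr -scalemxAl.
have -> : b *: (rv m0 *m rf (l0^-1 * k0)%g) = rp m0 *m (b *: (rv 1%g *m rf k0)) *m rp l0.
  rewrite -scalemxAr -scalemxAl; congr (_ *: _).
  rewrite mulmxA -rvM mulg1 -mulmxA -{2}(mulVKg l0 k0) rf_rp.
  by [].
apply: cvg_mulmx; last exact: (cvg_comp _ _ lc (@rp_continuous _ _ _ _ _ L l0)).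
apply: cvg_mulmx => //.
exact: (cvg_comp _ _ mc (@rp_continuous _ _ _ _ _ L m0)).
Qed.

Hypothesis theta_sym : symmetric_roots theta.

(** With Y in the chamber and [Ad k0 Y = - X], the inverse decomposes as (l^-1 k0) exp Y (k0^-1
    m^-1). Symmetry of theta makes Y diverge along theta as X does, and k0 squared in P identifies
    the repelling flag with that of m0. *)
Lemma cartan_rank_one_inv (T : Type) (F : set_system T) {FF : ProperFilter F}
    (m l : T -> G) (X : T -> 'rV[R]_n) m0 l0 :
  m @ F --> m0 -> l @ F --> l0 -> (forall t, chamber (X t)) ->
  (forall beta, theta beta -> (fun t => ev beta (X t)) @ F --> +oo) ->
  rank_one_limit F (fun t => (m t * exp (X t) * l t)^-1)%g (l0^-1 * k0)%g m0.
Proof.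
move=> mc lc Xc Xoo.
have [Y YP] := choice (fun t => (let: ex_intro2 Y Yc YE := k0_chamber_inv (Xc t) in
  ex_intro (fun Y => chamber Y /\ Ad k0 Y = - X t) Y (conj Yc YE))).
have Yoo beta : theta beta -> (fun t => ev beta (Y t)) @ F --> +oo.
  move=> tb; have [al ta ob] : [set beta | exists2 alpha, theta alpha & opposition_dual alpha beta] beta.
    by rewrite theta_sym.
  have -> : (fun t => ev beta (Y t)) = (fun t => ev al (X t)).
    apply/funext => t; have [[Ya _] YE] := YP t.
    by rewrite ob// YE ev_oppr opprK.
  exact: Xoo.
have lc' : (fun t => (l t)^-1 * k0)%g @ F --> (l0^-1 * k0)%g.
  by apply: cvg_mulg; [exact: cvg_invg|exact: cvg_cst].
have mc' : (fun t => k0^-1 * (m t)^-1)%g @ F --> (k0^-1 * m0^-1)%g.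
  by apply: cvg_mulg; [exact: cvg_cst|exact: cvg_invg].
have [c [b [c0 b0 h]]] := cartan_rank_one lc' mc' (fun t => (YP t).1) Yoo.
have [e e0 /(_ m0)[_ rfE]] := rv_parabolic L (k0_sq_parabolic theta_sym).
exists c, (b * e); split=> //; first exact: mulr_gt0.
have -> : (fun t => c t *: rp ((m t * exp (X t) * l t)^-1)%g) =
    (fun t => c t *: rp ((l t)^-1 * k0 * exp (Y t) * (k0^-1 * (m t)^-1))%g).
  apply/funext => t; congr (_ *: rp _); have [_ YE] := YP t.
  have := lie_exp_conj k0 (Y t); rewrite YE lie_expN => E.
  by rewrite !invgM E !mulgA.
move: h; rewrite invgM !invgK -mulgA rfE -scalemxAr scalerA; exact.
Qed.

End Flags.

Lemma filter_seq (T : Type) (I : eqType) (F : set_system T) (Q : I -> T -> Prop) (s : seq I) :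
  Filter F -> (forall i, i \in s -> F [set t | Q i t]) ->
  F [set t | forall i, i \in s -> Q i t].
Proof.
move=> FF; elim: s => [_|i s IH h]; first exact: filterE.
have h1 : F [set t | Q i t] by apply: h; rewrite inE eqxx.
have h2 : F [set t | forall i, i \in s -> Q i t].
  by apply: IH => j js; apply: h; rewrite inE js orbT.
by apply: filterS (filterI h1 h2) => t [q1 q2] j; rewrite inE => /predU1P[->//|]; exact: q2.
Qed.

(** * Dynamics of a transverse subgroup on flags *)

Section Dynamics.
Context (R : realType) (n : nat) (G : lieGroupType R n) (D : cartan_data G).
Local Notation a := (cd_a D).
Local Notation K := (cd_K D).
Local Notation chamber := (weyl_chamber (cd_pos D)).
Local Notation k0 := (cd_k0 D).
Local Notation exp := (lie_exp G).
Local Notation kap := (cartan_projection D).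
Context (theta : set (dual a)) (L : flag_model theta).
Local Notation P := (parabolic theta).
Local Notation rv := (rv L).
Local Notation rf := (rf L).
Local Notation rp := (rp L).
Local Notation rt := (rt L).
Local Notation mkf := (@mkflag R n G D theta).
Hypothesis Gc : connected [set: G].
Hypothesis theta_simple : theta `<=` simple_roots (cd_pos D).
Hypothesis theta_sym : symmetric_roots theta.
Hypothesis kernel1 : forall g : G, (forall h : G, P (h^-1 * g * h)%g) -> g = 1%g.
Context (Gam : set G).
Hypothesis GamT : transverse_subgroup theta Gam.

(** Along an ultrafilter, the counterpart of a sequence of distinct elements. *)
Definition wandering (T : Type) (U : set_system T) (gam : T -> G) :=
  forall g, ~ U [set t | gam t = g].

(** With nilradical 0 every element stabilizes it, so all of G lies in the kernel and is trivial;
    then nothing can wander. *)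
Lemma nil_index_gt0 (T : Type) (U : set_system T) (gam : T -> G) :
  Filter U -> wandering U gam -> (0 < #|nil_index theta|)%N.
Proof.
move=> UF w; rewrite lt0n; apply/negP => /eqP k0.
have all1 (g : G) : g = 1%g.
  apply: kernel1 => h; apply/parabolicP; apply/row_subP => i.
  by exfalso; have := ltn_ord i; rewrite [X in (_ < X)%N]k0.
by apply: (w 1%g); apply: filterE => t; exact: all1.
Qed.

Lemma theta_neq0 : (0 < #|nil_index theta|)%N -> exists beta, theta beta.
Proof.
move=> /card_gt0P[i]; rewrite inE => /(grade_gap)[beta tb _]; by exists beta.
Qed.

Section Ultra.
Context (T : Type) (U : set_system T) {UU : UltraFilter U}.
Implicit Type gam : T -> G.

(** Otherwise the family stays in a set B where a root of theta is bounded. If B is finite the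
    family is constant along U; if B is infinite it contains a sequence of distinct elements,
    against divergence. *)
Lemma wandering_div gam : (forall t, Gam (gam t)) -> wandering U gam ->
  forall beta, theta beta -> (fun t => ev beta (kap (gam t))) @ U --> +oo.
Proof.
move=> gG w beta tb; apply/cvgryPge => A.
have [//|h] := in_ultra_setVsetC [set t | A <= ev beta (kap (gam t))] UU.
exfalso; pose B := [set g | Gam g /\ ev beta (kap g) < A].
have UB : U [set t | B (gam t)].
  by apply: filterS h => t /= /negP; rewrite -ltNge => ?; split.
have [fB|/infiniteP/card_leP[f]] := pselect (finite_set B).
  by have [g Ug] := ultra_finite UU fB UB; exact: w Ug.
pose g i := set_val (f (exist _ i (mem_set (Logic.I : [set: nat] i)))).
have fP i : B (g i) by exact: set_valP.
have fi : injective g.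
  by move=> i j /val_inj e; have [] := @inj _ _ _ f _ _ (mem_set Logic.I) (mem_set Logic.I) e.
have [_ div _] := GamT.
have /cvgryPge/(_ A) := div g (fun i => (fP i).1) fi _ tb.
by move=> [N _ /(_ N (leqnn N))] /=; rewrite leNgt (fP N).2.
Qed.

Lemma wandering_KAK gam : (forall t, Gam (gam t)) -> wandering U gam ->
  exists ml : T -> G * G, U [set t | (forall beta, theta beta -> 0 < ev beta (kap (gam t))) /\
    KAK D (gam t) (ml t).1 (kap (gam t)) (ml t).2].
Proof.
move=> gG w; have div := wandering_div gG w.
have [b0 tb0] := theta_neq0 (nil_index_gt0 _ w).
(* An element without a decomposition would have the default Cartan projection 0, where b0 vanishes;
   so positivity of b0 provides the decomposition. *)
have ex t : exists ml : G * G, 0 < ev b0 (kap (gam t)) -> KAK D (gam t) ml.1 (kap (gam t)) ml.2.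
  have [h|h] := ltP 0 (ev b0 (kap (gam t))); last by exists (1%g, 1%g).
  move: h; rewrite /cartan_projection; case: xgetP => [X _ [m [l kak]] _|no].
    by exists (m, l).
  by rewrite ev_zeror ltxx.
have [ml mlP] := choice ex; exists ml.
have pos : U [set t | forall beta, beta \in simples D -> theta beta -> 0 < ev beta (kap (gam t))].
  apply: filter_seq => beta _; have [tb|ntb] := pselect (theta beta).
    have /cvgryPge/(_ 1) := div _ tb; apply: filterS => t /= h _.
    exact: lt_le_trans h.
  by apply: filterE => t /= /ntb.
apply: filterS pos => t pos.
have pos' beta : theta beta -> 0 < ev beta (kap (gam t)).
  by move=> tb; apply: pos => //; exact/mem_simples/theta_simple.
by split=> //; apply: mlP; exact: pos'.
Qed.

Lemma KAK_rank_one gam (m l : T -> G) : (forall t, Gam (gam t)) -> wandering U gam ->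
  U [set t | KAK D (gam t) (m t) (kap (gam t)) (l t)] ->
  exists m0 m1, [/\ (fun t => mkf (m t)) @ U --> mkf m0, rank_one_limit L U gam m0 m1 &
    rank_one_limit L U (fun t => (gam t)^-1%g) m1 m0].
Proof.
move=> gG w UK; have div := wandering_div gG w.
have [Kgrp Kc _] := cd_K_maximal D; have [K1 _ _] := Kgrp.
have [m0 _ mc] : exists2 p, K p & m @ U --> p.
  by apply: (compact_ultra_cvg UU Kc); apply: filterS UK => t [].
have [l0 _ lc] : exists2 p, K p & l @ U --> p.
  by apply: (compact_ultra_cvg UU Kc); apply: filterS UK => t [].
pose X t := if pselect (chamber (kap (gam t))) then kap (gam t) else 0.
have Xc t : chamber (X t).
  rewrite /X; case: pselect => [c|c] //=; split; first exact: mem0v.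
  by move=> al _; rewrite ev_zeror.
have XE : U [set t | X t = kap (gam t) /\ gam t = (m t * exp (X t) * l t)%g].
  have XK t : chamber (kap (gam t)) -> X t = kap (gam t).
    by move=> c; rewrite /X; case: pselect => [c'|c'].
  by apply: filterS UK => t [_ /XK Xt _ e]; rewrite /= Xt.
have Xoo beta : theta beta -> (fun t => ev beta (X t)) @ U --> +oo.
  move=> /div; apply: cvg_trans; apply: near_eq_cvg; apply: filterS XE => t [-> _] //.
have tr (g h : T -> G) x y : U [set t | h t = g t] -> rank_one_limit L U g x y -> rank_one_limit L U h x y.
  move=> gh [c [b [c0 b0 lim]]]; exists c, b; split=> //.
  by apply: cvg_trans lim; apply: near_eq_cvg; apply: filterS gh => t ->.
exists m0, (l0^-1 * k0)%g; split.
- exact: (cvg_comp _ _ mc (@mkflag_continuous _ _ _ _ theta m0)).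
- apply: tr (cartan_rank_one L Gc mc lc Xc Xoo).
  by apply: filterS XE => t [].
- apply: tr (cartan_rank_one_inv L Gc theta_sym mc lc Xc Xoo).
  by apply: filterS XE => t [_ e] /=; rewrite -e.
Qed.

(** The limit set is defined by injective sequences, so one is extracted recursively: the i-th index
    is within 1 / (i + 1) of the limit and its group element differs from those already listed,
    which is possible because a wandering family leaves every finite set. *)
Lemma limit_mem gam (m l : T -> G) F : (forall t, Gam (gam t)) -> wandering U gam ->
  U [set t | (forall beta, theta beta -> 0 < ev beta (kap (gam t))) /\
    KAK D (gam t) (m t) (kap (gam t)) (l t)] ->
  (fun t => mkf (m t)) @ U --> F -> limit_set theta Gam F.
Proof.
move=> gG w UK mF.
have tF : (fun t => tn L (mkf (m t))) @ U --> tn L F.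
  exact: (cvg_comp _ _ mF (@tn_continuous _ _ _ _ _ L F)).
pose B (i : nat) t := [/\ `|tn L F - tn L (mkf (m t))| <= i.+1%:R^-1,
  forall beta, theta beta -> 0 < ev beta (kap (gam t)) &
  KAK D (gam t) (m t) (kap (gam t)) (l t)].
have ex (x : nat * seq {classic G}) : exists t, B x.1 t /\ (gam t : {classic G}) \notin x.2.
  apply: contrapT => no.
  have UB : U [set t | B x.1 t].
    have i0 : 0 < x.1.+1%:R^-1 :> R by rewrite invr_gt0.
    have /cvgrPdist_le/(_ _ i0) := tF; move=> h.
    by apply: filterS (filterI h UK) => t [h1 [h2 h3]]; split.
  have fs : finite_set [set g : {classic G} | g \in x.2] by exact: finite_seq.
  have [g Ug] : exists g : {classic G}, U [set t | (gam t : {classic G}) = g].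
    apply: (ultra_finite UU fs); apply: filterS UB => t Bt /=.
    by apply: contrapT => h; apply: no; exists t; split=> //; exact/negP.
  exact: w Ug.
have [pick pickP] := choice ex.
pose s := fix s i : seq {classic G} := if i is j.+1 then (gam (pick (j, s j)) : {classic G}) :: s j else [::].
pose t i := pick (i, s i).
have sub i j : (i < j)%N -> (gam (t i) : {classic G}) \in s j.
  elim: j => // j IH; rewrite ltnS leq_eqVlt => /predU1P[->|/IH h].
    by rewrite inE eqxx.
  by rewrite inE h orbT.
have ginj : injective (gam \o t).
  move=> i j /= e; case: (ltngtP i j) => // ij.
    have [_ /negP] := pickP (j, s j); case; have := sub _ _ ij; by rewrite e.
  have [_ /negP] := pickP (i, s i); case; have := sub _ _ ij; by rewrite -e.
exists (gam \o t), (fun i => mkf (m (t i))); split=> // [i|i|].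
- exact: gG.
- have [[_ h1 h2] _] := pickP (i, s i); split=> //.
  by exists (m (t i)), (l (t i)).
- apply: (tn_cvg (L := L) Gc); apply/cvgrPdist_le => e e0.
  have /cvgrPdist_le/(_ _ e0) := @cvg_harmonic R; apply: filterS => i; rewrite sub0r normrN /= => h.
  have [[h1 _ _] _] := pickP (i, s i); apply: le_trans h1 _.
  by apply: le_trans h; rewrite ger0_norm ?invr_ge0.
Qed.

End Ultra.

Lemma rank_one_dir (T : Type) (F : set_system T) {FF : ProperFilter F} (gam : T -> G) m m'
    (z : T -> 'cV[R]_(fm_dim L)) z0 : rank_one_limit L F gam m m' -> z @ F --> z0 -> app (rf m') z0 != 0 ->
  (fun t => (app rt (rp (gam t) *m z t))^-1 *: (rp (gam t) *m z t)) @ F --> nv L m.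
Proof.
move=> [c [b [c0 b0 lim]]] zc z0n.
have h : (fun t => c t *: (rp (gam t) *m z t)) @ F --> (b * app (rf m') z0) *: rv m.
  exact: rank_one_apply lim zc.
have b1 : b * app (rf m') z0 != 0 by rewrite mulf_neq0// gt_eqF.
have rt0 : app rt ((b * app (rf m') z0) *: rv m) != 0.
  by rewrite appZr mulf_neq0// gt_eqF//; exact: rt_gt0.
have h1 : (fun t => app rt (c t *: (rp (gam t) *m z t))) @ F --> app rt ((b * app (rf m') z0) *: rv m).
  by apply: (app_cvg (x := fun=> rt) _ h); exact: cvg_cst.
have E : (fun t => (app rt (rp (gam t) *m z t))^-1 *: (rp (gam t) *m z t)) =
    (fun t => (app rt (c t *: (rp (gam t) *m z t)))^-1 *: (c t *: (rp (gam t) *m z t))).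
  by apply/funext => t; rewrite appZr scalerA invfM mulrAC mulVf ?mul1r// gt_eqF.
have -> : nv L m = (app rt ((b * app (rf m') z0) *: rv m))^-1 *: ((b * app (rf m') z0) *: rv m).
  by rewrite appZr scalerA invfM mulrAC mulVf// mul1r.
by rewrite E; apply: cvgZ => //; exact: cvgV.
Qed.

(** A vector z outside both kernels has a single limiting direction, which is the line of m and that
    of x. A sum of two vectors [rv] serves as z since the forms are nonnegative on them. *)
Lemma rank_one_unique (T : Type) (F : set_system T) {FF : ProperFilter F} (gam : T -> G) m m' x x' :
  rank_one_limit L F gam m m' -> rank_one_limit L F gam x x' -> mkf m = mkf x.
Proof.
move=> h1 h2.
have pos g : 0 < app (rf g) (rv (g * k0)%g).
  rewrite /app rf_sym -[X in rf _ *m rv X]mulg1 rvM mulmxA rf_rp.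
  exact: rf_k0.
pose z := rv (m' * k0)%g + rv (x' * k0)%g.
have z1 : app (rf m') z != 0 by rewrite gt_eqF// appDr ltr_wpDr//; exact: rf_ge0.
have z2 : app (rf x') z != 0 by rewrite gt_eqF// appDr ltr_wpDl//; exact: rf_ge0.
pose u t := (app rt (rp (gam t) *m z))^-1 *: (rp (gam t) *m z).
have c1 : u @ F --> nv L m by apply: (rank_one_dir h1 (cvg_cst z) z1).
have c2 : u @ F --> nv L x by apply: (rank_one_dir h2 (cvg_cst z) z2).
by apply: (tn_inj (L := L)); rewrite !tn_mkflag; exact: (cvg_unique (@norm_hausdorff _ _) c1 c2).
Qed.

Lemma GamV g : Gam g -> Gam (g^-1)%g.
Proof. by have [[_ _ h] _ _] := GamT; exact: h. Qed.

Lemma wanderingV (T : Type) (U : set_system T) (gam : T -> G) : Filter U ->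
  wandering U gam -> wandering U (fun t => (gam t)^-1)%g.
Proof.
move=> UF w g h; apply: (w (g^-1)%g); apply: filterS h => t /= <-.
by rewrite invgK.
Qed.

(** A decomposition of gam puts only its attracting flag in the limit set. For the repelling flag a
    second decomposition is taken, of the inverse, and uniqueness of attracting flags identifies the
    two. *)
Lemma gam_dynamics (T : Type) (U : set_system T) (gam : T -> G) : UltraFilter U ->
  (forall t, Gam (gam t)) -> wandering U gam ->
  exists m m', [/\ limit_set theta Gam (mkf m), limit_set theta Gam (mkf m'),
    rank_one_limit L U gam m m' & rank_one_limit L U (fun t => (gam t)^-1)%g m' m].
Proof.
move=> UU gG w.
have gG' t : Gam (gam t)^-1%g by exact: GamV.
have w' : wandering U (fun t => (gam t)^-1)%g by exact: wanderingV.
have [ml UK] := wandering_KAK gG w; have [ml' UK'] := wandering_KAK gG' w'.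
have UK1 : U [set t | KAK D (gam t) (ml t).1 (kap (gam t)) (ml t).2] by apply: filterS UK => t [].
have UK1' : U [set t | KAK D (gam t)^-1%g (ml' t).1 (kap (gam t)^-1%g) (ml' t).2] by apply: filterS UK' => t [].
have [m [m1 [c1 r1 r1']]] := KAK_rank_one gG w UK1.
have [m' [m1' [c2 r2 r2']]] := KAK_rank_one gG' w' UK1'.
exists m, m1; split=> //; first exact: limit_mem gG w UK c1.
by rewrite (rank_one_unique r1' r2); exact: limit_mem gG' w' UK' c2.
Qed.

Lemma injective_wandering (U : set_system nat) (gam : nat -> G) : UltraFilter U -> \oo `<=` U ->
  injective gam -> wandering U gam.
Proof.
move=> UU Uoo gi g Ug.
have [i gE] : exists i, gam i = g by apply: (@filter_ex _ U _ _ Ug).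
have Ui : U [set j | (i < j)%N] by apply: Uoo; exists i.+1.
apply: (@filter_not_empty _ U _); apply: filterS (filterI Ug Ui) => j [/=].
by rewrite -gE => /gi ->; rewrite ltnn.
Qed.

Lemma limit_set_sequence F : limit_set theta Gam F ->
  exists gam : nat -> G, [/\ forall i, Gam (gam i), injective gam &
    forall U, UltraFilter U -> \oo `<=` U -> exists m m', [/\ mkf m = F,
      limit_set theta Gam (mkf m'), rank_one_limit L U gam m m' &
      rank_one_limit L U (fun i => (gam i)^-1)%g m' m]].
Proof.
move=> [gam [V [gG gi gU VF]]]; exists gam; split=> // U UU Uoo.
have w := injective_wandering UU Uoo gi.
have ex i : exists ml : G * G, KAK D (gam i) ml.1 (kap (gam i)) ml.2 /\ V i = mkf ml.1.
  by have [_ [m [l [kak e]]]] := gU i; exists (m, l).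
have [ml mlP] := choice ex.
have UK : U [set i | KAK D (gam i) (ml i).1 (kap (gam i)) (ml i).2].
  by apply: filterE => i; case: (mlP i).
have [m [m1 [c1 r1 _]]] := KAK_rank_one gG w UK.
have [x [x' [_ Lx' rx rx']]] := gam_dynamics UU gG w.
exists x, x'; split=> //; rewrite -(rank_one_unique r1 rx).
apply: (flag_cvg_eq L c1 (F := U)).
have -> : (fun i => mkf (ml i).1) = V by apply/funext => i; case: (mlP i).
by apply: cvg_trans VF => A; exact: Uoo.
Qed.

End Dynamics.

Local Open Scope quotient_scope.

(** * Projective space *)

Section LineProjector.
Context (R : realType) (m : nat).
Implicit Types v w : 'cV[R]_m.

Definition sqn v : R := (v^T *m v) 0 0.

Lemma sqn_gt0 v : v != 0 -> 0 < sqn v.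
Proof.
move=> v0; have [i vi] : exists i, v i 0 != 0.
  apply/existsP; apply: contraNT v0; rewrite negb_exists => /forallP h0.
  by apply/eqP/colP => i; rewrite [RHS]mxE; apply/eqP; have := h0 i; rewrite negbK.
rewrite /sqn mxE (bigD1 i)//= mxE -expr2 ltr_wpDr//; last by rewrite exprn_even_gt0.
by apply: sumr_ge0 => j _; rewrite mxE -expr2 sqr_ge0.
Qed.

(** The orthogonal projector onto the line of v. It depends only on the line and so embeds
    projective space into a Hausdorff space of matrices. *)
Definition line_proj v : 'M[R]_m := (sqn v)^-1 *: (v *m v^T).

Lemma line_projZ (c : R) v : c != 0 -> line_proj (c *: v) = line_proj v.
Proof.
move=> c0; have cT : (c *: v)^T = c *: v^T by rewrite linearZ.
have h1 : (c *: v) *m (c *: v)^T = c ^+ 2 *: (v *m v^T).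
  by rewrite cT -scalemxAl -scalemxAr scalerA.
have h2 : sqn (c *: v) = c ^+ 2 * sqn v.
  by rewrite /sqn cT -scalemxAl -scalemxAr scalerA mxE.
rewrite /line_proj h1 h2 scalerA; congr (_ *: _).
have c20 : c ^+ 2 != 0 by rewrite expf_neq0.
by rewrite invfM mulrAC mulVf// mul1r.
Qed.

Lemma line_proj_eq v w : v != 0 -> line_proj v = line_proj w -> exists c, v = c *: w.
Proof.
move=> v0 e; have h : line_proj v *m v = v.
  rewrite /line_proj -scalemxAl -mulmxA.
  have -> : v^T *m v = (sqn v)%:M by apply/matrixP => i j; rewrite !ord1 [RHS]mxE eqxx mulr1n.
  by rewrite mul_mx_scalar scalerA mulVf ?scale1r// gt_eqF// sqn_gt0.
exists ((sqn w)^-1 * app w^T v); rewrite -{1}h e /line_proj -scalemxAl -mulmxA.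
by rewrite app_mx mul_mx_scalar scalerA.
Qed.

Lemma line_proj_cvg (T : Type) (F : set_system T) {FF : Filter F} (v : T -> 'cV[R]_m) v0 :
  v0 != 0 -> v @ F --> v0 -> (fun t => line_proj (v t)) @ F --> line_proj v0.
Proof.
move=> v00 vc; have vT : (fun t => (v t)^T) @ F --> v0^T by exact: cvg_trmx.
have h1 : (fun t => v t *m (v t)^T) @ F --> v0 *m v0^T by exact: cvg_mulmx.
have h2 : (fun t => sqn (v t)) @ F --> sqn v0 by apply: cvg_entry; exact: cvg_mulmx.
by apply: cvgZ => //; apply: cvgV => //; rewrite gt_eqF// sqn_gt0.
Qed.

End LineProjector.

Section ProjectiveSpace.
Context (R : realType) (d : nat).
Local Notation PR := (proj_space R d).
Implicit Types (v w : 'cV[R]_d) (x y : PR).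

Lemma proj_gen x : exists2 v, v != 0 & val x = <[v]>%VS.
Proof.
have dx := eqP (valP x); exists (vpick (val x)).
  by rewrite vpick0 -dimv_eq0 dx.
apply/esym/eqP; rewrite eqEdim -memvE memv_pick dx dim_vline vpick0 -dimv_eq0 dx//.
Qed.

Lemma line_eq v w : v != 0 -> <[v]>%VS = <[w]>%VS -> exists2 c, c != 0 & v = c *: w.
Proof.
move=> v0 e; have : v \in <[w]>%VS by rewrite -e memv_line.
by move=> /vlineP[c vE]; exists c => //; apply: contraNneq v0 => c0; rewrite vE c0 scale0r.
Qed.

Lemma line_scale c v : c != 0 -> <[c *: v]>%VS = <[v]>%VS.
Proof.
move=> c0; apply/eqP; rewrite eqEsubv -!memvE memvZ ?memv_line//=.
by apply/vlineP; exists c^-1; rewrite scalerA mulVf// scale1r.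
Qed.

Fact pline_subproof v : v != 0 -> \dim <[v]>%VS == 1%N.
Proof. by move=> v0; rewrite dim_vline v0. Qed.

Definition pline v (v0 : v != 0) : PR := exist (fun L => \dim L == 1%N) _ (pline_subproof v0).

Lemma proj_cvg (T : Type) (F : set_system T) {FF : Filter F} (v : T -> 'cV[R]_d) v0 (x : T -> PR) x0 :
  v0 != 0 -> v @ F --> v0 -> F [set t | val (x t) = <[v t]>%VS] -> val x0 = <[v0]>%VS ->
  x @ F --> x0.
Proof.
move=> v00 vc xv x0v A; rewrite nbhsE => -[B [oB Bx0] BA].
have nO : nbhs v0 [set v | exists2 L, B L & v != 0 /\ val L = <[v]>%VS].
  by apply: open_nbhs_nbhs; split; [exact: oB|exists x0].
suff : F [set t | A (x t)] by [].
have vB : F [set t | exists2 L, B L & v t != 0 /\ val L = <[v t]>%VS] := vc _ nO.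
apply: filterS (filterI xv vB) => t [xt [y By [_ yE]]]; apply: BA.
suff -> : x t = y by [].
by apply: val_inj; rewrite /= xt yE.
Qed.

Definition proj_mx x : 'M[R]_d := line_proj (vpick (val x)).

Lemma proj_mxE x v : v != 0 -> val x = <[v]>%VS -> proj_mx x = line_proj v.
Proof.
move=> v0 xv; have : vpick (val x) \in <[v]>%VS by rewrite -xv memv_pick.
move=> /vlineP[c cE]; rewrite /proj_mx cE line_projZ//.
apply: contraTneq (valP x) => c0.
have : vpick (val x) == 0 by rewrite cE c0 scale0r.
by rewrite vpick0 => /eqP ->; rewrite dimv0.
Qed.

Lemma proj_mx_inj : injective proj_mx.
Proof.
move=> x y e; have [v v0 xv] := proj_gen x; have [w w0 yw] := proj_gen y.
rewrite (proj_mxE v0 xv) (proj_mxE w0 yw) in e.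
have [c vE] := line_proj_eq v0 e.
apply: val_inj; rewrite /= xv yw vE line_scale//.
by apply: contraNneq v0 => c0; rewrite vE c0 scale0r.
Qed.

Lemma proj_mx_continuous : continuous proj_mx.
Proof.
apply/continuousP => A oA; rewrite /open/= /Defs.proj_open openE => v [x Ax [v0 xv]].
have cv : (fun w => line_proj w) @ v --> line_proj v.
  by apply: (line_proj_cvg (FF := nbhs_filter v)) => //; exact: cvg_id.
have nA : nbhs v [set w | A (line_proj w)].
  by apply: cv; rewrite -(proj_mxE v0 xv); exact: open_nbhs_nbhs.
have n0 : nbhs v [set w | w != 0].
  apply: open_nbhs_nbhs; split=> //.
  have -> : [set w : 'cV[R]_d | w != 0] = ~` [set 0].
    by apply/seteqP; split=> w /=; [move=> /eqP|move=> h; apply/eqP].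
  apply: closed_openC; apply: accessible_closed_set1.
  exact/hausdorff_accessible/norm_hausdorff.
suff : nbhs v [set w | exists2 L : PR, (proj_mx @^-1` A) L & w != 0 /\ val L = <[w]>%VS] by [].
apply: filterS (filterI nA n0) => w [Aw w0]; exists (pline w0) => //.
by rewrite /= (proj_mxE (x := pline w0) w0).
Qed.

Lemma proj_cvg_eq (T : Type) (F : set_system T) {FF : ProperFilter F} (u : T -> PR) x y :
  u @ F --> x -> u @ F --> y -> x = y.
Proof. exact: (cvg_eq_inj (@norm_hausdorff _ _) proj_mx_continuous proj_mx_inj). Qed.

Lemma PGL_actE (g : PGL R d) (A : 'M[R]_d) c v x : c != 0 -> PGL_mx g = c *: A ->
  val x = <[v]>%VS -> val (PGL_act g x) = <[A *m v]>%VS.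
Proof.
move=> c0 gA xv; rewrite /PGL_act /= xv limg_line lfunE /= gA -scalemxAl.
exact: line_scale.
Qed.

Lemma PGL_of_inj (A B : 'M[R]_d) (hA : A \in unitmx) (hB : B \in unitmx) :
  PGL_of hA = PGL_of hB -> exists2 c : R, c != 0 & B = c *: A.
Proof. by move=> /eqmodP/asboolP. Qed.

Lemma PGL_ofM (A B : 'M[R]_d) (hA : A \in unitmx) (hB : B \in unitmx) (hAB : A *m B \in unitmx) :
  (PGL_of hA * PGL_of hB)%g = PGL_of hAB.
Proof.
apply: PGL_of_eq; have [c c0 ->] := PGL_of_mx hA; have [e e0 ->] := PGL_of_mx hB.
exists (c * e)^-1; first by rewrite invr_eq0 mulf_neq0.
by rewrite -scalemxAl -scalemxAr [c *: (e *: _)]scalerA scalerA mulVf ?scale1r// mulf_neq0.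
Qed.

(** Treats an element of PGL as a point of the projective space of matrices, so that limits in PGL
    can be compared with limits of noninvertible matrices. *)
Definition PGL_line (g : PGL R d) := line_proj (mxvec (PGL_mx g))^T.

Lemma PGL_line_continuous : (0 < d)%N -> continuous PGL_line.
Proof.
move=> d0; pose f (A : @Defs.GL R d) := line_proj (mxvec (set_val A))^T.
have -> : PGL_line = f \o (repr : PGL R d -> @Defs.GL R d) by [].
apply: repr_comp_continuous.
  move=> A; have FF := nbhs_filter A.
  (* In dimension 0 the zero matrix is invertible, whence the condition d > 0. *)
  have A0 : (mxvec (set_val A))^T != 0.
    have := set_valP A; rewrite /Defs.GL /= => Au; apply/eqP => /(congr1 trmx).
    rewrite trmxK trmx0 => /(congr1 vec_mx); rewrite mxvecK linear0 => A0.
    have : set_val A \in unitmx by [].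
    by rewrite A0 unitmxE -(scale0r (1%:M : 'M[R]_d)) detZ expr0n eqn0Ngt d0 mul0r unitr0.
  apply: line_proj_cvg => //; apply: cvg_trmx; apply: cvg_mx => i j.
  rewrite ord1; case/mxvec_indexP: j => i' j'; rewrite mxvecE; under eq_fun do rewrite mxvecE.
  apply: cvg_entry; exact: initial_continuous.
move=> A B /eqP/eqmodP/asboolP[c c0 e]; apply/eqP.
have E : (mxvec (set_val B))^T = c *: (mxvec (set_val A))^T by rewrite e !linearZ.
by rewrite /f E line_projZ.
Qed.

Lemma PGL_line_of (A : 'M[R]_d) (hA : A \in unitmx) : PGL_line (PGL_of hA) = line_proj (mxvec A)^T.
Proof.
have [c c0 e] := PGL_of_mx hA.
have E : (mxvec (c *: A))^T = c *: (mxvec A)^T by rewrite !linearZ.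
by rewrite /PGL_line e E line_projZ.
Qed.

End ProjectiveSpace.

(** * The convex domain *)

Section ConvexDomain.
Context (R : realType) (n : nat) (G : lieGroupType R n) (D : cartan_data G).
Local Notation a := (cd_a D).
Local Notation k0 := (cd_k0 D).
Context (theta : set (dual a)) (L : flag_model theta).
Local Notation P := (parabolic theta).
Local Notation d := (fm_dim L).
Local Notation rv := (rv L).
Local Notation rf := (rf L).
Local Notation rp := (rp L).
Local Notation rt := (rt L).
Local Notation mkf := (@mkflag R n G D theta).
Hypothesis Gc : connected [set: G].
Hypothesis theta_simple : theta `<=` simple_roots (cd_pos D).
Hypothesis theta_sym : symmetric_roots theta.
Hypothesis kernel1 : forall g : G, (forall h : G, P (h^-1 * g * h)%g) -> g = 1%g.
Context (Gam : set G).
Hypothesis GamT : transverse_subgroup theta Gam.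
Local Notation Lam := (limit_set theta Gam).
Implicit Types (v w z u y : 'cV[R]_d).

Let Gam1 : Gam 1%g. Proof. by have [[]] := GamT. Qed.
Let GamM g h : Gam g -> Gam h -> Gam (g * h)%g. Proof. by have [[_ h' _] _ _] := GamT; exact: h'. Qed.
Let GamV g : Gam g -> Gam (g^-1)%g. Proof. by have [[_ _ h'] _ _] := GamT; exact: h'. Qed.
Let dyn := @gam_dynamics _ _ _ _ _ L Gc theta_simple theta_sym kernel1 _ GamT.
Let limit_seq := @limit_set_sequence _ _ _ _ _ L Gc theta_simple theta_sym kernel1 _ GamT.

Lemma rpK g v : rp (g^-1)%g *m (rp g *m v) = v.
Proof. by rewrite mulmxA -rpM mulVg rp1 mul1mx. Qed.

Lemma rpVK g v : rp g *m (rp (g^-1)%g *m v) = v.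
Proof. by rewrite mulmxA -rpM mulgV rp1 mul1mx. Qed.

(** The flag space is compact, so the vectors [nv g] are bounded and one constant serves all
    flags. *)
Fact slack_spec : {e : R | 0 < e & forall g, e * `|nv L g| < 1}.
Proof.
apply: cid2; have [C hC] := tn_bounded L Gc.
have C1 : 0 < `|C| + 1 by rewrite ltr_wpDl.
exists (`|C| + 1)^-1; rewrite ?invr_gt0// => g.
rewrite mulrC ltr_pdivrMr// mul1r (le_lt_trans (hC g))//.
by rewrite (le_lt_trans (ler_norm _))// ltrDl.
Qed.

Definition slack := s2val slack_spec.

Lemma slack_gt0 : 0 < slack. Proof. exact: s2valP slack_spec. Qed.

(* [q >= 0] is a closed properly convex cone with all lines [rv g] in its
   interior. *)
Definition q v : R := app rt v - slack * `|v|.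

Lemma q_rv g : 0 < q (rv g).
Proof.
have r0 := rt_gt0 L g; rewrite /q nvE appZr rt_nv mulr1 normrZ gtr0_norm// mulrCA.
by rewrite subr_gt0 gtr_pMr//; exact: (s2valP' slack_spec).
Qed.

Lemma q_add v w : q v + q w <= q (v + w).
Proof.
rewrite /q appDr; have := ler_normD v w; have := slack_gt0.
move: (`|v + w|) (`|v|) (`|w|) => a b c s0 h.
have : slack * a <= slack * (b + c) by rewrite ler_wpM2l// ltW.
lra.
Qed.

Lemma qZ c v : 0 <= c -> q (c *: v) = c * q v.
Proof. by move=> c0; rewrite /q appZr normrZ ger0_norm// mulrBr mulrCA. Qed.

Lemma q_le v : q v <= app rt v.
Proof. by rewrite /q gerBl mulr_ge0// ltW// slack_gt0. Qed.

Lemma q_continuous : continuous q.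
Proof.
move=> v; have FF := nbhs_filter v.
apply: cvgB; first by apply: app_cvg; [exact: cvg_cst|exact: cvg_id].
by apply: cvgM; [exact: cvg_cst|exact: norm_continuous].
Qed.

Definition cone : set 'cV[R]_d := [set v | forall g, Gam g -> 0 <= q (rp g *m v)].

Lemma cone_q v : cone v -> 0 <= q v.
Proof. by move=> /(_ 1%g Gam1); rewrite rp1 mul1mx. Qed.

Lemma cone_add v w : cone v -> cone w -> cone (v + w).
Proof.
move=> hv hw g Gg; rewrite mulmxDr; apply: le_trans (q_add _ _).
by apply: addr_ge0; [exact: hv|exact: hw].
Qed.

Lemma coneZ c v : 0 <= c -> cone v -> cone (c *: v).
Proof. by move=> c0 hv g Gg; rewrite -scalemxAr qZ// mulr_ge0// hv. Qed.

Lemma cone_act g v : Gam g -> cone v -> cone (rp g *m v).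
Proof. by move=> Gg hv h Gh; rewrite mulmxA -rpM; apply: hv; exact: GamM. Qed.

Lemma cone_closed : closed cone.
Proof.
have -> : cone = \bigcap_(g in Gam) ((fun v => q (rp g *m v)) @^-1` [set r | 0 <= r]) by [].
apply: closed_bigI => g _; apply: closed_comp; last exact: closed_ge.
move=> v _; apply: continuous_comp; last exact: q_continuous.
by apply: (cvg_mulmx (FF := nbhs_filter v)); [exact: cvg_cst|exact: cvg_id].
Qed.

Lemma int_add v w : nbhs v cone -> cone w -> nbhs (v + w) cone.
Proof.
move=> nv cw; have h : (fun y => y - w) @ (v + w) --> v.
  rewrite -[X in _ --> X](addrK w); apply: (cvgB (F := nbhs (v + w))); last exact: cvg_cst.
  exact: cvg_id.
have : nbhs (v + w) [set y | cone (y - w)] := h _ nv.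
by apply: filterS => y /= /cone_add/(_ cw); rewrite subrK.
Qed.

Lemma int_scale c v : 0 < c -> nbhs v cone -> nbhs (c *: v) cone.
Proof.
move=> c0 nv; have h : (fun y => c^-1 *: y) @ (c *: v) --> v.
  have {2}-> : v = c^-1 *: (c *: v) by rewrite scalerA mulVf ?scale1r// gt_eqF.
  by apply: (cvgZ (F := nbhs (c *: v))); [exact: cvg_cst|exact: cvg_id].
have : nbhs (c *: v) [set y | cone (c^-1 *: y)] := h _ nv.
apply: filterS => y /= /(coneZ (ltW c0)).
by rewrite scalerA mulfV ?scale1r// gt_eqF.
Qed.

Lemma int_act g v : Gam g -> nbhs v cone -> nbhs (rp g *m v) cone.
Proof.
move=> Gg nv; have h : (fun y => rp (g^-1)%g *m y) @ (rp g *m v) --> v.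
  rewrite -[X in _ --> X](rpK g).
  by apply: (cvg_mulmx (F := nbhs (rp g *m v))); [exact: cvg_cst|exact: cvg_id].
have : nbhs (rp g *m v) [set y | cone (rp (g^-1)%g *m y)] := h _ nv.
by apply: filterS => y /= /(cone_act Gg); rewrite rpVK.
Qed.

Lemma int_small v u : nbhs v cone -> exists2 t : R, 0 < t & cone (v + t *: u).
Proof.
move=> nv; have h : (fun t : R => v + t *: u) @ (0 : R)^'+ --> v.
  have {2}-> : v = v + 0 *: u by rewrite scale0r addr0.
  apply: cvgD; first exact: cvg_cst.
  apply: cvgZr_tmp; apply: cvg_within.
have h1 : (0 : R)^'+ [set t : R | cone (v + t *: u)] := h _ nv.
have h2 : (0 : R)^'+ [set t : R | 0 < t] by exact: nbhs_right_gt.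
have [t [t1 t2]] := @filter_ex _ _ _ _ (filterI h1 h2).
by exists t.
Qed.

Lemma int_q v : nbhs v cone -> 0 < q v.
Proof.
move=> /(int_small (- rv 1%g))[t t0 /cone_q h].
have -> : v = (v + t *: - rv 1%g) + t *: rv 1%g by rewrite scalerN subrK.
apply: lt_le_trans (q_add _ _); rewrite ltr_wpDl// qZ ?(ltW t0)// mulr_gt0//.
exact: q_rv.
Qed.

Lemma int_rt v : nbhs v cone -> 0 < app rt v.
Proof. by move=> /int_q h; apply: lt_le_trans h (q_le v). Qed.

Lemma int_neq0 v : nbhs v cone -> v != 0.
Proof. by move=> /int_rt h; apply: contraTneq h => ->; rewrite app0r ltxx. Qed.

Lemma q_limit_ge0 (T : Type) (F : set_system T) {FF : ProperFilter F} (u : T -> 'cV[R]_d) u0 :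
  u @ F --> u0 -> F [set t | 0 <= q (u t)] -> 0 <= q u0.
Proof.
move=> uc qu; have h : (fun t => q (u t)) @ F --> q u0 := cvg_comp _ _ uc (@q_continuous u0).
exact: (@closed_cvg _ _ F _ _ [set r : R | 0 <= r] (@closed_ge _ _) _ _ h).
Qed.

Lemma q_limit_neg (T : Type) (F : set_system T) {FF : ProperFilter F} (u : T -> 'cV[R]_d) u0 :
  u @ F --> u0 -> 0 < q u0 -> ~ F [set t | q (u t) < 0].
Proof.
move=> uc q0 qu; have h : (fun t => q (u t)) @ F --> q u0 := cvg_comp _ _ uc (@q_continuous u0).
suff : q u0 <= 0 by rewrite leNgt q0.
apply: (@closed_cvg _ _ F _ _ [set r : R | r <= 0] (@closed_le _ _) _ _ h).
by apply: filterS qu => t /ltW.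
Qed.

Lemma not_cone v : ~ cone v -> exists2 g, Gam g & q (rp g *m v) < 0.
Proof.
move=> h; apply: contrapT => no; apply: h => g Gg.
by rewrite leNgt; apply/negP => lt; apply: no; exists g.
Qed.

(** Each vector outside the cone has a group element witnessing it. Along the ultrafilter these
    witnesses are constant or wandering, and both cases are then excluded by a limit of q. *)
Lemma escaping_sequence (T : Type) (F : set_system T) (w : T -> 'cV[R]_d) : ProperFilter F ->
  F [set t | ~ cone (w t)] -> exists (U : set_system T) (gam : T -> G),
  [/\ UltraFilter U, F `<=` U, forall t, Gam (gam t) & U [set t | q (rp (gam t) *m w t) < 0]].
Proof.
move=> FF nc; have [U [UU FU]] := ultraFilterLemma FF.
have ex t : exists g, Gam g /\ (~ cone (w t) -> q (rp g *m w t) < 0).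
  have [c|nct] := pselect (cone (w t)); first by exists 1%g.
  by have [g Gg h] := not_cone nct; exists g.
have [gam gP] := choice ex; exists U, gam; split=> // [t|]; first by case: (gP t).
by apply: filterS (FU _ nc) => t; case: (gP t).
Qed.

(** If z is not interior, vectors near z are expelled by elements [gam t]. Were these constant, q
    would be nonpositive on a translate of z; if they wander, their normalized images tend to a
    positive multiple of some [rv m], where q is positive. *)
Lemma int_criterion z : (forall g, Gam g -> 0 < q (rp g *m z)) ->
  (forall m, Lam (mkf m) -> 0 < app (rf m) z) -> nbhs z cone.
Proof.
move=> qz fz; apply: contrapT => nz.
have FF : ProperFilter (within (~` cone) (nbhs z)).
  apply: Build_ProperFilter_ex => B; rewrite /within/= => nB.
  apply: contrapT => nb; apply: nz; apply: filterS nB => x xB.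
  by apply: contrapT => xc; apply: nb; exists x; exact: xB.
have nc : within (~` cone) (nbhs z) [set y | ~ cone y] by rewrite /within/=; exact: filterE.
have [U [gam [UU FU gG Uq]]] := escaping_sequence (w := fun y => y) FF nc.
have Uz : (fun y : 'cV[R]_d => y) @ U --> z.
  by move=> A zA; apply: FU; rewrite /within/=; apply: filterS zA => y.
have [[g Ug]|w] := pselect (exists g, U [set t | gam t = g]).
  have [t0 t0g] := @filter_ex _ _ _ _ Ug.
  have gz : (fun y : 'cV[R]_d => rp g *m y) @ U --> rp g *m z.
    by apply: cvg_mulmx => //; exact: cvg_cst.
  apply: (q_limit_neg gz); first by rewrite -t0g; exact: qz.
  by apply: filterS (filterI Ug Uq) => t [/= <-].
have {}w : wandering U gam by move=> g Ug; apply: w; exists g.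
have [m [m' [_ Lm' [c [b [c0 b0 lim]]] _]]] := dyn UU gG w.
have h : (fun t => c t *: (rp (gam t) *m t)) @ U --> (b * app (rf m') z) *: rv m.
  exact: (rank_one_apply lim).
have pos : 0 < b * app (rf m') z by rewrite mulr_gt0// fz.
apply: (q_limit_neg h); first by rewrite qZ ?(ltW pos)// mulr_gt0 ?q_rv.
by apply: filterS Uq => t /= qt; rewrite qZ ?(ltW (c0 t))// pmulr_rlt0.
Qed.

(** Take a sequence in Gamma attracted to m. Its inverses, normalized, send z to a limit with
    coefficient of the sign of [rf m z]; a negative coefficient would give the limit a negative
    trace, although q is nonnegative along the orbit. *)
Lemma cone_limit z m : cone z -> Lam (mkf m) -> 0 <= app (rf m) z.
Proof.
move=> cz /limit_seq[gam [gG _ dynU]].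
have [U [UU Uoo]] := ultra_oo.
have [x [x' [xm _ _ [c [b [c0 b0 lim]]]]]] := dynU U UU Uoo.
have [e e0 ->] := rf_flag L (esym xm).
have h : (fun t => c t *: (rp (gam t)^-1%g *m z)) @ U --> (b * app (rf x) z) *: rv x'.
  by apply: (rank_one_apply lim); exact: cvg_cst.
rewrite appZl mulr_ge0 ?(ltW e0)// leNgt; apply/negP => neg.
have : 0 <= q ((b * app (rf x) z) *: rv x').
  by apply: (q_limit_ge0 h); apply: filterE => t /=; rewrite qZ ?(ltW (c0 t))// mulr_ge0 ?(ltW (c0 t))//; apply/cz/GamV.
move=> /le_trans/(_ (q_le _)); rewrite appZr leNgt => /negP; apply.
by rewrite nmulr_rlt0 ?pmulr_rlt0//; exact: rt_gt0.
Qed.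

Lemma int_limit z m : nbhs z cone -> Lam (mkf m) -> 0 < app (rf m) z.
Proof.
move=> nz Lm; have [u u0] := rf_neq0 L m.
have [t t0 /cone_limit/(_ Lm)] := int_small (- u) nz.
rewrite appDr scalerN appNr appZr subr_ge0; apply: lt_le_trans.
exact: mulr_gt0.
Qed.

(** The sum of a spanning family of vectors [rv]: q is superadditive, and a form [rf m] is
    nonnegative on each term and cannot vanish on all of them. *)
Lemma int_point : exists z, nbhs z cone.
Proof.
have [m [x [C [rvE _]]]] := span_coordinates (fun g : G => (rv g)^T).
have rvS g : rv g = \sum_j ((rv g)^T *m C) 0 j *: rv (x j).
  apply: trmx_inj; rewrite {1}rvE linear_sum; apply: eq_bigr => j _.
  by rewrite linearZ.
exists (\sum_j rv (x j)); apply: int_criterion => [g Gg|m' _].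
  have [j] : exists j : 'I_m, True.
    apply: contrapT => no; have := rv_neq0 L 1%g; rewrite rvS big1 ?eqxx// => j _.
    by case: no; exists j.
  move=> _; rewrite (bigD1 j)//= mulmxDr -rvM; apply: lt_le_trans (q_add _ _).
  rewrite ltr_wpDr ?q_rv//; apply: (@le_trans _ _ (\sum_(i | i != j) q (rv (g * x i)%g))).
    by apply: sumr_ge0 => i _; rewrite ltW// q_rv.
  rewrite mulmx_sumr; elim/big_rec2: _ => [|i y1 y2 _ h]; first by rewrite /q app0r normr0 mulr0 subrr.
  by apply: le_trans (q_add _ _); rewrite -rvM lerD2l.
rewrite app_sumr lt_def; apply/andP; split; last by apply: sumr_ge0 => j _; exact: rf_ge0.
rewrite psumr_eq0; last by move=> j _; exact: rf_ge0.
apply/negP => /allP all0; have [u u0] := rf_neq0 L m'.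
have rf0 : rf m' = 0.
  apply: (rv_span (f := L)) => g; rewrite rvS mulmx_sumr big1// => j _.
  rewrite -scalemxAr app_mx.
  by have := all0 j; rewrite mem_index_enum => /(_ isT)/eqP ->; rewrite raddf0 scaler0.
by move: u0; rewrite rf0 /app mul0mx mxE ltxx.
Qed.

(* Moving from a limit line in a direction where [rf m] is positive, one
   stays in [cone] for a while: the elements of [Gam] which repel from a
   different limit flag keep [rv m] well inside, the others push [u] inside. *)
Lemma cone_tangent m u : Lam (mkf m) -> 0 < app (rf m) u ->
  exists2 t : R, 0 < t & cone (rv m + t *: u).
Proof.
move=> Lm u0; apply: contrapT => no.
have nc : (0 : R)^'+ [set t : R | ~ cone (rv m + t *: u)].
  have h2 : (0 : R)^'+ [set t : R | 0 < t] by exact: nbhs_right_gt.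
  by apply: filterS h2 => t t0 ct; apply: no; exists t.
have [U [gam [UU FU gG Uq]]] := escaping_sequence (w := fun t : R => rv m + t *: u) _ nc.
have Ut : (fun t : R => rv m + t *: u) @ U --> rv m.
  apply: cvg_trans (_ : (fun t : R => rv m + t *: u) @ (0 : R)^'+ --> rv m).
    by move=> A; exact: FU.
  have {2}-> : rv m = rv m + 0 *: u by rewrite scale0r addr0.
  apply: cvgD; first exact: cvg_cst.
  by apply: cvgZr_tmp; apply: cvg_within.
have Upos : U [set t : R | 0 < t] by apply: FU; exact: nbhs_right_gt.
have [[g Ug]|w] := pselect (exists g, U [set t | gam t = g]).
  have gz : (fun t : R => rp g *m (rv m + t *: u)) @ U --> rp g *m rv m.
    by apply: cvg_mulmx => //; exact: cvg_cst.
  apply: (q_limit_neg gz); first by rewrite -rvM q_rv.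
  by apply: filterS (filterI Ug Uq) => t [/= <-].
have {}w : wandering U gam by move=> g Ug; apply: w; exists g.
have [m1 [m2 [_ Lm2 [c [b [c0 b0 lim]]] _]]] := dyn UU gG w.
have [e|ne] := pselect (mkf m2 = mkf m).
  have [s s0 rfs] := rf_flag L e.
  have h : (fun t => c t *: (rp (gam t) *m u)) @ U --> (b * app (rf m2) u) *: rv m1.
    by apply: (rank_one_apply lim); exact: cvg_cst.
  have pos : 0 < b * app (rf m2) u by rewrite rfs appZl !mulr_gt0.
  apply: (q_limit_neg h); first by rewrite qZ ?(ltW pos)// mulr_gt0 ?q_rv.
  apply: filterS (filterI Uq Upos) => t [/= qt t0].
  rewrite qZ ?(ltW (c0 t))// pmulr_rlt0//.
  (* The translate of [rv m] has positive q, so superadditivity forces q to be negative on the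
     translate of u alone. *)
  move: qt; rewrite mulmxDr -scalemxAr => /(le_lt_trans (q_add _ _)).
  rewrite qZ ?(ltW t0)// -rvM => h1; have := q_rv (gam t * m)%g => h2.
  by rewrite -(pmulr_rlt0 _ t0); lra.
have h : (fun t => c t *: (rp (gam t) *m (rv m + t *: u))) @ U --> (b * app (rf m2) (rv m)) *: rv m1.
  exact: (rank_one_apply lim).
have pos : 0 < b * app (rf m2) (rv m).
  have [_ _ tr] := GamT.
  by rewrite mulr_gt0//; apply: transverse_gt0; exact: tr.
apply: (q_limit_neg h); first by rewrite qZ ?(ltW pos)// mulr_gt0 ?q_rv.
by apply: filterS Uq => t /= qt; rewrite qZ ?(ltW (c0 t))// pmulr_rlt0.
Qed.


Definition domain : set (proj_space R d) :=
  [set x : proj_space R d | exists2 v : 'cV[R]_d, nbhs v cone & val x = <[v]>%VS].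

(** Of the two rays on a line, the sign of the trace selects the one in the cone. *)
Lemma domain_int (x : proj_space R d) v :
  domain x -> val x = <[v]>%VS -> 0 < app rt v -> nbhs v cone.
Proof.
move=> [w nw xw] xv v0; have [c c0 wE] := line_eq (int_neq0 nw) (etrans (esym xw) xv).
have cp : 0 < c by have := int_rt nw; rewrite wE appZr pmulr_lgt0.
have -> : v = c^-1 *: w by rewrite wE scalerA mulVf ?scale1r.
by apply: int_scale => //; rewrite invr_gt0.
Qed.

Lemma domain_open : open domain.
Proof.
rewrite /open/= /Defs.proj_open openE => v [x [w nw xw] [v0 xv]].
have [c c0 vE] := line_eq v0 (etrans (esym xv) xw).
have h : (fun y => c^-1 *: y) @ v --> w.
  have e : w = c^-1 *: v by rewrite vE scalerA mulVf ?scale1r.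
  rewrite [X in _ --> X]e.
  by apply: (cvgZ (F := nbhs v)); [exact: cvg_cst|exact: cvg_id].
have : nbhs (v : 'cV[R]_d) [set y : 'cV[R]_d | nbhs (c^-1 *: y) cone] by exact: (h _ (nbhs_interior nw)).
apply: filterS => y /= ny.
have y0 : y != 0 by apply: contraNneq (int_neq0 ny) => ->; rewrite scaler0.
by exists (pline y0) => //; exists (c^-1 *: y) => //=; rewrite line_scale// invr_eq0.
Qed.

Lemma domain_slice v : affine_slice rt domain v -> app rt v = 1 /\ nbhs v cone.
Proof.
move=> [e [x Dx xv]]; have v1 : app rt v = 1 by rewrite /app e mxE eqxx.
by split=> //; apply: domain_int Dx xv _; rewrite v1.
Qed.

Lemma domain_convex : properly_convex_domain domain.
Proof.
split; [|exact: domain_open|exists rt; split].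
- by have [z nz] := int_point; exists (pline (int_neq0 nz)); exists z.
- move=> x [v nv ->]; exists v; first exact: memv_line.
  apply: contraTneq (int_rt nv) => e; rewrite /app e mxE ltxx //.
- move=> u v t /domain_slice[u1 nu] /domain_slice[v1 nv] /andP[t0 t1].
  have e1 : app rt (t *: u + (1 - t) *: v) = 1.
    by rewrite appDr !appZr u1 v1 !mulr1 addrC subrK.
  have nw : nbhs (t *: u + (1 - t) *: v) cone.
    have [->|tn0] := eqVneq t 0; first by rewrite scale0r add0r subr0 scale1r.
    apply: int_add; first by apply: int_scale => //; rewrite lt_def tn0.
    by apply: coneZ; [rewrite subr_ge0|exact: nbhs_singleton].
  split; first by rewrite app_mx e1.
  by exists (pline (int_neq0 nw)) => //; exists (t *: u + (1 - t) *: v).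
- exists slack^-1; split; first exact: num_real.
  move=> M hM v /domain_slice[v1 nv] /=.
  apply: le_trans (ltW hM); rewrite -div1r ler_pdivlMr ?slack_gt0// mulrC.
  by have := cone_q (nbhs_singleton nv); rewrite /q v1 subr_ge0.
Qed.

Lemma rp_unit g : rp g \in unitmx.
Proof. by have [] := mulmx1_unit (etrans (esym (rpM L g (g^-1)%g)) (etrans (congr1 rp (mulgV g)) (rp1 L))). Qed.

Definition emb g : PGL R d := PGL_of (rp_unit g).

Lemma emb_act g (x : proj_space R d) v : val x = <[v]>%VS ->
  val (PGL_act (emb g) x) = <[rp g *m v]>%VS.
Proof. by move=> xv; have [c c0 e] := PGL_of_mx (rp_unit g); exact: PGL_actE c0 e xv. Qed.

Lemma embM g h : emb (g * h)%g = (emb g * emb h)%g.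
Proof.
have u : rp g *m rp h \in unitmx by rewrite unitmx_mul !rp_unit.
rewrite /emb (PGL_ofM _ _ u); apply: PGL_of_eq; exists 1; first exact: oner_neq0.
by rewrite scale1r rpM.
Qed.

Lemma emb1 : emb 1%g = 1%g.
Proof. by apply: (mulgI (emb 1%g)); rewrite -embM !mulg1. Qed.

Lemma embV g : emb (g^-1)%g = (emb g)^-1%g.
Proof. by apply: (mulgI (emb g)); rewrite -embM !mulgV emb1. Qed.

(** Proportional operators act alike on lines, hence on flags, so the quotient of h by g lies in all
    conjugates of P. *)
Lemma rp_scalar_inj g h c : rp h = c *: rp g -> g = h.
Proof.
move=> e; have h1 : (g^-1 * h)%g = 1%g.
  apply: kernel1 => x; have := @rv_line _ _ _ _ _ L (h * x)%g (g * x)%g c.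
  by rewrite !rvM e -scalemxAl invgM !mulgA; apply.
by apply: (mulgI (g^-1)%g); rewrite h1 mulVg.
Qed.

Lemma emb_inj : injective emb.
Proof. by move=> g h /PGL_of_inj[c _]; exact: rp_scalar_inj. Qed.

Definition Gam0 : set (PGL R d) := emb @` Gam.

Lemma Gam0_subgroup : subgroup Gam0.
Proof.
split=> [|_ _ [g Gg <-] [h Gh <-]|_ [g Gg <-]].
- by exists 1%g => //; exact: emb1.
- by exists (g * h)%g; [exact: GamM|exact: embM].
- by exists (g^-1)%g; [exact: GamV|exact: embV].
Qed.

Lemma mxvec_line_proj (A B : 'M[R]_d) : A != 0 ->
  line_proj (mxvec A)^T = line_proj (mxvec B)^T -> exists c, A = c *: B.
Proof.
move=> A0 /line_proj_eq h.
have [c e] : exists c, (mxvec A)^T = c *: (mxvec B)^T.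
  apply: h; apply: contra_neq A0 => /(congr1 trmx); rewrite trmxK trmx0.
  by move=> /(congr1 vec_mx); rewrite mxvecK linear0.
exists c; move/(congr1 trmx): e; rewrite linearZ/= !trmxK => /(congr1 vec_mx).
by rewrite linearZ/= !mxvecK.
Qed.

Lemma rp_neq0 g : rp g != 0.
Proof.
have := rv_neq0 L g; rewrite -[X in rv X]mulg1 rvM.
by apply: contraNneq => ->; rewrite mul0mx.
Qed.

Lemma dim_gt0 : (0 < d)%N.
Proof.
rewrite lt0n; apply/negP => /eqP d0; have := rv_neq0 L 1%g; apply/negP; rewrite negbK.
by apply/eqP/colP => i; exfalso; have := ltn_ord i; rewrite [X in (_ < X)%N]d0.
Qed.

Lemma line_proj_rp_cvg (T : Type) (U : set_system T) (gam : T -> G) : UltraFilter U ->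
  (forall t, Gam (gam t)) -> wandering U gam -> exists m m' : G,
  [/\ app (rf m') (rv m') = 0, rv m *m rf m' != 0 &
  (fun t => line_proj (mxvec (rp (gam t)))^T) @ U --> line_proj (mxvec (rv m *m rf m'))^T].
Proof.
move=> UU gG w; have [m [m' [_ _ [c [b [c0 b0 lim]]] _]]] := dyn UU gG w.
have M0 : rv m *m rf m' != 0.
  have [u u0] := rf_neq0 L m'; apply: contraTneq (rv_neq0 L m) => e.
  have : (rv m *m rf m') *m u = 0 by rewrite e mul0mx.
  rewrite -mulmxA app_mx mul_mx_scalar => /eqP; rewrite scaler_eq0 gt_eqF//=.
  by move=> r0; rewrite negbK.
exists m, m'; split=> //; first by apply: rf_self; exact: (nil_index_gt0 kernel1 _ w).
have h : (fun t => line_proj (mxvec (c t *: rp (gam t)))^T) @ U --> line_proj (mxvec (b *: (rv m *m rf m')))^T.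
  apply: line_proj_cvg.
    apply: contra_neq M0 => /(congr1 trmx); rewrite trmxK trmx0.
    move=> /(congr1 vec_mx); rewrite mxvecK linear0 => /eqP; rewrite scaler_eq0 gt_eqF//= => /eqP ->.
    by [].
  apply: cvg_trmx; apply: cvg_mx => i j; rewrite ord1; case/mxvec_indexP: j => i' j'.
  by rewrite mxvecE; under eq_fun do rewrite mxvecE; exact: cvg_entry.
have E (k : R) (A : 'M[R]_d) : k != 0 -> line_proj (mxvec (k *: A))^T = line_proj (mxvec A)^T.
  move=> k0; have -> : (mxvec (k *: A))^T = k *: (mxvec A)^T by rewrite !linearZ.
  exact: line_projZ.
rewrite (E b) ?gt_eqF// in h.
have -> : (fun t => line_proj (mxvec (rp (gam t)))^T) = (fun t => line_proj (mxvec (c t *: rp (gam t)))^T).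
  by apply/funext => t; rewrite E// gt_eqF.
exact: h.
Qed.

(** Suppose other elements accumulate at p0. If their preimages in Gamma are constant along an
    ultrafilter, they equal p0 by injectivity. If they wander, p0 would be represented by a multiple
    of [rv m *m rf m'], which kills [rv m'], whereas p0 is invertible. *)
Lemma Gam0_discrete : discrete_subgroup Gam0.
Proof.
split=> [|p0 Gp0]; first exact: Gam0_subgroup.
split; first exact: mem_set.
apply: contrapT => no.
have FF : ProperFilter (within (Gam0 `\ p0) (nbhs p0)).
  apply: Build_ProperFilter_ex => B; rewrite /within/= => nB.
  apply: contrapT => nb; apply: no; exists [set p | (Gam0 `\ p0) p -> B p] => //.
  apply/seteqP; split=> p /= => [[h Gp]|->].
    by apply: contrapT => pn; apply: nb; exists p; apply: h.
  by split=> // -[].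
have [U [UU FU]] := ultraFilterLemma FF.
have UG : U (Gam0 `\ p0) by apply: FU; rewrite /within/=; exact: filterE.
have ex p : exists g, Gam g /\ (Gam0 p -> emb g = p).
  have [[g Gg e]|nG] := pselect (Gam0 p); first by exists g.
  by exists 1%g.
have [gam gP] := choice ex.
have gG p : Gam (gam p) by case: (gP p).
have lim : (fun p => line_proj (mxvec (rp (gam p)))^T) @ U --> PGL_line p0.
  have h : (fun p : PGL R d => PGL_line p) @ U --> PGL_line p0.
    have Up : U --> p0 by move=> A nA; apply: FU; rewrite /within/=; apply: filterS nA => p.
    by move=> A nA; apply: Up; exact: (@PGL_line_continuous R d dim_gt0 p0 A nA).
  apply: cvg_trans h; apply: near_eq_cvg; apply: filterS UG => p [Gp _].
  rewrite -(PGL_line_of (rp_unit (gam p))); case: (gP p) => _ /(_ Gp) e.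
  exact: (congr1 (@PGL_line R d) (esym e)).
have [g0 Gg0 e0] := Gp0; rewrite -e0 PGL_line_of in lim.
have [[g Ug]|w] := pselect (exists g, U [set t | gam t = g]).
  have cst : (fun p => line_proj (mxvec (rp (gam p)))^T) @ U --> line_proj (mxvec (rp g))^T.
    apply: cvg_near_cst; apply: filterS Ug => p /= -> //.
  have [c e] := mxvec_line_proj (rp_neq0 g) (cvg_unique (@norm_hausdorff _ _) cst lim).
  apply: (@filter_not_empty _ U _); apply: filterS (filterI Ug UG) => p [/= pg [Gp]]; apply.
  by case: (gP p) => _ /(_ Gp) <-; rewrite pg -e0 (rp_scalar_inj e).
have {}w : wandering U gam by move=> g Ug; apply: w; exists g.
have [m [m' [mm M0 cst]]] := line_proj_rp_cvg UU gG w.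
have [c e] := mxvec_line_proj (rp_neq0 g0) (cvg_unique (@norm_hausdorff _ _) lim cst).
have : rp g0 *m rv m' = 0.
  by rewrite e -scalemxAl -mulmxA app_mx mm mul_mx_scalar scale0r scaler0.
by rewrite -rvM => /eqP; rewrite (negbTE (rv_neq0 L _)).
Qed.

Lemma domain_act g (x : proj_space R d) : Gam g -> domain x -> domain (PGL_act (emb g) x).
Proof. by move=> Gg [v nv xv]; exists (rp g *m v); [exact: int_act|exact: emb_act]. Qed.

Lemma Gam0_Aut : Gam0 `<=` Aut domain.
Proof.
move=> _ [g Gg <-]; apply/seteqP; split=> [_ [x Dx <-]|x Dx]; first exact: domain_act.
exists (PGL_act (emb (g^-1)%g) x); first by apply: domain_act => //; exact: GamV.
have [v v0 xv] := proj_gen x; apply: val_inj.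
by rewrite [LHS](emb_act _ (emb_act (g^-1)%g xv)) rpVK [RHS]xv.
Qed.

Definition pt g : proj_space R d := pline (rv_neq0 L g).

Lemma pt_eq g h : pt g = pt h <-> mkf g = mkf h.
Proof.
split=> [e|/(rv_flag L)[c c0 e]].
  have [c _ vE] := line_eq (rv_neq0 L g) (congr1 val e).
  by apply/mkflag_eq; exact: rv_line vE.
by apply: val_inj; rewrite /= e line_scale// gt_eqF.
Qed.

Lemma val_pt_nv g : val (pt g) = <[nv L g]>%VS.
Proof. by rewrite /= {1}nvE line_scale// gt_eqF//; exact: rt_gt0. Qed.

Lemma orbit_cvg (T : Type) (U : set_system T) (gam : T -> G) m m' (x : proj_space R d) :
  ProperFilter U -> (forall t, Gam (gam t)) -> rank_one_limit L U gam m m' -> Lam (mkf m') ->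
  domain x -> (fun t => PGL_act (emb (gam t)) x) @ U --> pt m.
Proof.
move=> UU gG lim Lm' [v iv xv]; have v0 : app (rf m') v != 0 by rewrite gt_eqF// int_limit.
have h : (fun t => (app rt (rp (gam t) *m v))^-1 *: (rp (gam t) *m v)) @ U --> nv L m.
  by apply: (rank_one_dir lim) v0; exact: cvg_cst.
apply: (proj_cvg _ h _ (val_pt_nv m)).
  by apply: contraNneq (rv_neq0 L m) => e; rewrite nvE e scaler0.
have e t : val (PGL_act (emb (gam t)) x) = <[(app rt (rp (gam t) *m v))^-1 *: (rp (gam t) *m v)]>%VS.
  by rewrite (emb_act _ xv) line_scale// invr_eq0 gt_eqF//; apply: int_rt; exact: int_act.
exact: filterE e.
Qed.

Lemma Lam_nil_index F : Lam F -> (0 < #|nil_index theta|)%N.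
Proof.
move=> /limit_seq[gam [gG gi _]]; have [U [UU Uoo]] := ultra_oo.
exact: (nil_index_gt0 kernel1 _ (injective_wandering UU Uoo gi)).
Qed.

Lemma rf_rv m : Lam (mkf m) -> app (rf m) (rv m) = 0.
Proof. by move=> /Lam_nil_index h; exact: rf_self. Qed.

Lemma domain_pt m : Lam (mkf m) -> ~ domain (pt m).
Proof.
move=> Lm Dm; have := int_limit (domain_int Dm erefl (rt_gt0 L m)) Lm.
by rewrite rf_rv// ltxx.
Qed.

Lemma pt_orbit m (p : proj_space R d) : Lam (mkf m) -> domain p -> exists gam : nat -> G,
  (forall i, Gam (gam i)) /\ (fun i => PGL_act (emb (gam i)) p) @ \oo --> pt m.
Proof.
move=> /limit_seq[gam [gG _ dynU]] Dp; exists gam; split=> //.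
apply: cvg_ultra => U UU Uoo; have [x [x' [xm Lx' lim _]]] := dynU U UU Uoo.
by have /pt_eq <- := xm; exact: orbit_cvg lim Lx' Dp.
Qed.

(** An orbit whose limit lies on the boundary must wander, as a constant family would have its limit
    in the open domain; a wandering orbit tends to the line of an attracting flag. *)
Lemma limit_setP x : orbital_limit_set domain Gam0 x <-> exists2 m, Lam (mkf m) & x = pt m.
Proof.
split=> [[[_ nx] [p [Dp [gam [gG gc]]]]]|[m Lm ->]].
  have ex i : exists g, Gam g /\ emb g = gam i by case: (gG i) => g; exists g.
  have [g gP] := choice ex; have [U [UU Uoo]] := ultra_oo.
  have gc' : (fun i => PGL_act (emb (g i)) p) @ U --> x.
    have -> : (fun i => PGL_act (emb (g i)) p) = (fun i => PGL_act (gam i) p).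
      by apply/funext => i; case: (gP i) => _ ->.
    by apply: cvg_trans gc => A; exact: Uoo.
  have gG' i : Gam (g i) by case: (gP i).
  have [[h Uh]|w] := pselect (exists h, U [set i | g i = h]).
    case: nx; rewrite (_ : x = PGL_act (emb h) p).
      have [i gi] := @filter_ex _ _ _ _ Uh.
      move/interior_id: domain_open => ->.
      by rewrite -gi; exact: domain_act.
    apply: (proj_cvg_eq gc').
    by apply: cvg_near_cst; apply: filterS Uh => i /= ->.
  have {}w : wandering U g by move=> h Uh; apply: w; exists h.
  have [m [m' [Lm Lm' lim _]]] := dyn UU gG' w.
  by exists m => //; apply: (proj_cvg_eq gc'); exact: orbit_cvg lim Lm' Dp.
have [z nz] := int_point; pose p := pline (int_neq0 nz).
have Dp : domain p by exists z.
have [gam [gG gc]] := pt_orbit Lm Dp.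
split; last first.
  by exists p; split=> //; exists (emb \o gam); split=> // i; exists (gam i).
split=> [B /gc[N _ /(_ N (leqnn N)) BN]|].
  by exists (PGL_act (emb (gam N)) p); split=> //; exact: domain_act.
by move=> /interior_subset; exact: domain_pt.
Qed.

(** The lines that meet the cone away from 0 form a closed set: its preimage among nonzero vectors
    is the union of the cone and its opposite. *)
Lemma closure_domain x : closure domain x -> exists v : 'cV[R]_d, [/\ cone v, v != 0 & val x = <[v]>%VS].
Proof.
pose C := [set x : proj_space R d | exists v : 'cV[R]_d, [/\ cone v, v != 0 & val x = <[v]>%VS]].
have coneN : closed [set w | cone (- w)].
  by apply: closed_comp cone_closed => w _; exact: oppr_continuous.
have cC : closed C.
  rewrite -[C]setCK; apply: open_closedC; rewrite /open/= /Defs.proj_open.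
  have -> : [set v | exists2 y, (~` C) y & v != 0 /\ val y = <[v]>%VS] =
      ~` cone `&` ~` [set w | cone (- w)].
    apply/seteqP; split=> v /= => [[y nC [v0 yv]]|[nv nv']].
      split=> cv; apply: nC; first by exists v.
      by exists (- v); rewrite oppr_eq0 -scaleN1r line_scale ?oppr_eq0 ?oner_eq0//= scaleN1r.
    have v0 : v != 0.
      apply/eqP => v0; apply: nv => g _.
      by rewrite v0 mulmx0 /q app0r normr0 mulr0 subrr.
    exists (pline v0) => // -[w [cw w0 vw]].
    have [c c0 vE] := line_eq v0 vw.
    have [cp|cn] := leP 0 c; first by apply: nv; rewrite vE; exact: coneZ.
    by apply: nv'; rewrite vE -scaleNr; apply: coneZ => //; rewrite oppr_ge0 ltW.
  by apply: openI; apply: closed_openC; [exact: cone_closed|exact: coneN].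
have sub : domain `<=` C.
  by move=> y [v nv yv]; exists v; split=> //; [exact: nbhs_singleton|exact: int_neq0].
by move=> h; have := closure_subset sub h; rewrite -(proj1 (closure_id _) cC).
Qed.

(** A cone vector w on the segment is a combination of [rv m] and [rv m'] whose signs are not known
    beforehand, as both projective segments are possible. Testing w with [rf m'] and [rf m] makes
    both coefficients positive. Then w is interior, because each limit flag differs from m or from
    m' and so is transverse to one of them. *)
Lemma domain_visible (x y : proj_space R d) : orbital_limit_set domain Gam0 x -> orbital_limit_set domain Gam0 y ->
  x <> y -> open_segment domain x y `<=` domain.
Proof.
move=> /limit_setP[m Lm ->] /limit_setP[m' Lm' ->] ne z [u [v [xu yv sub [s [t [s0 t0 zE]]]]]].
have {}ne : mkf m <> mkf m' by move=> e; apply: ne; exact/pt_eq.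
have [|w [cw w0 zw]] := @closure_domain z; first by apply: sub; exists s, t.
have tr F F' : Lam F -> Lam F' -> F <> F' -> transverse F F' by have [_ _] := GamT; exact.
have u0 : u != 0 by apply: contraNneq (rv_neq0 L m) => e; move: xu; rewrite e => /line_eq-/(_ (rv_neq0 L m))[c _ ->]; rewrite scaler0.
have v0 : v != 0 by apply: contraNneq (rv_neq0 L m') => e; move: yv; rewrite e => /line_eq-/(_ (rv_neq0 L m'))[c _ ->]; rewrite scaler0.
have [al al0 uE] := line_eq u0 (esym xu); have [be be0 vE] := line_eq v0 (esym yv).
have [k k0 wE] := line_eq w0 (etrans (esym zw) zE).
have {}wE : w = (k * s * al) *: rv m + (k * t * be) *: rv m'.
  by rewrite wE uE vE scalerDr !scalerA.
have a0 : 0 < k * s * al.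
  have p := transverse_gt0 L (tr _ _ Lm' Lm (nesym ne)).
  have := cone_limit cw Lm'; rewrite wE appDr !appZr (rf_rv Lm') mulr0 addr0 pmulr_lge0//.
  by rewrite lt_def => ->; rewrite !mulf_neq0// gt_eqF.
have b0 : 0 < k * t * be.
  have p := transverse_gt0 L (tr _ _ Lm Lm' ne).
  have := cone_limit cw Lm; rewrite wE appDr !appZr (rf_rv Lm) mulr0 add0r pmulr_lge0//.
  by rewrite lt_def => ->; rewrite !mulf_neq0// gt_eqF.
exists w => //; apply: int_criterion => [g Gg|m2 Lm2].
  rewrite wE mulmxDr -!scalemxAr -!rvM; apply: lt_le_trans (q_add _ _).
  by rewrite !qZ ?(ltW a0) ?(ltW b0)// addr_gt0// mulr_gt0// q_rv.
rewrite wE appDr !appZr; have [e|ne2] := pselect (mkf m2 = mkf m).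
  apply: ltr_wpDl; first by rewrite mulr_ge0 ?(ltW a0)//; exact: rf_ge0.
  by rewrite mulr_gt0//; apply: transverse_gt0; apply: tr => //; rewrite e.
apply: ltr_wpDr; first by rewrite mulr_ge0 ?(ltW b0)//; exact: rf_ge0.
by rewrite mulr_gt0//; apply: transverse_gt0; exact: tr.
Qed.

(** If a supporting hyperplane contained v with [rf m v > 0], moving from [rv m] along v would enter
    the domain inside that hyperplane. It is thus contained in the kernel of [rf m], and dimensions
    agree. *)
Lemma domain_C1 x : orbital_limit_set domain Gam0 x -> C1_smooth_point domain x.
Proof.
move=> /limit_setP[m Lm ->]; pose f := linfun (mulmx (rf m)) : 'Hom('cV[R]_d, 'cV[R]_1).
have fE v : (v \in lker f) = (app (rf m) v == 0).
  rewrite memv_ker lfunE /= app_mx; apply/eqP/eqP => [/matrixP/(_ 0 0)|->].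
    by rewrite !mxE mulr1n.
  by apply/matrixP => i j; rewrite !mxE mul0rn.
have [u u0] := rf_neq0 L m.
have dimH : (\dim (lker f)).+1 = d.
  have := limg_ker_dim f fullv; rewrite capfv dimvf dim_matrix mulr1 => e.
  rewrite -[RHS]e -addn1; congr (_ + _)%N; apply/eqP; rewrite eqn_leq; apply/andP; split.
    rewrite lt0n dimv_eq0; apply/negP => /eqP h.
    have : f u \in (f @: fullv)%VS by rewrite memv_img// memvf.
    by rewrite h memv0 -memv_ker fE gt_eqF.
  by rewrite (leq_trans (dimvS (subvf _)))// dimvf dim_matrix mulr1.
exists (lker f); split; first split=> // [|y [v nv ->]].
- by rewrite -memvE fE rf_rv.
- by rewrite -memvE fE gt_eqF// int_limit.
move=> H [dH xH yH]; apply/esym/eqP; rewrite eqEdim; apply/andP; split; last first.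
  by rewrite -ltnS dimH dH.
have key v : v \in H -> 0 < app (rf m) v -> False.
  move=> vH v0; have [z nz] := int_point; have z0 := int_limit nz Lm.
  (* With this e, subtracting e z halves the value of [rf m] at v. The tangent lemma then applies to
     v - e z, and adding back the interior vector z makes the point interior. *)
  have e0 : 0 < app (rf m) v / app (rf m) z / 2 by rewrite !divr_gt0.
  set e := (X in 0 < X) in e0.
  have h : 0 < app (rf m) (v - e *: z).
    by rewrite appDr appNr appZr /e mulrAC divfK ?gt_eqF//; lra.
  have [t t0 ct] := cone_tangent Lm h.
  have nw : nbhs (rv m + t *: v) cone.
    have -> : rv m + t *: v = (t * e) *: z + (rv m + t *: (v - e *: z)).
      by rewrite scalerBr scalerA [RHS]addrC -addrA subrK.
    by apply: int_add => //; apply: int_scale => //; exact: mulr_gt0.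
  apply: (yH (pline (int_neq0 nw))); first by exists (rv m + t *: v).
  by rewrite -memvE memvD// ?memvZ// memvE.
apply/subvP => v vH; rewrite fE; apply/negP => /negP v0.
have [vp|vn|/eqP] := ltgtP 0 (app (rf m) v); last by rewrite eq_sym (negbTE v0).
  exact: key vH vp.
by apply: (key (- v)); rewrite ?memvN// appNr oppr_gt0.
Qed.

Lemma domain_projectively_visible : projectively_visible domain Gam0.
Proof.
split; [exact: Gam0_discrete|exact: Gam0_Aut|exact: domain_visible|exact: domain_C1].
Qed.

Local Notation Lambda := (orbital_limit_set domain Gam0).

Definition xi (x : proj_space R d) : flag theta := mkf (xget 1%g [set g | x = pt g]).

Lemma xi_pt g : xi (pt g) = mkf g.
Proof.
by rewrite /xi; case: xgetP => [h _ /esym/pt_eq//|/(_ g)]; case.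
Qed.

Definition flag_line (F : flag theta) : proj_space R d := pt (repr F).

Lemma flag_line_mkflag g : flag_line (mkf g) = pt g.
Proof. by apply/pt_eq; exact: mkflag_repr. Qed.

Lemma flag_line_continuous : continuous flag_line.
Proof.
move=> F; have FF := nbhs_filter F.
apply: (proj_cvg _ (@tn_continuous _ _ _ _ _ L F) _ (val_pt_nv (repr F))).
  by apply: contraNneq (rv_neq0 L (repr F)) => e; rewrite nvE [nv L _]e scaler0.
exact: filterE (fun F' => val_pt_nv (repr F')).
Qed.

Lemma flag_line_xi x : Lambda x -> flag_line (xi x) = x.
Proof. by move=> /limit_setP[m _ ->]; rewrite xi_pt flag_line_mkflag. Qed.

(** On the limit set [xi] has the left inverse [flag_line], continuous on all flags. Compactness of
    the flag space makes [xi] continuous, and preimages under [flag_line] give relatively open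
    images. *)
Lemma xi_embedding : embedding domain Gam0 xi.
Proof.
split=> [|x y Lx Ly e|U oU].
- apply/subspace_continuousP => x Lx; apply: cvg_ultra => U UU sub.
  have [F0 xF0] := flag_ultra Gc xi UU.
  suff e : F0 = xi x by move: xF0; rewrite e.
  have Ux : (fun y : proj_space R d => y) @ U --> x.
    by move=> A nA; apply: sub; rewrite /within/=; apply: filterS nA => y.
  have UF : (fun y : proj_space R d => y) @ U --> flag_line F0.
    have h : (flag_line \o xi) @ U --> flag_line F0.
      exact: (cvg_comp _ _ xF0 (@flag_line_continuous F0)).
    apply: cvg_trans h; apply: near_eq_cvg; apply: sub; rewrite /within/=.
    by apply: filterE => y Ly; rewrite /= flag_line_xi.
  by rewrite (proj_cvg_eq Ux UF) /flag_line xi_pt mkflag_repr.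
- by rewrite -(flag_line_xi Lx) e flag_line_xi.
- exists (flag_line @^-1` U); first by apply: open_comp => // F _; exact: flag_line_continuous.
  apply/seteqP; split=> [_ [x [Lx Ux] <-]|_ [[x Lx <-]]] /=.
    by split; [exists x|rewrite /= flag_line_xi].
  by rewrite flag_line_xi// => Ux; exists x.
Qed.

Definition rho (p : PGL R d) : G := xget 1%g [set g | Gam g /\ emb g = p].

Lemma rho_emb g : Gam g -> rho (emb g) = g.
Proof.
move=> Gg; rewrite /rho; case: xgetP => [h _ [_ /emb_inj//]|/(_ g)].
by case.
Qed.

Lemma pt_act g m : PGL_act (emb g) (pt m) = pt (g * m)%g.
Proof.
by apply: val_inj; rewrite [LHS](@emb_act g (pt m) (rv m) erefl) -rvM.
Qed.

(** The orbits of b0 under the elements and under their inverses identify the attracting flag with m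
    and the repelling flag with m'. A flag F transverse to the latter is outside the kernel of the
    rank one limit. *)
Lemma rho_dynamics (gam : nat -> PGL R d) (x y b0 : proj_space R d) :
  (forall i, Gam0 (gam i)) -> Lambda x -> Lambda y -> domain b0 ->
  (fun i => PGL_act (gam i) b0) @ \oo --> x ->
  (fun i => PGL_act ((gam i)^-1)%g b0) @ \oo --> y ->
  forall F : flag theta, ~ not_transverse_to (xi y) F ->
    (fun i => flag_act (rho (gam i)) F) @ \oo --> xi x.
Proof.
move=> gG /limit_setP[m Lm ->] /limit_setP[m' Lm' ->] Db cx cy F /contrapT.
rewrite !xi_pt -(mkflag_repr F); set f := repr F => tr.
have gG' i : Gam (rho (gam i)) /\ emb (rho (gam i)) = gam i.
  by case: (gG i) => g Gg <-; rewrite rho_emb.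
apply: cvg_ultra => U UU Uoo.
have cx' : (fun i => PGL_act (emb (rho (gam i))) b0) @ U --> pt m.
  have -> : (fun i => PGL_act (emb (rho (gam i))) b0) = (fun i => PGL_act (gam i) b0).
    by apply/funext => i; case: (gG' i) => _ ->.
  by apply: cvg_trans cx => A; exact: Uoo.
have cy' : (fun i => PGL_act (emb ((rho (gam i))^-1)%g) b0) @ U --> pt m'.
  have -> : (fun i => PGL_act (emb ((rho (gam i))^-1)%g) b0) = (fun i => PGL_act ((gam i)^-1)%g b0).
    by apply/funext => i; rewrite embV; case: (gG' i) => _ ->.
  by apply: cvg_trans cy => A; exact: Uoo.
have gG1 i : Gam (rho (gam i)) by case: (gG' i).
(* If the elements were constant along U, the limit of the orbit would be a point of the domain, but
   limit lines are not in it. *)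
have [[h Uh]|w] := pselect (exists h, U [set i | rho (gam i) = h]).
  case: (domain_pt Lm); have [i gi] := @filter_ex _ _ _ _ Uh.
  suff -> : pt m = PGL_act (emb h) b0 by rewrite -gi; exact: domain_act.
  apply: (proj_cvg_eq cx').
  by apply: cvg_near_cst; apply: filterS Uh => j /= ->.
have {}w : wandering U (rho \o gam) by move=> h Uh; apply: w; exists h.
have [m1 [m2 [Lm1 Lm2 lim lim']]] := dyn UU gG1 w.
have e1 : mkf m1 = mkf m.
  by apply/pt_eq; apply: (proj_cvg_eq _ cx'); exact: orbit_cvg lim Lm2 Db.
have e2 : mkf m2 = mkf m'.
  apply/pt_eq; apply: (proj_cvg_eq _ cy').
  apply: (@orbit_cvg _ U (fun i => (rho (gam i))^-1%g) m2 m1) => // i.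
  exact: GamV.
have p : app (rf m2) (rv f) != 0.
  by rewrite gt_eqF// /app rf_sym; apply: transverse_gt0; rewrite e2.
rewrite -e1; apply: (tn_cvg (L := L) Gc).
have -> : (fun i => tn L (flag_act (rho (gam i)) (mkf f))) =
    (fun i => (app rt (rp (rho (gam i)) *m rv f))^-1 *: (rp (rho (gam i)) *m rv f)).
  by apply/funext => i; rewrite flag_act_mkflag tn_mkflag /nv rvM.
by rewrite tn_mkflag; apply: (rank_one_dir lim) p; exact: cvg_cst.
Qed.

Lemma rho_transverse : transverse_representation domain Gam0 rho xi.
Proof.
split; [|exact: xi_embedding| | |exact: rho_dynamics].
- move=> _ _ [g Gg <-] [h Gh <-].
  by rewrite -embM !rho_emb//; exact: GamM.
- move=> _ _ [g Gg <-] /limit_setP[m _ ->].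
  by rewrite pt_act !xi_pt rho_emb// flag_act_mkflag.
- move=> _ _ /limit_setP[m Lm ->] /limit_setP[m' Lm' ->]; rewrite !xi_pt => ne.
  by have [_ _] := GamT; exact.
Qed.

Lemma rho_faithful : faithful Gam0 rho.
Proof. by move=> _ _ [g Gg <-] [h Gh <-]; rewrite !rho_emb// => ->. Qed.

Lemma rho_image : rho @` Gam0 = Gam.
Proof.
apply/seteqP; split=> [_ [_ [g Gg <-] <-]|g Gg]; first by rewrite rho_emb.
by exists (emb g); [exists g|exact: rho_emb].
Qed.

Lemma xi_image : xi @` Lambda = Lam.
Proof.
apply/seteqP; split=> [_ [x /limit_setP[m Lm ->] <-]|F LF]; first by rewrite xi_pt.
exists (pt (repr F)); last by rewrite xi_pt mkflag_repr.
by apply/limit_setP; exists (repr F); rewrite ?mkflag_repr.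
Qed.

End ConvexDomain.

Theorem theorem6p2 (R : realType) (n : nat) (G : lieGroupType R n)
  (D : cartan_data G) (theta : set (dual (cd_a D))) (Gam : set G) :
  connected [set: G] ->
  semisimple G ->
  without_compact_factors G ->
  trivial_center G ->
  theta `<=` simple_roots (cd_pos D) ->
  symmetric_roots theta ->
  (forall H : set G, simple_factor H -> ~ H `<=` parabolic theta) ->
  transverse_subgroup theta Gam ->
  exists (d : nat) (Om : set (proj_space R d)) (Gam0 : set (PGL R d))
         (rho : PGL R d -> G) (xi : proj_space R d -> flag theta),
    [/\ properly_convex_domain Om,
        projectively_visible Om Gam0,
        transverse_representation Om Gam0 rho xi,
        faithful Gam0 rho &
        rho @` Gam0 = Gam /\
        xi @` orbital_limit_set Om Gam0 = limit_set theta Gam].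
Proof.
move=> Gc ss _ Gz theta_simple theta_sym noP GamT.
have [L] := flag_model_ex theta_simple theta_sym.
have kernel1 := kernel_trivial Gc ss Gz noP.
exists (fm_dim L), (@domain _ _ _ _ _ L Gc Gam), (@Gam0 _ _ _ _ _ L Gam), (@rho _ _ _ _ _ L Gam), (@xi _ _ _ _ _ L); split.
- by apply: domain_convex.
- by apply: domain_projectively_visible.
- by apply: rho_transverse.
- by apply: rho_faithful.
- by split; [apply: rho_image|apply: xi_image].
Qed.
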